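(* (Absolute uniqueness beyond the natural boundary.) Let $p\ge5$ be a prime, $\ell_p=(p-1)/2$, and for $t\in\mathbb R^-$ put $Q=e^{-2t}$, $Q_1=e^{-2\pi^2/t}$, $\zeta=Q^{-1/(24p)}$, $\zeta_1=Q_1^{-1/(24p)}$. The equation $$\mathcal L^{(p)}(t)=F^{(p)}(\zeta)+i\sqrt{\frac{\pi}{|t|}}\;M^{(p)}F^{(p)}(\zeta_1),\qquad t\in\mathbb R^-,$$ has a unique solution $F^{(p)}$ (an $\ell_p$-component vector) holomorphic in the unit disk. Equivalently, when the rational prefactors and the corresponding series in $Q^{-1}$ are regarded together (i.e. as series in rational powers of $Q^{-1}$), the modular transformation laws admit a unique holomorphic solution on the side $|Q|>1$. (No growth condition or order normalization is needed.)
   Context: $M^{(p)}$ is the $\ell_p\times\ell_p$ matrix $M^{(p)}_{jk}=\frac{2}{\sqrt p}(-1)^{j+k+\lfloor (p+3)/6\rfloor}\sin\bigl(\frac{6\pi jk}{p}\bigr)$. For $\Re t>0$ let $JS_{(P,a)}(t)=\frac1t\int_0^\infty e^{-Pu^2/t}\frac{\sinh((P-a)u)}{\sinh(Pu)}\,du$, and let $\mathcal L^{(p)}(t)$ be the column vector with components, $1\le j\le\ell_p$, $$\mathcal L^{(p)}_j(t)=\sqrt{\tfrac{48pt}{\pi}}\bigl[\mathrm{sign}(6j-p)JS_{(12p,|12j-2p|)}(t)+JS_{(12p,14p-12j)}(t)+JS_{(12p,12j+2p)}(t)+JS_{(12p,10p-12j)}(t)\bigr].$$ Each component extends analytically to a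 sector of opening $3\pi$ in $t$ centered on $\mathbb R^+$ (by rotating the $u$-contour). For $t\in\mathbb R^-$ (the Stokes line), $\mathcal L^{(p)}(t)$ denotes the analytic continuation from $\Re t>0$ to the negative real axis; the convention is continuation through the upper half $t$-plane, $t=-T+i0$, $T>0$. The modular transformation laws on the side $|Q|>1$ are the displayed equation, in which the $j$-th component $F^{(p)}_j(\zeta)$ is written as a rational power $Q^{-\Delta_{(p,j)}}$, $\Delta_{(p,j)}=\frac{(6j-p)^2}{24p}$, times a series in $Q^{-1}$.
   Formalization: With continuation through the upper half t-plane and the sign +i no solution exists; the formal theorem proves the result for both consistent pairings: upper continuation with -i√(π/|t|), and lower continuation with the displayed +i√(π/|t|). *)

(* Defs.v *)
From Stdlib Require Import Reals ZArith Znumtheory ClassicalEpsilon.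
From Coquelicot Require Import Coquelicot.

Open Scope R_scope.

Definition ell (p : nat) : nat := Nat.div (p - 1) 2.

Definition Mmat (p j k : nat) : R :=
  2 / sqrt (INR p) * (-1) ^ (j + k + Nat.div (p + 3) 6)
    * sin (6 * PI * INR j * INR k / INR p).

Definition Cexp (z : C) : C :=
  (exp (Re z) * cos (Im z), exp (Re z) * sin (Im z)).

(* Principal branch off the half-line (-oo, 0]; only used for Re z > 0. *)
Definition Csqrt (z : C) : C :=
  (sqrt ((Cmod z + Re z) / 2), sign (Im z) * sqrt ((Cmod z - Re z) / 2)).

(* The integrand takes a junk value at u = 0, which does not affect the
   integral. *)
Definition JS (P a : R) (t : C) : C :=
  (/ t * RInt_gen (V := C_R_CompleteNormedModule)
           (fun u : R =>
              Cexp (- (RtoC (P * u ^ 2) / t))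
                * RtoC (sinh ((P - a) * u) / sinh (P * u)))%C
           (at_point 0) (Rbar_locally p_infty))%C.

(* The column vector L^(p) on its initial domain Re t > 0. *)
Definition calL (p j : nat) (t : C) : C :=
  let P := INR p in
  let J := INR j in
  (Csqrt (RtoC (48 * P / PI) * t)
   * (RtoC (sign (6 * J - P)) * JS (12 * P) (Rabs (12 * J - 2 * P)) t
      + JS (12 * P) (14 * P - 12 * J) t
      + JS (12 * P) (12 * J + 2 * P) t
      + JS (12 * P) (10 * P - 12 * J) t))%C.

Definition holomorphic_on (D : C -> Prop) (f : C -> C) : Prop :=
  forall z : C, D z -> @ex_derive C_AbsRing C_NormedModule f z.

Definition unit_disk (z : C) : Prop := Cmod z < 1.

(* The half-plane crossed on the way from Re t > 0 to the negative axis, that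
   is t = -T + i0 or t = -T - i0. *)
Inductive side := Upper | Lower.

(* The plane cut along the half-line from 0 to -i oo (resp. +i oo): it
   contains Re t > 0, the half-plane that is crossed, and the negative axis. *)
Definition cut_plane (s : side) (t : C) : Prop :=
  match s with
  | Upper => Re t <> 0 \/ 0 < Im t
  | Lower => Re t <> 0 \/ Im t < 0
  end.

Definition is_continuation (s : side) (f g : C -> C) : Prop :=
  holomorphic_on (cut_plane s) g /\ forall t : C, 0 < Re t -> g t = f t.

(* Two continuations agree on the connected set [cut_plane s], so there the
   choice is immaterial. *)
Definition continuation (s : side) (f : C -> C) : C -> C :=
  epsilon (inhabits f) (is_continuation s f).

(* The value at t < 0 of sqrt (pi / t), continued from t > 0 along the same
   side as the vector L^(p). *)
Definition stokes_factor (s : side) (t : R) : C :=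
  match s with
  | Upper => (- (Ci * RtoC (sqrt (PI / Rabs t))))%C
  | Lower => (Ci * RtoC (sqrt (PI / Rabs t)))%C
  end.

Definition Qvar (t : R) : R := exp (- 2 * t).
Definition Qvar1 (t : R) : R := exp (- 2 * PI ^ 2 / t).
Definition zeta (p : nat) (t : R) : R := Rpower (Qvar t) (- 1 / (24 * INR p)).
Definition zeta1 (p : nat) (t : R) : R := Rpower (Qvar1 t) (- 1 / (24 * INR p)).

(* Vectors are indexed from 1 to [ell p]; components outside are ignored. *)
Definition in_range (p j : nat) : Prop := (1 <= j <= ell p)%nat.

Definition holomorphic_solution (p : nat) (s : side) (F : nat -> C -> C) : Prop :=
  (forall j : nat, in_range p j -> holomorphic_on unit_disk (F j)) /\
  (forall (t : R) (j : nat), t < 0 -> in_range p j ->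
     continuation s (calL p j) (RtoC t)
     = (F j (RtoC (zeta p t))
        + stokes_factor s t
          * sum_n_m (G := C_AbelianMonoid)
              (fun k : nat => RtoC (Mmat p j k) * F k (RtoC (zeta1 p t)))
              1 (ell p))%C).

Definition CSeries (a : nat -> C) : C :=
  (Series (fun n => Re (a n)), Series (fun n => Im (a n))).

(* The series in rational powers: the sum of c n * Q^(- n / (24 p)). *)
Definition Qseries (p : nat) (c : nat -> C) (Q : R) : C :=
  CSeries (fun n : nat => c n * RtoC (Rpower Q (- (INR n / (24 * INR p)))))%C.

(* With z = Q^(-1/(24p)), convergence for |z| < 1 is convergence for |Q| > 1. *)
Definition converges_on_disk (c : nat -> C) : Prop :=
  forall z : C, unit_disk z ->
    ex_series (V := C_NormedModule) (fun n : nat => c n * z ^ n)%C.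

Definition series_solution (p : nat) (s : side) (c : nat -> nat -> C) : Prop :=
  (forall j : nat, in_range p j -> converges_on_disk (c j)) /\
  (forall (t : R) (j : nat), t < 0 -> in_range p j ->
     continuation s (calL p j) (RtoC t)
     = (Qseries p (c j) (Qvar t)
        + stokes_factor s t
          * sum_n_m (G := C_AbelianMonoid)
              (fun k : nat => RtoC (Mmat p j k) * Qseries p (c k) (Qvar1 t))
              1 (ell p))%C).

Definition Delta (p j : nat) : R :=
  (6 * INR j - INR p) ^ 2 / (24 * INR p).

(* The series is Q^(- Delta p j) times a power series in 1/Q. *)
Definition has_prefactor (p j : nat) (c : nat -> C) : Prop :=
  forall n : nat, c n <> RtoC 0 ->
    exists m : nat, INR n / (24 * INR p) = Delta p j + INR m.

(* Main.v *)
Require Import Defs.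
From Stdlib Require Import Reals ZArith Znumtheory Lra Lia ClassicalEpsilon.
From Coquelicot Require Import Coquelicot.

(** Uniqueness: the difference [G] of two solutions satisfies the homogeneous law;
    combining the law at [t] with the law at [PI^2 / t] gives [G = - M^2 G], and
    since [M] is real symmetric, [|G|^2 = - |M G|^2], so [G] vanishes on [(0, 1)].
    The identity theorem does the rest.

    Existence: rotating the contour, the continuation of [JS] is a Gaussian integral
    of [sinh (b u) / sinh (P u)] along a ray that depends holomorphically on [t].
    At [t = - T], in the variable [v = - i u], it is the integral of
    [exp (- P v^2 / T) sin (b v) / sin (P v)] along the ray of angle [- PI / 4].
    Its real part, by geometric expansion of [1 / sin (P v)] on that ray, is a false
    theta series in [zeta].  Its imaginary part is half the difference between the
    conjugate rays of angles [- PI / 4] and [PI / 4], that is a sum of residues at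
    [v = PI m / P], which is a series in [zeta1].  The coefficients of the first
    series form a function [chi p j] of period [12 p]; those of the second are sine
    sums, which [M] expresses through the [chi p k].  Hence the false theta series
    themselves solve the equation.

    The complex analysis is built on Goursat's theorem for rectangles; disks and
    sectors are reduced to rectangles by the coordinate [log]. *)

Open Scope R_scope.

(** * Complex differentiability *)

(** Uniqueness rests on a sign: [t] and [PI^2 / t] are both negative and [stokes_factor s t *
    stokes_factor s (PI^2 / t) = - 1]. A real factor of the same size would only give [G = M^2 G],
    from which positivity concludes nothing. The negative axis is also large enough: there [zeta] is
    [exp (t / (12 p))], which covers all of (0, 1), and [t -> PI^2 / t] exchanges [zeta] and
    [zeta1].

    The theta series are false because [chi p j] is odd: the sum of [chi p j m * x^(m^2)] over all
    integers cancels, and the half sum over [m >= 0] is what the integral produces. These half sums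
    are real for real [x] while the Stokes factor is imaginary, so the two terms of the equation are
    exactly the real and the imaginary part of the continued integral. The same splitting lets one
    [F] serve both sides of the cut: conjugation changes only the sign of the imaginary part.

    The ray of angle [- PI / 4] is forced at [t = - T]: on it the Gaussian only oscillates, with
    modulus 1, and all decay comes from the quotient of sines. *)

Definition cdiff (f : C -> C) (z l : C) : Prop :=
  forall e, 0 < e -> exists d, 0 < d /\ forall w, Cmod (w - z) < d ->
    Cmod (f w - f z - (w - z) * l) <= e * Cmod (w - z).

Definition chol (f : C -> C) (z : C) : Prop := exists l, cdiff f z l.

Definition ccont (f : C -> C) (z : C) : Prop :=
  forall e, 0 < e -> exists d, 0 < d /\ forall w, Cmod (w - z) < d ->
    Cmod (f w - f z) < e.

Definition rcont (g : R -> C) (x : R) : Prop :=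
  forall e, 0 < e -> exists d, 0 < d /\ forall y, Rabs (y - x) < d ->
    Cmod (g y - g x) < e.

(** The norm of [C] as a module over itself is [Cmod], so the little-o condition of [is_derive]
    unfolds to the inequality of [cdiff]. Multiplied out in this way it needs no exception at
    [w = z]. *)
Lemma cdiff_is_derive (f : C -> C) (z l : C) :
  @is_derive C_AbsRing C_NormedModule f z l <-> cdiff f z l.
Proof.
  split.
  - intros [_ H] e He.
    assert (Hz : is_filter_lim (locally (z : AbsRing_UniformSpace C_AbsRing)) z)
      by (intros P HP; exact HP).
    destruct (H z Hz (mkposreal e He)) as [d Hd].
    exists d; split; [apply cond_pos|]. intros w Hw.
    specialize (Hd w Hw). exact Hd.
  - intros H. split.
    + apply is_linear_scal_l.
    + intros x Hx.
      replace x with z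
        by (apply (is_filter_lim_locally_unique (V := AbsRing_NormedModule C_AbsRing) z x Hx)).
      intros e. destruct (H e (cond_pos e)) as [d [Hd H']].
      exists (mkposreal d Hd). intros w Hw. exact (H' w Hw).
Qed.

Lemma ex_derive_chol (f : C -> C) (z : C) :
  @ex_derive C_AbsRing C_NormedModule f z <-> chol f z.
Proof.
  split; intros [l H]; exists l; now apply cdiff_is_derive.
Qed.

Lemma Cmod_minus_sym (a b : C) : Cmod (a - b) = Cmod (b - a).
Proof. rewrite <- Cmod_opp. f_equal. ring. Qed.

Lemma Cmod_minus_triangle (a b c : C) : Cmod (a - c) <= Cmod (a - b) + Cmod (b - c).
Proof. replace (a - c)%C with ((a - b) + (b - c))%C by ring. apply Cmod_triangle. Qed.

Lemma Cmod_le_minus (a b : C) : Cmod a <= Cmod (a - b) + Cmod b.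
Proof. replace a with ((a - b) + b)%C at 1 by ring. apply Cmod_triangle. Qed.

Lemma im_le_Cmod (c : C) : Rabs (Im c) <= Cmod c.
Proof.
  eapply Rle_trans; [|apply Rmax_Cmod]. apply Rmax_r.
Qed.

Lemma Cmod_le_sum (c : C) : Cmod c <= Rabs (Re c) + Rabs (Im c).
Proof.
  destruct c as [x y]. replace (x, y) with (RtoC x + RtoC y * Ci)%C.
  - eapply Rle_trans; [apply Cmod_triangle|].
    rewrite Cmod_mult, !Cmod_R, Cmod_Ci. simpl.
    replace (x + (y * 0 - 0 * 1)) with x by ring.
    replace (0 + (y * 1 + 0 * 0)) with y by ring. lra.
  - unfold Cplus, Cmult, RtoC, Ci; simpl. f_equal; ring.
Qed.

Lemma cdiff_ccont f z l : cdiff f z l -> ccont f z.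
Proof.
  intros H e He. destruct (H 1 Rlt_0_1) as [d [Hd H1]].
  assert (Hl : 0 <= Cmod l) by apply Cmod_ge_0.
  exists (Rmin d (e / (2 + Cmod l))). split.
  - apply Rmin_pos; auto. apply Rdiv_lt_0_compat; lra.
  - intros w Hw. pose proof (Rmin_l d (e / (2 + Cmod l))). pose proof (Rmin_r d (e / (2 + Cmod l))).
    assert (Hw2 : Cmod (w - z) < e / (2 + Cmod l)) by lra.
    specialize (H1 w ltac:(lra)).
    pose proof (Cmod_le_minus (f w - f z) ((w - z) * l)) as H2'.
    rewrite Cmod_mult in H2'.
    assert (Hm : Cmod (w - z) * (2 + Cmod l) < e).
    { apply (Rmult_lt_compat_r (2 + Cmod l)) in Hw2; [|lra]. 
      unfold Rdiv in Hw2. rewrite Rmult_assoc, Rinv_l in Hw2 by lra. lra. }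
    pose proof (Cmod_ge_0 (w - z)). nra.
Qed.

Lemma chol_ccont f z : chol f z -> ccont f z.
Proof. intros [l H]; eapply cdiff_ccont; eauto. Qed.

Lemma cdiff_ext_loc f g z l r :
  0 < r -> (forall w, Cmod (w - z) < r -> f w = g w) -> cdiff f z l -> cdiff g z l.
Proof.
  intros Hr He H e Hpe. destruct (H e Hpe) as [d [Hd H1]].
  exists (Rmin d r). split; [now apply Rmin_pos|].
  intros w Hw. pose proof (Rmin_l d r). pose proof (Rmin_r d r).
  rewrite <- (He w) by lra. rewrite <- (He z).
  - apply H1; lra.
  - replace (z - z)%C with (RtoC 0) by ring. rewrite Cmod_0; lra.
Qed.

Lemma chol_ext_loc f g z r :
  0 < r -> (forall w, Cmod (w - z) < r -> f w = g w) -> chol f z -> chol g z.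
Proof. intros Hr He [l H]; exists l; eapply cdiff_ext_loc; eauto. Qed.

Lemma chol_ext f g z : (forall w, f w = g w) -> chol f z -> chol g z.
Proof. intros; eapply (chol_ext_loc f g z 1); auto; lra. Qed.

Lemma cdiff_const c z : cdiff (fun _ => c) z 0.
Proof.
  intros e He. exists 1. split; [lra|]. intros w _.
  replace (c - c - (w - z) * 0)%C with (RtoC 0) by ring. rewrite Cmod_0.
  pose proof (Cmod_ge_0 (w - z)). nra.
Qed.

Lemma cdiff_id z : cdiff (fun w => w) z 1.
Proof.
  intros e He. exists 1. split; [lra|]. intros w _.
  replace (w - z - (w - z) * 1)%C with (RtoC 0) by ring. rewrite Cmod_0.
  pose proof (Cmod_ge_0 (w - z)). nra.
Qed.

Lemma cdiff_plus f g z a b :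
  cdiff f z a -> cdiff g z b -> cdiff (fun w => f w + g w)%C z (a + b)%C.
Proof.
  intros Hf Hg e He.
  destruct (Hf (e / 2)) as [d1 [Hd1 H1]]; [lra|].
  destruct (Hg (e / 2)) as [d2 [Hd2 H2]]; [lra|].
  exists (Rmin d1 d2). split; [now apply Rmin_pos|].
  intros w Hw. pose proof (Rmin_l d1 d2). pose proof (Rmin_r d1 d2).
  specialize (H1 w ltac:(lra)). specialize (H2 w ltac:(lra)).
  replace (f w + g w - (f z + g z) - (w - z) * (a + b))%C
    with ((f w - f z - (w - z) * a) + (g w - g z - (w - z) * b))%C by ring.
  eapply Rle_trans; [apply Cmod_triangle|]. lra.
Qed.

Lemma cdiff_mult f g z a b :
  cdiff f z a -> cdiff g z b ->
  cdiff (fun w => f w * g w)%C z (a * g z + f z * b)%C.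
Proof.
  intros Hf Hg e He.
  set (K := 1 + Cmod (g z) + Cmod a + Cmod (f z)).
  pose proof (Cmod_ge_0 (g z)). pose proof (Cmod_ge_0 a). pose proof (Cmod_ge_0 (f z)).
  assert (HK : 0 < K) by (unfold K; lra).
  set (e' := Rmin 1 (e / (3 * K))).
  assert (He1 : 0 < e') by (apply Rmin_pos; [lra|apply Rdiv_lt_0_compat; lra]).
  assert (He3 : e' <= 1) by apply Rmin_l.
  assert (He2 : e' * (3 * K) <= e).
  { pose proof (Rmin_r 1 (e / (3 * K))) as Hr. fold e' in Hr.
    apply (Rmult_le_compat_r (3 * K)) in Hr; [|lra].
    unfold Rdiv in Hr. rewrite Rmult_assoc, Rinv_l in Hr by lra. lra. }
  destruct (Hf e' He1) as [d1 [Hd1 J1]].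
  destruct (Hg e' He1) as [d2 [Hd2 J2]].
  destruct (cdiff_ccont _ _ _ Hg e' He1) as [d3 [Hd3 J3]].
  exists (Rmin d1 (Rmin d2 d3)). split; [repeat apply Rmin_pos; auto|].
  intros w Hw. pose proof (Rmin_l d1 (Rmin d2 d3)). pose proof (Rmin_r d1 (Rmin d2 d3)).
  pose proof (Rmin_l d2 d3). pose proof (Rmin_r d2 d3).
  specialize (J1 w ltac:(lra)). specialize (J2 w ltac:(lra)). specialize (J3 w ltac:(lra)).
  replace (f w * g w - f z * g z - (w - z) * (a * g z + f z * b))%C
    with ((f w - f z - (w - z) * a) * g w + ((w - z) * a * (g w - g z) + f z * (g w - g z - (w - z) * b)))%C by ring.
  eapply Rle_trans; [apply Cmod_triangle|].
  pose proof (Cmod_triangle ((w - z) * a * (g w - g z)) (f z * (g w - g z - (w - z) * b))) as H9.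
  rewrite !Cmod_mult in *.
  pose proof (Cmod_le_minus (g w) (g z)) as H10.
  set (m := Cmod (w - z)) in *. assert (0 <= m) by apply Cmod_ge_0.
  pose proof (Cmod_ge_0 (g w)). pose proof (Cmod_ge_0 (g w - g z)).
  assert (Q1 : Cmod (f w - f z - (w - z) * a) * Cmod (g w) <= (e' * m) * K).
  { apply Rmult_le_compat; auto using Cmod_ge_0. unfold K; lra. }
  assert (Q2 : m * Cmod a * Cmod (g w - g z) <= m * (K * e')).
  { rewrite Rmult_assoc. apply Rmult_le_compat_l; auto. apply Rmult_le_compat; auto; unfold K; lra. }
  assert (Q3 : Cmod (f z) * Cmod (g w - g z - (w - z) * b) <= K * (e' * m)).
  { apply Rmult_le_compat; auto using Cmod_ge_0. unfold K; lra. }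
  nra.
Qed.

Lemma cdiff_comp f g z a b :
  cdiff g z b -> cdiff f (g z) a -> cdiff (fun w => f (g w)) z (b * a)%C.
Proof.
  intros Hg Hf e He.
  set (K := 1 + Cmod b). pose proof (Cmod_ge_0 b). pose proof (Cmod_ge_0 a).
  set (L := 1 + Cmod a).
  assert (He1 : 0 < e / (2 * K)) by (apply Rdiv_lt_0_compat; unfold K; lra).
  assert (He2 : 0 < Rmin 1 (e / (2 * L)))
    by (apply Rmin_pos; [lra|apply Rdiv_lt_0_compat; unfold L; lra]).
  destruct (Hf _ He1) as [d1 [Hd1 J1]].
  destruct (Hg _ He2) as [d2 [Hd2 J2]].
  destruct (cdiff_ccont _ _ _ Hg d1 Hd1) as [d3 [Hd3 J3]].
  exists (Rmin d2 d3). split; [now apply Rmin_pos|].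
  intros w Hw. pose proof (Rmin_l d2 d3). pose proof (Rmin_r d2 d3).
  specialize (J3 w ltac:(lra)). specialize (J2 w ltac:(lra)). specialize (J1 (g w) J3).
  replace (f (g w) - f (g z) - (w - z) * (b * a))%C
    with ((f (g w) - f (g z) - (g w - g z) * a) + (g w - g z - (w - z) * b) * a)%C by ring.
  eapply Rle_trans; [apply Cmod_triangle|]. rewrite Cmod_mult.
  set (m := Cmod (w - z)) in *. assert (0 <= m) by apply Cmod_ge_0.
  assert (Hgm : Cmod (g w - g z) <= K * m).
  { pose proof (Cmod_le_minus (g w - g z) ((w - z) * b)) as Q. rewrite Cmod_mult in Q. fold m in Q.
    pose proof (Rmin_l 1 (e / (2 * L))). unfold K. nra. }
  assert (E1 : e / (2 * K) * (K * m) = e / 2 * m) by (field; unfold K; lra).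
  assert (E2 : Cmod (g w - g z - (w - z) * b) * Cmod a <= e / 2 * m).
  { apply Rle_trans with ((e / (2 * L) * m) * L).
    - apply Rmult_le_compat; auto using Cmod_ge_0; [|unfold L; lra].
      eapply Rle_trans; [exact J2|]. apply Rmult_le_compat_r; auto. apply Rmin_r.
    - right. field. unfold L; lra. }
  apply Rle_trans with (e / (2 * K) * (K * m) + e / 2 * m); [|lra].
  apply Rplus_le_compat; auto. eapply Rle_trans; [exact J1|].
  apply Rmult_le_compat_l; lra.
Qed.

Lemma cdiff_inv (z : C) : z <> 0 -> cdiff (fun w => / w)%C z (- (/ z * / z))%C.
Proof.
  intros Hz e He. pose proof (proj1 (Cmod_gt_0 z) Hz) as Hm.
  set (m := Cmod z) in *.
  (* The error is exactly [(w - z)^2 / (w z^2)]. For [|w| >= m / 2] it is at most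
     [2 |w - z|^2 / m^3], whence the second bound on the radius. *)
  assert (Hd : 0 < Rmin (m / 2) (e * m ^ 3 / 2)).
  { apply Rmin_pos; [lra|]. assert (0 < m ^ 3) by (apply pow_lt; auto). nra. }
  exists (Rmin (m / 2) (e * m ^ 3 / 2)). split; auto.
  intros w Hw. pose proof (Rmin_l (m / 2) (e * m ^ 3 / 2)). pose proof (Rmin_r (m / 2) (e * m ^ 3 / 2)).
  assert (Hwm : m / 2 <= Cmod w).
  { pose proof (Cmod_le_minus z w) as Q. rewrite (Cmod_minus_sym z w) in Q. fold m in Q. lra. }
  assert (Hw0 : w <> 0) by (apply Cmod_gt_0; lra).
  replace (/ w - / z - (w - z) * - (/ z * / z))%C
    with ((w - z) * (w - z) * (/ w * (/ z * / z)))%C by (field; auto).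
  rewrite !Cmod_mult, !Cmod_inv by auto. fold m.
  rewrite Rmult_assoc, (Rmult_comm e).
  apply Rmult_le_compat_l; [apply Cmod_ge_0|].
  apply Rle_trans with ((e * m ^ 3 / 2) * (/ (m / 2) * (/ m * / m))).
  - apply Rmult_le_compat.
    + apply Cmod_ge_0.
    + apply Rmult_le_pos; [|apply Rmult_le_pos]; left; apply Rinv_0_lt_compat; lra.
    + lra.
    + apply Rmult_le_compat_r.
      * apply Rmult_le_pos; left; apply Rinv_0_lt_compat; lra.
      * apply Rinv_le_contravar; lra.
  - right. field. lra.
Qed.

Lemma chol_const c z : chol (fun _ => c) z.
Proof. eexists; apply cdiff_const. Qed.
Lemma chol_id z : chol (fun w => w) z.
Proof. eexists; apply cdiff_id. Qed.
Lemma chol_plus f g z : chol f z -> chol g z -> chol (fun w => f w + g w)%C z.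
Proof. intros [a Ha] [b Hb]; eexists; apply cdiff_plus; eauto. Qed.
Lemma chol_mult f g z : chol f z -> chol g z -> chol (fun w => f w * g w)%C z.
Proof. intros [a Ha] [b Hb]; eexists; apply cdiff_mult; eauto. Qed.
Lemma chol_comp f g z : chol g z -> chol f (g z) -> chol (fun w => f (g w)) z.
Proof. intros [a Ha] [b Hb]; eexists; eapply cdiff_comp; eauto. Qed.
Lemma chol_opp f z : chol f z -> chol (fun w => - f w)%C z.
Proof.
  intros H. apply (chol_ext (fun w => (- (1)) * f w)%C); [intros; ring|].
  apply chol_mult; auto using chol_const.
Qed.
Lemma chol_minus f g z : chol f z -> chol g z -> chol (fun w => f w - g w)%C z.
Proof. intros; apply chol_plus; auto using chol_opp. Qed.
Lemma chol_inv f z : chol f z -> f z <> 0 -> chol (fun w => / f w)%C z.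
Proof.
  intros [a Ha] H. eexists. eapply (cdiff_comp (fun w => / w)%C f); [exact Ha|].
  now apply cdiff_inv.
Qed.
Lemma chol_div f g z : chol f z -> chol g z -> g z <> 0 -> chol (fun w => f w / g w)%C z.
Proof. intros; apply chol_mult; auto using chol_inv. Qed.

Lemma Cexp_plus (z w : C) : Cexp (z + w) = (Cexp z * Cexp w)%C.
Proof.
  destruct z as [a b], w as [c d]. unfold Cexp, Cmult, Cplus; simpl.
  rewrite exp_plus, cos_plus, sin_plus. f_equal; ring.
Qed.

Lemma Cexp_0 : Cexp 0 = 1.
Proof. unfold Cexp, RtoC; simpl. rewrite exp_0, cos_0, sin_0. f_equal; ring. Qed.

Lemma Cmod_Cexp (z : C) : Cmod (Cexp z) = exp (Re z).
Proof.
  unfold Cmod, Cexp; simpl.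
  replace (_ + _) with (exp (Re z) * exp (Re z)).
  - apply sqrt_square. left; apply exp_pos.
  - transitivity (exp (Re z) * exp (Re z) * (Rsqr (sin (Im z)) + Rsqr (cos (Im z)))).
    + rewrite sin2_cos2. ring.
    + unfold Rsqr. ring.
Qed.

Lemma Cexp_neq_0 (z : C) : Cexp z <> 0.
Proof. apply Cmod_gt_0. rewrite Cmod_Cexp. apply exp_pos. Qed.

Lemma derivable_polar_lim_dom (f : R -> R) (x l : R) :
  derivable_pt_lim f x l -> forall e, 0 < e -> exists d, 0 < d /\
    forall h, Rabs h < d -> Rabs (f (x + h) - f x - h * l) <= e * Rabs h.
Proof.
  intros H e He. destruct (H e He) as [d Hd]. exists d; split; [apply cond_pos|].
  intros h Hh. destruct (Req_dec h 0) as [->|Hn].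
  - rewrite Rplus_0_r, Rmult_0_l, Rabs_R0.
    replace (f x - f x - 0) with 0 by ring. rewrite Rabs_R0; lra.
  - specialize (Hd h Hn Hh).
    replace (f (x + h) - f x - h * l) with (((f (x + h) - f x) / h - l) * h) by (field; auto).
    rewrite Rabs_mult. apply Rmult_le_compat_r; [apply Rabs_pos|lra].
Qed.

Lemma cdiff_Cexp_0 : cdiff Cexp 0 1.
Proof.
  intros e He.
  (* The errors of the two components add up to [1 + 4 + 4 + 2 = 11] copies of [e' * m], where 4
     bounds [exp x] for [|x| <= 1]; 16 leaves room. *)
  set (e' := Rmin 1 (e / 16)). assert (He' : 0 < e') by (apply Rmin_pos; lra).
  assert (He1 : e' <= 1) by apply Rmin_l. assert (He16 : e' <= e / 16) by apply Rmin_r.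
  destruct (derivable_polar_lim_dom _ _ _ (derivable_pt_lim_exp 0) e' He') as [d1 [Hd1 H1]].
  destruct (derivable_polar_lim_dom _ _ _ (derivable_pt_lim_sin 0) e' He') as [d2 [Hd2 H2]].
  destruct (derivable_polar_lim_dom _ _ _ (derivable_pt_lim_cos 0) e' He') as [d3 [Hd3 H3]].
  exists (Rmin (Rmin d1 d2) (Rmin d3 (Rmin 1 e'))).
  split; [repeat apply Rmin_pos; auto; lra|].
  intros w Hw. replace (w - 0)%C with w in * by ring.
  pose proof (Rmin_l (Rmin d1 d2) (Rmin d3 (Rmin 1 e'))).
  pose proof (Rmin_r (Rmin d1 d2) (Rmin d3 (Rmin 1 e'))).
  pose proof (Rmin_l d1 d2). pose proof (Rmin_r d1 d2).
  pose proof (Rmin_l d3 (Rmin 1 e')). pose proof (Rmin_r d3 (Rmin 1 e')).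
  pose proof (Rmin_l 1 e'). pose proof (Rmin_r 1 e').
  pose proof (re_le_Cmod w) as Hr. pose proof (im_le_Cmod w) as Hi.
  set (m := Cmod w) in *.
  destruct w as [x y]; simpl in Hr, Hi.
  specialize (H1 x ltac:(lra)). specialize (H2 y ltac:(lra)). specialize (H3 y ltac:(lra)).
  rewrite Rplus_0_l in *. rewrite exp_0 in H1. rewrite sin_0, cos_0 in H2. rewrite cos_0, sin_0 in H3.
  eapply Rle_trans; [apply Cmod_le_sum|].
  unfold Cexp; simpl. rewrite exp_0, cos_0, sin_0.
  assert (Hx1 : Rabs x <= 1) by lra.
  assert (Hex : 0 < exp x <= 4).
  { split; [apply exp_pos|]. apply Rle_trans with (exp 1); [|pose proof exp_le_3; lra].
    pose proof (Rle_abs x). destruct (Rle_lt_or_eq_dec x 1) as [Hlt|Heq]; [lra| left; now apply exp_increasing | right; now rewrite Heq]. }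
  assert (Hm : 0 <= m) by apply Cmod_ge_0.
  assert (Q1 : Rabs (exp x - 1 - x) <= e' * m).
  { rewrite Rmult_1_r in H1. eapply Rle_trans; [exact H1|]. apply Rmult_le_compat_l; lra. }
  assert (Q2 : Rabs (cos y - 1) <= e' * m).
  { replace (cos y - 1 - y * - 0) with (cos y - 1) in H3 by ring.
    eapply Rle_trans; [exact H3|]. apply Rmult_le_compat_l; lra. }
  assert (Q3 : Rabs (sin y - y) <= e' * m).
  { replace (sin y - 0 - y * 1) with (sin y - y) in H2 by ring.
    eapply Rle_trans; [exact H2|]. apply Rmult_le_compat_l; lra. }
  assert (R1 : Rabs (exp x * (cos y - 1)) <= 4 * (e' * m)).
  { rewrite Rabs_mult, (Rabs_pos_eq (exp x)) by lra. apply Rmult_le_compat; try lra. apply Rabs_pos. }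
  assert (R2 : Rabs (exp x * (sin y - y)) <= 4 * (e' * m)).
  { rewrite Rabs_mult, (Rabs_pos_eq (exp x)) by lra. apply Rmult_le_compat; try lra. apply Rabs_pos. }
  assert (R3 : Rabs ((exp x - 1) * y) <= (2 * m) * e').
  { rewrite Rabs_mult. apply Rmult_le_compat; try apply Rabs_pos.
    - apply Rabs_le_between in Q1. apply Rabs_le_between in Hr. apply Rabs_le_between. 
      assert (e' * m <= m * 1) by (rewrite Rmult_comm; apply Rmult_le_compat_l; lra). lra.
    - lra. }
  match goal with |- Rabs ?A + Rabs ?B <= _ =>
    replace A with ((exp x - 1 - x) + exp x * (cos y - 1)) by ring;
    replace B with (exp x * (sin y - y) + (exp x - 1) * y) by ring end.
  pose proof (Rabs_triang (exp x - 1 - x) (exp x * (cos y - 1))).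
  pose proof (Rabs_triang (exp x * (sin y - y)) ((exp x - 1) * y)).
  assert (11 * (e' * m) <= e * m).
  { rewrite <- Rmult_assoc. apply Rmult_le_compat_r; lra. }
  lra.
Qed.

Lemma cdiff_Cexp (z : C) : cdiff Cexp z (Cexp z).
Proof.
  assert (Hs : cdiff (fun w => w - z)%C z 1).
  { replace (RtoC 1) with (1 + 0)%C by ring. apply (cdiff_plus (fun w => w) (fun _ => - z)%C).
    apply cdiff_id. apply cdiff_const. }
  assert (Hc : cdiff (fun w => Cexp (w - z)) z (1 * 1)%C).
  { apply (cdiff_comp Cexp (fun w => w - z)%C); auto.
    replace (z - z)%C with (RtoC 0) by ring. apply cdiff_Cexp_0. }
  pose proof (cdiff_mult _ _ _ _ _ (cdiff_const (Cexp z) z) Hc) as Hm. simpl in Hm.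
  replace (0 * Cexp (z - z) + Cexp z * (1 * 1))%C with (Cexp z) in Hm by ring.
  apply (cdiff_ext_loc _ _ _ _ 1 Rlt_0_1) with (2 := Hm).
  intros w _. rewrite <- Cexp_plus. f_equal. ring.
Qed.

Lemma chol_Cexp f z : chol f z -> chol (fun w => Cexp (f w)) z.
Proof. intros H. apply (chol_comp Cexp); auto. eexists; apply cdiff_Cexp. Qed.

(** * Complex-valued integrals *)

(** The variable of integration is real, so [C] is taken as a module over [R]; its product norm is
    [Cmod] by [norm_C_R]. *)
Definition CI (f : R -> C) (a b : R) : C := RInt (V := C_R_CompleteNormedModule) f a b.
Definition ex_CI (f : R -> C) (a b : R) : Prop := ex_RInt (V := C_R_NormedModule) f a b.
Definition is_CI (f : R -> C) (a b : R) (l : C) : Prop := is_RInt (V := C_R_NormedModule) f a b l.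

Lemma norm_C_R (x : C) : @norm R_AbsRing C_R_NormedModule x = Cmod x.
Proof.
  unfold norm; simpl. unfold prod_norm, Cmod, norm; simpl. unfold abs; simpl.
  f_equal. rewrite !Rmult_1_r, <- !Rabs_mult, !Rabs_pos_eq by apply Rle_0_sqr. reflexivity.
Qed.

Lemma CI_correct f a b : ex_CI f a b -> is_CI f a b (CI f a b).
Proof. intros H. apply (RInt_correct (V := C_R_CompleteNormedModule)). exact H. Qed.

Lemma is_CI_unique f a b l : is_CI f a b l -> CI f a b = l.
Proof. intros H. apply (is_RInt_unique (V := C_R_CompleteNormedModule)). exact H. Qed.

Lemma is_CI_ex_CI f a b l : is_CI f a b l -> ex_CI f a b.
Proof. intros H; exists l; exact H. Qed.

Lemma is_CI_pair (f : R -> C) a b (x y : R) :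
  is_RInt (fun t => Re (f t)) a b x -> is_RInt (fun t => Im (f t)) a b y ->
  is_CI f a b (x, y).
Proof. intros Hx Hy. apply (is_RInt_fct_extend_pair (U := R_NormedModule) (V := R_NormedModule)); auto. Qed.

Lemma is_CI_Re (f : R -> C) a b l : is_CI f a b l -> is_RInt (fun t => Re (f t)) a b (Re l).
Proof. intros H. apply (is_RInt_fct_extend_fst (U := R_NormedModule) (V := R_NormedModule)) in H. exact H. Qed.

Lemma is_CI_Im (f : R -> C) a b l : is_CI f a b l -> is_RInt (fun t => Im (f t)) a b (Im l).
Proof. intros H. apply (is_RInt_fct_extend_snd (U := R_NormedModule) (V := R_NormedModule)) in H. exact H. Qed.

Lemma is_CI_ext f g a b l :
  (forall x, Rmin a b < x < Rmax a b -> f x = g x) -> is_CI f a b l -> is_CI g a b l.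
Proof. intros; eapply is_RInt_ext; eauto. Qed.

Lemma is_CI_plus f g a b l m :
  is_CI f a b l -> is_CI g a b m -> is_CI (fun x => f x + g x)%C a b (l + m)%C.
Proof. intros; apply (is_RInt_plus (V := C_R_NormedModule)); auto. Qed.

(** A complex factor is not a scalar of the real module, so the product is integrated component by
    component. *)
Lemma is_CI_scal f c a b l : is_CI f a b l -> is_CI (fun x => c * f x)%C a b (c * l)%C.
Proof.
  intros H. pose proof (is_CI_Re _ _ _ _ H) as Hr. pose proof (is_CI_Im _ _ _ _ H) as Hi.
  destruct c as [c d], l as [u v]; simpl in *.
  apply is_CI_pair; simpl.
  - apply (is_RInt_minus (V := R_NormedModule)); apply (is_RInt_scal (V := R_NormedModule)); auto.
  - apply (is_RInt_plus (V := R_NormedModule)); apply (is_RInt_scal (V := R_NormedModule)); auto.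
Qed.

Lemma is_CI_opp f a b l : is_CI f a b l -> is_CI (fun x => - f x)%C a b (- l)%C.
Proof. intros; apply (is_RInt_opp (V := C_R_NormedModule)); auto. Qed.

Lemma is_CI_minus f g a b l m :
  is_CI f a b l -> is_CI g a b m -> is_CI (fun x => f x - g x)%C a b (l - m)%C.
Proof. intros; apply is_CI_plus; auto using is_CI_opp. Qed.

Lemma is_CI_Chasles f a b c l m : is_CI f a b l -> is_CI f b c m -> is_CI f a c (l + m)%C.
Proof. intros; eapply (is_RInt_Chasles (V := C_R_NormedModule)); eauto. Qed.

Lemma is_CI_bound f a b l M : a <= b ->
  (forall x, a <= x <= b -> Cmod (f x) <= M) -> is_CI f a b l -> Cmod l <= (b - a) * M.
Proof.
  intros Hab H Hi. rewrite <- norm_C_R. eapply norm_RInt_le_const; eauto.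
  intros x Hx; simpl. rewrite norm_C_R; auto.
Qed.

Lemma is_CI_bound_fun f g a b l m : a <= b ->
  (forall x, a <= x <= b -> Cmod (f x) <= g x) -> is_CI f a b l -> is_RInt g a b m -> Cmod l <= m.
Proof.
  intros Hab H Hi Hg. rewrite <- norm_C_R.
  apply (norm_RInt_le (V := C_R_NormedModule) f g a b); auto.
  intros x Hx; simpl. rewrite norm_C_R; auto.
Qed.

Lemma is_CI_const c a b : is_CI (fun _ => c) a b (RtoC (b - a) * c)%C.
Proof.
  rewrite <- scal_R_Cmult. apply @is_RInt_const.
Qed.

Lemma is_CI_conj f a b l : is_CI f a b l -> is_CI (fun x => Cconj (f x)) a b (Cconj l).
Proof.
  intros H. apply is_CI_pair; simpl.
  - apply is_CI_Re in H; exact H.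
  - apply (is_RInt_opp (V := R_NormedModule)). apply is_CI_Im in H; exact H.
Qed.

Lemma rcont_continuous (g : R -> C) (x : R) :
  rcont g x -> @continuous R_UniformSpace C_R_NormedModule g x.
Proof.
  intros H P [e HP]. destruct (H e (cond_pos e)) as [d [Hd Hc]].
  exists (mkposreal d Hd). intros y Hy. apply HP.
  specialize (Hc y Hy). 
  pose proof (re_le_Cmod (g y - g x)). pose proof (im_le_Cmod (g y - g x)).
  destruct (g y) as [u v], (g x) as [u' v'].
  split; simpl; unfold ball; simpl; unfold AbsRing_ball, abs, minus, plus, opp; simpl;
  unfold Re, Im in *; simpl in *; lra.
Qed.

Lemma ex_CI_rcont f a b : a <= b -> (forall x, a <= x <= b -> rcont f x) -> ex_CI f a b.
Proof.
  intros Hab H. apply (ex_RInt_continuous (V := C_R_CompleteNormedModule)).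
  intros z Hz. rewrite Rmin_left, Rmax_right in Hz by auto.
  apply rcont_continuous; auto.
Qed.

Lemma rcont_comp f g x : ccont f (g x) -> rcont g x -> rcont (fun y => f (g y)) x.
Proof.
  intros Hf Hg e He. destruct (Hf e He) as [d [Hd H]]. destruct (Hg d Hd) as [d' [Hd' H']].
  exists d'; auto.
Qed.

Lemma rcont_horiz y x : rcont (fun t => (t, y) : C) x.
Proof.
  intros e He. exists e; split; auto. intros t Ht.
  eapply Rle_lt_trans; [apply Cmod_le_sum|]. simpl.
  replace (y + - y) with 0 by ring. rewrite Rabs_R0. unfold Rminus in Ht. lra.
Qed.

Lemma rcont_vert x y : rcont (fun t => (x, t) : C) y.
Proof.
  intros e He. exists e; split; auto. intros t Ht.
  eapply Rle_lt_trans; [apply Cmod_le_sum|]. simpl.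
  replace (x + - x) with 0 by ring. rewrite Rabs_R0. unfold Rminus in Ht. lra.
Qed.

Lemma CI_Chasles f a b c : ex_CI f a b -> ex_CI f b c -> CI f a c = (CI f a b + CI f b c)%C.
Proof.
  intros H1 H2. apply is_CI_unique. apply is_CI_Chasles with b; now apply CI_correct.
Qed.

Lemma CI_ext f g a b : (forall x, Rmin a b < x < Rmax a b -> f x = g x) -> CI f a b = CI g a b.
Proof. intros H. apply (RInt_ext (V := C_R_CompleteNormedModule)). exact H. Qed.

Lemma CI_scal f c a b : ex_CI f a b -> CI (fun x => c * f x)%C a b = (c * CI f a b)%C.
Proof. intros H. apply is_CI_unique, is_CI_scal, CI_correct, H. Qed.

Lemma CI_bound f a b M : a <= b ->
  (forall x, a <= x <= b -> Cmod (f x) <= M) -> ex_CI f a b -> Cmod (CI f a b) <= (b - a) * M.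
Proof. intros; eapply is_CI_bound; eauto using CI_correct. Qed.

(** * Goursat's theorem and residues on rectangles *)

(** The contour integral along the boundary, counterclockwise; [Ci] is [dz / dy] on the vertical
    sides. *)
Definition rect_int (f : C -> C) (a b c d : R) : C :=
  (CI (fun x => f (x, c)) a b + Ci * CI (fun y => f (b, y)) c d
   - CI (fun x => f (x, d)) a b - Ci * CI (fun y => f (a, y)) c d)%C.

Definition in_rect (a b c d : R) (w : C) : Prop := a <= fst w <= b /\ c <= snd w <= d.

Definition rect_ok (f : C -> C) (a b c d : R) : Prop :=
  forall w, in_rect a b c d w -> ccont f w.

Lemma ex_CI_horiz f a b y : a <= b -> (forall x, a <= x <= b -> ccont f (x, y)) ->
  ex_CI (fun x => f (x, y)) a b.
Proof.
  intros Hab H. apply ex_CI_rcont; auto. intros x Hx.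
  apply (rcont_comp f (fun t => (t, y))); auto. apply rcont_horiz.
Qed.

Lemma ex_CI_vert f c d x : c <= d -> (forall y, c <= y <= d -> ccont f (x, y)) ->
  ex_CI (fun y => f (x, y)) c d.
Proof.
  intros Hab H. apply ex_CI_rcont; auto. intros y Hy.
  apply (rcont_comp f (fun t => (x, t))); auto. apply rcont_vert.
Qed.

Lemma rect_int_split_x f a m b c d : a <= m <= b -> c <= d ->
  (forall x, a <= x <= b -> ccont f (x, c)) -> (forall x, a <= x <= b -> ccont f (x, d)) ->
  rect_int f a b c d = (rect_int f a m c d + rect_int f m b c d)%C.
Proof.
  intros Hm Hc H1 H2. unfold rect_int.
  rewrite (CI_Chasles (fun x => f (x, c)) a m b);
    try (apply ex_CI_horiz; [lra|intros; apply H1; lra]).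
  rewrite (CI_Chasles (fun x => f (x, d)) a m b);
    try (apply ex_CI_horiz; [lra|intros; apply H2; lra]).
  ring.
Qed.

Lemma rect_int_split_y f a b c m d : c <= m <= d -> a <= b ->
  (forall y, c <= y <= d -> ccont f (a, y)) -> (forall y, c <= y <= d -> ccont f (b, y)) ->
  rect_int f a b c d = (rect_int f a b c m + rect_int f a b m d)%C.
Proof.
  intros Hm Hc H1 H2. unfold rect_int.
  rewrite (CI_Chasles (fun y => f (a, y)) c m d);
    try (apply ex_CI_vert; [lra|intros; apply H1; lra]).
  rewrite (CI_Chasles (fun y => f (b, y)) c m d);
    try (apply ex_CI_vert; [lra|intros; apply H2; lra]).
  ring.
Qed.

Definition bdry (a b c d : R) (w : C) : Prop :=
  in_rect a b c d w /\ (fst w = a \/ fst w = b \/ snd w = c \/ snd w = d).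

Lemma rect_int_bound f a b c d M : a <= b -> c <= d -> 0 <= M ->
  (forall w, bdry a b c d w -> ccont f w) ->
  (forall w, bdry a b c d w -> Cmod (f w) <= M) ->
  Cmod (rect_int f a b c d) <= 2 * ((b - a) + (d - c)) * M.
Proof.
  intros Hab Hcd HM HC HB. unfold rect_int.
  assert (X : forall y, y = c \/ y = d -> Cmod (CI (fun x => f (x, y)) a b) <= (b - a) * M).
  { intros y Hy. apply CI_bound; auto.
    - intros; apply HB; split; [split|]; simpl; lra.
    - apply ex_CI_horiz; auto. intros; apply HC; split; [split|]; simpl; lra. }
  assert (Y : forall x, x = a \/ x = b -> Cmod (CI (fun y => f (x, y)) c d) <= (d - c) * M).
  { intros x Hx. apply CI_bound; auto.
    - intros; apply HB; split; [split|]; simpl; lra.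
    - apply ex_CI_vert; auto. intros; apply HC; split; [split|]; simpl; lra. }
  pose proof (X c ltac:(auto)). pose proof (X d ltac:(auto)).
  pose proof (Y a ltac:(auto)). pose proof (Y b ltac:(auto)).
  unfold Cminus.
  eapply Rle_trans; [apply Cmod_triangle|].
  eapply Rle_trans; [apply Rplus_le_compat_r, Cmod_triangle|].
  eapply Rle_trans; [apply Rplus_le_compat_r, Rplus_le_compat_r, Cmod_triangle|].
  rewrite !Cmod_opp, !Cmod_mult, Cmod_Ci. lra.
Qed.

Lemma is_CI_horiz_id a b y : is_CI (fun x => (x, y) : C) a b ((b ^ 2 - a ^ 2) / 2, y * (b - a)).
Proof.
  apply is_CI_pair; simpl.
  - replace ((b * (b * 1) - a * (a * 1)) / 2) with (minus (b ^ 2 / 2) (a ^ 2 / 2))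
      by (unfold minus, plus, opp; simpl; field).
    apply (is_RInt_derive (fun x => x ^ 2 / 2) (fun x => x)).
    + intros x _. auto_derive; auto. field.
    + intros x _. apply continuous_id.
  - replace (y * (b - a)) with (scal (b - a) y) by (unfold scal; simpl; unfold mult; simpl; ring).
    apply @is_RInt_const.
Qed.

Lemma is_CI_vert_id c d x : is_CI (fun y => (x, y) : C) c d (x * (d - c), (d ^ 2 - c ^ 2) / 2).
Proof.
  apply is_CI_pair; simpl.
  - replace (x * (d - c)) with (scal (d - c) x) by (unfold scal; simpl; unfold mult; simpl; ring).
    apply @is_RInt_const.
  - replace ((d * (d * 1) - c * (c * 1)) / 2) with (minus (d ^ 2 / 2) (c ^ 2 / 2))
      by (unfold minus, plus, opp; simpl; field).
    apply (is_RInt_derive (fun x => x ^ 2 / 2) (fun x => x)).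
    + intros z _. auto_derive; auto. field.
    + intros z _. apply continuous_id.
Qed.

(** The four side integrals are explicit and cancel. This allows the affine part of a function to be
    removed before its contour integral is estimated. *)
Lemma rect_int_affine A B a b c d : rect_int (fun w => A + B * w)%C a b c d = 0.
Proof.
  unfold rect_int.
  rewrite (is_CI_unique _ _ _ _ (is_CI_plus _ _ _ _ _ _ (is_CI_const A a b) (is_CI_scal _ B _ _ _ (is_CI_horiz_id a b c)))).
  rewrite (is_CI_unique _ _ _ _ (is_CI_plus _ _ _ _ _ _ (is_CI_const A a b) (is_CI_scal _ B _ _ _ (is_CI_horiz_id a b d)))).
  rewrite (is_CI_unique _ _ _ _ (is_CI_plus _ _ _ _ _ _ (is_CI_const A c d) (is_CI_scal _ B _ _ _ (is_CI_vert_id c d b)))).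
  rewrite (is_CI_unique _ _ _ _ (is_CI_plus _ _ _ _ _ _ (is_CI_const A c d) (is_CI_scal _ B _ _ _ (is_CI_vert_id c d a)))).
  destruct A as [A1 A2], B as [B1 B2].
  apply injective_projections; simpl; field.
Qed.

Lemma rect_int_plus f g a b c d : a <= b -> c <= d ->
  (forall w, bdry a b c d w -> ccont f w) -> (forall w, bdry a b c d w -> ccont g w) ->
  rect_int (fun w => f w + g w)%C a b c d = (rect_int f a b c d + rect_int g a b c d)%C.
Proof.
  intros Hab Hcd Hf Hg. unfold rect_int.
  assert (X : forall F y, (forall w, bdry a b c d w -> ccont F w) -> y = c \/ y = d ->
    is_CI (fun x => F (x, y)) a b (CI (fun x => F (x, y)) a b)).
  { intros F y HF Hy. apply CI_correct, ex_CI_horiz; auto.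
    intros; apply HF; split; [split|]; simpl; lra. }
  assert (Y : forall F x, (forall w, bdry a b c d w -> ccont F w) -> x = a \/ x = b ->
    is_CI (fun y => F (x, y)) c d (CI (fun y => F (x, y)) c d)).
  { intros F y HF Hy. apply CI_correct, ex_CI_vert; auto.
    intros; apply HF; split; [split|]; simpl; lra. }
  rewrite (is_CI_unique _ _ _ _ (is_CI_plus _ _ _ _ _ _ (X f c Hf ltac:(auto)) (X g c Hg ltac:(auto)))).
  rewrite (is_CI_unique _ _ _ _ (is_CI_plus _ _ _ _ _ _ (X f d Hf ltac:(auto)) (X g d Hg ltac:(auto)))).
  rewrite (is_CI_unique _ _ _ _ (is_CI_plus _ _ _ _ _ _ (Y f a Hf ltac:(auto)) (Y g a Hg ltac:(auto)))).
  rewrite (is_CI_unique _ _ _ _ (is_CI_plus _ _ _ _ _ _ (Y f b Hf ltac:(auto)) (Y g b Hg ltac:(auto)))).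
  ring.
Qed.

Lemma ccont_affine A B z : ccont (fun w => A + B * w)%C z.
Proof. apply chol_ccont, chol_plus, chol_mult; auto using chol_const, chol_id. Qed.

Lemma ccont_plus f g z : ccont f z -> ccont g z -> ccont (fun w => f w + g w)%C z.
Proof.
  intros Hf Hg e He. destruct (Hf (e / 2)) as [d1 [Hd1 J1]]; [lra|].
  destruct (Hg (e / 2)) as [d2 [Hd2 J2]]; [lra|].
  exists (Rmin d1 d2); split; [now apply Rmin_pos|]. intros w Hw.
  pose proof (Rmin_l d1 d2). pose proof (Rmin_r d1 d2).
  specialize (J1 w ltac:(lra)). specialize (J2 w ltac:(lra)).
  replace (f w + g w - (f z + g z))%C with ((f w - f z) + (g w - g z))%C by ring.
  eapply Rle_lt_trans; [apply Cmod_triangle|]. lra.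
Qed.

Lemma in_rect_Cmod a b c d z w : in_rect a b c d z -> in_rect a b c d w ->
  Cmod (z - w) <= (b - a) + (d - c).
Proof.
  intros [H1 H2] [H3 H4]. eapply Rle_trans; [apply Cmod_le_sum|].
  destruct z as [x y], w as [u v]; simpl in *.
  apply Rplus_le_compat; apply Rabs_le; lra.
Qed.

(** After subtraction of the affine part at [w0], the integrand is at most [e] times the half
    perimeter, and the contour is twice the half perimeter long. *)
Lemma goursat_local f a b c d w0 l e : a <= b -> c <= d -> 0 < e ->
  rect_ok f a b c d -> in_rect a b c d w0 ->
  (forall w, in_rect a b c d w -> Cmod (f w - f w0 - (w - w0) * l) <= e * Cmod (w - w0)) ->
  Cmod (rect_int f a b c d) <= 2 * e * ((b - a) + (d - c)) ^ 2.
Proof.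
  intros Hab Hcd He Hok Hw0 H.
  set (A := (f w0 - w0 * l)%C).
  set (g := fun w => (f w + ((- A) + (- l) * w))%C).
  assert (Hg : rect_ok g a b c d).
  { intros w Hw. apply ccont_plus; auto. apply ccont_affine. }
  assert (E : rect_int f a b c d = rect_int g a b c d).
  { unfold g. rewrite rect_int_plus; auto.
    - rewrite rect_int_affine. ring.
    - intros w [Hw _]. auto.
    - intros w _; apply ccont_affine. }
  rewrite E.
  assert (B : forall w, in_rect a b c d w -> Cmod (g w) <= e * ((b - a) + (d - c))).
  { intros w Hw. unfold g, A.
    replace (f w + (- (f w0 - w0 * l) + - l * w))%C with (f w - f w0 - (w - w0) * l)%C by ring.
    eapply Rle_trans; [apply H; auto|]. apply Rmult_le_compat_l; [lra|].
    eapply in_rect_Cmod; eauto. }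
  replace (2 * e * (b - a + (d - c)) ^ 2) with (2 * ((b - a) + (d - c)) * (e * ((b - a) + (d - c)))) by ring.
  apply rect_int_bound; auto; try (intros w [Hw _]; auto).
  apply Rmult_le_pos; lra.
Qed.

Definition quarter (r r' : R * R * R * R) : Prop :=
  let '(a, b, c, d) := r in let '(a', b', c', d') := r' in
  ((a' = a /\ b' = (a + b) / 2) \/ (a' = (a + b) / 2 /\ b' = b)) /\
  ((c' = c /\ d' = (c + d) / 2) \/ (c' = (c + d) / 2 /\ d' = d)).

Definition is_rect (r : R * R * R * R) : Prop :=
  let '(a, b, c, d) := r in a <= b /\ c <= d.

(** If a property passes from the quarters to the rectangle, then a rectangle without it has a
    quarter without it. Dependent choice on the subtype of bad rectangles iterates this. *)
Lemma bisect_seq (P : R * R * R * R -> Prop) (r0 : R * R * R * R) :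
  is_rect r0 -> ~ P r0 ->
  (forall r, is_rect r -> (forall r', quarter r r' -> P r') -> P r) ->
  exists u : nat -> R * R * R * R, u 0%nat = r0 /\
    (forall n, is_rect (u n) /\ ~ P (u n) /\ quarter (u n) (u (S n))).
Proof.
  intros H0 HP0 Hstep.
  set (T := {r | is_rect r /\ ~ P r}).
  assert (next : forall t : T, exists t' : T, quarter (proj1_sig t) (proj1_sig t')).
  { intros [r [Hr HP]]. simpl.
    destruct (classic (exists r', quarter r r' /\ ~ P r')) as [[r' [Hq HP']]|Hn].
    - assert (Hr' : is_rect r').
      { destruct r as [[[a b] c] d], r' as [[[a' b'] c'] d']. simpl in *.
        destruct Hq as [[[-> ->]|[-> ->]] [[-> ->]|[-> ->]]]; lra. }
      exists (exist _ r' (conj Hr' HP')). exact Hq.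
    - exfalso. apply HP. apply Hstep; auto. intros r' Hq.
      apply NNPP. intros HP'. apply Hn. exists r'. auto. }
  set (nx := fun t => proj1_sig (constructive_indefinite_description _ (next t))).
  set (u := fix u n := match n with O => exist _ r0 (conj H0 HP0) : T | S n => nx (u n) end).
  exists (fun n => proj1_sig (u n)). split; auto.
  intros n. split; [|split].
  - exact (proj1 (proj2_sig (u n))).
  - exact (proj2 (proj2_sig (u n))).
  - simpl. unfold nx. exact (proj2_sig (constructive_indefinite_description _ (next (u n)))).
Qed.

Lemma nested_point (a b : nat -> R) :
  (forall n, a n <= b n) -> (forall n, a n <= a (S n)) -> (forall n, b (S n) <= b n) ->
  exists x, forall n, a n <= x <= b n.
Proof.
  intros Hab Ha Hb.
  assert (Ha' : forall n m, (n <= m)%nat -> a n <= a m).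
  { intros n m Hnm. induction Hnm; [lra|]. specialize (Ha m). lra. }
  assert (Hb' : forall n m, (n <= m)%nat -> b m <= b n).
  { intros n m Hnm. induction Hnm; [lra|]. specialize (Hb m). lra. }
  assert (Hx : forall n m, a n <= b m).
  { intros n m. apply Rle_trans with (a (max n m)); [apply Ha'; lia|].
    apply Rle_trans with (b (max n m)); [apply Hab|apply Hb'; lia]. }
  destruct (completeness (fun x => exists n, x = a n)) as [x [Hub Hlub]].
  - exists (b 0%nat). intros y [n ->]. apply Hx.
  - exists (a 0%nat). now exists 0%nat.
  - exists x. intros n. split.
    + apply Hub. now exists n.
    + apply Hlub. intros y [m ->]. apply Hx.
Qed.

Lemma goursat f a b c d : a <= b -> c <= d ->
  (forall w, in_rect a b c d w -> chol f w) -> rect_int f a b c d = 0.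
Proof.
  intros Hab Hcd Hf. apply Cmod_eq_0, Rle_antisym; [|apply Cmod_ge_0].
  set (s := fun r : R * R * R * R => let '(a, b, c, d) := r in (b - a) + (d - c)).
  set (I := fun r : R * R * R * R => let '(a, b, c, d) := r in rect_int f a b c d).
  assert (Main : forall e, 0 < e -> Cmod (rect_int f a b c d) <= 2 * e * ((b - a) + (d - c)) ^ 2).
  { intros e He.
    set (sub := fun r : R * R * R * R => let '(a', b', c', d') := r in a <= a' /\ b' <= b /\ c <= c' /\ d' <= d).
    (* The bound is quadratic in the size: each quarter contributes a fourth of it, so [P] passes
       from the quarters to the rectangle. It is restricted to subrectangles because [f] is
       holomorphic only there. *)
    set (P := fun r => sub r -> Cmod (I r) <= 2 * e * (s r) ^ 2).
    destruct (classic (P (a, b, c, d))) as [HP|HP].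
    { apply HP. simpl; lra. }
    exfalso.
    destruct (bisect_seq P (a, b, c, d)) as [u [Hu0 Hu]]; auto; [simpl; auto| |].
    - intros [[[a' b'] c'] d'] [H1 H2] HQ Hs. simpl in Hs. unfold I, s.
      set (m := (a' + b') / 2). set (k := (c' + d') / 2).
      assert (Hm : a' <= m <= b') by (unfold m; lra).
      assert (Hk : c' <= k <= d') by (unfold k; lra).
      assert (Hc : forall w, in_rect a' b' c' d' w -> ccont f w).
      { intros w [Hw1 Hw2]. apply chol_ccont, Hf. split; lra. }
      rewrite (rect_int_split_x f a' m b' c' d') by
        (first [lra | intros; apply Hc; split; simpl; lra]).
      rewrite (rect_int_split_y f a' m c' k d') by
        (first [lra | intros; apply Hc; split; simpl; lra]).
      rewrite (rect_int_split_y f m b' c' k d') by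
        (first [lra | intros; apply Hc; split; simpl; lra]).
      assert (Q1 := HQ (a', m, c', k) ltac:(simpl; auto) ltac:(simpl; lra)).
      assert (Q2 := HQ (a', m, k, d') ltac:(simpl; auto) ltac:(simpl; lra)).
      assert (Q3 := HQ (m, b', c', k) ltac:(simpl; auto) ltac:(simpl; lra)).
      assert (Q4 := HQ (m, b', k, d') ltac:(simpl; auto) ltac:(simpl; lra)).
      unfold I, s in Q1, Q2, Q3, Q4.
      eapply Rle_trans; [apply Cmod_triangle|].
      pose proof (Cmod_triangle (rect_int f a' m c' k) (rect_int f a' m k d')).
      pose proof (Cmod_triangle (rect_int f m b' c' k) (rect_int f m b' k d')).
      replace (m - a' + (k - c')) with ((b' - a' + (d' - c')) / 2) in Q1 by (unfold m, k; field).
      replace (m - a' + (d' - k)) with ((b' - a' + (d' - c')) / 2) in Q2 by (unfold m, k; field).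
      replace (b' - m + (k - c')) with ((b' - a' + (d' - c')) / 2) in Q3 by (unfold m, k; field).
      replace (b' - m + (d' - k)) with ((b' - a' + (d' - c')) / 2) in Q4 by (unfold m, k; field).
      lra.
    - set (ua := fun n => let '(a', b', c', d') := u n in a').
      set (ub := fun n => let '(a', b', c', d') := u n in b').
      set (uc := fun n => let '(a', b', c', d') := u n in c').
      set (ud := fun n => let '(a', b', c', d') := u n in d').
      assert (E : forall n, u n = (ua n, ub n, uc n, ud n)).
      { intros n. unfold ua, ub, uc, ud. destruct (u n) as [[[? ?] ?] ?]; auto. }
      assert (Hr : forall n, (ua n <= ub n /\ uc n <= ud n) /\
         (ua n <= ua (S n) /\ ub (S n) <= ub n /\ uc n <= uc (S n) /\ ud (S n) <= ud n) /\
         (ub (S n) - ua (S n) = (ub n - ua n) / 2 /\ ud (S n) - uc (S n) = (ud n - uc n) / 2)).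
      { intros n. destruct (Hu n) as [H1 [_ H2]]. rewrite (E n) in H1, H2. rewrite (E (S n)) in H2.
        simpl in H1, H2. split; auto.
        destruct H2 as [[[-> ->]|[-> ->]] [[-> ->]|[-> ->]]]; split; lra. }
      destruct (nested_point ua ub) as [x Hx]; try (intros; apply Hr).
      destruct (nested_point uc ud) as [y Hy]; try (intros; apply Hr).
      assert (E0 : ua 0%nat = a /\ ub 0%nat = b /\ uc 0%nat = c /\ ud 0%nat = d).
      { unfold ua, ub, uc, ud. rewrite Hu0. auto. }
      destruct E0 as [Ea [Eb [Ec Ed]]].
      assert (Hsub : forall n, a <= ua n /\ ub n <= b /\ c <= uc n /\ ud n <= d).
      { induction n; [lra|]. specialize (Hr n). lra. }
      assert (Hsz : forall n, (ub n - ua n) + (ud n - uc n) = ((b - a) + (d - c)) * (/ 2) ^ n).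
      { induction n; [simpl; lra|]. destruct (Hr n) as [_ [_ [R1 R2]]]. rewrite R1, R2. simpl. lra. }
      assert (Hin : in_rect a b c d (x, y)).
      { specialize (Hx 0%nat). specialize (Hy 0%nat). split; simpl; lra. }
      destruct (Hf _ Hin) as [l Hl]. destruct (Hl e He) as [dl [Hdl Hd]].
      assert (exists n, ((b - a) + (d - c)) * (/ 2) ^ n < dl) as [n Hn].
      { destruct (pow_lt_1_zero (/ 2)) with (y := dl / ((b - a) + (d - c) + 1)) as [N HN].
        - rewrite Rabs_pos_eq; lra.
        - apply Rdiv_lt_0_compat; lra.
        - exists N. specialize (HN N (Nat.le_refl N)).
          assert (Hp : 0 < (/ 2) ^ N) by (apply pow_lt; lra).
          rewrite Rabs_pos_eq in HN by lra.
          apply (Rmult_lt_compat_r ((b - a) + (d - c) + 1)) in HN; [|lra].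
          unfold Rdiv in HN. rewrite Rmult_assoc, Rinv_l in HN by lra. nra. }
      destruct (Hu n) as [_ [HnP _]]. apply HnP. rewrite (E n). intros _. unfold I, s.
      destruct (Hr n) as [[R1 R2] _]. specialize (Hsub n).
      assert (Hxy : in_rect (ua n) (ub n) (uc n) (ud n) (x, y)) by (split; simpl; auto).
      apply goursat_local with (w0 := (x, y)) (l := l); auto.
      + intros w [W1 W2]. apply chol_ccont, Hf. split; lra.
      + intros w Hw. apply Hd. eapply Rle_lt_trans; [|exact Hn].
        rewrite <- (Hsz n). eapply in_rect_Cmod; eauto. }
  apply Rnot_lt_le. intros Hpos.
  set (S0 := ((b - a) + (d - c)) ^ 2). assert (0 <= S0) by apply pow2_ge_0.
  (* With this [e] the bound is at most half of the integral itself; the [+ 1] covers a degenerate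
     rectangle. *)
  specialize (Main (Cmod (rect_int f a b c d) / (4 * (S0 + 1)))).
  fold S0 in Main. set (X := Cmod (rect_int f a b c d)) in *.
  assert (HX : 0 < X / (4 * (S0 + 1))) by (apply Rdiv_lt_0_compat; lra).
  specialize (Main HX).
  assert (2 * (X / (4 * (S0 + 1))) * S0 <= X / 2).
  { replace (2 * (X / (4 * (S0 + 1))) * S0) with (X / 2 * (S0 / (S0 + 1))) by (field; lra).
    rewrite <- (Rmult_1_r (X / 2)) at 2. apply Rmult_le_compat_l; [lra|].
    apply Rmult_le_reg_r with (S0 + 1); [lra|]. unfold Rdiv. rewrite Rmult_assoc, Rinv_l by lra. lra. }
  lra.
Qed.

Lemma is_RInt_odd_kernel t0 c : 0 < c ->
  is_RInt (fun t => (t - t0) / ((t - t0) ^ 2 + c ^ 2)) (t0 - c) (t0 + c) 0.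
Proof.
  intros Hc.
  assert (Hp : forall t, 0 < (t - t0) ^ 2 + c ^ 2)
    by (intros t; pose proof (pow2_ge_0 (t - t0)); pose proof (pow_lt c 2 Hc); lra).
  replace 0 with (minus (ln ((t0 + c - t0) ^ 2 + c ^ 2) / 2) (ln ((t0 - c - t0) ^ 2 + c ^ 2) / 2)).
  - apply (is_RInt_derive (fun t => ln ((t - t0) ^ 2 + c ^ 2) / 2)).
    + intros x _. specialize (Hp x). auto_derive; [simpl in *; lra|].
      field. simpl in *. lra.
    + intros x _. apply @ex_derive_continuous. specialize (Hp x). auto_derive. simpl in *; lra.
  - unfold minus, plus, opp; simpl.
    replace (t0 + c - t0) with c by ring. replace (t0 - c - t0) with (- c) by ring.
    replace (- c * (- c * 1)) with (c * (c * 1)) by ring. ring.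
Qed.

(** [PI / 2] is the angle under which a side of a square is seen from its centre. *)
Lemma is_RInt_poisson_kernel t0 c : 0 < c ->
  is_RInt (fun t => c / ((t - t0) ^ 2 + c ^ 2)) (t0 - c) (t0 + c) (PI / 2).
Proof.
  intros Hc.
  assert (Hp : forall t, 0 < (t - t0) ^ 2 + c ^ 2)
    by (intros t; pose proof (pow2_ge_0 (t - t0)); pose proof (pow_lt c 2 Hc); lra).
  replace (PI / 2) with (minus (atan ((t0 + c - t0) / c)) (atan ((t0 - c - t0) / c))).
  - apply (is_RInt_derive (fun t => atan ((t - t0) / c))).
    + intros x _. specialize (Hp x). auto_derive; auto.
      field. repeat split; simpl in *; nra.
    + intros x _. apply @ex_derive_continuous. specialize (Hp x). auto_derive. simpl in *; lra.
  - unfold minus, plus, opp; simpl.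
    replace ((t0 + c - t0) / c) with 1 by (field; lra).
    replace ((t0 - c - t0) / c) with (Ropp 1) by (field; lra).
    rewrite (atan_opp 1), atan_1. field.
Qed.

Lemma is_RInt_ext_all (f g : R -> R) a b l : (forall x, f x = g x) -> is_RInt f a b l -> is_RInt g a b l.
Proof. intros H; apply is_RInt_ext; auto. Qed.

(** On each side one component of [1 / (w - w0)] is odd about the midpoint and integrates to 0, the
    other gives a quarter turn. *)
Lemma rect_int_inv_square w0 c : 0 < c ->
  rect_int (fun w => / (w - w0))%C (fst w0 - c) (fst w0 + c) (snd w0 - c) (snd w0 + c)
  = (RtoC (2 * PI) * Ci)%C.
Proof.
  intros Hc. destruct w0 as [x0 y0]; simpl. unfold rect_int.
  assert (Hp : forall t t0 : R, 0 < (t - t0) * ((t - t0) * 1) + c * (c * 1)) 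
    by (intros t t0; pose proof (pow2_ge_0 (t - t0)); pose proof (pow_lt c 2 Hc); simpl in *; lra).
  assert (N : forall k t0 c' (g : R -> R), is_RInt g (t0 - c') (t0 + c') k ->
     is_RInt (fun x => - g x) (t0 - c') (t0 + c') (- k)).
  { intros. apply (is_RInt_opp (V := R_NormedModule)). auto. }
  assert (E1 : is_CI (fun x => / ((x, (y0 - c)%R) - (x0, y0)))%C (x0 - c) (x0 + c) (0, PI / 2)).
  { apply is_CI_pair; simpl.
    - eapply is_RInt_ext_all; [|apply is_RInt_odd_kernel; eauto]. intros x; simpl.
      unfold Rdiv; rewrite ?Ropp_mult_distr_l; apply f_equal2; [ring|apply f_equal; ring].
    - eapply is_RInt_ext_all; [|apply is_RInt_poisson_kernel; eauto]. intros x; simpl.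
      unfold Rdiv; rewrite ?Ropp_mult_distr_l; apply f_equal2; [ring|apply f_equal; ring]. }
  assert (E2 : is_CI (fun y => / (((x0 + c)%R, y) - (x0, y0)))%C (y0 - c) (y0 + c) (PI / 2, - 0)).
  { apply is_CI_pair; simpl.
    - eapply is_RInt_ext_all; [|apply is_RInt_poisson_kernel; eauto]. intros x; simpl.
      unfold Rdiv; rewrite ?Ropp_mult_distr_l; apply f_equal2; [ring|apply f_equal; ring].
    - eapply is_RInt_ext_all; [|apply N, is_RInt_odd_kernel; eauto]. intros x; simpl.
      unfold Rdiv; rewrite ?Ropp_mult_distr_l; apply f_equal2; [ring|apply f_equal; ring]. }
  assert (E3 : is_CI (fun x => / ((x, (y0 + c)%R) - (x0, y0)))%C (x0 - c) (x0 + c) (0, - (PI / 2))).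
  { apply is_CI_pair; simpl.
    - eapply is_RInt_ext_all; [|apply is_RInt_odd_kernel; eauto]. intros x; simpl.
      unfold Rdiv; rewrite ?Ropp_mult_distr_l; apply f_equal2; [ring|apply f_equal; ring].
    - eapply is_RInt_ext_all; [|apply N, is_RInt_poisson_kernel; eauto]. intros x; simpl.
      unfold Rdiv; rewrite ?Ropp_mult_distr_l; apply f_equal2; [ring|apply f_equal; ring]. }
  assert (E4 : is_CI (fun y => / (((x0 - c)%R, y) - (x0, y0)))%C (y0 - c) (y0 + c) (- (PI / 2), - 0)).
  { apply is_CI_pair; simpl.
    - eapply is_RInt_ext_all; [|apply N, is_RInt_poisson_kernel; eauto]. intros x; simpl.
      unfold Rdiv; rewrite ?Ropp_mult_distr_l; apply f_equal2; [ring|apply f_equal; ring].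
    - eapply is_RInt_ext_all; [|apply N, is_RInt_odd_kernel; eauto]. intros x; simpl.
      unfold Rdiv; rewrite ?Ropp_mult_distr_l; apply f_equal2; [ring|apply f_equal; ring]. }
  rewrite (is_CI_unique _ _ _ _ E1), (is_CI_unique _ _ _ _ E2), (is_CI_unique _ _ _ _ E3), (is_CI_unique _ _ _ _ E4).
  apply injective_projections; simpl; field.
Qed.

Lemma rect_int_scal f k a b c d : a <= b -> c <= d ->
  (forall w, bdry a b c d w -> ccont f w) ->
  rect_int (fun w => k * f w)%C a b c d = (k * rect_int f a b c d)%C.
Proof.
  intros Hab Hcd Hf. unfold rect_int.
  assert (X : forall y, y = c \/ y = d -> CI (fun x => k * f (x, y))%C a b = (k * CI (fun x => f (x, y)) a b)%C).
  { intros y Hy. apply (CI_scal (fun x => f (x, y))), ex_CI_horiz; auto.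
    intros; apply Hf; split; [split|]; simpl; lra. }
  assert (Y : forall x, x = a \/ x = b -> CI (fun y => k * f (x, y))%C c d = (k * CI (fun y => f (x, y)) c d)%C).
  { intros x Hx. apply (CI_scal (fun y => f (x, y))), ex_CI_vert; auto.
    intros; apply Hf; split; [split|]; simpl; lra. }
  rewrite (X c), (X d), (Y a), (Y b) by auto. ring.
Qed.

Lemma bdry_square_Cmod w0 s w : 0 < s ->
  bdry (fst w0 - s) (fst w0 + s) (snd w0 - s) (snd w0 + s) w ->
  s <= Cmod (w - w0) <= 2 * s.
Proof.
  intros Hs [[H1 H2] H3]. split.
  - pose proof (re_le_Cmod (w - w0)) as Hr. pose proof (im_le_Cmod (w - w0)) as Hi.
    destruct w as [x y], w0 as [x0 y0]; simpl in *.
    destruct H3 as [->|[->|[->| ->]]].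
    + eapply Rle_trans; [|exact Hr]. rewrite Rabs_left1; lra.
    + eapply Rle_trans; [|exact Hr]. rewrite Rabs_pos_eq; lra.
    + eapply Rle_trans; [|exact Hi]. rewrite Rabs_left1; lra.
    + eapply Rle_trans; [|exact Hi]. rewrite Rabs_pos_eq; lra.
  - eapply Rle_trans; [apply Cmod_le_sum|].
    destruct w as [x y], w0 as [x0 y0]; simpl in *.
    assert (Rabs (x + - x0) <= s) by (apply Rabs_le; lra).
    assert (Rabs (y + - y0) <= s) by (apply Rabs_le; lra). lra.
Qed.

(** Two vertical and two horizontal cuts remove four rectangles that avoid [w0]; Goursat's theorem
    annihilates each of them. *)
Lemma rect_int_shrink f a b c d w0 s : 0 < s ->
  a <= fst w0 - s -> fst w0 + s <= b -> c <= snd w0 - s -> snd w0 + s <= d ->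
  (forall w, in_rect a b c d w -> w <> w0 -> chol f w) ->
  rect_int f a b c d = rect_int f (fst w0 - s) (fst w0 + s) (snd w0 - s) (snd w0 + s).
Proof.
  intros Hs H1 H2 H3 H4 Hf. destruct w0 as [x0 y0]; simpl in *.
  assert (K : forall x y, a <= x <= b -> c <= y <= d -> x <> x0 \/ y <> y0 -> chol f (x, y)).
  { intros x y Hx Hy Hne. apply Hf; [split; auto|]. intros E; inversion E; tauto. }
  assert (G : forall a' b' c' d', a <= a' <= b' -> b' <= b -> c <= c' <= d' -> d' <= d ->
     (b' < x0 \/ x0 < a' \/ d' < y0 \/ y0 < c') -> rect_int f a' b' c' d' = 0).
  { intros. apply goursat; try lra. intros [x y] [W1 W2]; simpl in *. apply K; lra. }
  assert (Q : forall x y, a <= x <= b -> c <= y <= d -> x <> x0 \/ y <> y0 -> ccont f (x, y))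
    by (intros; apply chol_ccont, K; auto).
  rewrite (rect_int_split_x f a (x0 - s) b c d) by (first [lra | intros; apply Q; lra]).
  rewrite (G a (x0 - s) c d) by lra.
  rewrite (rect_int_split_x f (x0 - s) (x0 + s) b c d) by (first [lra | intros; apply Q; lra]).
  rewrite (G (x0 + s) b c d) by lra.
  rewrite (rect_int_split_y f (x0 - s) (x0 + s) c (y0 - s) d) by (first [lra | intros; apply Q; lra]).
  rewrite (G (x0 - s) (x0 + s) c (y0 - s)) by lra.
  rewrite (rect_int_split_y f (x0 - s) (x0 + s) (y0 - s) (y0 + s) d) by (first [lra | intros; apply Q; lra]).
  rewrite (G (x0 - s) (x0 + s) (y0 + s) d) by lra.
  ring.
Qed.

(** Subtracting [r / (w - w0)] leaves an integrand that is [o (1 / |w - w0|)] on a square around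
    [w0] whose perimeter is proportional to its size. The residue is given as a limit, so the value
    [f w0] is irrelevant. *)
Lemma residue_rect f a b c d w0 r :
  a < fst w0 < b -> c < snd w0 < d ->
  (forall w, in_rect a b c d w -> w <> w0 -> chol f w) ->
  (forall e, 0 < e -> exists dl, 0 < dl /\ forall w, w <> w0 -> Cmod (w - w0) < dl ->
     Cmod ((w - w0) * f w - r) <= e) ->
  rect_int f a b c d = (RtoC (2 * PI) * Ci * r)%C.
Proof.
  intros Hx Hy Hf Hr. apply Ceq_minus, Cmod_eq_0, Rle_antisym; [|apply Cmod_ge_0].
  apply Rnot_lt_le. intros Hpos.
  set (X := Cmod _) in Hpos.
  (* The square of half side [s] has perimeter [8 s], and the corrected integrand is at most
     [X / 16 / s] on it; the product is [X / 2]. *)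
  destruct (Hr (X / 16)) as [dl [Hdl Hd]]; [lra|].
  set (s := Rmin (Rmin (fst w0 - a) (b - fst w0)) (Rmin (Rmin (snd w0 - c) (d - snd w0)) (dl / 4))).
  assert (Hs : 0 < s) by (unfold s; repeat apply Rmin_pos; lra).
  assert (s <= fst w0 - a) by (unfold s; eapply Rle_trans; [apply Rmin_l|apply Rmin_l]).
  assert (s <= b - fst w0) by (unfold s; eapply Rle_trans; [apply Rmin_l|apply Rmin_r]).
  assert (s <= snd w0 - c) by (unfold s; eapply Rle_trans; [apply Rmin_r|]; eapply Rle_trans; [apply Rmin_l|apply Rmin_l]).
  assert (s <= d - snd w0) by (unfold s; eapply Rle_trans; [apply Rmin_r|]; eapply Rle_trans; [apply Rmin_l|apply Rmin_r]).
  assert (s <= dl / 4) by (unfold s; eapply Rle_trans; [apply Rmin_r|]; apply Rmin_r).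
  assert (B : forall w, bdry (fst w0 - s) (fst w0 + s) (snd w0 - s) (snd w0 + s) w ->
     w <> w0 /\ s <= Cmod (w - w0) <= 2 * s).
  { intros w Hw. pose proof (bdry_square_Cmod _ _ _ Hs Hw) as Q. split; auto.
    intros ->. replace (w0 - w0)%C with (RtoC 0) in Q by ring. rewrite Cmod_0 in Q. lra. }
  assert (Hcf : forall w, bdry (fst w0 - s) (fst w0 + s) (snd w0 - s) (snd w0 + s) w -> ccont f w).
  { intros w Hw. apply chol_ccont, Hf; [|apply B; auto]. destruct Hw as [[W1 W2] _]. split; lra. }
  assert (Hci : forall w, bdry (fst w0 - s) (fst w0 + s) (snd w0 - s) (snd w0 + s) w ->
     ccont (fun w => / (w - w0))%C w).
  { intros w Hw. apply chol_ccont, (chol_inv (fun w => w - w0)%C).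
    - apply chol_minus; auto using chol_id, chol_const.
    - apply B in Hw. intros E. apply Ceq_minus in E. tauto. }
  assert (Hck : forall k w, bdry (fst w0 - s) (fst w0 + s) (snd w0 - s) (snd w0 + s) w ->
     ccont (fun w => k * / (w - w0))%C w).
  { intros k w Hw. apply chol_ccont, chol_mult; [apply chol_const|].
    apply (chol_inv (fun w => w - w0)%C).
    - apply chol_minus; auto using chol_id, chol_const.
    - apply B in Hw. intros E. apply Ceq_minus in E. tauto. }
  assert (E : (rect_int f a b c d - RtoC (2 * PI) * Ci * r)%C =
     rect_int (fun w => f w + (- r) * / (w - w0))%C (fst w0 - s) (fst w0 + s) (snd w0 - s) (snd w0 + s)).
  { rewrite rect_int_plus by (auto; lra).
    rewrite rect_int_scal by (auto; lra). rewrite rect_int_inv_square by auto.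
    rewrite (rect_int_shrink f a b c d w0 s) by (auto; lra). ring. }
  assert (X <= 2 * ((fst w0 + s - (fst w0 - s)) + (snd w0 + s - (snd w0 - s))) * (X / 16 / s)).
  { unfold X at 1. rewrite E. apply rect_int_bound; try lra.
    - apply Rlt_le, Rdiv_lt_0_compat; lra.
    - intros w Hw. apply ccont_plus; auto.
    - intros w Hw. destruct (B w Hw) as [Hne [Q1 Q2]].
      assert (Hne' : (w - w0)%C <> 0) by (intros Z; apply Ceq_minus in Z; tauto).
      replace (f w + - r * / (w - w0))%C with (((w - w0) * f w - r) / (w - w0))%C by (field; auto).
      rewrite Cmod_div by auto. specialize (Hd w Hne ltac:(lra)).
      apply Rmult_le_compat; auto using Cmod_ge_0.
      + left. apply Rinv_0_lt_compat; lra.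
      + apply Rinv_le_contravar; lra. }
  replace (2 * ((fst w0 + s - (fst w0 - s)) + (snd w0 + s - (snd w0 - s))) * (X / 16 / s)) with (X / 2) in * by (field; lra).
  lra.
Qed.

Lemma ccont_mult f g z : ccont f z -> ccont g z -> ccont (fun w => f w * g w)%C z.
Proof.
  intros Hf Hg e He.
  set (K := 1 + Cmod (f z) + Cmod (g z)).
  pose proof (Cmod_ge_0 (f z)). pose proof (Cmod_ge_0 (g z)).
  assert (HK : 0 < K) by (unfold K; lra).
  set (e' := Rmin 1 (e / (2 * K))).
  assert (He1 : 0 < e') by (apply Rmin_pos; [lra|apply Rdiv_lt_0_compat; lra]).
  assert (He3 : e' <= 1) by apply Rmin_l.
  assert (He2 : e' * (2 * K) <= e).
  { pose proof (Rmin_r 1 (e / (2 * K))) as Hr. fold e' in Hr.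
    apply (Rmult_le_compat_r (2 * K)) in Hr; [|lra].
    unfold Rdiv in Hr. rewrite Rmult_assoc, Rinv_l in Hr by lra. lra. }
  destruct (Hf e' He1) as [d1 [Hd1 J1]]. destruct (Hg e' He1) as [d2 [Hd2 J2]].
  exists (Rmin d1 d2); split; [now apply Rmin_pos|]. intros w Hw.
  pose proof (Rmin_l d1 d2). pose proof (Rmin_r d1 d2).
  specialize (J1 w ltac:(lra)). specialize (J2 w ltac:(lra)).
  replace (f w * g w - f z * g z)%C with ((f w - f z) * g w + f z * (g w - g z))%C by ring.
  eapply Rle_lt_trans; [apply Cmod_triangle|]. rewrite !Cmod_mult.
  pose proof (Cmod_le_minus (g w) (g z)).
  pose proof (Cmod_ge_0 (f w - f z)). pose proof (Cmod_ge_0 (g w - g z)). pose proof (Cmod_ge_0 (g w)).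
  assert (Cmod (f w - f z) * Cmod (g w) <= e' * (1 + Cmod (g z))) by (apply Rmult_le_compat; lra).
  assert (Cmod (f z) * Cmod (g w - g z) <= Cmod (f z) * e') by (apply Rmult_le_compat_l; lra).
  unfold K in He2. nra.
Qed.

Lemma ccont_inv f z : ccont f z -> f z <> 0 -> ccont (fun w => / f w)%C z.
Proof.
  intros Hf Hz e He. destruct (cdiff_ccont _ _ _ (cdiff_inv _ Hz) e He) as [d [Hd J]].
  destruct (Hf d Hd) as [d' [Hd' J']]. exists d'; auto.
Qed.

Lemma ccont_comp f g z : ccont g z -> ccont f (g z) -> ccont (fun w => f (g w)) z.
Proof.
  intros Hg Hf e He. destruct (Hf e He) as [d [Hd J]]. destruct (Hg d Hd) as [d' [Hd' J']].
  exists d'; auto.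
Qed.

(** The slope [D w / (w - w0)], completed by [l] at [w0], is continuous and not zero there, so [N]
    divided by it is continuous at [w0]. *)
Lemma residue_quotient N D w0 l : ccont N w0 -> cdiff D w0 l -> D w0 = 0 -> l <> 0 ->
  forall e, 0 < e -> exists dl, 0 < dl /\ forall w, w <> w0 -> Cmod (w - w0) < dl ->
     Cmod ((w - w0) * (N w / D w) - N w0 / l) <= e.
Proof.
  intros HN HD HD0 Hl e He.
  set (q := fun w => if excluded_middle_informative (w = w0) then l else (D w / (w - w0))%C).
  assert (Eq0 : q w0 = l).
  { unfold q. destruct (excluded_middle_informative (w0 = w0)); tauto. }
  assert (Hq : ccont q w0).
  { intros e' He'. destruct (HD (e' / 2)) as [d [Hd J]]; [lra|]. exists d; split; auto.
    intros w Hw. rewrite Eq0. unfold q. destruct (excluded_middle_informative (w = w0)) as [->|Hne].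
    - replace (l - l)%C with (RtoC 0) by ring. rewrite Cmod_0; lra.
    - assert (Hne' : (w - w0)%C <> 0) by (intros Z; apply Ceq_minus in Z; tauto).
      replace (D w / (w - w0) - l)%C with ((D w - D w0 - (w - w0) * l) / (w - w0))%C
        by (rewrite HD0; field; auto).
      rewrite Cmod_div by auto. specialize (J w Hw).
      apply Cmod_gt_0 in Hne'. apply Rle_lt_trans with (e' / 2); [|lra].
      apply Rmult_le_reg_r with (Cmod (w - w0)); auto. unfold Rdiv at 1.
      rewrite Rmult_assoc, Rinv_l by lra. lra. }
  assert (Hc : ccont (fun w => N w * / q w)%C w0).
  { apply ccont_mult; auto. apply ccont_inv; auto. rewrite Eq0; auto. }
  destruct (Hc e He) as [d [Hd J]].
  assert (Hlp : 0 < Cmod l) by (now apply Cmod_gt_0).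
  (* Within [d2] the linear term of [D] dominates the error, hence [D w <> 0] for [w <> w0] and the
     quotient is genuine. *)
  destruct (HD (Cmod l / 2)) as [d2 [Hd2 J2]]; [lra|].
  exists (Rmin d d2). split; [now apply Rmin_pos|].
  intros w Hne Hw. pose proof (Rmin_l d d2). pose proof (Rmin_r d d2).
  specialize (J w ltac:(lra)). specialize (J2 w ltac:(lra)). rewrite Eq0 in J.
  assert (Hne' : (w - w0)%C <> 0) by (intros Z; apply Ceq_minus in Z; tauto).
  pose proof (proj1 (Cmod_gt_0 _) Hne') as Hp.
  assert (HDw : D w <> 0).
  { intros Z. rewrite HD0, Z in J2.
    replace (0 - 0 - (w - w0) * l)%C with (- ((w - w0) * l))%C in J2 by ring.
    rewrite Cmod_opp, Cmod_mult in J2. nra. }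
  unfold q in J. destruct (excluded_middle_informative (w = w0)); [tauto|].
  replace ((w - w0) * (N w / D w) - N w0 / l)%C
    with (N w * / (D w / (w - w0)) - N w0 * / l)%C by (field; auto).
  lra.
Qed.

(** * Cauchy's formula and the identity theorem on a disk *)

Lemma polar_form (z : C) : z <> 0 -> exists t, z = Cexp (ln (Cmod z), t).
Proof.
  intros Hz. pose proof (proj1 (Cmod_gt_0 z) Hz) as Hp. unfold Cexp. simpl. rewrite exp_ln by auto.
  pose proof (Cmod2_alt z) as H2. pose proof (re_le_Cmod z) as Hr.
  set (m := Cmod z) in *. destruct z as [x y]; simpl in *.
  assert (Hu : -1 <= x / m <= 1).
  { apply Rabs_le_between in Hr. split; apply Rmult_le_reg_r with m; auto;
    unfold Rdiv; rewrite Rmult_assoc, Rinv_l by lra; lra. }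
  assert (Hs : m * sqrt (1 - (x / m)²) = Rabs y).
  { rewrite <- (sqrt_square m) at 1 by lra. rewrite <- sqrt_mult_alt by nra.
    rewrite <- (sqrt_Rsqr_abs y). f_equal. unfold Rsqr. 
    replace (m * m * (1 - x / m * (x / m))) with (m * m - x * x) by (field; lra). nra. }
  destruct (Rle_dec 0 y).
  - exists (acos (x / m)). rewrite cos_acos, sin_acos by auto. rewrite Hs, Rabs_pos_eq by auto.
    f_equal; field; lra.
  - exists (- acos (x / m)). rewrite cos_neg, sin_neg, cos_acos, sin_acos by auto.
    rewrite Ropp_mult_distr_r_reverse, Hs, Rabs_left by lra. f_equal; [field|]; lra.
Qed.

Lemma cos_1_eq_0 t : Rabs t <= PI -> cos t = 1 -> t = 0.
Proof.
  intros Ht Hc. replace t with (2 * (t / 2)) in Hc by field. rewrite cos_2a_sin in Hc.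
  assert (Hs : sin (t / 2) = 0) by nra.
  apply Rabs_le_between in Ht. pose proof PI_RGT_0.
  destruct (Rtotal_order t 0) as [H0|[H0|H0]]; auto.
  - pose proof (sin_gt_0 (- (t / 2)) ltac:(lra) ltac:(lra)) as Q. rewrite sin_neg in Q. lra.
  - pose proof (sin_gt_0 (t / 2) ltac:(lra) ltac:(lra)). lra.
Qed.

Lemma Cexp_inj_strip (w w0 : C) : Rabs (Im w - Im w0) <= PI -> Cexp w = Cexp w0 -> w = w0.
Proof.
  intros Hi He. 
  assert (Hm : exp (Re w) = exp (Re w0)) by (rewrite <- !Cmod_Cexp; now f_equal).
  apply exp_inv in Hm.
  destruct w as [x y], w0 as [x0 y0]; simpl in *. subst x0.
  unfold Cexp in He; simpl in He. injection He as H1 H2.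
  pose proof (exp_pos x).
  assert (cos y = cos y0) by (apply Rmult_eq_reg_l with (exp x); lra).
  assert (sin y = sin y0) by (apply Rmult_eq_reg_l with (exp x); lra).
  f_equal. apply Rminus_diag_uniq. apply cos_1_eq_0; auto.
  rewrite cos_minus, H0, H3. pose proof (sin2_cos2 y0). unfold Rsqr in *. lra.
Qed.

Lemma Cexp_2PI x y : Cexp (x, y + 2 * PI) = Cexp (x, y).
Proof. unfold Cexp; simpl. rewrite sin_plus, cos_plus, sin_2PI, cos_2PI. f_equal; ring. Qed.

Definition circ (r t : R) : C := Cexp (ln r, t).

Lemma Cmod_circ r t : 0 < r -> Cmod (circ r t) = r.
Proof. intros. unfold circ. rewrite Cmod_Cexp. simpl. now apply exp_ln. Qed.

Lemma circ_neq_0 r t : circ r t <> 0.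
Proof. apply Cexp_neq_0. Qed.

Lemma rcont_circ r t : rcont (circ r) t.
Proof.
  apply (rcont_comp Cexp (fun t => (ln r, t))); [|apply rcont_vert].
  eapply cdiff_ccont, cdiff_Cexp.
Qed.

Lemma ex_CI_any f a b : (forall x, rcont f x) -> ex_CI f a b.
Proof.
  intros H. apply (ex_RInt_continuous (V := C_R_CompleteNormedModule)).
  intros z Hz. apply rcont_continuous; auto.
Qed.

Lemma CI_periodic f p t0 : (forall x, rcont f x) -> (forall x, f (x + p) = f x) ->
  CI f t0 (t0 + p) = CI f 0 p.
Proof.
  intros Hc Hp.
  assert (E1 := CI_Chasles f t0 0 (t0 + p) (ex_CI_any _ _ _ Hc) (ex_CI_any _ _ _ Hc)).
  assert (E2 := CI_Chasles f 0 p (t0 + p) (ex_CI_any _ _ _ Hc) (ex_CI_any _ _ _ Hc)).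
  assert (E3 := CI_Chasles f t0 0 t0 (ex_CI_any _ _ _ Hc) (ex_CI_any _ _ _ Hc)).
  assert (E4 : CI f t0 t0 = 0) by (unfold CI; rewrite RInt_point; reflexivity).
  assert (E5 : CI f p (t0 + p) = CI f 0 t0).
  { unfold CI. pose proof (RInt_comp_lin (V := C_R_CompleteNormedModule) f 1 p 0 t0) as Q.
    replace (1 * 0 + p) with p in Q by ring. replace (1 * t0 + p) with (t0 + p) in Q by ring.
    rewrite <- Q; [|apply ex_CI_any; auto].
    apply (RInt_ext (V := C_R_CompleteNormedModule)). intros x _. rewrite scal_R_Cmult.
    rewrite Rmult_1_l, Hp. apply Cmult_1_l. }
  rewrite E1, E2, E5. rewrite E4 in E3.
  replace (CI f t0 0 + (CI f 0 p + CI f 0 t0))%C with (CI f 0 p + (CI f t0 0 + CI f 0 t0))%C by ring.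
  rewrite <- E3. ring.
Qed.

(** By periodicity the horizontal sides cancel: a rectangle of height [2 PI] in the coordinate [log]
    is an annulus, bounded by two circles. *)
Lemma rect_int_periodic h a b t0 : 
  (forall x, h (x, t0 + 2 * PI) = h (x, t0)) ->
  rect_int h a b t0 (t0 + 2 * PI) =
    (Ci * (CI (fun y => h (b, y)) t0 (t0 + 2 * PI) - CI (fun y => h (a, y)) t0 (t0 + 2 * PI)))%C.
Proof.
  intros Hp. unfold rect_int.
  rewrite (CI_ext (fun x => h (x, t0 + 2 * PI)) (fun x => h (x, t0))) by auto. ring.
Qed.

Lemma Ci_mult_cancel (x y : C) : (Ci * x)%C = (Ci * y)%C -> x = y.
Proof.
  intros H. replace x with (/ Ci * (Ci * x))%C by (field; apply Ci_nz).
  rewrite H. field. apply Ci_nz.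
Qed.

(** In the coordinate [log], Goursat's theorem makes the integral over the circle of radius [exp a]
    independent of [a]. As [a -> - oo] it tends to [2 PI f(0)] by continuity. *)
Lemma mean_value_disk f (R0 r : R) : 0 < r < R0 -> (forall w, Cmod w < R0 -> chol f w) ->
  CI (fun t => f (circ r t)) 0 (2 * PI) = (RtoC (2 * PI) * f 0)%C.
Proof.
  intros Hr Hf. pose proof PI_RGT_0 as HPI.
  set (h := fun w => f (Cexp w)).
  assert (Hh : forall w, Re w <= ln r -> chol h w).
  { intros w Hw. apply (chol_comp f Cexp); [eexists; apply cdiff_Cexp|]. apply Hf. rewrite Cmod_Cexp.
    apply Rle_lt_trans with r; [|lra].
    rewrite <- (exp_ln r) by lra. destruct Hw as [Hw| ->]; [left; now apply exp_increasing|lra]. }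
  assert (Hper : forall x y, h (x, y + 2 * PI) = h (x, y)).
  { intros x y. unfold h. now rewrite Cexp_2PI. }
  assert (Hrc : forall a t, a <= ln r -> rcont (fun y => h (a, y)) t).
  { intros a t Ha. apply (rcont_comp h (fun y => (a, y))); [|apply rcont_vert].
    apply chol_ccont, Hh; auto. }
  set (A := fun a => CI (fun y => h (a, y)) 0 (2 * PI)).
  assert (HA : forall a, a < ln r -> A (ln r) = A a).
  { intros a Ha.
    assert (G : rect_int h a (ln r) 0 (0 + 2 * PI) = 0).
    { apply goursat; try lra. intros w [W1 W2]. apply Hh. unfold Re; lra. }
    rewrite rect_int_periodic in G by (intros; apply Hper). rewrite Rplus_0_l in G.
    apply Ceq_minus, Ci_mult_cancel. rewrite Cmult_0_r. exact G. }
  change (A (ln r) = (RtoC (2 * PI) * f 0)%C).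
  apply Ceq_minus, Cmod_eq_0, Rle_antisym; [|apply Cmod_ge_0].
  apply Rnot_lt_le. intros Hpos. set (X := Cmod _) in Hpos.
  destruct (chol_ccont _ _ (Hf 0 ltac:(rewrite Cmod_0; lra)) (X / (4 * PI))) as [d [Hd Jd]].
  { apply Rdiv_lt_0_compat; lra. }
  set (a := Rmin (ln d) (ln r) - 1).
  pose proof (Rmin_l (ln d) (ln r)). pose proof (Rmin_r (ln d) (ln r)).
  assert (Hed : exp a < d) by (rewrite <- (exp_ln d) by auto; apply exp_increasing; unfold a; lra).
  assert (X <= (2 * PI - 0) * (X / (4 * PI))).
  { unfold X at 1. rewrite (HA a) by (unfold a; lra).
    apply (is_CI_bound (fun y => h (a, y) + (- f 0))%C 0 (2 * PI)); [lra| |].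
    - intros y _. left. apply Jd. replace (Cexp (a, y) - 0)%C with (Cexp (a, y)) by ring.
      rewrite Cmod_Cexp. auto.
    - replace (A a - RtoC (2 * PI) * f 0)%C with (A a + RtoC (2 * PI - 0) * (- f 0))%C
        by (rewrite Rminus_0_r; ring).
      apply is_CI_plus; [|apply is_CI_const].
      apply CI_correct, ex_CI_any. intros; apply Hrc. unfold a; lra. }
  replace ((2 * PI - 0) * (X / (4 * PI))) with (X / 2) in * by (field; lra). lra.
Qed.

(* In the coordinate [w = log], the pole [z] is the only one in a strip of height [2 PI]. *)
Lemma cauchy_disk f (R0 r : R) (z : C) : 0 < r < R0 -> Cmod z < r ->
  (forall w, Cmod w < R0 -> chol f w) ->
  CI (fun t => f (circ r t) * (circ r t / (circ r t - z)))%C 0 (2 * PI) = (RtoC (2 * PI) * f z)%C.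
Proof.
  intros Hr Hz Hf. pose proof PI_RGT_0 as HPI.
  destruct (Ceq_dec z 0) as [->|E].
  { rewrite <- (mean_value_disk f R0 r) by auto. apply CI_ext. intros x _.
    field. replace (circ r x - 0)%C with (circ r x) by ring. apply circ_neq_0. }
  set (h := fun w => (f (Cexp w) * Cexp w / (Cexp w - z))%C).
  assert (Hh : forall w, Re w <= ln r -> Cexp w <> z -> chol h w).
  { intros w Hw Hne. assert (HE : chol Cexp w) by (eexists; apply cdiff_Cexp).
    apply chol_div.
    - apply chol_mult; auto. apply (chol_comp f Cexp); auto. apply Hf. rewrite Cmod_Cexp.
      apply Rle_lt_trans with r; [|lra].
      rewrite <- (exp_ln r) by lra. destruct Hw as [Hw| ->]; [left; now apply exp_increasing|lra].
    - apply chol_minus; auto using chol_const.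
    - intros Z. apply Ceq_minus in Z. auto. }
  assert (Hper : forall x y, h (x, y + 2 * PI) = h (x, y)).
  { intros x y. unfold h. now rewrite Cexp_2PI. }
  pose proof (proj1 (Cmod_gt_0 z) E) as Hzp.
  assert (Hrc : forall a t, a <= ln r -> a <> ln (Cmod z) -> rcont (fun y => h (a, y)) t).
  { intros a t Ha Hne. apply (rcont_comp h (fun y => (a, y))); [|apply rcont_vert].
    apply chol_ccont, Hh; auto. intros Z. apply Hne.
    assert (Q : Cmod z = exp a) by (rewrite <- Z, Cmod_Cexp; reflexivity).
    rewrite Q, ln_exp. auto. }
  set (A := fun a => CI (fun y => h (a, y)) 0 (2 * PI)).
  assert (EA : CI (fun t => f (circ r t) * (circ r t / (circ r t - z)))%C 0 (2 * PI) = A (ln r)).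
  { apply CI_ext. intros x _. unfold h, circ, Cdiv. ring. }
  rewrite EA. clear EA.
  destruct (polar_form z E) as [t Ht].
  destruct (chol_ccont _ _ (Hf 0 ltac:(rewrite Cmod_0; lra)) 1 Rlt_0_1) as [d [Hd Jd]].
  set (M := Cmod (f 0) + 1). assert (HM : 0 < M) by (unfold M; pose proof (Cmod_ge_0 (f 0)); lra).
  assert (Hmin : 0 < Rmin d (Cmod z / 2)) by (apply Rmin_pos; lra).
  pose proof (Rmin_l d (Cmod z / 2)). pose proof (Rmin_r d (Cmod z / 2)).
  set (c := ln (Rmin d (Cmod z / 2))).
  assert (Hcz : c < ln (Cmod z)) by (apply ln_increasing; lra).
  assert (Hzr : ln (Cmod z) < ln r) by (apply ln_increasing; lra).
  set (K := 2 * PI * (M * (2 / Cmod z))).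
  assert (HK : 0 <= K).
  { apply Rmult_le_pos; [lra|]. apply Rmult_le_pos; [lra|]. apply Rlt_le, Rdiv_lt_0_compat; lra. }
  (* The inner circle disappears as [a -> - oo]: the factor [Cexp w] makes the integrand at most a
     constant times [exp a] on it. *)
  assert (HL : forall a, a < c -> Cmod (A (ln r) - RtoC (2 * PI) * f z) <= K * exp a).
  { intros a Ha.
    assert (Hea : exp a < Rmin d (Cmod z / 2)).
    { rewrite <- (exp_ln (Rmin d (Cmod z / 2))) by auto. now apply exp_increasing. }
    (* The strip is centred at the argument [t] of [z], which keeps the pole off the horizontal
       sides. *)
    assert (G : rect_int h a (ln r) (t - PI) (t - PI + 2 * PI) = (RtoC (2 * PI) * Ci * f z)%C).
    { apply residue_rect with (w0 := (ln (Cmod z), t)); simpl; try lra.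
      - intros w [W1 W2] Hne. apply Hh; [unfold Re; lra|].
        intros Z. apply Hne. apply Cexp_inj_strip.
        + unfold Im; simpl. apply Rabs_le; lra.
        + rewrite Z; auto.
      - intros e He.
        assert (El : Cexp (ln (Cmod z), t) = z) by auto.
        replace (f z) with (f (Cexp (ln (Cmod z), t)) * Cexp (ln (Cmod z), t) / Cexp (ln (Cmod z), t))%C
          by (rewrite El; field; auto).
        apply (residue_quotient (fun w => f (Cexp w) * Cexp w)%C (fun w => Cexp w - z)%C); auto.
        + apply chol_ccont. assert (HE : chol Cexp (ln (Cmod z), t)) by (eexists; apply cdiff_Cexp).
          apply chol_mult; auto. apply (chol_comp f Cexp); auto. apply Hf. rewrite El; lra.
        + replace (Cexp (ln (Cmod z), t)) with (Cexp (ln (Cmod z), t) + 0)%C at 1 by ring.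
          apply (cdiff_plus Cexp (fun _ => - z)%C); [apply cdiff_Cexp|apply cdiff_const].
        + rewrite El. ring.
        + apply Cexp_neq_0. }
    rewrite rect_int_periodic in G by (intros; apply Hper).
    rewrite (CI_periodic (fun y => h (ln r, y))) in G.
    2:{ intros x; apply Hrc; lra. }
    2:{ intros; apply Hper. }
    rewrite (CI_periodic (fun y => h (a, y))) in G.
    2:{ intros x; apply Hrc; lra. }
    2:{ intros; apply Hper. }
    fold (A (ln r)) in G. fold (A a) in G.
    assert (G' : (A (ln r) - RtoC (2 * PI) * f z)%C = A a).
    { assert (Q : (A (ln r) - A a)%C = (RtoC (2 * PI) * f z)%C)
        by (apply Ci_mult_cancel; rewrite G; ring).
      rewrite <- Q. ring. }
    rewrite G'. unfold A, K.
    replace (2 * PI * (M * (2 / Cmod z)) * exp a) with ((2 * PI - 0) * (M * (2 / Cmod z) * exp a)) by ring.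
    apply CI_bound; [lra| |apply ex_CI_any; intros; apply Hrc; lra].
    intros y _. unfold h.
    assert (Hne : (Cexp (a, y) - z)%C <> 0).
    { intros Z. apply Ceq_minus in Z. assert (Q : Cmod (Cexp (a, y)) = Cmod z) by now rewrite Z.
      rewrite Cmod_Cexp in Q. simpl in Q. lra. }
    rewrite Cmod_div by auto. rewrite Cmod_mult, Cmod_Cexp; simpl.
    assert (Hfa : Cmod (f (Cexp (a, y))) <= M).
    { unfold M. pose proof (Cmod_le_minus (f (Cexp (a, y))) (f 0)).
      specialize (Jd (Cexp (a, y))). replace (Cexp (a, y) - 0)%C with (Cexp (a, y)) in Jd by ring.
      rewrite Cmod_Cexp in Jd. simpl in Jd. specialize (Jd ltac:(lra)). lra. }
    assert (Hden : Cmod z / 2 <= Cmod (Cexp (a, y) - z)).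
    { pose proof (Cmod_le_minus z (Cexp (a, y))) as Q. rewrite Cmod_minus_sym, Cmod_Cexp in Q. simpl in Q. lra. }
    replace (M * (2 / Cmod z) * exp a) with ((M * exp a) * / (Cmod z / 2)) by (field; lra).
    pose proof (exp_pos a).
    apply Rmult_le_compat.
    * apply Rmult_le_pos; [apply Cmod_ge_0|lra].
    * left. apply Rinv_0_lt_compat; lra.
    * apply Rmult_le_compat_r; lra.
    * apply Rinv_le_contravar; lra. }
  apply Ceq_minus, Cmod_eq_0, Rle_antisym; [|apply Cmod_ge_0].
  apply Rnot_lt_le. intros Hpos. set (X := Cmod (A (ln r) - RtoC (2 * PI) * f z)) in *.
  set (a := Rmin (c - 1) (ln (X / (2 * (K + 1))) - 1)).
  pose proof (Rmin_l (c - 1) (ln (X / (2 * (K + 1))) - 1)).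
  pose proof (Rmin_r (c - 1) (ln (X / (2 * (K + 1))) - 1)).
  specialize (HL a ltac:(unfold a; lra)).
  assert (HX : 0 < X / (2 * (K + 1))) by (apply Rdiv_lt_0_compat; lra).
  assert (exp a < X / (2 * (K + 1))).
  { rewrite <- (exp_ln (X / (2 * (K + 1)))) by auto. apply exp_increasing. unfold a; lra. }
  assert (K * exp a <= (K + 1) * (X / (2 * (K + 1)))).
  { apply Rmult_le_compat; try lra. left; apply exp_pos. }
  replace ((K + 1) * (X / (2 * (K + 1)))) with (X / 2) in * by (field; lra). lra.
Qed.

Lemma Cmod_circ_minus r t z : 0 < r -> Cmod z < r -> r - Cmod z <= Cmod (circ r t - z) /\ (circ r t - z)%C <> 0.
Proof.
  intros Hr Hz. assert (Q : r - Cmod z <= Cmod (circ r t - z)).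
  { pose proof (Cmod_le_minus (circ r t) z) as Q. rewrite Cmod_circ in Q by auto. lra. }
  split; auto. apply Cmod_gt_0. lra.
Qed.

Lemma rcont_circ_fun g r t : ccont g (circ r t) -> rcont (fun t => g (circ r t)) t.
Proof. intros H. apply (rcont_comp g (circ r)); auto. apply rcont_circ. Qed.

(** * Difference quotients and limits of holomorphic functions *)

Definition diff_quot (f : C -> C) (z h : C) : C := ((f (z + h) - f z) / h)%C.

(** Cauchy's formula on the circle of radius [R0 / 2] represents the difference by the integrand
    [f w * (h - k) / ((w - h) (w - k))]. Both denominators are at least [R0 / 4], whence the 16.
    Only a bound of [f] enters, so the estimate survives limits and integration over a parameter. *)
Lemma diff_quot_estimate_0 f (R0 B : R) : 0 < R0 ->
  (forall w, Cmod w < R0 -> chol f w) -> (forall w, Cmod w < R0 -> Cmod (f w) <= B) ->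
  forall h k : C, h <> 0 -> k <> 0 -> Cmod h <= R0 / 4 -> Cmod k <= R0 / 4 ->
  Cmod (diff_quot f 0 h - diff_quot f 0 k) <= 16 * B / R0 ^ 2 * Cmod (h - k).
Proof.
  intros HR Hf HB h k Hh Hk Lh Lk. pose proof PI_RGT_0 as HPI.
  set (r := R0 / 2). assert (Hr : 0 < r < R0) by (unfold r; lra).
  assert (Z : forall h : C, h <> 0 -> Cmod h <= R0 / 4 ->
    is_CI (fun t => f (circ r t) * / (circ r t - h))%C 0 (2 * PI) (RtoC (2 * PI) * diff_quot f 0 h)%C).
  { clear h k Hh Hk Lh Lk. intros h Hh Lh.
    assert (E1 : is_CI (fun t => f (circ r t) * (circ r t / (circ r t - h)))%C 0 (2 * PI) (RtoC (2 * PI) * f h)%C).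
    { rewrite <- (cauchy_disk f R0 r h) by (auto; unfold r; lra). apply CI_correct, ex_CI_any.
      intros t. destruct (Cmod_circ_minus r t h) as [_ Hne]; [lra|unfold r; lra|].
      apply (rcont_circ_fun (fun w => f w * (w / (w - h)))%C). apply chol_ccont, chol_mult.
      - apply Hf. rewrite Cmod_circ; lra.
      - apply chol_div; auto using chol_id. apply chol_minus; auto using chol_id, chol_const. }
    assert (E0 : is_CI (fun t => f (circ r t)) 0 (2 * PI) (RtoC (2 * PI) * f 0)%C).
    { rewrite <- (mean_value_disk f R0 r) by auto. apply CI_correct, ex_CI_any.
      intros t. apply rcont_circ_fun, chol_ccont, Hf. rewrite Cmod_circ; lra. }
    pose proof (is_CI_scal _ (/ h)%C _ _ _ (is_CI_minus _ _ _ _ _ _ E1 E0)) as E.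
    replace (RtoC (2 * PI) * diff_quot f 0 h)%C with (/ h * (RtoC (2 * PI) * f h - RtoC (2 * PI) * f 0))%C.
    - revert E. apply is_CI_ext. intros t _.
      destruct (Cmod_circ_minus r t h) as [_ Hne]; [lra|unfold r; lra|]. field; auto.
    - unfold diff_quot. rewrite Cplus_0_l. field; auto. }
  pose proof (is_CI_minus _ _ _ _ _ _ (Z h Hh Lh) (Z k Hk Lk)) as E.
  apply (is_CI_bound _ _ _ _ (16 * B / R0 ^ 2 * Cmod (h - k))) in E; [|lra|].
  - replace (RtoC (2 * PI) * diff_quot f 0 h - RtoC (2 * PI) * diff_quot f 0 k)%C
      with (RtoC (2 * PI) * (diff_quot f 0 h - diff_quot f 0 k))%C in E by ring.
    rewrite Cmod_mult, Cmod_R, Rabs_pos_eq in E by lra. rewrite Rminus_0_r in E.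
    apply Rmult_le_reg_l in E; auto; lra.
  - intros t _.
    destruct (Cmod_circ_minus r t h) as [Dh Hne]; [lra|unfold r; lra|].
    destruct (Cmod_circ_minus r t k) as [Dk Kne]; [lra|unfold r; lra|].
    replace (f (circ r t) * / (circ r t - h) - f (circ r t) * / (circ r t - k))%C
      with (f (circ r t) * (h - k) * (/ (circ r t - h) * / (circ r t - k)))%C by (field; auto).
    rewrite !Cmod_mult, !Cmod_inv by auto.
    assert (I : forall x : R, R0 / 4 <= x -> 0 <= / x <= 4 / R0).
    { intros x Hx. split; [left; apply Rinv_0_lt_compat; lra|].
      replace (4 / R0) with (/ (R0 / 4)) by (field; lra). apply Rinv_le_contravar; lra. }
    assert (Ih := I (Cmod (circ r t - h)) ltac:(unfold r in *; lra)).
    assert (Ik := I (Cmod (circ r t - k)) ltac:(unfold r in *; lra)).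
    assert (HBc := HB (circ r t) ltac:(rewrite Cmod_circ; lra)).
    replace (16 * B / R0 ^ 2 * Cmod (h - k)) with ((B * Cmod (h - k)) * (4 / R0 * (4 / R0))) by (field; lra).
    apply Rmult_le_compat.
    + apply Rmult_le_pos; apply Cmod_ge_0.
    + apply Rmult_le_pos; lra.
    + apply Rmult_le_compat_r; auto using Cmod_ge_0.
    + apply Rmult_le_compat; lra.
Qed.

Lemma diff_quot_estimate f (z0 : C) (R0 B : R) : 0 < R0 ->
  (forall w, Cmod (w - z0) < R0 -> chol f w) -> (forall w, Cmod (w - z0) < R0 -> Cmod (f w) <= B) ->
  forall h k : C, h <> 0 -> k <> 0 -> Cmod h <= R0 / 4 -> Cmod k <= R0 / 4 ->
  Cmod (diff_quot f z0 h - diff_quot f z0 k) <= 16 * B / R0 ^ 2 * Cmod (h - k).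
Proof.
  intros HR Hf HB h k Hh Hk Lh Lk.
  assert (E : forall h, diff_quot f z0 h = diff_quot (fun w => f (z0 + w)%C) 0 h).
  { intros x. unfold diff_quot. now rewrite Cplus_0_l, Cplus_0_r. }
  rewrite !E. apply diff_quot_estimate_0; auto.
  - intros w Hw. apply (chol_comp f (fun w => z0 + w)%C).
    + apply chol_plus; auto using chol_const, chol_id.
    + apply Hf. replace (z0 + w - z0)%C with w by ring. auto.
  - intros w Hw. apply HB. replace (z0 + w - z0)%C with w by ring. auto.
Qed.

(** A function that is Lipschitz off 0 has a limit at 0. It is found along the sequence
    [d / (n + 1)]; the Lipschitz bound then compares it with every other [h]. *)
Lemma C_lim_of_Cauchy (q : C -> C) (d K : R) : 0 < d -> 0 <= K ->
  (forall h k : C, h <> 0 -> k <> 0 -> Cmod h <= d -> Cmod k <= d -> Cmod (q h - q k) <= K * Cmod (h - k)) ->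
  exists l, forall h : C, h <> 0 -> Cmod h <= d -> Cmod (q h - l) <= K * Cmod h.
Proof.
  intros Hd HK Hq.
  set (u := fun n : nat => RtoC (d / (INR n + 1))).
  assert (Hn : forall n, 0 < INR n + 1) by (intros n; pose proof (pos_INR n); lra).
  assert (Hu : forall n, u n <> 0 /\ Cmod (u n) = d / (INR n + 1) /\ Cmod (u n) <= d).
  { intros n. specialize (Hn n). pose proof (pos_INR n).
    assert (P : 0 < d / (INR n + 1)) by (apply Rdiv_lt_0_compat; auto).
    assert (E : Cmod (u n) = d / (INR n + 1)) by (unfold u; rewrite Cmod_R, Rabs_pos_eq; lra).
    repeat split; auto.
    - apply Cmod_gt_0. lra.
    - rewrite E. apply Rmult_le_reg_r with (INR n + 1); auto. unfold Rdiv. rewrite Rmult_assoc, Rinv_l; nra. }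
  assert (Small : forall e, 0 < e -> exists N, forall n, (N <= n)%nat -> K * Cmod (u n) < e).
  { intros e He. destruct (INR_unbounded (K * d / e)) as [N HN]. exists N. intros n Hnn.
    destruct (Hu n) as [_ [-> _]]. apply le_INR in Hnn. specialize (Hn n).
    apply Rmult_lt_reg_r with (INR n + 1); auto.
    replace (K * (d / (INR n + 1)) * (INR n + 1)) with (K * d) by (field; lra).
    assert (Q : K * d / e < INR n + 1) by lra.
    apply (Rmult_lt_compat_r e) in Q; auto. unfold Rdiv in Q. rewrite Rmult_assoc, Rinv_l in Q by lra. lra. }
  assert (Cau : forall e, 0 < e -> exists N, forall n m, (N <= n)%nat -> (N <= m)%nat -> Cmod (q (u n) - q (u m)) < e).
  { intros e He. destruct (Small (e / 2)) as [N HN]; [lra|]. exists N. intros n m Hnn Hmm.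
    destruct (Hu n) as [P1 [P2 P3]]. destruct (Hu m) as [Q1 [Q2 Q3]].
    eapply Rle_lt_trans; [apply Hq; auto|].
    pose proof (HN n Hnn). pose proof (HN m Hmm).
    pose proof (Cmod_triangle (u n) (- u m)) as T. rewrite Cmod_opp in T. 
    apply (Rmult_le_compat_l K) in T; auto. unfold Cminus. lra. }
  assert (CR : ex_finite_lim_seq (fun n => Re (q (u n)))).
  { apply ex_lim_seq_cauchy_corr. intros e. destruct (Cau e (cond_pos e)) as [N HN]. exists N. intros n m Hnn Hmm.
    eapply Rle_lt_trans; [|apply (HN n m Hnn Hmm)].
    replace (Re (q (u n)) - Re (q (u m))) with (Re (q (u n) - q (u m))) by (simpl; unfold Re; ring).
    apply re_le_Cmod. }
  assert (CIm : ex_finite_lim_seq (fun n => Im (q (u n)))).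
  { apply ex_lim_seq_cauchy_corr. intros e. destruct (Cau e (cond_pos e)) as [N HN]. exists N. intros n m Hnn Hmm.
    eapply Rle_lt_trans; [|apply (HN n m Hnn Hmm)].
    replace (Im (q (u n)) - Im (q (u m))) with (Im (q (u n) - q (u m))) by (simpl; unfold Im; ring).
    apply im_le_Cmod. }
  destruct CR as [lr Hlr]. destruct CIm as [li Hli].
  exists (lr, li). intros h Hh Lh. apply Rnot_lt_le. intros Hlt.
  set (e := Cmod (q h - (lr, li)) - K * Cmod h). assert (He : 0 < e) by (unfold e; lra).
  destruct (Small (e / 4)) as [N HN]; [lra|].
  assert (He4 : 0 < e / 4) by lra.
  apply is_lim_seq_spec in Hlr. apply is_lim_seq_spec in Hli.
  destruct (Hlr (mkposreal _ He4)) as [N1 HN1]. destruct (Hli (mkposreal _ He4)) as [N2 HN2].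
  set (n := (N + N1 + N2)%nat).
  specialize (HN n ltac:(unfold n; lia)). specialize (HN1 n ltac:(unfold n; lia)). specialize (HN2 n ltac:(unfold n; lia)).
  simpl in HN1, HN2. destruct (Hu n) as [P1 [P2 P3]].
  assert (D : Cmod (q (u n) - (lr, li)) < e / 2).
  { eapply Rle_lt_trans; [apply Cmod_le_sum|].
    replace (Re (q (u n) - (lr, li))) with (Re (q (u n)) - lr) by (unfold Re; simpl; ring).
    replace (Im (q (u n) - (lr, li))) with (Im (q (u n)) - li) by (unfold Im; simpl; ring). lra. }
  pose proof (Cmod_minus_triangle (q h) (q (u n)) (lr, li)) as T.
  pose proof (Hq h (u n) Hh P1 Lh P3) as Q.
  pose proof (Cmod_triangle h (- u n)) as T2. rewrite Cmod_opp in T2.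
  apply (Rmult_le_compat_l K) in T2; auto.
  change (h + - u n)%C with (h - u n)%C in T2. unfold e in *. lra.
Qed.

Lemma chol_of_diff_quot f z0 (d K : R) : 0 < d -> 0 <= K ->
  (forall h k : C, h <> 0 -> k <> 0 -> Cmod h <= d -> Cmod k <= d ->
    Cmod (diff_quot f z0 h - diff_quot f z0 k) <= K * Cmod (h - k)) -> chol f z0.
Proof.
  intros Hd HK Hq. destruct (C_lim_of_Cauchy (diff_quot f z0) d K Hd HK Hq) as [l Hl].
  exists l. intros e He. exists (Rmin d (e / (K + 1))).
  split; [apply Rmin_pos; auto; apply Rdiv_lt_0_compat; lra|].
  intros w Hw. pose proof (Rmin_l d (e / (K + 1))). pose proof (Rmin_r d (e / (K + 1))).
  destruct (Ceq_dec w z0) as [->|Hne].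
  - replace (f z0 - f z0 - (z0 - z0) * l)%C with (RtoC 0) by ring. rewrite Cmod_0.
    pose proof (Cmod_ge_0 (z0 - z0)). nra.
  - assert (Hne' : (w - z0)%C <> 0) by (intros Z; apply Ceq_minus in Z; tauto).
    specialize (Hl (w - z0)%C Hne' ltac:(lra)).
    replace (f w - f z0 - (w - z0) * l)%C with ((w - z0) * (diff_quot f z0 (w - z0) - l))%C.
    + rewrite Cmod_mult, (Rmult_comm e). apply Rmult_le_compat_l; [apply Cmod_ge_0|].
      eapply Rle_trans; [exact Hl|].
      assert (Q : Cmod (w - z0) < e / (K + 1)) by lra.
      apply (Rmult_lt_compat_r (K + 1)) in Q; [|lra]. unfold Rdiv in Q.
      rewrite Rmult_assoc, Rinv_l in Q by lra. pose proof (Cmod_ge_0 (w - z0)). nra.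
    + unfold diff_quot. replace (z0 + (w - z0))%C with w by ring. field; auto.
Qed.

(** The Lipschitz constant of the difference quotients is the same for all [n], so pointwise
    convergence under a common bound already carries it to the limit. *)
Lemma chol_limit (f : C -> C) (fn : nat -> C -> C) (z0 : C) (R0 B : R) : 0 < R0 ->
  (forall n w, Cmod (w - z0) < R0 -> chol (fn n) w) ->
  (forall n w, Cmod (w - z0) < R0 -> Cmod (fn n w) <= B) ->
  (forall w e, Cmod (w - z0) < R0 -> 0 < e -> exists N, forall n, (N <= n)%nat -> Cmod (fn n w - f w) < e) ->
  chol f z0.
Proof.
  intros HR Hf HB Hlim.
  assert (H00 : Cmod (z0 - z0) < R0) by (replace (z0 - z0)%C with (RtoC 0) by ring; rewrite Cmod_0; auto).
  assert (HB0 : 0 <= B) by (eapply Rle_trans; [apply Cmod_ge_0|apply (HB 0%nat z0 H00)]).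
  apply (chol_of_diff_quot f z0 (R0 / 4) (16 * B / R0 ^ 2)); [lra| |].
  { apply Rmult_le_pos; [lra|]. left. apply Rinv_0_lt_compat, pow_lt; auto. }
  intros h k Hh Hk Lh Lk. apply Rnot_lt_le. intros Hlt.
  set (K := 16 * B / R0 ^ 2 * Cmod (h - k)) in *.
  set (e := Cmod (diff_quot f z0 h - diff_quot f z0 k) - K). assert (He : 0 < e) by (unfold e; lra).
  pose proof (proj1 (Cmod_gt_0 h) Hh) as Ph. pose proof (proj1 (Cmod_gt_0 k) Hk) as Pk.
  assert (A : forall x : C, x <> 0 -> Cmod x <= R0 / 4 -> exists N, forall n, (N <= n)%nat ->
     Cmod (diff_quot (fn n) z0 x - diff_quot f z0 x) <= e / 4).
  { intros x Hx Lx. pose proof (proj1 (Cmod_gt_0 x) Hx) as Px.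
    assert (Hx0 : Cmod (z0 + x - z0) < R0) by (replace (z0 + x - z0)%C with x by ring; lra).
    destruct (Hlim (z0 + x)%C (e / 8 * Cmod x) Hx0) as [N1 H1]; [nra|].
    destruct (Hlim z0 (e / 8 * Cmod x) H00) as [N2 H2]; [nra|].
    exists (N1 + N2)%nat. intros n Hn. specialize (H1 n ltac:(lia)). specialize (H2 n ltac:(lia)).
    replace (diff_quot (fn n) z0 x - diff_quot f z0 x)%C
      with (((fn n (z0 + x) - f (z0 + x)) - (fn n z0 - f z0)) / x)%C by (unfold diff_quot; field; auto).
    rewrite Cmod_div by auto. apply Rmult_le_reg_r with (Cmod x); auto.
    unfold Rdiv at 1. rewrite Rmult_assoc, Rinv_l, Rmult_1_r by lra.
    pose proof (Cmod_triangle (fn n (z0 + x)%C - f (z0 + x)%C) (- (fn n z0 - f z0))) as T.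
    rewrite Cmod_opp in T. unfold Cminus at 1. unfold Cminus in *. lra. }
  destruct (A h Hh Lh) as [N1 H1]. destruct (A k Hk Lk) as [N2 H2].
  specialize (H1 (N1 + N2)%nat ltac:(lia)). specialize (H2 (N1 + N2)%nat ltac:(lia)).
  set (n := (N1 + N2)%nat) in *.
  pose proof (diff_quot_estimate (fn n) z0 R0 B HR (Hf n) (HB n) h k Hh Hk Lh Lk) as Q. fold K in Q.
  pose proof (Cmod_minus_triangle (diff_quot f z0 h) (diff_quot (fn n) z0 h) (diff_quot f z0 k)) as T1.
  pose proof (Cmod_minus_triangle (diff_quot (fn n) z0 h) (diff_quot (fn n) z0 k) (diff_quot f z0 k)) as T2.
  rewrite (Cmod_minus_sym (diff_quot f z0 h) (diff_quot (fn n) z0 h)) in T1. unfold e in *. lra.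
Qed.

(** The Taylor coefficients at 0 vanish one after the other, because [f] vanishes on a real interval
    ending at 0. Then [f z] equals [z^n] times a remainder of order [r^(- n)], which tends to 0 for
    [|z| < r]. *)
Lemma identity_disk f (eps : R) : 0 < eps -> (forall w, Cmod w < 1 -> chol f w) ->
  (forall x : R, 0 < x < eps -> f (RtoC x) = 0) -> forall z, Cmod z < 1 -> f z = 0.
Proof.
  intros Heps Hf H0 z Hz. pose proof PI_RGT_0 as HPI.
  set (r := (1 + Cmod z) / 2). assert (Hr : 0 < r < 1) by (unfold r; pose proof (Cmod_ge_0 z); lra).
  assert (Hzr : Cmod z < r) by (unfold r; lra).
  (* Up to the factor [2 PI], [c n] is the Taylor coefficient of order [n], and [Rem n z] is the
     Taylor remainder of order [n] divided by [z^n]. *)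
  set (g := fun (n : nat) (z : C) (w : C) => (f w * ((/ w) ^ n * (w / (w - z))))%C).
  set (Rem := fun n z => CI (fun t => g n z (circ r t)) 0 (2 * PI)).
  set (c := fun n : nat => CI (fun t => f (circ r t) * (/ circ r t) ^ n)%C 0 (2 * PI)).
  assert (Hfc : forall t, chol f (circ r t)) by (intros; apply Hf; rewrite Cmod_circ; lra).
  assert (Hpc : forall n t, chol (fun w => (/ w) ^ n)%C (circ r t)).
  { induction n; intros t; simpl; [apply chol_const|]. apply chol_mult; auto.
    apply (chol_inv (fun w => w)); [apply chol_id|apply circ_neq_0]. }
  assert (Hgc : forall n z t, Cmod z < r -> rcont (fun t => g n z (circ r t)) t).
  { intros n y t Hy. apply (rcont_circ_fun (g n y)), chol_ccont. unfold g.
    apply chol_mult; auto. apply chol_mult; auto. apply chol_div; auto using chol_id.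
    - apply chol_minus; auto using chol_id, chol_const.
    - apply Cmod_circ_minus; lra. }
  assert (Hcc : forall n t, rcont (fun t => f (circ r t) * (/ circ r t) ^ n)%C t).
  { intros n t. apply (rcont_circ_fun (fun w => f w * (/ w) ^ n)%C), chol_ccont. apply chol_mult; auto. }
  assert (Rec : forall n z, Cmod z < r -> Rem n z = (c n + z * Rem (S n) z)%C).
  { intros n y Hy. unfold Rem, c. apply is_CI_unique.
    eapply is_CI_ext; [|apply is_CI_plus; [apply CI_correct, ex_CI_any, Hcc|apply is_CI_scal, CI_correct, ex_CI_any; intros; apply (Hgc (S n) y); auto]].
    intros t _. unfold g. simpl. destruct (Cmod_circ_minus r t y) as [_ Hne]; [lra|auto|].
    pose proof (circ_neq_0 r t). field; auto. }
  assert (HB : exists B, forall t, 0 <= t <= 2 * PI -> Cmod (f (circ r t)) <= B).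
  { assert (K : forall t, 0 <= t <= 2 * PI -> continuity_pt (fun t => Cmod (f (circ r t))) t).
    { intros t _. pose proof (rcont_circ_fun f r t (chol_ccont _ _ (Hfc t))) as Q.
      intros e He. destruct (Q e He) as [d [Hd J]]. exists d. split; auto.
      intros x [_ Hx]. simpl in *. unfold R_dist in *. specialize (J x Hx).
      eapply Rle_lt_trans; [|exact J].
      pose proof (Cmod_le_minus (f (circ r x)) (f (circ r t))).
      pose proof (Cmod_le_minus (f (circ r t)) (f (circ r x))). rewrite (Cmod_minus_sym (f (circ r t))) in H1.
      apply Rabs_le; lra. }
    destruct (continuity_ab_maj _ 0 (2 * PI) ltac:(lra) K) as [M [HM _]].
    exists (Cmod (f (circ r M))). auto. }
  destruct HB as [B HB].
  assert (HB0 : 0 <= B) by (eapply Rle_trans; [apply Cmod_ge_0|apply (HB 0); lra]).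
  assert (Bd : forall n y, Cmod y < r -> Cmod (Rem n y) <= (2 * PI - 0) * (B * ((/ r) ^ n * (r / (r - Cmod y))))).
  { intros n y Hy. unfold Rem. apply CI_bound; [lra| |apply ex_CI_any; intros; apply Hgc; auto].
    intros t Ht. unfold g. destruct (Cmod_circ_minus r t y) as [Dy Hne]; [lra|auto|].
    rewrite !Cmod_mult, Cmod_pow, Cmod_inv, Cmod_div by (auto using circ_neq_0). rewrite Cmod_circ by lra.
    assert (0 <= (/ r) ^ n) by (apply pow_le; left; apply Rinv_0_lt_compat; lra).
    assert (0 <= r / Cmod (circ r t - y)) by (apply Rmult_le_pos; [lra|left; apply Rinv_0_lt_compat; lra]).
    apply Rmult_le_compat; auto using Cmod_ge_0.
    - apply Rmult_le_pos; auto.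
    - apply Rmult_le_compat_l; auto. apply Rmult_le_compat_l; [lra|]. apply Rinv_le_contravar; lra. }
  assert (R0f : forall y, Cmod y < r -> Rem 0%nat y = (RtoC (2 * PI) * f y)%C).
  { intros y Hy. rewrite <- (cauchy_disk f 1 r y) by auto. apply CI_ext. intros t _. unfold g. simpl. ring. }
  set (d := Rmin eps (r / 2)). assert (Hd : 0 < d) by (apply Rmin_pos; lra).
  assert (Hd1 : d <= eps) by apply Rmin_l. assert (Hd2 : d <= r / 2) by apply Rmin_r.
  (* If [Rem n] vanishes on [(0, d)], then [c n = - x Rem (S n) x] there; letting [x -> 0] gives
     [c n = 0], and division by [x] passes the vanishing on to [Rem (S n)]. *)
  assert (Van : forall n, (forall x : R, 0 < x < d -> Rem n (RtoC x) = 0) /\ 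
     (forall k, (k < n)%nat -> c k = 0)).
  { induction n as [|n [IH1 IH2]].
    - split; [|lia]. intros x Hx. rewrite R0f by (rewrite Cmod_R, Rabs_pos_eq; lra).
      rewrite H0 by lra. ring.
    - assert (Hcn : c n = 0).
      { apply Cmod_eq_0, Rle_antisym; [|apply Cmod_ge_0]. apply Rnot_lt_le. intros Hpos.
        set (K := (2 * PI - 0) * (B * ((/ r) ^ S n * 2))).
        assert (HK : 0 <= K).
        { assert (0 <= (/ r) ^ S n) by (apply pow_le; left; apply Rinv_0_lt_compat; lra).
          apply Rmult_le_pos; [lra|]. apply Rmult_le_pos; auto. apply Rmult_le_pos; auto; lra. }
        set (x := Rmin (d / 2) (Cmod (c n) / (2 * (K + 1)))).
        assert (Hx : 0 < x) by (apply Rmin_pos; [lra|apply Rdiv_lt_0_compat; lra]).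
        assert (Hx1 : x <= d / 2) by apply Rmin_l.
        assert (Hx2 : x <= Cmod (c n) / (2 * (K + 1))) by apply Rmin_r.
        assert (Hxm : Cmod (RtoC x) = x) by (rewrite Cmod_R, Rabs_pos_eq; lra).
        pose proof (Rec n (RtoC x) ltac:(lra)) as Q. rewrite IH1 in Q by lra.
        assert (Q' : c n = (- (RtoC x * Rem (S n) (RtoC x)))%C)
          by (rewrite <- (Cplus_0_l (- _)%C), Q; ring).
        assert (Bx := Bd (S n) (RtoC x) ltac:(lra)). rewrite Hxm in Bx.
        assert (Cmod (c n) <= x * K).
        { rewrite Q' at 1. rewrite Cmod_opp, Cmod_mult, Hxm. apply Rmult_le_compat_l; [lra|].
          eapply Rle_trans; [exact Bx|]. unfold K. apply Rmult_le_compat_l; [lra|].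
          apply Rmult_le_compat_l; auto. apply Rmult_le_compat_l.
          - apply pow_le; left; apply Rinv_0_lt_compat; lra.
          - apply Rmult_le_reg_r with (r - x); [lra|]. unfold Rdiv. rewrite Rmult_assoc, Rinv_l by lra. lra. }
        assert (x * (K + 1) <= Cmod (c n) / 2).
        { apply Rle_trans with (Cmod (c n) / (2 * (K + 1)) * (K + 1)).
          - apply Rmult_le_compat_r; lra.
          - right; field; lra. }
        lra. }
      split.
      + intros x Hx. assert (Hxm : Cmod (RtoC x) = x) by (rewrite Cmod_R, Rabs_pos_eq; lra).
        pose proof (Rec n (RtoC x) ltac:(lra)) as Q. rewrite IH1, Hcn in Q by lra.
        rewrite Cplus_0_l in Q. destruct (Ceq_dec (Rem (S n) (RtoC x)) 0) as [|NE]; auto.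
        exfalso. symmetry in Q. revert Q. apply Cmult_neq_0; auto. apply Cmod_gt_0; lra.
      + intros k Hk. destruct (Nat.eq_dec k n) as [->|]; auto. apply IH2. lia. }
  assert (Pow : forall n, (RtoC (2 * PI) * f z)%C = (z ^ n * Rem n z)%C).
  { induction n; [rewrite <- R0f by auto; simpl; ring|].
    rewrite IHn, Rec by auto. rewrite (proj2 (Van (S n)) n) by lia. simpl. ring. }
  assert (Hfz : (RtoC (2 * PI) * f z)%C = 0).
  { apply Cmod_eq_0, Rle_antisym; [|apply Cmod_ge_0]. apply Rnot_lt_le. intros Hpos.
    set (X := Cmod (RtoC (2 * PI) * f z)) in *.
    set (K := (2 * PI - 0) * (B * (r / (r - Cmod z)))).
    assert (HK : 0 <= K).
    { apply Rmult_le_pos; [lra|]. apply Rmult_le_pos; auto. apply Rmult_le_pos; [lra|].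
      left; apply Rinv_0_lt_compat; lra. }
    assert (Hq : 0 <= Cmod z / r < 1).
    { split; [apply Rmult_le_pos; [apply Cmod_ge_0|left; apply Rinv_0_lt_compat; lra]|].
      apply Rmult_lt_reg_r with r; [lra|]. unfold Rdiv. rewrite Rmult_assoc, Rinv_l; lra. }
    destruct (pow_lt_1_zero (Cmod z / r)) with (y := X / (K + 1)) as [N HN].
    - rewrite Rabs_pos_eq; lra.
    - apply Rdiv_lt_0_compat; lra.
    - specialize (HN N (Nat.le_refl N)).
      assert (0 <= (Cmod z / r) ^ N) by (apply pow_le; lra).
      rewrite Rabs_pos_eq in HN by auto.
      assert (Q : X <= (Cmod z / r) ^ N * K).
      { unfold X. rewrite (Pow N), Cmod_mult, Cmod_pow.
        replace ((Cmod z / r) ^ N * K) with (Cmod z ^ N * ((2 * PI - 0) * (B * ((/ r) ^ N * (r / (r - Cmod z)))))).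
        - apply Rmult_le_compat_l; [apply pow_le, Cmod_ge_0|]. auto.
        - unfold K, Rdiv. rewrite Rpow_mult_distr. ring. }
      apply (Rmult_lt_compat_r (K + 1)) in HN; [|lra]. unfold Rdiv at 2 in HN.
      rewrite Rmult_assoc, Rinv_l in HN by lra. nra. }
  destruct (Ceq_dec (f z) 0) as [|NE]; auto. exfalso. revert Hfz.
  apply Cmult_neq_0; auto. apply Cmod_gt_0. rewrite Cmod_R, Rabs_pos_eq; lra.
Qed.

(** * Continuation to the cut plane *)

Definition slit (z : C) : Prop := Im z <> 0 \/ 0 < Re z.

Lemma slit_Cmod z : slit z -> 0 < Cmod z + Re z.
Proof.
  intros H. pose proof (re_le_Cmod z) as Hr. apply Rabs_le_between in Hr.
  destruct (Rle_lt_or_eq_dec 0 (Cmod z + Re z)) as [|E]; [lra|auto|]. exfalso.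
  pose proof (Cmod2_alt z) as Q. assert (Cmod z = - Re z) by lra. 
  destruct H as [H|H].
  - apply H. nra.
  - pose proof (Cmod_ge_0 z). lra.
Qed.

Lemma Csqrt_Re_pos z : slit z -> 0 < Re (Csqrt z).
Proof. intros H. apply slit_Cmod in H. unfold Csqrt, Re; simpl. apply sqrt_lt_R0. unfold Re in H. lra. Qed.

Lemma Csqrt_sqr z : slit z -> (Csqrt z * Csqrt z)%C = z.
Proof.
  intros H. pose proof (slit_Cmod z H) as Hp. pose proof (re_le_Cmod z) as Hr. apply Rabs_le_between in Hr.
  pose proof (Cmod2_alt z) as Q. unfold Csqrt. set (m := Cmod z) in *.
  destruct z as [x y]. unfold slit in H. simpl in *. unfold Cmult; simpl.
  set (A := (m + x) / 2). set (B := (m - x) / 2).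
  assert (HA : 0 <= A) by (unfold A; lra). assert (HB : 0 <= B) by (unfold B; lra).
  assert (EA := sqrt_sqrt A HA). assert (EB := sqrt_sqrt B HB).
  assert (EAB : sqrt A * sqrt B = Rabs y / 2).
  { rewrite <- sqrt_mult by auto. replace (A * B) with ((y / 2)²).
    - rewrite sqrt_Rsqr_abs. unfold Rdiv. rewrite Rabs_mult, (Rabs_pos_eq (/ 2)) by lra. ring.
    - unfold A, B, Rsqr. nra. }
  assert (Hs : sign y * Rabs y = y).
  { destruct (Rtotal_order y 0) as [Hy|[Hy|Hy]].
    - rewrite sign_eq_m1, Rabs_left by auto. ring.
    - subst y. rewrite Rabs_R0. ring.
    - rewrite sign_eq_1, Rabs_pos_eq by lra. ring. }
  f_equal.
  - replace (sqrt A * sqrt A - sign y * sqrt B * (sign y * sqrt B))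
      with (sqrt A * sqrt A - sign y * sign y * (sqrt B * sqrt B)) by ring.
    rewrite EA, EB. destruct (Req_dec y 0) as [Hy|Hy].
    + assert (HB0 : B = 0). { destruct H as [H|H]; [tauto|]. unfold B. nra. }
      rewrite HB0. unfold A, B in *. lra.
    + assert (S2 : sign y * sign y = 1).
      { destruct (Rtotal_order y 0) as [Hy1|[Hy1|Hy1]]; [|tauto|].
        - rewrite sign_eq_m1 by auto; ring.
        - rewrite sign_eq_1 by auto; ring. }
      rewrite S2. unfold A, B. lra.
  - replace (sqrt A * (sign y * sqrt B) + sign y * sqrt B * sqrt A) with (2 * sign y * (sqrt A * sqrt B)) by ring.
    rewrite EAB. lra.
Qed.

Lemma Cmult_eq_0 (a b : C) : (a * b)%C = 0 -> a = 0 \/ b = 0.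
Proof.
  intros H. destruct (Ceq_dec a 0) as [|Ha]; auto. destruct (Ceq_dec b 0) as [|Hb]; auto.
  exfalso. revert H. now apply Cmult_neq_0.
Qed.

Lemma Re_pos_neq_0 (z : C) : 0 < Re z -> z <> 0.
Proof. intros H ->. simpl in H. lra. Qed.

Lemma slit_of_sqr (w : C) : 0 < Re w -> slit (w * w)%C.
Proof.
  intros H. destruct w as [x y]; simpl in *. unfold slit; simpl.
  destruct (Req_dec y 0) as [->|Hy]; [right; nra|left; nra].
Qed.

Lemma Csqrt_unique (w z : C) : 0 < Re w -> (w * w)%C = z -> Csqrt z = w.
Proof.
  intros Hw <-. pose proof (slit_of_sqr w Hw) as Hs.
  pose proof (Csqrt_sqr _ Hs) as E. pose proof (Csqrt_Re_pos _ Hs) as P.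
  set (v := Csqrt (w * w)) in *.
  assert (F : ((v - w) * (v + w))%C = 0) by (replace ((v - w) * (v + w))%C with (v * v - w * w)%C by ring; rewrite E; ring).
  apply Cmult_eq_0 in F. destruct F as [F|F]; [now apply Ceq_minus|].
  exfalso. revert F. apply Re_pos_neq_0. destruct v, w; simpl in *; lra.
Qed.

Lemma slit_open z : slit z -> exists d, 0 < d /\ forall w, Cmod (w - z) < d -> slit w.
Proof.
  intros [H|H].
  - exists (Rabs (Im z)). split; [now apply Rabs_pos_lt|]. intros w Hw. left. intros E.
    pose proof (im_le_Cmod (w - z)) as Q. destruct w, z; simpl in *. subst.
    rewrite Rplus_0_l, Rabs_Ropp in Q. lra.
  - exists (Re z). split; auto. intros w Hw. right.
    pose proof (re_le_Cmod (w - z)) as Q. destruct w, z; simpl in *.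
    apply Rabs_le_between in Q. lra.
Qed.

(** [Csqrt w - Csqrt z = (w - z) / (Csqrt w + Csqrt z)], and the denominator stays away from 0 since
    both roots lie in the right half-plane. This gives continuity, and then the derivative. *)
Lemma chol_Csqrt_at (z : C) : slit z -> chol Csqrt z.
Proof.
  intros Hz. destruct (slit_open z Hz) as [d [Hd Hop]].
  pose proof (Csqrt_Re_pos z Hz) as Hp. set (m := Re (Csqrt z)) in *.
  assert (Hsum : forall w, slit w -> m <= Cmod (Csqrt w + Csqrt z) /\ (Csqrt w + Csqrt z)%C <> 0).
  { intros w Hw. pose proof (Csqrt_Re_pos w Hw). pose proof (re_le_Cmod (Csqrt w + Csqrt z)) as Q.
    apply Rabs_le_between in Q.
    replace (Re (Csqrt w + Csqrt z)) with (Re (Csqrt w) + m) in Q by (unfold m, Re; simpl; ring).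
    assert (m <= Cmod (Csqrt w + Csqrt z)) by lra. split; auto. apply Cmod_gt_0. lra. }
  assert (Hdif : forall w, slit w -> (Csqrt w - Csqrt z)%C = ((w - z) * / (Csqrt w + Csqrt z))%C).
  { intros w Hw. destruct (Hsum w Hw) as [_ Hne].
    rewrite <- (Csqrt_sqr w Hw) at 2. rewrite <- (Csqrt_sqr z Hz) at 2. field; auto. }
  assert (Hc : ccont Csqrt z).
  { intros e He. exists (Rmin d (e * m)). split; [apply Rmin_pos; nra|]. intros w Hw.
    pose proof (Rmin_l d (e * m)). pose proof (Rmin_r d (e * m)).
    assert (Hsw : slit w) by (apply Hop; lra). destruct (Hsum w Hsw) as [B Hne].
    rewrite Hdif by auto. rewrite Cmod_mult, Cmod_inv by auto.
    apply Rmult_lt_reg_r with (Cmod (Csqrt w + Csqrt z)); [lra|].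
    rewrite Rmult_assoc, Rinv_l by lra. nra. }
  destruct (Hsum z Hz) as [_ Hne].
  assert (Hq : ccont (fun w => / (Csqrt w + Csqrt z))%C z).
  { apply ccont_inv; auto. apply ccont_plus; auto. intros e He; exists 1; split; [lra|].
    intros w _. replace (Csqrt z - Csqrt z)%C with (RtoC 0) by ring. rewrite Cmod_0; auto. }
  exists (/ (Csqrt z + Csqrt z))%C. intros e He. destruct (Hq e He) as [d' [Hd' J]].
  exists (Rmin d d'). split; [now apply Rmin_pos|]. intros w Hw.
  pose proof (Rmin_l d d'). pose proof (Rmin_r d d').
  rewrite Hdif by (apply Hop; lra).
  replace ((w - z) * / (Csqrt w + Csqrt z) - (w - z) * / (Csqrt z + Csqrt z))%C
    with ((w - z) * (/ (Csqrt w + Csqrt z) - / (Csqrt z + Csqrt z)))%C by ring.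
  rewrite Cmod_mult, (Rmult_comm e). apply Rmult_le_compat_l; [apply Cmod_ge_0|].
  left. apply J. lra.
Qed.

Lemma chol_conj f z : chol f (Cconj z) -> chol (fun w => Cconj (f (Cconj w))) z.
Proof.
  intros [l H]. exists (Cconj l). intros e He. destruct (H e He) as [d [Hd J]].
  exists d; split; auto. intros w Hw.
  specialize (J (Cconj w)). rewrite <- Cminus_conj, Cmod_conj in J. specialize (J Hw).
  rewrite <- (Cmod_conj (w - z)), <- (Cmod_conj (_ - _ - _)).
  rewrite !Cminus_conj, Cmult_conj, Cminus_conj, !Cconj_conj. rewrite <- Cminus_conj, Cmod_conj. exact J.
Qed.

(* The Moebius map [m] sends the unit disk onto the right half-plane and [0] to
   the square root of [- i], so [i m^2] sends the disk onto the upper cut plane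
   and [0] to [1]. *)
Lemma identity_cut_plane (g : C -> C) :
  (forall t, cut_plane Upper t -> chol g t) -> (forall t, 0 < Re t -> g t = 0) ->
  forall t, cut_plane Upper t -> g t = 0.
Proof.
  intros Hg H0 t Ht.
  set (q := sqrt (/ 2)). assert (Hq : q * q = / 2) by (apply sqrt_sqrt; lra).
  assert (Hq0 : 0 < q) by (apply sqrt_lt_R0; lra).
  set (w0 := (q, - q) : C). set (w1 := (q, q) : C).
  set (m := fun z : C => ((w0 + w1 * z) / (1 - z))%C).
  assert (Hz1 : forall z : C, Cmod z < 1 -> (1 - z)%C <> 0).
  { intros z Hz E. apply Ceq_minus in E. rewrite <- E, Cmod_1 in Hz. lra. }
  assert (Hm : forall z, Cmod z < 1 -> 0 < Re (m z)).
  { intros z Hz. pose proof (Hz1 z Hz) as Hne. pose proof (Cmod2_alt z) as Q.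
    assert (Hlt : Cmod z ^ 2 < 1) by (pose proof (Cmod_ge_0 z); nra).
    pose proof (Cmod2_alt (1 - z)) as Q1. apply Cmod_gt_0 in Hne.
    assert (P1 : 0 < Cmod (1 - z) ^ 2) by (apply pow_lt; auto).
    destruct z as [x y]. unfold m, w0, w1, Cdiv, Cmult, Cinv, Cplus, Cminus, Copp, RtoC, Re, Im in *; simpl in *.
    match goal with |- 0 < ?E => replace E with (q * (1 - (x * x + y * y)) / ((1 + - x) * ((1 + - x) * 1) + (0 + - y) * ((0 + - y) * 1))) end.
    - apply Rdiv_lt_0_compat; nra.
    - field. nra. }
  assert (Hcut : forall w, 0 < Re w -> cut_plane Upper (Ci * (w * w))%C).
  { intros [x y] Hw; simpl in *. destruct (Req_dec y 0) as [->|Hy]; [right; nra|left; nra]. }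
  assert (Hhol : forall z, Cmod z < 1 -> chol (fun z => Ci * (m z * m z))%C z).
  { intros z Hz. apply chol_mult; [apply chol_const|].
    assert (chol m z).
    { apply chol_div; auto.
      - apply chol_plus; [apply chol_const|apply chol_mult; auto using chol_const, chol_id].
      - apply chol_minus; auto using chol_id, chol_const. }
    now apply chol_mult. }
  assert (Hm0 : (Ci * (m 0 * m 0))%C = 1).
  { replace (m 0) with w0 by (unfold m; field; replace (1 - 0)%C with (RtoC 1) by ring; apply C1_nz).
    apply injective_projections; simpl; lra. }
  (* Near [z = 0] the image [i m(z)^2] is close to 1, hence in the right half-plane, where [g]
     vanishes; a short real interval is enough for the identity theorem. *)
  assert (Hf : forall z, Cmod z < 1 -> g (Ci * (m z * m z))%C = 0).
  { destruct (chol_ccont _ _ (Hhol 0 ltac:(rewrite Cmod_0; lra)) 1 Rlt_0_1) as [d [Hd J]].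
    apply (identity_disk (fun z => g (Ci * (m z * m z))%C) d Hd).
    - intros w Hw. apply (chol_comp g (fun z => Ci * (m z * m z))%C); auto.
    - intros x Hx. apply H0.
      specialize (J (RtoC x)). rewrite Hm0 in J.
      replace (x - 0)%C with (RtoC x) in J by ring. rewrite Cmod_R, Rabs_pos_eq in J by lra.
      specialize (J ltac:(lra)). pose proof (re_le_Cmod (Ci * (m x * m x) - 1)) as Q.
      apply Rabs_le_between in Q.
      replace (Re (Ci * (m x * m x) - 1)) with (Re (Ci * (m x * m x)) - 1) in Q by (unfold Re; simpl; ring).
      lra. }
  assert (Hsl : slit (- Ci * t)%C).
  { unfold slit. destruct t as [x y]; simpl in *. destruct Ht as [Ht|Ht]; [left|right]; nra. }
  set (w := Csqrt (- Ci * t)). assert (Hw := Csqrt_Re_pos _ Hsl). fold w in Hw.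
  assert (Ew : (Ci * (w * w))%C = t).
  { unfold w. rewrite Csqrt_sqr by auto. apply injective_projections; simpl; ring. }
  (* The inverse of [m]. It lands in the disk because [w], in the right half-plane, is closer to
     [w0] than to [- w1], the mirror image of [w0] in the imaginary axis. *)
  set (z := ((w - w0) / (w + w1))%C).
  assert (Hne : (w + w1)%C <> 0).
  { apply Re_pos_neq_0. destruct w; simpl in *. lra. }
  assert (Hne2 : (w0 + w1)%C <> 0).
  { apply Re_pos_neq_0. simpl. lra. }
  assert (Emz : m z = w).
  { unfold m, z. field. repeat split; auto; intros Z; apply Hne2; rewrite <- Z; field; auto. }
  assert (Hz : Cmod z < 1).
  { unfold z. rewrite Cmod_div by auto. apply Cmod_gt_0 in Hne.
    apply Rmult_lt_reg_r with (Cmod (w + w1)); auto. unfold Rdiv.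
    rewrite Rmult_assoc, Rinv_l by lra. rewrite Rmult_1_r, Rmult_1_l.
    apply Rsqr_incrst_0; try apply Cmod_ge_0. rewrite !Rsqr_pow2, !Cmod2_alt.
    unfold w0, w1. destruct w as [x y]; simpl in *. nra. }
  rewrite <- Ew, <- Emz. auto.
Qed.

Lemma cut_plane_conj t : cut_plane Lower (Cconj t) <-> cut_plane Upper t.
Proof. destruct t as [x y]; simpl. split; intros [H|H]; auto; right; lra. Qed.

Lemma identity_cut_plane_side s (g : C -> C) :
  (forall t, cut_plane s t -> chol g t) -> (forall t, 0 < Re t -> g t = 0) ->
  forall t, cut_plane s t -> g t = 0.
Proof.
  destruct s; [apply identity_cut_plane|]. intros Hg H0 t Ht.
  rewrite <- (Cconj_conj (g t)), <- (Cconj_conj t).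
  rewrite (identity_cut_plane (fun t => Cconj (g (Cconj t)))).
  - unfold Cconj, RtoC; simpl. f_equal; ring.
  - intros u Hu. apply chol_conj, Hg, cut_plane_conj, Hu.
  - intros u Hu. rewrite H0 by auto. unfold Cconj, RtoC; simpl. f_equal; ring.
  - apply cut_plane_conj. now rewrite Cconj_conj.
Qed.

(** As soon as one continuation is exhibited, [epsilon] yields a continuation, and the identity
    theorem forces its values. *)
Lemma continuation_value s f g t : is_continuation s f g -> cut_plane s t -> continuation s f t = g t.
Proof.
  intros Hg Ht. unfold continuation.
  assert (Hc : is_continuation s f (epsilon (inhabits f) (is_continuation s f)))
    by (apply epsilon_spec; now exists g).
  set (c := epsilon (inhabits f) (is_continuation s f)) in *.
  destruct Hg as [G1 G2], Hc as [C1 C2].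
  apply Ceq_minus. apply (identity_cut_plane_side s (fun t => c t - g t)%C); auto.
  - intros u Hu. apply chol_minus; apply ex_derive_chol; auto.
  - intros u Hu. rewrite C2, G2 by auto. ring.
Qed.

(** * Integrals on the half-line *)

Definition is_CI_inf (f : R -> C) (l : C) : Prop :=
  (forall N, 0 <= N -> ex_CI f 0 N) /\
  forall e, 0 < e -> exists M, forall N, 0 <= N -> M <= N -> Cmod (CI f 0 N - l) < e.

Lemma is_CI_inf_RInt_gen f l : is_CI_inf f l ->
  RInt_gen (V := C_R_CompleteNormedModule) f (at_point 0) (Rbar_locally p_infty) = l.
Proof.
  intros [Hex Hl].
  apply (is_RInt_gen_unique (V := C_R_CompleteNormedModule) (Fa := at_point 0) (Fb := Rbar_locally p_infty)).
  intros P [e HP]. destruct (Hl e (cond_pos e)) as [M HM].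
  exists (fun x => x = 0) (fun x => Rmax 0 M < x).
  - reflexivity.
  - exists (Rmax 0 M). auto.
  - intros x y -> Hy. pose proof (Rmax_l 0 M). pose proof (Rmax_r 0 M).
    exists (CI f 0 y). split; [apply CI_correct, Hex; lra|].
    apply HP. specialize (HM y ltac:(lra) ltac:(lra)).
    pose proof (re_le_Cmod (CI f 0 y - l)). pose proof (im_le_Cmod (CI f 0 y - l)).
    destruct (CI f 0 y) as [u v], l as [u' v'].
    split; simpl; unfold ball; simpl; unfold AbsRing_ball, abs, minus, plus, opp; simpl;
    unfold Re, Im in *; simpl in *; lra.
Qed.

Lemma small_eq_0 (X : C) : (forall e, 0 < e -> Cmod X <= e) -> X = 0.
Proof.
  intros H. apply Cmod_eq_0, Rle_antisym; [|apply Cmod_ge_0]. apply Rnot_lt_le. intros Hp.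
  specialize (H (Cmod X / 2) ltac:(lra)). lra.
Qed.

(** Agreement is asked only for [x > 0]: the integrand of [JS] has a junk value at 0, while the
    kernels below are continuous there. *)
Lemma is_CI_inf_ext f g l : (forall x, 0 < x -> f x = g x) -> is_CI_inf f l -> is_CI_inf g l.
Proof.
  intros H [Hex Hl]. split.
  - intros N HN. destruct (Hex N HN) as [v Hv]. exists v. revert Hv. apply is_CI_ext.
    intros x. rewrite Rmin_left by auto. intros; apply H; lra.
  - intros e He. destruct (Hl e He) as [M HM]. exists M. intros N HN HMN.
    rewrite <- (CI_ext f g); auto. intros x. rewrite Rmin_left by auto. intros; apply H; lra.
Qed.

Lemma is_CI_inf_plus f g l m : is_CI_inf f l -> is_CI_inf g m -> is_CI_inf (fun x => f x + g x)%C (l + m)%C.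
Proof.
  intros [Fex Fl] [Gex Gl].
  assert (E : forall N, 0 <= N -> is_CI (fun x => f x + g x)%C 0 N (CI f 0 N + CI g 0 N)%C)
    by (intros; apply is_CI_plus; apply CI_correct; auto).
  split; [intros; eapply is_CI_ex_CI; eauto|].
  intros e He. destruct (Fl (e / 2)) as [M1 H1]; [lra|]. destruct (Gl (e / 2)) as [M2 H2]; [lra|].
  exists (Rmax M1 M2). intros N HN HM. pose proof (Rmax_l M1 M2). pose proof (Rmax_r M1 M2).
  rewrite (is_CI_unique _ _ _ _ (E N HN)).
  specialize (H1 N HN ltac:(lra)). specialize (H2 N HN ltac:(lra)).
  replace (CI f 0 N + CI g 0 N - (l + m))%C with ((CI f 0 N - l) + (CI g 0 N - m))%C by ring.
  eapply Rle_lt_trans; [apply Cmod_triangle|]. lra.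
Qed.

Lemma is_CI_inf_scal f c l : is_CI_inf f l -> is_CI_inf (fun x => c * f x)%C (c * l)%C.
Proof.
  intros [Fex Fl].
  assert (E : forall N, 0 <= N -> is_CI (fun x => c * f x)%C 0 N (c * CI f 0 N)%C)
    by (intros; apply is_CI_scal; apply CI_correct; auto).
  split; [intros; eapply is_CI_ex_CI; eauto|].
  intros e He. pose proof (Cmod_ge_0 c).
  destruct (Fl (e / (Cmod c + 1))) as [M1 H1]; [apply Rdiv_lt_0_compat; lra|].
  exists M1. intros N HN HM. rewrite (is_CI_unique _ _ _ _ (E N HN)). specialize (H1 N HN HM).
  replace (c * CI f 0 N - c * l)%C with (c * (CI f 0 N - l))%C by ring. rewrite Cmod_mult.
  apply (Rmult_lt_compat_r (Cmod c + 1)) in H1; [|lra]. unfold Rdiv in H1.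
  rewrite Rmult_assoc, Rinv_l in H1 by lra. pose proof (Cmod_ge_0 (CI f 0 N - l)). nra.
Qed.

Lemma is_CI_inf_minus f g l m : is_CI_inf f l -> is_CI_inf g m -> is_CI_inf (fun x => f x - g x)%C (l - m)%C.
Proof.
  intros Hf Hg. apply (is_CI_inf_scal _ (- (1))%C) in Hg. 
  replace (l - m)%C with (l + - (1) * m)%C by ring.
  eapply is_CI_inf_ext; [|apply is_CI_inf_plus; eauto]. intros x _; simpl. ring.
Qed.

Lemma is_CI_inf_conj f l : is_CI_inf f l -> is_CI_inf (fun x => Cconj (f x)) (Cconj l).
Proof.
  intros [Fex Fl].
  assert (E : forall N, 0 <= N -> is_CI (fun x => Cconj (f x)) 0 N (Cconj (CI f 0 N)))
    by (intros; apply is_CI_conj; apply CI_correct; auto).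
  split; [intros; eapply is_CI_ex_CI; eauto|].
  intros e He. destruct (Fl e He) as [M HM]. exists M. intros N HN HMN.
  rewrite (is_CI_unique _ _ _ _ (E N HN)), <- Cminus_conj, Cmod_conj. auto.
Qed.

Lemma is_RInt_exp_decay K d a b : 0 < d ->
  is_RInt (fun x => K * exp (- d * x)) a b (K / d * (exp (- d * a) - exp (- d * b))).
Proof.
  intros Hd.
  replace (K / d * (exp (- d * a) - exp (- d * b)))
    with (minus (- (K / d) * exp (- d * b)) (- (K / d) * exp (- d * a)))
    by (unfold minus, plus, opp; simpl; ring).
  apply (is_RInt_derive (fun x => - (K / d) * exp (- d * x))).
  - intros x _. auto_derive; auto. field. lra.
  - intros x _. apply @ex_derive_continuous. auto_derive; auto.
Qed.

Lemma CI_exp_decay f K d a b : 0 < d -> 0 <= K -> a <= b -> ex_CI f a b ->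
  (forall x, a <= x <= b -> Cmod (f x) <= K * exp (- d * x)) ->
  Cmod (CI f a b) <= K / d * exp (- d * a).
Proof.
  intros Hd HK Hab Hex Hf.
  eapply Rle_trans.
  { eapply is_CI_bound_fun; [exact Hab|exact Hf|apply CI_correct, Hex|apply is_RInt_exp_decay, Hd]. }
  pose proof (exp_pos (- d * b)). 
  assert (0 <= K / d) by (apply Rmult_le_pos; auto; left; apply Rinv_0_lt_compat; auto).
  apply Rmult_le_compat_l; lra.
Qed.

Lemma is_CI_inf_bound f l K d : 0 < d -> 0 <= K -> is_CI_inf f l ->
  (forall x, 0 <= x -> Cmod (f x) <= K * exp (- d * x)) -> Cmod l <= K / d.
Proof.
  intros Hd HK [Hex Hl] Hf. apply Rnot_lt_le. intros Hlt.
  destruct (Hl (Cmod l - K / d)) as [M HM]; [lra|].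
  set (N := Rmax 0 M). assert (HN : 0 <= N) by apply Rmax_l. assert (HMN : M <= N) by apply Rmax_r.
  specialize (HM N HN HMN).
  assert (B : Cmod (CI f 0 N) <= K / d * exp (- d * 0)) by (apply CI_exp_decay; auto; intros; apply Hf; lra).
  rewrite Rmult_0_r, exp_0, Rmult_1_r in B.
  pose proof (Cmod_le_minus l (CI f 0 N)) as T. rewrite Cmod_minus_sym in T. lra.
Qed.

Lemma exp_decay_small K d e : 0 < d -> 0 <= K -> 0 < e -> exists M, 0 <= M /\ forall x, M <= x -> K * exp (- d * x) < e.
Proof.
  intros Hd HK He. exists (Rmax 0 (- ln (e / (K + 1)) / d + 1)). split; [apply Rmax_l|].
  intros x Hx. pose proof (Rmax_r 0 (- ln (e / (K + 1)) / d + 1)).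
  assert (He' : 0 < e / (K + 1)) by (apply Rdiv_lt_0_compat; lra).
  assert (L : exp (- d * x) < e / (K + 1)).
  { rewrite <- (exp_ln (e / (K + 1))) by auto. apply exp_increasing.
    assert (Q : - ln (e / (K + 1)) / d < x) by lra.
    apply (Rmult_lt_compat_r d) in Q; auto. unfold Rdiv at 1 in Q. rewrite Rmult_assoc, Rinv_l in Q by lra. lra. }
  apply (Rmult_lt_compat_r (K + 1)) in L; [|lra]. unfold Rdiv in L. rewrite Rmult_assoc, Rinv_l in L by lra.
  pose proof (exp_pos (- d * x)). nra.
Qed.

Lemma is_CI_inf_exists f K d : 0 < d -> 0 <= K -> (forall N, 0 <= N -> ex_CI f 0 N) ->
  (forall x, 0 <= x -> Cmod (f x) <= K * exp (- d * x)) -> exists l, is_CI_inf f l.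
Proof.
  intros Hd HK Hex Hf.
  assert (Hex2 : forall a b, 0 <= a <= b -> ex_CI f a b).
  { intros a b Hab. apply (ex_RInt_Chasles_2 (V := C_R_CompleteNormedModule) f 0 a b); [lra|]. apply Hex; lra. }
  assert (Dif : forall a b, 0 <= a <= b -> Cmod (CI f 0 b - CI f 0 a) <= K / d * exp (- d * a)).
  { intros a b Hab. rewrite (CI_Chasles f 0 a b) by (apply Hex2; lra).
    replace (CI f 0 a + CI f a b - CI f 0 a)%C with (CI f a b) by ring.
    apply CI_exp_decay; auto; try lra. intros; apply Hf; lra. }
  assert (HKd : 0 <= K / d) by (apply Rmult_le_pos; auto; left; apply Rinv_0_lt_compat; auto).
  assert (Cau : forall e, 0 < e -> exists N, forall n m, (N <= n)%nat -> (N <= m)%nat ->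
     Cmod (CI f 0 (INR n) - CI f 0 (INR m)) < e).
  { intros e He. destruct (exp_decay_small (K / d) d e Hd HKd He) as [M [HM HMx]].
    destruct (INR_unbounded M) as [N HN]. exists N. intros n m Hn Hm.
    apply le_INR in Hn. apply le_INR in Hm.
    destruct (Rle_dec (INR n) (INR m)).
    - rewrite Cmod_minus_sym. eapply Rle_lt_trans; [apply Dif; lra|]. apply HMx; lra.
    - eapply Rle_lt_trans; [apply Dif; lra|]. apply HMx; lra. }
  assert (CR : ex_finite_lim_seq (fun n => Re (CI f 0 (INR n)))).
  { apply ex_lim_seq_cauchy_corr. intros e. destruct (Cau e (cond_pos e)) as [N HN]. exists N. intros n m Hnn Hmm.
    eapply Rle_lt_trans; [|apply (HN n m Hnn Hmm)].
    replace (Re (CI f 0 (INR n)) - Re (CI f 0 (INR m))) with (Re (CI f 0 (INR n) - CI f 0 (INR m))) by (unfold Re; simpl; ring).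
    apply re_le_Cmod. }
  assert (CIm : ex_finite_lim_seq (fun n => Im (CI f 0 (INR n)))).
  { apply ex_lim_seq_cauchy_corr. intros e. destruct (Cau e (cond_pos e)) as [N HN]. exists N. intros n m Hnn Hmm.
    eapply Rle_lt_trans; [|apply (HN n m Hnn Hmm)].
    replace (Im (CI f 0 (INR n)) - Im (CI f 0 (INR m))) with (Im (CI f 0 (INR n) - CI f 0 (INR m))) by (unfold Im; simpl; ring).
    apply im_le_Cmod. }
  destruct CR as [lr Hlr]. destruct CIm as [li Hli]. exists (lr, li). split; auto.
  intros e He. assert (He4 : 0 < e / 4) by lra.
  destruct (exp_decay_small (K / d) d (e / 4) Hd HKd He4) as [M [HM HMx]].
  exists M. intros N HN HMN.
  apply is_lim_seq_spec in Hlr. apply is_lim_seq_spec in Hli.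
  destruct (Hlr (mkposreal _ He4)) as [N1 HN1]. destruct (Hli (mkposreal _ He4)) as [N2 HN2].
  destruct (INR_unbounded N) as [N3 HN3].
  set (n := (N1 + N2 + N3)%nat).
  specialize (HN1 n ltac:(unfold n; lia)). specialize (HN2 n ltac:(unfold n; lia)).
  change (Rabs (Re (CI f 0 (INR n)) - lr) < e / 4) in HN1. change (Rabs (Im (CI f 0 (INR n)) - li) < e / 4) in HN2.
  assert (Hn : N <= INR n) by (apply Rle_trans with (INR N3); [lra|apply le_INR; unfold n; lia]).
  assert (D : Cmod (CI f 0 (INR n) - (lr, li)) < e / 2).
  { eapply Rle_lt_trans; [apply Cmod_le_sum|].
    replace (Re (CI f 0 (INR n) - (lr, li))) with (Re (CI f 0 (INR n)) - lr) by (unfold Re; simpl; ring).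
    replace (Im (CI f 0 (INR n) - (lr, li))) with (Im (CI f 0 (INR n)) - li) by (unfold Im; simpl; ring). lra. }
  pose proof (Dif N (INR n) ltac:(lra)) as D2. specialize (HMx N HMN).
  pose proof (Cmod_minus_triangle (CI f 0 N) (CI f 0 (INR n)) (lr, li)) as T.
  rewrite (Cmod_minus_sym (CI f 0 N) (CI f 0 (INR n))) in T. lra.
Qed.

Lemma is_CI_inf_scale f c l : 0 < c -> is_CI_inf f l -> is_CI_inf (fun y => RtoC c * f (c * y)%R)%C l.
Proof.
  intros Hc [Hex Hl].
  assert (E : forall N, 0 <= N -> is_CI (fun y => RtoC c * f (c * y)%R)%C 0 N (CI f 0 (c * N))).
  { intros N HN. 
    assert (HcN : 0 <= c * N) by nra.
    pose proof (is_RInt_comp_lin (V := C_R_NormedModule) f c 0 0 N (CI f 0 (c * N))) as Q.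
    replace (c * 0 + 0) with 0 in Q by ring. replace (c * N + 0) with (c * N) in Q by ring.
    specialize (Q (CI_correct _ _ _ (Hex _ HcN))). revert Q. apply is_CI_ext. intros x _.
    rewrite scal_R_Cmult, Rplus_0_r. reflexivity. }
  split; [intros; eapply is_CI_ex_CI; eauto|].
  intros e He. destruct (Hl e He) as [M HM]. exists (Rmax 0 M / c). intros N HN HMN.
  rewrite (is_CI_unique _ _ _ _ (E N HN)). apply (Rmult_le_compat_r c) in HMN; [|lra].
  unfold Rdiv in HMN. rewrite Rmult_assoc, Rinv_l in HMN by lra.
  pose proof (Rmax_l 0 M). pose proof (Rmax_r 0 M). apply HM; lra.
Qed.

(** * The quotient of hyperbolic sines and its removable singularity *)

Definition Csinh (z : C) : C := ((Cexp z - Cexp (- z)) / 2)%C.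

Lemma Csinh_pair x y : Csinh (x, y) = (sinh x * cos y, cosh x * sin y).
Proof.
  unfold Csinh, Cexp, sinh, cosh. apply injective_projections; simpl; rewrite cos_neg, sin_neg; field.
Qed.

Lemma Csinh_RtoC x : Csinh (RtoC x) = RtoC (sinh x).
Proof. unfold RtoC at 1. rewrite Csinh_pair, cos_0, sin_0. unfold RtoC. f_equal; ring. Qed.

(** Both later estimates come from this identity: dropping the sine bounds [|Csinh z|] from below
    off the imaginary axis, and near that axis the sine term takes over. *)
Lemma Cmod2_Csinh z : Cmod (Csinh z) ^ 2 = sinh (Re z) ^ 2 + sin (Im z) ^ 2.
Proof.
  destruct z as [x y]. rewrite Csinh_pair, Cmod2_alt. simpl.
  pose proof (sin2_cos2 y) as Q. unfold Rsqr in Q.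
  assert (Hc : cosh x * cosh x = 1 + sinh x * sinh x).
  { unfold cosh, sinh. assert (exp x * exp (- x) = 1) by (rewrite <- exp_plus, Rplus_opp_r, exp_0; auto).
    field_simplify. nra. }
  replace (cosh x * sin y * (cosh x * sin y * 1)) with (cosh x * cosh x * (sin y * sin y)) by ring.
  rewrite Hc. replace (cos y * (1)) with (cos y) by ring.
  replace (sinh x * cos y * (sinh x * cos y * 1)) with (sinh x * sinh x * (cos y * cos y)) by ring.
  replace (cos y * cos y) with (1 - sin y * sin y) by lra. ring.
Qed.

Lemma sinh_pos x : 0 < x -> 0 < sinh x.
Proof. intros H. unfold sinh. assert (exp (- x) < exp x) by (apply exp_increasing; lra). lra. Qed.

Lemma sinh_opp x : sinh (- x) = - sinh x.
Proof. unfold sinh. rewrite Ropp_involutive. field. Qed.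

Lemma Rabs_sinh x : Rabs (sinh x) = sinh (Rabs x).
Proof.
  destruct (Rle_lt_dec 0 x) as [[H|<-]|H].
  - pose proof (sinh_pos x H). rewrite !Rabs_pos_eq; lra.
  - rewrite sinh_0, !Rabs_R0, sinh_0. auto.
  - pose proof (sinh_pos (- x) ltac:(lra)). rewrite sinh_opp in *. rewrite (Rabs_left x), sinh_opp, Rabs_left; lra.
Qed.

Lemma sinh_ge x : 0 <= x -> x <= sinh x.
Proof.
  intros [H|<-]; [|rewrite sinh_0; lra].
  destruct (MVT_gen (fun x => sinh x - x) 0 x (fun x => cosh x - 1)) as [c [_ Hc]].
  - intros c _. unfold sinh, cosh. auto_derive; auto. field.
  - intros c _. apply derivable_continuous_pt. unfold sinh. reg.
  - rewrite sinh_0 in Hc.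
    assert (1 <= cosh c).
    { unfold cosh. assert (exp c * exp (- c) = 1) by (rewrite <- exp_plus, Rplus_opp_r, exp_0; auto).
      pose proof (exp_pos c). pose proof (exp_pos (- c)). pose proof (Rle_0_sqr (exp c - exp (- c))) as Q. unfold Rsqr in Q. apply Rnot_lt_le. intros Hlt. nra. }
    nra.
Qed.

Lemma sinh_ratio b P x : 0 <= b <= P -> 0 <= x -> sinh (b * x) <= exp (- (P - b) * x) * sinh (P * x).
Proof.
  intros Hb Hx. unfold sinh.
  replace (exp (- (P - b) * x) * ((exp (P * x) - exp (- (P * x))) / 2))
    with ((exp (b * x) - exp (- (2 * P - b) * x)) / 2).
  - assert (exp (- (2 * P - b) * x) <= exp (- (b * x))).
    { destruct (Rle_lt_or_eq_dec (- (2 * P - b) * x) (- (b * x))) as [L|E]; [nra| |].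
      - left. now apply exp_increasing.
      - rewrite E. lra. }
    lra.
  - replace (exp (- (P - b) * x) * ((exp (P * x) - exp (- (P * x))) / 2))
      with ((exp (- (P - b) * x) * exp (P * x) - exp (- (P - b) * x) * exp (- (P * x))) / 2) by field.
    rewrite <- !exp_plus. f_equal. f_equal; f_equal; ring.
Qed.

Lemma Cmod_Csinh_ge z : Rabs (sinh (Re z)) <= Cmod (Csinh z).
Proof.
  apply Rsqr_incr_0_var; [|apply Cmod_ge_0]. rewrite <- Rsqr_abs, !Rsqr_pow2, Cmod2_Csinh.
  pose proof (pow2_ge_0 (sin (Im z))). lra.
Qed.

Lemma Cmod_Csinh_le z : Cmod (Csinh z) <= Rabs (sinh (Re z)) + Rabs (sin (Im z)).
Proof.
  pose proof (Rabs_pos (sinh (Re z))). pose proof (Rabs_pos (sin (Im z))).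
  apply Rsqr_incr_0_var; [|lra]. rewrite !Rsqr_pow2, Cmod2_Csinh.
  rewrite <- (pow2_abs (sinh (Re z))), <- (pow2_abs (sin (Im z))). nra.
Qed.

Lemma Rabs_sin_le y : Rabs (sin y) <= Rabs y.
Proof.
  assert (K : forall y, 0 <= y -> Rabs (sin y) <= y).
  { intros x Hx. destruct (Rle_lt_dec x 1) as [H1|H1].
    - pose proof PI2_1. assert (0 <= sin x) by (apply sin_ge_0; lra). rewrite Rabs_pos_eq by auto.
      destruct Hx as [Hx|<-]; [left; now apply sin_lt_x|rewrite sin_0; lra].
    - apply Rle_trans with 1; [|lra]. apply Rabs_le. apply SIN_bound. }
  destruct (Rle_lt_dec 0 y) as [H|H].
  - rewrite (Rabs_pos_eq y) by auto. auto.
  - rewrite (Rabs_left y) by auto. rewrite <- (Ropp_involutive y) at 1. rewrite sin_neg, Rabs_Ropp. apply K. lra.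
Qed.

Lemma chol_Csinh f z : chol f z -> chol (fun w => Csinh (f w)) z.
Proof.
  intros H. unfold Csinh. apply chol_div; [|apply chol_const|].
  - apply chol_minus; apply chol_Cexp; auto using chol_opp.
  - intros E. apply (f_equal Re) in E. simpl in E. lra.
Qed.

Lemma Csinh_neq_0 z : Re z <> 0 -> Csinh z <> 0.
Proof.
  intros H. apply Cmod_gt_0. eapply Rlt_le_trans; [|apply Cmod_Csinh_ge].
  rewrite Rabs_sinh. apply sinh_pos. now apply Rabs_pos_lt.
Qed.

Definition Phi (b P : R) (u : C) : C := (Csinh (RtoC b * u) / Csinh (RtoC P * u))%C.

Lemma Re_scal (a : R) (u : C) : Re (RtoC a * u) = a * Re u.
Proof. apply re_scal_l. Qed.
Lemma Im_scal (a : R) (u : C) : Im (RtoC a * u) = a * Im u.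
Proof. apply im_scal_l. Qed.

Lemma chol_scal_id c z : chol (fun w => c * w)%C z.
Proof. apply chol_mult; auto using chol_const, chol_id. Qed.

Lemma chol_Phi b P u : 0 < P -> 0 < Re u -> chol (Phi b P) u.
Proof.
  intros HP Hu. unfold Phi. apply chol_div; try (apply chol_Csinh, chol_scal_id).
  apply Csinh_neq_0. rewrite Re_scal. nra.
Qed.

(** In a cone of slope [K] the sine part of the numerator is absorbed: [|sin (b Im u)| <= K |b| Re u
    <= K sinh (|b| Re u)]. What remains is the decay of the quotient at [Re u]. *)
Lemma Phi_bound b P K u : Rabs b < P -> 0 < Re u -> Rabs (Im u) <= K * Re u ->
  Cmod (Phi b P u) <= (1 + K) * exp (- (P - Rabs b) * Re u).
Proof.
  intros Hb Hu HK. pose proof (Rabs_pos b).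
  assert (HKp : 0 <= K) by (pose proof (Rabs_pos (Im u)); nra).
  assert (HPx : 0 < sinh (P * Re u)) by (apply sinh_pos; nra).
  unfold Phi. assert (Hne : Csinh (RtoC P * u) <> 0) by (apply Csinh_neq_0; rewrite Re_scal; nra).
  rewrite Cmod_div by auto.
  pose proof (Cmod_Csinh_ge (RtoC P * u)) as L. pose proof (Cmod_Csinh_le (RtoC b * u)) as U.
  rewrite Re_scal in L, U. rewrite Im_scal in U. rewrite Rabs_pos_eq in L by lra.
  rewrite Rabs_sinh, Rabs_mult, (Rabs_pos_eq (Re u)) in U by lra.
  pose proof (Rabs_sin_le (b * Im u)) as S. rewrite Rabs_mult in S.
  pose proof (sinh_ratio (Rabs b) P (Re u) ltac:(lra) ltac:(lra)) as Q.
  pose proof (sinh_ge (Rabs b * Re u) ltac:(nra)) as G.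
  assert (U2 : Cmod (Csinh (RtoC b * u)) <= (1 + K) * sinh (Rabs b * Re u)).
  { assert (Rabs b * Rabs (Im u) <= K * sinh (Rabs b * Re u)).
    { apply Rle_trans with (Rabs b * (K * Re u)); [apply Rmult_le_compat_l; lra|].
      replace (Rabs b * (K * Re u)) with (K * (Rabs b * Re u)) by ring. apply Rmult_le_compat_l; auto. }
    lra. }
  pose proof (proj1 (Cmod_gt_0 _) Hne) as HD.
  apply Rmult_le_reg_r with (Cmod (Csinh (RtoC P * u))); auto.
  unfold Rdiv. rewrite Rmult_assoc, Rinv_l, Rmult_1_r by lra.
  eapply Rle_trans; [exact U2|]. rewrite Rmult_assoc. apply Rmult_le_compat_l; [lra|].
  eapply Rle_trans; [exact Q|]. apply Rmult_le_compat_l; [left; apply exp_pos|auto].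
Qed.

Definition sinh_slope (b : R) (u : C) : C :=
  if excluded_middle_informative (u = 0) then RtoC b else (Csinh (RtoC b * u) / u)%C.

Lemma cdiff_Csinh_scal b : cdiff (fun u => Csinh (RtoC b * u)) 0 b.
Proof.
  assert (H1 : forall c : C, cdiff (fun u => Cexp (c * u)) 0 c).
  { intros c.
    assert (Q : cdiff (fun u => c * u)%C 0 c).
    { pose proof (cdiff_mult _ _ _ _ _ (cdiff_const c 0) (cdiff_id 0)) as Q. cbv beta in Q.
      replace (0 * 0 + c * 1)%C with c in Q by ring. exact Q. }
    pose proof (cdiff_comp Cexp (fun u => c * u)%C 0 _ _ Q (cdiff_Cexp _)) as Q2. cbv beta in Q2.
    replace (c * Cexp (c * 0))%C with c in Q2 by (rewrite Cmult_0_r, Cexp_0; ring). exact Q2. }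
  pose proof (cdiff_plus _ _ _ _ _ (H1 b) (cdiff_mult _ _ _ _ _ (cdiff_const (- (1))%C 0) (H1 (- b)%C))) as H2.
  pose proof (cdiff_mult _ _ _ _ _ H2 (cdiff_const (/ 2)%C 0)) as H3. cbv beta in H3.
  match type of H3 with cdiff _ _ ?l => replace l with (RtoC b) in H3 end.
  - revert H3. apply (cdiff_ext_loc _ _ _ _ 1); [lra|]. intros w _. unfold Csinh, Cdiv.
    replace (- b * w)%C with (- (b * w))%C by ring. ring.
  - rewrite !Cmult_0_r, Cexp_0. field.
Qed.

Lemma ccont_sinh_slope b : ccont (sinh_slope b) 0.
Proof.
  intros e He. destruct (cdiff_Csinh_scal b (e / 2)) as [d [Hd J]]; [lra|]. exists d. split; auto.
  intros w Hw. unfold sinh_slope. destruct (excluded_middle_informative (RtoC 0 = 0)); [|tauto].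
  destruct (excluded_middle_informative (w = 0)) as [->|Hne].
  - replace (b - b)%C with (RtoC 0) by ring. rewrite Cmod_0; lra.
  - specialize (J w Hw). replace (w - 0)%C with w in * by ring.
    rewrite Cmult_0_r, Csinh_RtoC, sinh_0 in J.
    replace (Csinh (b * w) / w - b)%C with ((Csinh (b * w) - 0 - w * b) / w)%C by (field; auto).
    rewrite Cmod_div by auto. apply Cmod_gt_0 in Hne.
    apply Rle_lt_trans with (e / 2); [|lra].
    apply Rmult_le_reg_r with (Cmod w); auto. unfold Rdiv at 1.
    rewrite Rmult_assoc, Rinv_l by lra. lra.
Qed.

(** Numerator and denominator of [Phi] both vanish at 0. Dividing each by [u] beforehand gives the
    continuous extension, with value [b / P]. *)
Definition Phi_ext (b P : R) (u : C) : C := (sinh_slope b u * / sinh_slope P u)%C.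

Lemma Cinv_0 : (/ (0 : C))%C = 0.
Proof. unfold Cinv, RtoC; simpl. f_equal; unfold Rdiv; ring. Qed.

Lemma Phi_ext_Phi b P (u : C) : u <> 0 -> Phi_ext b P u = Phi b P u.
Proof.
  intros Hu. unfold Phi_ext, Phi, sinh_slope. destruct (excluded_middle_informative (u = 0)); [tauto|].
  (* At a pole both sides are 0, by the convention [/ 0 = 0]. *)
  destruct (Ceq_dec (Csinh (RtoC P * u)) 0) as [E|E].
  - rewrite E. unfold Cdiv. rewrite !Cmult_0_l, !Cinv_0. ring.
  - field. auto.
Qed.

Lemma sinh_slope_0 b : sinh_slope b 0 = b.
Proof. unfold sinh_slope. destruct (excluded_middle_informative (RtoC 0 = 0)); tauto. Qed.

Lemma RtoC_neq_0 (x : R) : x <> 0 -> RtoC x <> 0.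
Proof. intros H E. apply H. apply (f_equal Re) in E. exact E. Qed.

Lemma ccont_Phi_ext_0 b P : 0 < P -> ccont (Phi_ext b P) 0.
Proof.
  intros HP. apply ccont_mult; [apply ccont_sinh_slope|]. apply ccont_inv; [apply ccont_sinh_slope|].
  rewrite sinh_slope_0. apply RtoC_neq_0. lra.
Qed.

Lemma chol_Phi_ext b P u : 0 < P -> 0 < Re u -> chol (Phi_ext b P) u.
Proof.
  intros HP Hu. apply (chol_ext_loc (Phi b P) _ _ (Re u) Hu); [|apply chol_Phi; auto].
  intros w Hw. symmetry. apply Phi_ext_Phi, Re_pos_neq_0.
  pose proof (re_le_Cmod (w - u)) as Q. destruct w, u; simpl in *. apply Rabs_le_between in Q. lra.
Qed.

Lemma Phi_ext_bound b P K u : Rabs b < P -> 0 <= K -> 0 < Re u \/ u = 0 -> Rabs (Im u) <= K * Re u ->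
  Cmod (Phi_ext b P u) <= (1 + K) * exp (- (P - Rabs b) * Re u).
Proof.
  intros Hb HK Hu Hi. pose proof (Rabs_pos b). destruct Hu as [Hu|Hu].
  - rewrite Phi_ext_Phi by now apply Re_pos_neq_0. apply Phi_bound; auto.
  - subst u. simpl. rewrite Rmult_0_r, exp_0. unfold Phi_ext. rewrite !sinh_slope_0, Cmod_mult, Cmod_inv, !Cmod_R.
    + rewrite (Rabs_pos_eq P) by lra. apply Rmult_le_reg_r with P; [lra|]. rewrite Rmult_assoc, Rinv_l by lra. nra.
    + apply RtoC_neq_0. lra.
Qed.

(** * The integral along a ray as a holomorphic function of its direction *)

Lemma ccont_Phi_ext_ray b P (s : C) (y : R) : 0 < P -> 0 < Re s -> 0 <= y -> ccont (Phi_ext b P) (s * RtoC y).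
Proof.
  intros HP Hs [Hy|<-].
  - apply chol_ccont, chol_Phi_ext; auto. rewrite Cmult_comm, Re_scal. nra.
  - rewrite Cmult_0_r. apply ccont_Phi_ext_0; auto.
Qed.

(** For [u = s y] with [s^2 = - i t] the Gaussian [exp (- P u^2 / t)] becomes [exp (i P y^2)], free
    of [t]. Thus [t] enters only through the direction [s], and the kernel makes sense for every [s]
    in the right half-plane. *)
Definition ray_kernel (b P : R) (s : C) (y : R) : C :=
  (Cexp (Ci * RtoC (P * y ^ 2)) * Phi_ext b P (s * RtoC y))%C.

Lemma rcont_RtoC y : rcont RtoC y.
Proof. apply rcont_horiz. Qed.

Lemma rcont_ray_kernel b P s y : 0 < P -> 0 < Re s -> 0 <= y -> rcont (ray_kernel b P s) y.
Proof.
  intros HP Hs Hy.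
  intros e He.
  assert (Hc : ccont (fun z => Cexp (Ci * (RtoC P * (z * z))) * Phi_ext b P (s * z))%C (RtoC y)).
  { apply ccont_mult.
    - apply chol_ccont, chol_Cexp. repeat apply chol_mult; auto using chol_const, chol_id.
    - apply (ccont_comp (Phi_ext b P) (fun z => s * z)%C); [apply chol_ccont, chol_scal_id|].
      apply ccont_Phi_ext_ray; auto. }
  destruct (rcont_comp _ RtoC y Hc (rcont_RtoC y) e He) as [d [Hd J]].
  exists d; split; auto. intros x Hx. specialize (J x Hx). unfold ray_kernel.
  replace (RtoC (P * x ^ 2)) with (RtoC P * (RtoC x * RtoC x))%C
    by (rewrite !RtoC_mult, RtoC_pow; simpl; ring).
  replace (RtoC (P * y ^ 2)) with (RtoC P * (RtoC y * RtoC y))%C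
    by (rewrite !RtoC_mult, RtoC_pow; simpl; ring).
  exact J.
Qed.

Lemma ex_CI_ray_kernel b P s N : 0 < P -> 0 < Re s -> 0 <= N -> ex_CI (ray_kernel b P s) 0 N.
Proof. intros. apply ex_CI_rcont; auto. intros; apply rcont_ray_kernel; auto; lra. Qed.

Lemma Cmod_Cexp_imag x : Cmod (Cexp (Ci * RtoC x)) = 1.
Proof. rewrite Cmod_Cexp. simpl. replace (0 * x - 1 * 0) with 0 by ring. apply exp_0. Qed.

Lemma ray_kernel_bound b P s K y : Rabs b < P -> 0 < Re s -> 0 <= K -> Rabs (Im s) <= K * Re s -> 0 <= y ->
  Cmod (ray_kernel b P s y) <= (1 + K) * exp (- ((P - Rabs b) * Re s) * y).
Proof.
  intros Hb Hs HK Hi Hy. unfold ray_kernel. rewrite Cmod_mult, Cmod_Cexp_imag, Rmult_1_l.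
  replace (- ((P - Rabs b) * Re s) * y) with (- (P - Rabs b) * Re (s * RtoC y)).
  - apply Phi_ext_bound; auto.
    + destruct Hy as [Hy|<-]; [left|right; ring]. rewrite Cmult_comm, Re_scal. nra.
    + rewrite Cmult_comm, Re_scal, Im_scal, Rabs_mult, (Rabs_pos_eq y) by auto. nra.
  - rewrite Cmult_comm, Re_scal. ring.
Qed.

Definition ray_int (b P : R) (s : C) : C :=
  RInt_gen (V := C_R_CompleteNormedModule) (ray_kernel b P s) (at_point 0) (Rbar_locally p_infty).

Lemma ray_int_correct b P s : Rabs b < P -> 0 < Re s -> is_CI_inf (ray_kernel b P s) (ray_int b P s).
Proof.
  intros Hb Hs. pose proof (Rabs_pos b).
  set (K := Rabs (Im s) / Re s).
  assert (HK : 0 <= K) by (apply Rmult_le_pos; [apply Rabs_pos|left; now apply Rinv_0_lt_compat]).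
  assert (HKi : Rabs (Im s) <= K * Re s) by (right; unfold K; field; lra).
  destruct (is_CI_inf_exists (ray_kernel b P s) (1 + K) ((P - Rabs b) * Re s)) as [l Hl].
  - apply Rmult_lt_0_compat; lra.
  - lra.
  - intros; apply ex_CI_ray_kernel; lra.
  - intros; apply ray_kernel_bound; auto.
  - unfold ray_int. rewrite (is_CI_inf_RInt_gen _ _ Hl). exact Hl.
Qed.

(** For fixed [y] the kernel is holomorphic in [s], so its difference quotients satisfy the
    Lipschitz estimate with a constant that decays exponentially in [y]; integration over [y] gives
    the estimate for the integral. *)
Lemma chol_ray_int b P s0 : Rabs b < P -> 0 < Re s0 -> chol (ray_int b P) s0.
Proof.
  intros Hb Hs0. pose proof (Rabs_pos b).
  set (r := Re s0 / 2). assert (Hr : 0 < r) by (unfold r; lra).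
  (* All [s] in the ball of radius [r] have real part at least [r] and lie in the cone of slope [K],
     so one bound serves the whole ball. *)
  set (K := (Rabs (Im s0) + r) / r).
  assert (HK : 0 <= K) by (apply Rmult_le_pos; [pose proof (Rabs_pos (Im s0)); lra|left; now apply Rinv_0_lt_compat]).
  assert (Hball : forall s, Cmod (s - s0) < r -> r <= Re s /\ Rabs (Im s) <= K * Re s).
  { intros s Hs. pose proof (re_le_Cmod (s - s0)) as Q1. pose proof (im_le_Cmod (s - s0)) as Q2.
    apply Rabs_le_between in Q1.
    replace (Re (s - s0)) with (Re s - Re s0) in Q1 by (unfold Re; simpl; ring).
    replace (Im (s - s0)) with (Im s - Im s0) in Q2 by (unfold Im; simpl; ring).
    assert (Hre : r <= Re s) by (unfold r in *; lra). split; auto.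
    apply Rle_trans with (Rabs (Im s0) + r).
    - replace (Im s) with (Im s0 + (Im s - Im s0)) by ring. eapply Rle_trans; [apply Rabs_triang|]. lra.
    - apply Rle_trans with (K * r); [right; unfold K; field; lra|apply Rmult_le_compat_l; auto]. }
  set (d := (P - Rabs b) * r). assert (Hd : 0 < d) by (apply Rmult_lt_0_compat; lra).
  assert (Hbd : forall s y, Cmod (s - s0) < r -> 0 <= y -> Cmod (ray_kernel b P s y) <= (1 + K) * exp (- d * y)).
  { intros s y Hs Hy. destruct (Hball s Hs) as [B1 B2].
    eapply Rle_trans; [apply (ray_kernel_bound b P s K); auto; lra|].
    apply Rmult_le_compat_l; [lra|].
    destruct (Rle_lt_or_eq_dec (- ((P - Rabs b) * Re s) * y) (- d * y)) as [L|E].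
    - unfold d. assert ((P - Rabs b) * r <= (P - Rabs b) * Re s) by (apply Rmult_le_compat_l; lra). nra.
    - left. now apply exp_increasing.
    - rewrite E; lra. }
  apply (chol_of_diff_quot (ray_int b P) s0 (r / 4) (16 * (1 + K) / r ^ 2 / d)); [lra| |].
  { apply Rmult_le_pos; [apply Rmult_le_pos; [lra|]|]; left; apply Rinv_0_lt_compat; auto. apply pow_lt; auto. }
  intros h k Hh Hk Lh Lk.
  assert (S0 : Cmod (s0 - s0) < r) by (replace (s0 - s0)%C with (RtoC 0) by ring; rewrite Cmod_0; auto).
  assert (Sh : Cmod (s0 + h - s0) < r) by (replace (s0 + h - s0)%C with h by ring; lra).
  assert (Sk : Cmod (s0 + k - s0) < r) by (replace (s0 + k - s0)%C with k by ring; lra).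
  assert (C : forall s, Cmod (s - s0) < r -> is_CI_inf (ray_kernel b P s) (ray_int b P s)).
  { intros s Hs. apply ray_int_correct; auto. destruct (Hball s Hs). lra. }
  assert (D : is_CI_inf (fun y => / h * (ray_kernel b P (s0 + h) y - ray_kernel b P s0 y)
       - / k * (ray_kernel b P (s0 + k) y - ray_kernel b P s0 y))%C
     (/ h * (ray_int b P (s0 + h) - ray_int b P s0) - / k * (ray_int b P (s0 + k) - ray_int b P s0))%C).
  { apply is_CI_inf_minus; apply is_CI_inf_scal, is_CI_inf_minus; auto. }
  replace (diff_quot (ray_int b P) s0 h - diff_quot (ray_int b P) s0 k)%C
    with (/ h * (ray_int b P (s0 + h) - ray_int b P s0) - / k * (ray_int b P (s0 + k) - ray_int b P s0))%C
    by (unfold diff_quot; field; auto).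
  replace (16 * (1 + K) / r ^ 2 / d * Cmod (h - k)) with ((16 * (1 + K) / r ^ 2 * Cmod (h - k)) / d) by (field; lra).
  apply (is_CI_inf_bound _ _ (16 * (1 + K) / r ^ 2 * Cmod (h - k)) d Hd) with (2 := D).
  { apply Rmult_le_pos; [|apply Cmod_ge_0]. apply Rmult_le_pos; [lra|]. left; apply Rinv_0_lt_compat, pow_lt; auto. }
  intros y Hy.
  pose proof (diff_quot_estimate (fun s => ray_kernel b P s y) s0 r ((1 + K) * exp (- d * y)) Hr) as Q.
  replace (16 * (1 + K) / r ^ 2 * Cmod (h - k) * exp (- d * y))
    with (16 * ((1 + K) * exp (- d * y)) / r ^ 2 * Cmod (h - k)) by (field; lra).
  replace (/ h * (ray_kernel b P (s0 + h) y - ray_kernel b P s0 y)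
       - / k * (ray_kernel b P (s0 + k) y - ray_kernel b P s0 y))%C
    with (diff_quot (fun s => ray_kernel b P s y) s0 h - diff_quot (fun s => ray_kernel b P s y) s0 k)%C
    by (unfold diff_quot; field; auto).
  apply Q; auto.
  intros s Hs. destruct (Hball s Hs) as [B1 B2]. unfold ray_kernel.
  destruct Hy as [Hy|<-].
  - apply chol_mult; [apply chol_const|].
    apply (chol_comp (Phi_ext b P) (fun s => s * RtoC y)%C).
    + apply chol_mult; auto using chol_const, chol_id.
    + apply chol_Phi_ext; [lra|]. rewrite Cmult_comm, Re_scal. nra.
  - apply (chol_ext (fun _ => Cexp (Ci * RtoC (P * 0 ^ 2)) * Phi_ext b P 0)%C); [|apply chol_const].
    intros w. now rewrite Cmult_0_r.
Qed.

(** * Rotation of rays *)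

Definition cis (t : R) : C := Cexp (0, t).

Lemma cis_pair t : cis t = (cos t, sin t).
Proof. unfold cis, Cexp. simpl. rewrite exp_0. f_equal; ring. Qed.

Lemma Cmod_cis t : Cmod (cis t) = 1.
Proof. unfold cis. rewrite Cmod_Cexp. apply exp_0. Qed.

Lemma cis_neq_0 t : cis t <> 0.
Proof. apply Cexp_neq_0. Qed.

Lemma cis_plus a b : cis (a + b) = (cis a * cis b)%C.
Proof. unfold cis. rewrite <- Cexp_plus. f_equal. apply injective_projections; simpl; ring. Qed.

Lemma cis_0 : cis 0 = 1.
Proof. apply Cexp_0. Qed.

Lemma cis_opp t : cis (- t) = (/ cis t)%C.
Proof.
  replace (cis (- t)) with (/ cis t * (cis t * cis (- t)))%C by (field; apply cis_neq_0).
  rewrite <- cis_plus, Rplus_opp_r, cis_0. ring.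
Qed.

Definition polar (r t : R) : C := (RtoC r * cis t)%C.

Lemma Cexp_polar x t : Cexp (x, t) = polar (exp x) t.
Proof. unfold polar. rewrite cis_pair. apply injective_projections; simpl; ring. Qed.

Lemma polar_pair r t : polar r t = (r * cos t, r * sin t).
Proof. unfold polar. rewrite cis_pair. apply injective_projections; simpl; ring. Qed.

Lemma Cmod_polar r t : 0 <= r -> Cmod (polar r t) = r.
Proof.
  intros H. unfold polar. rewrite Cmod_mult, Cmod_R, Cmod_cis, Rabs_pos_eq by auto. ring.
Qed.

Definition ray (f : C -> C) (t r : R) : C := (f (polar r t) * cis t)%C.

Lemma rcont_polar t r : rcont (fun r => polar r t) r.
Proof.
  apply (rcont_comp (fun z => z * cis t)%C RtoC); [|apply rcont_RtoC].
  apply chol_ccont, chol_mult; auto using chol_id, chol_const.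
Qed.

Lemma rcont_ray f t r : ccont f (polar r t) -> rcont (ray f t) r.
Proof.
  intros H. unfold ray.
  apply (rcont_comp (fun z => f z * cis t)%C (fun r => polar r t)); [|apply rcont_polar].
  apply ccont_mult; auto. apply chol_ccont, chol_const.
Qed.

(** The pullback of [f u du] under [u = Cexp w]; sectors become rectangles and rays become
    horizontal lines. *)
Definition log_form (f : C -> C) (w : C) : C := (f (Cexp w) * Cexp w)%C.

Lemma CI_ray_log f t a b : a <= b -> (forall r, exp a <= r <= exp b -> ccont f (polar r t)) ->
  CI (fun x => log_form f (x, t)) a b = CI (ray f t) (exp a) (exp b).
Proof.
  intros Hab Hc. unfold CI.
  rewrite <- (RInt_comp (V := C_R_CompleteNormedModule) (ray f t) exp exp a b).
  - apply (RInt_ext (V := C_R_CompleteNormedModule)). intros x _.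
    rewrite scal_R_Cmult. unfold log_form, ray. rewrite Cexp_polar. unfold polar. 
    change (f (exp x * cis t) * (exp x * cis t) = exp x * (f (exp x * cis t) * cis t))%C.
    ring.
  - intros x. rewrite Rmin_left, Rmax_right by auto. intros Hx.
    apply rcont_continuous, rcont_ray, Hc.
    split; (destruct (Rle_lt_or_eq_dec _ _ (proj1 Hx)) as [L|E]; destruct (Rle_lt_or_eq_dec _ _ (proj2 Hx)) as [L'|E']);
    subst; try (left; now apply exp_increasing); lra.
  - intros x _. split; [auto_derive; auto; ring|]. apply @ex_derive_continuous. auto_derive; auto.
Qed.

Lemma exp_le x y : x <= y -> exp x <= exp y.
Proof. intros [H| ->]; [left; now apply exp_increasing|lra]. Qed.

(** [S n] is the contour integral over the sector up to radius [rn n]: zero for holomorphic [f], a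
    sum of residues otherwise. Continuity is asked only on the two rays, near 0 and on the arcs of
    radius [rn n], which leaves room for poles between the arcs. *)
Lemma wedge_limit f t1 t2 (C0 r0 : R) (l1 l2 : C) (rn : nat -> R) (S : nat -> C) :
  t1 <= t2 -> 0 < r0 -> 0 <= C0 ->
  is_CI_inf (ray f t1) l1 -> is_CI_inf (ray f t2) l2 ->
  (forall r, 0 < r -> ccont f (polar r t1)) -> (forall r, 0 < r -> ccont f (polar r t2)) ->
  (forall r t, 0 < r <= r0 -> t1 <= t <= t2 -> ccont f (polar r t)) ->
  (forall n t, t1 <= t <= t2 -> ccont f (polar (rn n) t)) ->
  (forall r t, 0 <= r <= r0 -> t1 <= t <= t2 -> Cmod (f (polar r t)) <= C0) ->
  (forall n, r0 <= rn n) ->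
  (forall M, exists N, forall n, (N <= n)%nat -> M <= rn n) ->
  (forall e, 0 < e -> exists N, forall n t, (N <= n)%nat -> t1 <= t <= t2 -> Cmod (f (polar (rn n) t)) * rn n <= e) ->
  (forall n a, exp a <= r0 -> rect_int (log_form f) a (ln (rn n)) t1 t2 = S n) ->
  forall e, 0 < e -> exists N, forall n, (N <= n)%nat -> Cmod (S n - (l1 - l2)) <= e.
Proof.
  intros Ht Hr0 HC0 [E1 L1] [E2 L2] C1 C2 Cs Ca Bs Rn Rinf Barc HS e He.
  destruct (L1 (e / 8)) as [M1 H1]; [lra|]. destruct (L2 (e / 8)) as [M2 H2]; [lra|].
  destruct (Rinf (Rmax M1 M2)) as [N1 HN1].
  destruct (Barc (e / (8 * (t2 - t1 + 1)))) as [N2 HN2]; [apply Rdiv_lt_0_compat; lra|].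
  exists (N1 + N2)%nat. intros n Hn.
  specialize (HN1 n ltac:(lia)). pose proof (Rmax_l M1 M2). pose proof (Rmax_r M1 M2).
  (* As [|f| <= C0] near 0, the inner arc and the two initial segments cost at most [e / 8] each;
     the [+ 1] cover [t1 = t2] and [C0 = 0]. The outer arc and the two tails bring the number of
     such terms to six. *)
  set (rho := Rmin r0 (e / (8 * (t2 - t1 + 1) * (C0 + 1)))).
  assert (Hq : 0 < e / (8 * (t2 - t1 + 1) * (C0 + 1))) by (apply Rdiv_lt_0_compat; [lra|apply Rmult_lt_0_compat; lra]).
  assert (Hrho : 0 < rho) by (apply Rmin_pos; auto).
  assert (Hrho1 : rho <= r0) by apply Rmin_l.
  assert (Hrho2 : rho * ((t2 - t1 + 1) * (C0 + 1)) <= e / 8).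
  { apply Rle_trans with (e / (8 * (t2 - t1 + 1) * (C0 + 1)) * ((t2 - t1 + 1) * (C0 + 1))).
    - apply Rmult_le_compat_r; [apply Rmult_le_pos; lra|apply Rmin_r].
    - right. field. lra. }
  assert (Hrn : r0 <= rn n) by apply Rn.
  specialize (HS n (ln rho)). rewrite exp_ln in HS by auto. specialize (HS Hrho1).
  unfold rect_int in HS.
  assert (Hln : ln rho <= ln (rn n)) by (apply ln_le; lra).
  rewrite !CI_ray_log in HS; auto.
  2:{ intros r. rewrite !exp_ln by lra. intros; apply C2; lra. }
  2:{ intros r. rewrite !exp_ln by lra. intros; apply C1; lra. }
  rewrite !exp_ln in HS by lra.
  assert (Q1 : CI (ray f t1) 0 (rn n) = (CI (ray f t1) 0 rho + CI (ray f t1) rho (rn n))%C).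
  { apply CI_Chasles; [apply E1; lra|]. apply ex_CI_rcont; [lra|]. intros x Hx. apply rcont_ray, C1; lra. }
  assert (Q2 : CI (ray f t2) 0 (rn n) = (CI (ray f t2) 0 rho + CI (ray f t2) rho (rn n))%C).
  { apply CI_Chasles; [apply E2; lra|]. apply ex_CI_rcont; [lra|]. intros x Hx. apply rcont_ray, C2; lra. }
  assert (Bray : forall t, t1 <= t <= t2 -> ex_CI (ray f t) 0 rho -> Cmod (CI (ray f t) 0 rho) <= e / 8).
  { intros t Htt Hex. eapply Rle_trans; [apply (CI_bound _ _ _ C0)|]; auto; [lra| |].
    - intros x Hx. unfold ray. rewrite Cmod_mult, Cmod_cis, Rmult_1_r.
      apply Bs; auto; lra.
    - apply Rle_trans with (rho * ((t2 - t1 + 1) * (C0 + 1))); auto. rewrite Rminus_0_r.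
      apply Rmult_le_compat_l; [lra|]. nra. }
  assert (B1 := Bray t1 ltac:(lra) (E1 rho ltac:(lra))).
  assert (B2 := Bray t2 ltac:(lra) (E2 rho ltac:(lra))).
  assert (V : forall x, (forall t, t1 <= t <= t2 -> ccont f (polar (exp x) t)) -> ex_CI (fun y => log_form f (x, y)) t1 t2).
  { intros x Hx. apply ex_CI_vert; auto. intros y Hy. unfold log_form. apply ccont_mult.
    - apply (ccont_comp f Cexp); [eapply cdiff_ccont, cdiff_Cexp|]. rewrite Cexp_polar. auto.
    - eapply cdiff_ccont, cdiff_Cexp. }
  assert (B3 : Cmod (CI (fun y => log_form f (ln rho, y)) t1 t2) <= e / 8).
  { eapply Rle_trans; [apply (CI_bound _ _ _ (C0 * rho)); auto|].
    - intros y Hy. unfold log_form. rewrite Cexp_polar, exp_ln, Cmod_mult, Cmod_polar by lra.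
      apply Rmult_le_compat_r; [lra|]. apply Bs; auto; lra.
    - apply V. intros t Htt. rewrite exp_ln by auto. apply Cs; auto.
    - apply Rle_trans with (rho * ((t2 - t1 + 1) * (C0 + 1))); auto.
      replace ((t2 - t1) * (C0 * rho)) with (rho * ((t2 - t1) * C0)) by ring.
      apply Rmult_le_compat_l; [lra|]. apply Rmult_le_compat; lra. }
  assert (B4 : Cmod (CI (fun y => log_form f (ln (rn n), y)) t1 t2) <= e / 8).
  { eapply Rle_trans; [apply (CI_bound _ _ _ (e / (8 * (t2 - t1 + 1)))); auto|].
    - intros y Hy. unfold log_form. rewrite Cexp_polar, exp_ln, Cmod_mult, Cmod_polar by lra.
      apply HN2; auto; lia.
    - apply V. intros t Htt. rewrite exp_ln by lra. apply Ca; auto.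
    - apply Rle_trans with ((t2 - t1 + 1) * (e / (8 * (t2 - t1 + 1)))).
      + apply Rmult_le_compat_r; [|lra]. apply Rlt_le, Rdiv_lt_0_compat; lra.
      + right. field. lra. }
  specialize (H1 (rn n) ltac:(lra) ltac:(lra)). specialize (H2 (rn n) ltac:(lra) ltac:(lra)).
  set (V1 := CI (fun y => log_form f (ln (rn n), y)) t1 t2) in *.
  set (V2 := CI (fun y => log_form f (ln rho, y)) t1 t2) in *.
  replace (S n - (l1 - l2))%C with ((CI (ray f t1) 0 (rn n) - l1) + (- CI (ray f t1) 0 rho) + Ci * V1
     + (- (CI (ray f t2) 0 (rn n) - l2)) + CI (ray f t2) 0 rho + (- (Ci * V2)))%C
    by (rewrite <- HS, Q1, Q2; ring).
  assert (T5 : forall a b c d g h : C, Cmod (a + b + c + d + g + h) <= Cmod a + Cmod b + Cmod c + Cmod d + Cmod g + Cmod h).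
  { intros a b c d g h.
    eapply Rle_trans; [apply Cmod_triangle|]. apply Rplus_le_compat_r.
    eapply Rle_trans; [apply Cmod_triangle|]. apply Rplus_le_compat_r.
    eapply Rle_trans; [apply Cmod_triangle|]. apply Rplus_le_compat_r.
    eapply Rle_trans; [apply Cmod_triangle|]. apply Rplus_le_compat_r. apply Cmod_triangle. }
  eapply Rle_trans; [apply T5|]. rewrite !Cmod_opp, !Cmod_mult, Cmod_Ci. lra.
Qed.

Lemma decay_times_x d x : 0 < d -> 0 < x -> x * exp (- d * x) <= 4 / (d ^ 2 * x).
Proof.
  intros Hd Hx. 
  assert (Q : (d * x) ^ 2 / 4 <= exp (d * x)).
  { assert (H : 0 <= d * x / 2) by nra. pose proof (exp_ineq1_le (d * x / 2)) as E.
    replace (exp (d * x)) with (exp (d * x / 2) * exp (d * x / 2)) by (rewrite <- exp_plus; f_equal; field).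
    assert ((1 + d * x / 2) * (1 + d * x / 2) <= exp (d * x / 2) * exp (d * x / 2)) by (apply Rmult_le_compat; lra).
    simpl. nra. }
  replace (- d * x) with (- (d * x)) by ring. rewrite exp_Ropp.
  assert (0 < d * x) by nra. assert (0 < (d * x) ^ 2 / 4) by nra.
  apply Rle_trans with (x * / ((d * x) ^ 2 / 4)).
  - apply Rmult_le_compat_l; [lra|]. apply Rinv_le_contravar; auto.
  - right. field. lra.
Qed.

Lemma decay_times_x_small C0 d e : 0 < d -> 0 <= C0 -> 0 < e -> exists M, 0 < M /\ forall x, M <= x -> C0 * exp (- d * x) * x <= e.
Proof.
  intros Hd HC He. exists (C0 * 4 / (d ^ 2 * e) + 1).
  assert (Hp : 0 < d ^ 2 * e) by (apply Rmult_lt_0_compat; [apply pow_lt|]; auto).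
  assert (0 <= C0 * 4 / (d ^ 2 * e)) by (apply Rmult_le_pos; [lra|left; now apply Rinv_0_lt_compat]).
  split; [lra|]. intros x Hx. assert (Hx0 : 0 < x) by lra.
  pose proof (decay_times_x d x Hd Hx0) as Q.
  apply Rle_trans with (C0 * (4 / (d ^ 2 * x))).
  - rewrite Rmult_assoc. apply Rmult_le_compat_l; auto. lra.
  - assert (Hd2 : 0 < d ^ 2) by (apply pow_lt; auto).
    apply Rmult_le_reg_r with (d ^ 2 * x); [apply Rmult_lt_0_compat; auto|].
    replace (C0 * (4 / (d ^ 2 * x)) * (d ^ 2 * x)) with (C0 * 4) by (field; lra).
    assert (Q2 : C0 * 4 / (d ^ 2 * e) <= x) by lra.
    apply (Rmult_le_compat_r (d ^ 2 * e)) in Q2; [|lra].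
    unfold Rdiv in Q2. rewrite Rmult_assoc, Rinv_l in Q2 by lra. lra.
Qed.

Lemma rotate_ray f t1 t2 (C0 d : R) (l1 l2 : C) :
  t1 <= t2 -> 0 < d -> 0 <= C0 ->
  is_CI_inf (ray f t1) l1 -> is_CI_inf (ray f t2) l2 ->
  (forall r t, 0 < r -> t1 <= t <= t2 -> chol f (polar r t)) ->
  (forall r t, 0 <= r -> t1 <= t <= t2 -> Cmod (f (polar r t)) <= C0 * exp (- d * r)) ->
  l1 = l2.
Proof.
  intros Ht Hd HC0 I1 I2 Hf Hb. apply Ceq_minus.
  apply small_eq_0. intros e He.
  destruct (wedge_limit f t1 t2 C0 1 l1 l2 (fun n => INR n + 1) (fun _ => RtoC 0)) with (e := e) as [N HN]; auto; try lra.
  - intros; apply chol_ccont, Hf; lra.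
  - intros; apply chol_ccont, Hf; lra.
  - intros; apply chol_ccont, Hf; lra.
  - intros n t Htt; apply chol_ccont, Hf; auto. pose proof (pos_INR n); lra.
  - intros r t Hr Htt. eapply Rle_trans; [apply Hb; auto; lra|].
    rewrite <- (Rmult_1_r C0) at 2. apply Rmult_le_compat_l; auto.
    rewrite <- exp_0. apply exp_le. nra.
  - intros n. pose proof (pos_INR n); lra.
  - intros M. destruct (INR_unbounded M) as [N HN]. exists N. intros n Hn. apply le_INR in Hn. lra.
  - intros e' He'. destruct (decay_times_x_small C0 d e' Hd HC0 He') as [M [HM HMx]].
    destruct (INR_unbounded M) as [N HN]. exists N. intros n t Hn Htt. apply le_INR in Hn.
    pose proof (pos_INR n).
    eapply Rle_trans; [apply Rmult_le_compat_r; [lra|apply Hb; auto; lra]|]. apply HMx. lra.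
  - intros n a Ha. apply goursat; auto.
    + rewrite <- (ln_exp a). pose proof (exp_pos a). pose proof (pos_INR n). apply ln_le; lra.
    + intros w [W1 W2]. unfold log_form. assert (HE : chol Cexp w) by (eexists; apply cdiff_Cexp).
      apply chol_mult; auto. apply (chol_comp f Cexp); auto.
      destruct w as [x y]. rewrite Cexp_polar. apply Hf; auto. apply exp_pos.
  - specialize (HN N (Nat.le_refl N)). rewrite <- Cmod_opp.
    replace (- (l1 - l2))%C with (0 - (l1 - l2))%C by ring. auto.
Qed.

Lemma polar_right (z : C) : 0 < Re z -> z = polar (Cmod z) (atan (Im z / Re z)).
Proof.
  intros Hx. rewrite polar_pair. pose proof (Cmod2_alt z) as Q. pose proof (Cmod_ge_0 z) as H0.
  rewrite cos_atan, sin_atan. destruct z as [x y]; simpl in *.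
  assert (E : sqrt (1 + (y / x)²) = Cmod (x, y) / x).
  { replace (1 + (y / x)²) with ((Cmod (x, y) / x)²).
    - rewrite sqrt_Rsqr_abs, Rabs_pos_eq; auto. apply Rmult_le_pos; auto. left; now apply Rinv_0_lt_compat.
    - unfold Rsqr. replace (Cmod (x, y) / x * (Cmod (x, y) / x)) with (Cmod (x, y) * (Cmod (x, y) * 1) / (x * x)) by (field; lra).
      rewrite Q. field. lra. }
  rewrite E. assert (Hp : 0 < Cmod (x, y)).
  { apply Cmod_gt_0. intros Z. injection Z as Z1 Z2. lra. }
  apply injective_projections; simpl; field; lra.
Qed.

Lemma cis_pi4_sqr : (cis (PI / 4) * cis (PI / 4))%C = Ci.
Proof.
  rewrite <- cis_plus. replace (PI / 4 + PI / 4) with (PI / 2) by field.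
  rewrite cis_pair, cos_PI2, sin_PI2. reflexivity.
Qed.

Lemma cis_pi4_inv : (cis (PI / 4) * cis (- (PI / 4)))%C = 1.
Proof.
  rewrite <- cis_plus, Rplus_opp_r. apply cis_0.
Qed.

Lemma cos_pos_bound t b : - PI / 2 < b -> b <= t <= 0 -> 0 < cos b <= cos t.
Proof.
  intros Hb Ht. pose proof PI_RGT_0. split; [apply cos_gt_0; lra|].
  rewrite <- (cos_neg b), <- (cos_neg t). apply cos_decr_1; lra.
Qed.

(** * The continuation of JS *)

Definition JS_integrand (P a : R) (t : C) (u : R) : C :=
  (Cexp (- (RtoC (P * u ^ 2) / t)) * RtoC (sinh ((P - a) * u) / sinh (P * u)))%C.

(** The positive axis is rotated to the ray through [s = Csqrt (- i t)]. In the sector between them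
    the Gaussian has modulus at most 1, and the quotient of sines supplies the exponential decay
    because the sector stays inside the right half-plane. *)
Lemma JS_integral (P a : R) (t : C) : Rabs (P - a) < P -> 0 < Re t ->
  is_CI_inf (JS_integrand P a t) (Csqrt (- Ci * t) * ray_int (P - a) P (Csqrt (- Ci * t)))%C.
Proof.
  intros Hb Ht. set (b := P - a) in *. pose proof (Rabs_pos b) as Hb0. pose proof PI_RGT_0 as HPI.
  assert (Ht0 : t <> 0) by (now apply Re_pos_neq_0).
  assert (Hsl : slit (- Ci * t)%C) by (left; destruct t; simpl in *; lra).
  set (s := Csqrt (- Ci * t)).
  assert (Hs : 0 < Re s) by (now apply Csqrt_Re_pos).
  assert (Ess : (s * s)%C = (- Ci * t)%C) by (now apply Csqrt_sqr).
  assert (Hsi : Im s < 0).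
  { apply (f_equal Im) in Ess. destruct s as [x y], t as [u v]; simpl in *. nra. }
  set (rho := Cmod s). set (be := atan (Im s / Re s)).
  assert (Hs0 : s <> 0) by (now apply Re_pos_neq_0).
  assert (Hrho : 0 < rho) by (now apply Cmod_gt_0).
  assert (Epol : s = polar rho be) by (now apply polar_right).
  assert (Hbe : - PI / 2 < be < 0).
  { split; [apply atan_bound|]. unfold be. rewrite <- atan_0. apply atan_increasing.
    apply Rmult_lt_reg_r with (Re s); auto. unfold Rdiv. rewrite Rmult_assoc, Rinv_l; lra. }
  set (f := fun u : C => (Cexp (- (RtoC P * (u * u) / t)) * Phi_ext b P u)%C).
  assert (Hcos : forall th, be <= th <= 0 -> 0 < cos be <= cos th) by (intros; apply cos_pos_bound; lra).
  set (K := / cos be).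
  assert (HK : 0 <= K).
  { left; apply Rinv_0_lt_compat. apply (Hcos be). lra. }
  (* With [t = i s^2] the exponent equals [i (P r^2 / rho^2) exp (2 i (th - be))]. Its real part is
     [- (P r^2 / rho^2) sin (2 (th - be))], which is not positive since the angle lies between 0 and
     [PI]. *)
  assert (Hexp : forall r th, be <= th <= 0 -> Cmod (Cexp (- (RtoC P * (polar r th * polar r th) / t))) <= 1).
  { intros r th Hth. rewrite Cmod_Cexp. rewrite <- exp_0. apply exp_le.
    replace t with (Ci * (s * s))%C
      by (rewrite Ess; apply injective_projections; simpl; ring).
    rewrite Epol.
    set (g := sin (2 * (th - be))).
    assert (Hg : 0 <= g) by (apply sin_ge_0; lra).
    assert (E : (- (RtoC P * (polar r th * polar r th) / (Ci * (polar rho be * polar rho be))))%C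
       = (RtoC (P * r ^ 2 / rho ^ 2) * (Ci * cis (2 * (th - be))))%C).
    { assert (Hcb : cis be <> 0) by apply cis_neq_0.
      assert (Hrc : RtoC rho <> 0) by (apply RtoC_neq_0; lra).
      replace (cis (2 * (th - be))) with (cis th * cis th / (cis be * cis be))%C.
      - unfold polar. rewrite RtoC_div, RtoC_mult, !RtoC_pow by (apply pow_nonzero; lra).
        replace (Ci * (cis th * cis th / (cis be * cis be)))%C
          with (- (cis th * cis th / (Ci * (cis be * cis be))))%C.
        + field. repeat split; auto using Ci_nz.
        + replace (- (cis th * cis th / (Ci * (cis be * cis be))))%C
            with (- / Ci * (cis th * cis th / (cis be * cis be)))%C by (field; auto using Ci_nz).
          rewrite Ci_inv. ring.
      - replace (2 * (th - be)) with ((th + th) + (- be + - be)) by ring.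
        rewrite !cis_plus, cis_opp. field. auto. }
    rewrite E, Re_scal.
    replace (Re (Ci * cis (2 * (th - be)))) with (- g)
      by (unfold g; rewrite cis_pair; simpl; ring).
    assert (0 <= P * r ^ 2 / rho ^ 2).
    { apply Rmult_le_pos; [apply Rmult_le_pos; [lra|apply pow2_ge_0]|]. left; apply Rinv_0_lt_compat, pow_lt; auto. }
    nra. }
  assert (Hbd : forall r th, 0 <= r -> be <= th <= 0 ->
     Cmod (f (polar r th)) <= (1 + K) * exp (- ((P - Rabs b) * cos be) * r)).
  { intros r th Hr Hth. unfold f. rewrite Cmod_mult. destruct (Hcos th Hth) as [Hc1 Hc2].
    apply Rle_trans with (1 * ((1 + K) * exp (- (P - Rabs b) * Re (polar r th)))).
    - apply Rmult_le_compat; auto using Cmod_ge_0. apply Phi_ext_bound; auto.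
      + rewrite polar_pair; simpl. destruct Hr as [Hr|<-]; [left; nra|right].
        apply injective_projections; simpl; ring.
      + rewrite polar_pair; simpl. rewrite Rabs_mult, (Rabs_pos_eq r) by auto.
        assert (Rabs (sin th) <= 1) by (apply Rabs_le, SIN_bound).
        assert (1 <= K * cos th).
        { unfold K. apply Rmult_le_reg_l with (cos be); auto. rewrite <- Rmult_assoc, Rinv_r by lra. lra. }
        nra.
    - rewrite Rmult_1_l. apply Rmult_le_compat_l; [lra|]. apply exp_le. rewrite polar_pair; simpl.
      assert (cos be * r <= r * cos th) by nra. nra. }
  assert (Hchol : forall r th, 0 < r -> be <= th <= 0 -> chol f (polar r th)).
  { intros r th Hr Hth. unfold f. apply chol_mult.
    - apply chol_Cexp, chol_opp, chol_div; auto using chol_const.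
      repeat apply chol_mult; auto using chol_const, chol_id.
    - apply chol_Phi_ext; [lra|]. rewrite polar_pair; simpl. destruct (Hcos th Hth). nra. }
  assert (Hc0 : ccont f 0).
  { unfold f. apply ccont_mult; [|apply ccont_Phi_ext_0; lra]. apply chol_ccont, chol_Cexp, chol_opp, chol_div; auto using chol_const.
    repeat apply chol_mult; auto using chol_const, chol_id. }
  assert (Hd : 0 < (P - Rabs b) * cos be) by (apply Rmult_lt_0_compat; [lra|apply (Hcos be); lra]).
  destruct (is_CI_inf_exists (ray f 0) (1 + K) ((P - Rabs b) * cos be)) as [l Hl]; auto; [lra| | |].
  { intros N HN. apply ex_CI_rcont; auto. intros x Hx. apply rcont_ray.
    destruct (proj1 Hx) as [Hx0|<-]; [apply chol_ccont, Hchol; lra|].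
    replace (polar 0 0) with (RtoC 0) by (unfold polar; ring). auto. }
  { intros x Hx. unfold ray. rewrite Cmod_mult, Cmod_cis, Rmult_1_r. apply Hbd; lra. }
  assert (Hray : is_CI_inf (ray f be) (s * ray_int b P s)%C).
  { pose proof (is_CI_inf_scal _ s _ (ray_int_correct b P s Hb Hs)) as Q.
    apply (is_CI_inf_scale _ (/ rho)) in Q; [|now apply Rinv_0_lt_compat].
    revert Q. apply is_CI_inf_ext. intros r Hr. unfold ray, ray_kernel, f.
    assert (Ey : (s * RtoC (/ rho * r)%R)%C = polar r be).
    { rewrite Epol. unfold polar. rewrite RtoC_mult, RtoC_inv by lra. field. apply RtoC_neq_0; lra. }
    assert (Es : (RtoC (/ rho) * s)%C = cis be).
    { rewrite Epol. unfold polar. rewrite RtoC_inv by lra. field. apply RtoC_neq_0; lra. }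
    assert (Earg : (Ci * RtoC (P * (/ rho * r) ^ 2))%C = (- (RtoC P * (polar r be * polar r be) / t))%C).
    { rewrite <- Ey.
      replace (s * RtoC (/ rho * r)%R * (s * RtoC (/ rho * r)%R))%C with (s * s * RtoC ((/ rho * r) ^ 2))%C
        by (rewrite RtoC_pow; simpl; ring).
      rewrite Ess, RtoC_mult. field. auto. }
    rewrite Ey, Earg, <- Es. ring. }
  assert (El : l = (s * ray_int b P s)%C).
  { symmetry. apply (rotate_ray f be 0 (1 + K) ((P - Rabs b) * cos be)); auto; lra. }
  rewrite <- El. revert Hl. apply is_CI_inf_ext. intros r Hr. unfold ray, f, JS_integrand.
  assert (E0 : polar r 0 = RtoC r) by (rewrite polar_pair, cos_0, sin_0; apply injective_projections; simpl; ring).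
  rewrite E0, Phi_ext_Phi by (apply Re_pos_neq_0; simpl; lra).
  unfold Phi. rewrite <- !RtoC_mult, !Csinh_RtoC. rewrite cis_0.
  assert (Hsh : sinh (P * r) <> 0) by (apply Rgt_not_eq, sinh_pos; nra).
  fold b. rewrite RtoC_div by auto.
  replace (RtoC P * RtoC (r * r)%R)%C with (RtoC (P * r ^ 2)) by (rewrite <- RtoC_mult; f_equal; ring).
  rewrite Cmult_1_r. replace (P * (r * r)) with (P * r ^ 2) by ring. reflexivity.
Qed.

Lemma JS_rotate (P a : R) (t : C) : Rabs (P - a) < P -> 0 < Re t ->
  JS P a t = (/ t * (Csqrt (- Ci * t) * ray_int (P - a) P (Csqrt (- Ci * t))))%C.
Proof. intros Hb Ht. unfold JS. f_equal. apply is_CI_inf_RInt_gen, JS_integral; auto. Qed.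

(** As [s^2 = - i t], the root of [k t] is [sqrt k * cis (PI / 4) * s], and the factor [s / t] of
    the rotated integral turns it into the constant [sqrt k * cis (- (PI / 4))]. Hence the product
    continues holomorphically wherever [s] stays in the right half-plane. *)
Lemma Csqrt_JS (P a k : R) (t : C) : 0 < k -> Rabs (P - a) < P -> 0 < Re t ->
  (Csqrt (RtoC k * t) * JS P a t)%C
  = (RtoC (sqrt k) * cis (- (PI / 4)) * ray_int (P - a) P (Csqrt (- Ci * t)))%C.
Proof.
  intros Hk Hb Ht. rewrite JS_rotate by auto.
  assert (Ht0 : t <> 0) by (now apply Re_pos_neq_0).
  assert (Hsl : slit (- Ci * t)%C) by (left; destruct t; simpl in *; lra).
  set (s := Csqrt (- Ci * t)).
  assert (Hs : 0 < Re s) by (now apply Csqrt_Re_pos).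
  assert (Ess : (s * s)%C = (- Ci * t)%C) by (now apply Csqrt_sqr).
  assert (Hsi : Im s < 0).
  { apply (f_equal Im) in Ess. destruct s as [x y], t as [u v]; simpl in *. nra. }
  assert (Hsq : (RtoC (sqrt k) * RtoC (sqrt k))%C = RtoC k) by (rewrite <- RtoC_mult, sqrt_sqrt by lra; reflexivity).
  rewrite (Csqrt_unique (RtoC (sqrt k) * (cis (PI / 4) * s))%C (RtoC k * t)%C).
  - set (G := ray_int (P - a) P s).
    replace (RtoC (sqrt k) * (cis (PI / 4) * s) * (/ t * (s * G)))%C
      with (RtoC (sqrt k) * cis (PI / 4) * ((s * s) / t) * G)%C by (field; auto).
    rewrite Ess. replace (- Ci * t / t)%C with (- Ci)%C by (field; auto).
    replace (RtoC (sqrt k) * cis (PI / 4) * - Ci * G)%C with (RtoC (sqrt k) * (cis (PI / 4) * - Ci) * G)%C by ring.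
    do 2 f_equal. 
    replace (- Ci)%C with (/ Ci)%C by apply Ci_inv. rewrite <- cis_pi4_sqr.
    rewrite <- (Cmult_1_l (cis (- (PI / 4)))).
    replace (RtoC 1 * cis (- (PI / 4)))%C with (/ cis (PI / 4) * (cis (PI / 4) * cis (- (PI / 4))))%C
      by (field; apply cis_neq_0).
    rewrite cis_pi4_inv. field. apply cis_neq_0.
  - rewrite Re_scal. apply Rmult_lt_0_compat; [now apply sqrt_lt_R0|].
    rewrite cis_pair, cos_PI4, sin_PI4. destruct s as [x y]; simpl in *.
    assert (0 < 1 / sqrt 2) by (apply Rdiv_lt_0_compat; [lra|apply sqrt_lt_R0; lra]). nra.
  - replace (RtoC (sqrt k) * (cis (PI / 4) * s) * (RtoC (sqrt k) * (cis (PI / 4) * s)))%C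
      with ((RtoC (sqrt k) * RtoC (sqrt k)) * ((cis (PI / 4) * cis (PI / 4)) * (s * s)))%C by ring.
    rewrite Hsq, cis_pi4_sqr, Ess. f_equal. apply injective_projections; simpl; ring.
Qed.

(** * The imaginary part: residues *)

Definition Ccosh (z : C) : C := ((Cexp z + Cexp (- z)) / 2)%C.

Lemma cdiff_Csinh z : cdiff Csinh z (Ccosh z).
Proof.
  assert (H1 : cdiff (fun w => - w)%C z (- (1))%C).
  { pose proof (cdiff_mult _ _ _ _ _ (cdiff_const (- (1))%C z) (cdiff_id z)) as Q. cbv beta in Q.
    replace (0 * z + - (1) * 1)%C with (- (1))%C in Q by ring. revert Q.
    apply (cdiff_ext_loc _ _ _ _ 1); [lra|]. intros; ring. }
  pose proof (cdiff_comp Cexp (fun w => - w)%C z _ _ H1 (cdiff_Cexp _)) as H2.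
  pose proof (cdiff_plus _ _ _ _ _ (cdiff_Cexp z) (cdiff_mult _ _ _ _ _ (cdiff_const (- (1))%C z) H2)) as H3.
  pose proof (cdiff_mult _ _ _ _ _ H3 (cdiff_const (/ 2)%C z)) as H4. cbv beta in H4.
  match type of H4 with cdiff _ _ ?l => replace l with (Ccosh z) in H4 end.
  - revert H4. apply (cdiff_ext_loc _ _ _ _ 1); [lra|]. intros w _. unfold Csinh, Cdiv. ring.
  - unfold Ccosh, Cdiv. ring.
Qed.

Lemma Csinh_Ci x : Csinh (Ci * RtoC x) = (Ci * RtoC (sin x))%C.
Proof.
  replace (Ci * RtoC x)%C with (0, x) by (apply injective_projections; simpl; ring).
  rewrite Csinh_pair, sinh_0, cosh_0. apply injective_projections; simpl; ring.
Qed.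

Lemma Ccosh_Ci x : Ccosh (Ci * RtoC x) = RtoC (cos x).
Proof.
  unfold Ccosh, Cexp. apply injective_projections; simpl.
  - replace (0 * x - 1 * 0) with 0 by ring. rewrite Ropp_0, exp_0.
    replace (0 * 0 + 1 * x) with x by ring. rewrite cos_neg, sin_neg. field.
  - replace (0 * x - 1 * 0) with 0 by ring. rewrite Ropp_0, exp_0.
    replace (0 * 0 + 1 * x) with x by ring. rewrite cos_neg, sin_neg. field.
Qed.

(* The integrand in the variable [v = - i u], with [s = P / T]. *)
Definition gauss_kernel (b P s : R) (v : C) : C := (Cexp (- (RtoC s * (v * v))) * Phi_ext b P (Ci * v))%C.

Lemma chol_sinh_slope b (u : C) : u <> 0 -> chol (sinh_slope b) u.
Proof.
  intros Hu. apply (chol_ext_loc (fun u => Csinh (RtoC b * u) / u)%C _ _ (Cmod u)).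
  - now apply Cmod_gt_0.
  - intros w Hw. unfold sinh_slope. destruct (excluded_middle_informative (w = 0)) as [->|]; auto.
    exfalso. replace (0 - u)%C with (- u)%C in Hw by ring. rewrite Cmod_opp in Hw. lra.
  - apply chol_div; auto using chol_id. apply chol_Csinh, chol_scal_id.
Qed.

Lemma chol_gauss_kernel b P s (v : C) : v <> 0 -> Csinh (RtoC P * (Ci * v)) <> 0 -> chol (gauss_kernel b P s) v.
Proof.
  intros Hv Hs. assert (Hiv : (Ci * v)%C <> 0) by (apply Cmult_neq_0; auto using Ci_nz).
  unfold gauss_kernel. apply chol_mult.
  - apply chol_Cexp, chol_opp. repeat apply chol_mult; auto using chol_const, chol_id.
  - apply (chol_comp (Phi_ext b P) (fun v => Ci * v)%C); [apply chol_scal_id|].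
    unfold Phi_ext. apply chol_mult; [now apply chol_sinh_slope|]. apply chol_inv; [now apply chol_sinh_slope|].
    unfold sinh_slope. destruct (excluded_middle_informative (Ci * v = 0)%C); [tauto|].
    intros E. apply Hs. replace (Csinh (RtoC P * (Ci * v))) with (Csinh (RtoC P * (Ci * v)) / (Ci * v) * (Ci * v))%C.
    + rewrite E. ring.
    + field. split; auto using Ci_nz.
Qed.

Lemma Cmod_Cexp_gauss s r t : Cmod (Cexp (- (RtoC s * (polar r t * polar r t)))) = exp (- s * r ^ 2 * cos (2 * t)).
Proof.
  rewrite Cmod_Cexp. f_equal. rewrite polar_pair, cos_2a. simpl. ring.
Qed.

Lemma polar_Ci r t : (Ci * polar r t)%C = (- (r * sin t), r * cos t).
Proof. rewrite polar_pair. apply injective_projections; simpl; ring. Qed.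

(** [Csinh] vanishes only on the imaginary axis, so in the variable [v] the zeros of the denominator
    are real, at multiples of [PI / P]. *)
Lemma Csinh_polar_neq_0 P r t : 0 < P -> 0 < r -> sin t <> 0 \/ sin (P * r) <> 0 -> Rabs t <= PI / 4 ->
  Csinh (RtoC P * (Ci * polar r t)) <> 0.
Proof.
  intros HP Hr H Ht. destruct (Req_dec (sin t) 0) as [E|E].
  - destruct H as [H|H]; [tauto|]. intros Z. apply H.
    assert (Et : t = 0).
    { apply Rabs_le_between in Ht. pose proof PI_RGT_0.
      destruct (Rtotal_order t 0) as [L|[L|L]]; auto.
      - pose proof (sin_gt_0 (- t) ltac:(lra) ltac:(lra)) as Q. rewrite sin_neg in Q. lra.
      - pose proof (sin_gt_0 t ltac:(lra) ltac:(lra)). lra. }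
    subst t. rewrite polar_Ci, sin_0, cos_0 in Z.
    replace (RtoC P * ((- (r * 0))%R, (r * 1)%R))%C with (Ci * RtoC (P * r))%C in Z by (apply injective_projections; simpl; ring).
    rewrite Csinh_Ci in Z. apply Cmult_eq_0 in Z. destruct Z as [Z|Z]; [exfalso; revert Z; apply Ci_nz|].
    now apply (f_equal Re) in Z.
  - apply Csinh_neq_0. rewrite Re_scal, polar_Ci. simpl. intros Z.
    apply Rmult_integral in Z. destruct Z as [Z|Z]; [lra|].
    assert (Z' : r * sin t = 0) by lra. apply Rmult_integral in Z'. destruct Z'; lra.
Qed.

Lemma Csinh_conj z : Csinh (Cconj z) = Cconj (Csinh z).
Proof.
  destruct z as [x y]. unfold Cconj at 1. simpl fst. simpl snd. rewrite !Csinh_pair, cos_neg, sin_neg.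
  apply injective_projections; simpl; ring.
Qed.

Lemma Csinh_opp z : Csinh (- z) = (- Csinh z)%C.
Proof. unfold Csinh, Cdiv. replace (- - z)%C with z by ring. ring. Qed.

Lemma Cexp_conj z : Cexp (Cconj z) = Cconj (Cexp z).
Proof. destruct z as [x y]. apply injective_projections; unfold Cexp, Cconj, Re, Im; simpl; rewrite ?cos_neg, ?sin_neg; ring. Qed.

Lemma polar_conj r t : polar r (- t) = Cconj (polar r t).
Proof. rewrite !polar_pair, cos_neg, sin_neg. apply injective_projections; simpl; ring. Qed.

Lemma RtoC_conj x : Cconj (RtoC x) = RtoC x.
Proof. apply injective_projections; simpl; ring. Qed.

Lemma Phi_opp_conj b P u : Csinh (RtoC P * u) <> 0 -> Phi b P (- Cconj u) = Cconj (Phi b P u).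
Proof.
  intros H. unfold Phi. rewrite Cdiv_conj by auto. rewrite <- !Csinh_conj, !Cmult_conj, !RtoC_conj.
  assert (H2 : Csinh (RtoC P * Cconj u) <> 0).
  { rewrite <- (RtoC_conj P), <- Cmult_conj, Csinh_conj. intros E. apply H.
    rewrite <- (Cconj_conj (Csinh _)), E. apply RtoC_conj. }
  replace (RtoC b * - Cconj u)%C with (- (RtoC b * Cconj u))%C by ring.
  replace (RtoC P * - Cconj u)%C with (- (RtoC P * Cconj u))%C by ring.
  rewrite !Csinh_opp. field. auto.
Qed.

Lemma polar_neq_0 r t : 0 < r -> polar r t <> 0.
Proof. intros H. apply Cmod_gt_0. rewrite Cmod_polar; lra. Qed.

(** Since [i * Cconj v = - Cconj (i * v)], and [Phi b P] is even with real coefficients, conjugate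
    rays carry conjugate integrands. *)
Lemma ray_gauss_kernel_conj b P s r : 0 < P -> 0 < r ->
  ray (gauss_kernel b P s) (PI / 4) r = Cconj (ray (gauss_kernel b P s) (- (PI / 4)) r).
Proof.
  intros HP Hr. unfold ray, gauss_kernel. rewrite !Cmult_conj. pose proof PI_RGT_0.
  assert (Hs4 : sin (PI / 4) <> 0) by (apply Rgt_not_eq, sin_gt_0; lra).
  assert (E1 : polar r (PI / 4) = Cconj (polar r (- (PI / 4)))) by (rewrite polar_conj, Cconj_conj; auto).
  f_equal; [f_equal|].
  - rewrite <- Cexp_conj. f_equal. rewrite Copp_conj, !Cmult_conj, RtoC_conj, <- E1. ring.
  - assert (Hne : forall t, (Ci * polar r t)%C <> 0) by (intros; apply Cmult_neq_0; auto using Ci_nz, polar_neq_0).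
    rewrite !Phi_ext_Phi by auto. rewrite <- Phi_opp_conj.
    + f_equal. rewrite Cmult_conj, <- E1. replace (Cconj Ci) with (- Ci)%C by (apply injective_projections; simpl; ring). ring.
    + apply Csinh_polar_neq_0; auto.
      * left. rewrite sin_neg. lra.
      * rewrite Rabs_Ropp, Rabs_pos_eq; lra.
  - rewrite !cis_pair, cos_neg, sin_neg. apply injective_projections; simpl; ring.
Qed.

Definition pole (P : R) (m : nat) : R := PI * INR m / P.
(** The residue of [exp (- s v^2) sin (b v) / sin (P v)] at [v = pole P m]. *)
Definition residue_at (b P s : R) (m : nat) : R :=
  sin (b * pole P m) * exp (- s * pole P m ^ 2) / (P * cos (P * pole P m)).

Lemma P_pole P m : 0 < P -> P * pole P m = INR m * PI.
Proof. intros. unfold pole. field. lra. Qed.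

Lemma cos_nat_PI m : cos (INR m * PI) = (-1) ^ m /\ sin (INR m * PI) = 0.
Proof.
  induction m as [|m [IH1 IH2]].
  - simpl. rewrite Rmult_0_l, cos_0, sin_0. auto.
  - rewrite S_INR. replace ((INR m + 1) * PI) with (INR m * PI + PI) by ring.
    rewrite neg_cos, neg_sin, IH1, IH2. simpl. split; ring.
Qed.

Lemma pow_m1_sqr m : (-1) ^ m * (-1) ^ m = 1.
Proof. rewrite <- Rpow_mult_distr. replace (-1 * -1) with 1 by ring. apply pow1. Qed.

Lemma sin_neq_0_between x m : (INR m - 1) * PI < x < (INR m + 1) * PI -> x <> INR m * PI -> sin x <> 0.
Proof.
  intros Hx Hne E. apply sin_eq_0_0 in E. destruct E as [k ->]. pose proof PI_RGT_0.
  assert (H1 : INR m - 1 < IZR k < INR m + 1) by (split; apply Rmult_lt_reg_r with PI; lra).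
  rewrite INR_IZR_INZ in *. rewrite <- minus_IZR, <- plus_IZR in H1.
  destruct H1 as [H1 H2]. apply lt_IZR in H1, H2. apply Hne. do 2 f_equal. lia.
Qed.

(** Poles are [PI / P] apart, so the conditions on [exp A] and [exp B] separate [pole P m] from both
    neighbours. *)
Lemma rect_int_one_pole b P s m A B : 0 < P -> (0 < m)%nat -> A < B ->
  pole P m - PI / P < exp A -> exp A < pole P m -> pole P m < exp B -> exp B < pole P m + PI / P ->
  rect_int (log_form (gauss_kernel b P s)) A B (- (PI / 4)) (PI / 4) = (RtoC (2 * PI) * Ci * RtoC (residue_at b P s m))%C.
Proof.
  intros HP Hm HAB H1 H2 H3 H4. pose proof PI_RGT_0 as HPI.
  assert (Hp : 0 < pole P m).
  { unfold pole. apply Rdiv_lt_0_compat; auto. apply Rmult_lt_0_compat; auto. now apply lt_0_INR. }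
  assert (El : exp (ln (pole P m)) = pole P m) by now apply exp_ln.
  destruct (cos_nat_PI m) as [Ec Es]. pose proof (pow_m1_sqr m) as E1.
  set (w0 := (ln (pole P m), 0) : C).
  assert (Ew0 : Cexp w0 = RtoC (pole P m)).
  { unfold w0. rewrite Cexp_polar, El, polar_pair, cos_0, sin_0. apply injective_projections; simpl; ring. }
  apply residue_rect with (w0 := w0); simpl.
  - split; [rewrite <- (ln_exp A)|rewrite <- (ln_exp B)]; apply ln_increasing; auto using exp_pos.
  - lra.
  - intros [x y] [W1 W2] Hne. simpl in W1, W2. unfold log_form.
    assert (HE : chol Cexp (x, y)) by (eexists; apply cdiff_Cexp).
    apply chol_mult; auto. apply (chol_comp (gauss_kernel b P s) Cexp); auto.
    rewrite Cexp_polar. apply chol_gauss_kernel; [apply polar_neq_0, exp_pos|].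
    apply Csinh_polar_neq_0; auto using exp_pos; [|apply Rabs_le; lra].
    destruct (Req_dec (sin y) 0) as [E|E]; auto. right.
    assert (Ey : y = 0).
    { destruct (Rtotal_order y 0) as [L|[L|L]]; auto.
      - pose proof (sin_gt_0 (- y) ltac:(lra) ltac:(lra)) as Q. rewrite sin_neg in Q. lra.
      - pose proof (sin_gt_0 y ltac:(lra) ltac:(lra)). lra. }
    subst y. apply (sin_neq_0_between _ m).
    + pose proof (exp_le A x ltac:(lra)). pose proof (exp_le x B ltac:(lra)).
      rewrite Rmult_minus_distr_r, Rmult_plus_distr_r, <- (P_pole P m HP), Rmult_1_l.
      assert (EP : P * (PI / P) = PI) by (field; lra). split; nra.
    + rewrite <- (P_pole P m HP). intros Z. apply Rmult_eq_reg_l in Z; [|lra].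
      apply Hne. unfold w0. f_equal. rewrite <- Z, ln_exp. auto.
  - intros e He.
    (* The factor [Cexp w] of [log_form] is put into [N]; the chain rule produces the same factor in
       the derivative of [D]. They cancel, so the residue in [w] is the residue in [v]. *)
    set (N := fun w => (Cexp (- (RtoC s * (Cexp w * Cexp w))) * Csinh (RtoC b * (Ci * Cexp w)) * Cexp w)%C).
    set (D := fun w => Csinh (RtoC P * (Ci * Cexp w))).
    assert (HE : forall w, chol Cexp w) by (intros; eexists; apply cdiff_Cexp).
    assert (Dw0 : (RtoC P * (Ci * Cexp w0))%C = (Ci * RtoC (INR m * PI))%C).
    { rewrite Ew0, <- (P_pole P m HP), RtoC_mult. ring. }
    destruct (residue_quotient N D w0 (Cexp w0 * (RtoC P * Ci) * Ccosh (Ci * RtoC (INR m * PI)))%C) with (e := e) as [d [Hd J]]; auto.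
    + apply chol_ccont. unfold N. apply chol_mult; auto. apply chol_mult.
      * apply chol_Cexp, chol_opp, chol_mult; [apply chol_const|]. now apply chol_mult.
      * apply chol_Csinh, chol_mult; [apply chol_const|]. apply chol_mult; auto using chol_const.
    + unfold D.
      assert (Q : cdiff (fun w => RtoC P * (Ci * Cexp w))%C w0 (Cexp w0 * (RtoC P * Ci))%C).
      { pose proof (cdiff_mult _ _ _ _ _ (cdiff_const (RtoC P * Ci)%C w0) (cdiff_Cexp w0)) as Q. cbv beta in Q.
        replace (0 * Cexp w0 + RtoC P * Ci * Cexp w0)%C with (Cexp w0 * (RtoC P * Ci))%C in Q by ring.
        revert Q. apply (cdiff_ext_loc _ _ _ _ 1); [lra|]. intros; ring. }
      rewrite <- Dw0. apply (cdiff_comp Csinh (fun w => RtoC P * (Ci * Cexp w))%C); auto. apply cdiff_Csinh.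
    + unfold D. rewrite Dw0, Csinh_Ci, Es. ring.
    + rewrite Ccosh_Ci, Ec. repeat apply Cmult_neq_0; auto using Cexp_neq_0, Ci_nz; apply RtoC_neq_0; nra.
    + exists d; split; auto. intros w Hne Hw. specialize (J w Hne Hw).
      replace (log_form (gauss_kernel b P s) w) with (N w / D w)%C.
      * replace (RtoC (residue_at b P s m)) with (N w0 / (Cexp w0 * (RtoC P * Ci) * Ccosh (Ci * RtoC (INR m * PI))))%C; auto.
        unfold N, residue_at. rewrite Ccosh_Ci, Ew0, (P_pole P m HP), Ec.
        replace (RtoC b * (Ci * RtoC (pole P m)))%C with (Ci * RtoC (b * pole P m))%C by (rewrite RtoC_mult; ring).
        rewrite Csinh_Ci.
        replace (Cexp (- (RtoC s * (RtoC (pole P m) * RtoC (pole P m))))) with (RtoC (exp (- s * pole P m ^ 2))).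
        -- assert (Hpm : (-1) ^ m <> 0) by nra.
           rewrite RtoC_div, !RtoC_mult by nra. field.
           repeat split; auto using Ci_nz; apply RtoC_neq_0; lra.
        -- rewrite <- !RtoC_mult, <- RtoC_opp. unfold Cexp. simpl. rewrite cos_0, sin_0.
           replace (- (s * (pole P m * pole P m))) with (- s * (pole P m * (pole P m * 1))) by ring.
           apply injective_projections; simpl; ring.
      * unfold log_form, gauss_kernel, N, D. rewrite Phi_ext_Phi by (apply Cmult_neq_0; auto using Ci_nz, Cexp_neq_0).
        unfold Phi, Cdiv. ring.
Qed.

Fixpoint Rsum (u : nat -> R) (n : nat) : R :=
  match n with O => 0 | S n => Rsum u n + u n end.

(** The outer radius lies halfway between the poles [n + 1] and [n + 2], the inner one below the
    first pole, and the induction adds a sector with one pole at a time. Indices are shifted by [S]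
    because the singularity at [m = 0] is removable. *)
Lemma rect_int_poles b P s a n : 0 < P -> exp a <= PI / (2 * P) ->
  rect_int (log_form (gauss_kernel b P s)) a (ln (PI * (INR n + 3 / 2) / P)) (- (PI / 4)) (PI / 4)
  = (RtoC (2 * PI) * Ci * RtoC (Rsum (fun m => residue_at b P s (S m)) (S n)))%C.
Proof.
  intros HP Ha. pose proof PI_RGT_0 as HPI.
  assert (HPP : 0 < PI / P) by (apply Rdiv_lt_0_compat; auto).
  assert (Epi : PI / (2 * P) = PI / P / 2) by (field; lra).
  assert (Er : forall k : R, PI * k / P = k * (PI / P)) by (intros; field; lra).
  assert (Hpos : forall n : nat, 0 < PI * (INR n + 3 / 2) / P).
  { intros k. rewrite Er. pose proof (pos_INR k). apply Rmult_lt_0_compat; lra. }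
  induction n as [|n IH].
  - rewrite (rect_int_one_pole b P s 1); auto.
    + simpl. do 2 f_equal. ring.
    + rewrite <- (ln_exp a). apply ln_increasing; [apply exp_pos|]. rewrite Er. simpl. lra.
    + unfold pole. rewrite Er. simpl. pose proof (exp_pos a). lra.
    + unfold pole. rewrite Er. simpl. lra.
    + rewrite exp_ln by auto. unfold pole. rewrite !Er. simpl. lra.
    + rewrite exp_ln by auto. unfold pole. rewrite !Er. simpl. lra.
  - assert (Hlt : ln (PI * (INR n + 3 / 2) / P) < ln (PI * (INR (S n) + 3 / 2) / P)).
    { apply ln_increasing; auto. rewrite !Er, S_INR. lra. }
    assert (Hla : a < ln (PI * (INR n + 3 / 2) / P)).
    { rewrite <- (ln_exp a). apply ln_increasing; [apply exp_pos|]. rewrite Er. pose proof (pos_INR n). nra. }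
    assert (Hcc : forall x t, t = PI / 4 \/ t = - (PI / 4) -> ccont (log_form (gauss_kernel b P s)) (x, t)).
    { intros x t Ht. apply chol_ccont. unfold log_form. assert (HE : chol Cexp (x, t)) by (eexists; apply cdiff_Cexp).
      apply chol_mult; auto. apply (chol_comp (gauss_kernel b P s) Cexp); auto. rewrite Cexp_polar.
      apply chol_gauss_kernel; [apply polar_neq_0, exp_pos|]. apply Csinh_polar_neq_0; auto using exp_pos.
      - left. pose proof (sin_gt_0 (PI / 4) ltac:(lra) ltac:(lra)).
        destruct Ht as [->| ->]; rewrite ?sin_neg; lra.
      - apply Rabs_le. lra. }
    rewrite (rect_int_split_x _ _ (ln (PI * (INR n + 3 / 2) / P))); auto; try lra.
    rewrite IH. rewrite (rect_int_one_pole b P s (S (S n))); auto; try lia.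
    + change (Rsum (fun m => residue_at b P s (S m)) (S (S n))) with (Rsum (fun m => residue_at b P s (S m)) (S n) + residue_at b P s (S (S n))).
      rewrite RtoC_plus. ring.
    + rewrite exp_ln by auto. unfold pole. rewrite !Er, !S_INR. lra.
    + rewrite exp_ln by auto. unfold pole. rewrite !Er, !S_INR. lra.
    + rewrite exp_ln by auto. unfold pole. rewrite !Er, !S_INR. lra.
    + rewrite exp_ln by auto. unfold pole. rewrite !Er, !S_INR. lra.
Qed.

(** Radii halfway between consecutive poles, where [|sin (P r)| = 1]. *)
Definition arc (P : R) (n : nat) : R := PI * (INR n + 3 / 2) / P.

Lemma sinh_plus_1_le x : sinh x + 1 <= exp x.
Proof.
  unfold sinh. assert (exp x * exp (- x) = 1) by (rewrite <- exp_plus, Rplus_opp_r, exp_0; auto).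
  pose proof (exp_pos x). pose proof (exp_pos (- x)).
  pose proof (Rle_0_sqr (exp x - exp (- x))) as Q. unfold Rsqr in Q.
  apply Rnot_lt_le. intros Hlt. nra.
Qed.

Lemma sin_arc_bound A Y n : A = INR n * PI + PI / 2 -> 0 <= A - Y <= PI / 4 -> 1 / 2 <= Rabs (sin Y).
Proof.
  intros HA HY. replace Y with (INR n * PI + (PI / 2 - (A - Y))) by (rewrite HA at 1; ring).
  rewrite sin_plus. destruct (cos_nat_PI n) as [-> ->]. rewrite sin_shift, Rmult_0_l, Rplus_0_l.
  rewrite Rabs_mult, pow_1_abs, Rmult_1_l. pose proof PI_RGT_0.
  assert (Hc : cos (PI / 4) <= cos (A - Y)) by (apply cos_decr_1; lra).
  rewrite cos_PI4 in Hc.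
  assert (1 / 2 <= 1 / sqrt 2).
  { assert (sqrt 2 <= 2).
    { rewrite <- (sqrt_square 2) at 2 by lra. apply sqrt_le_1_alt. lra. }
    assert (0 < sqrt 2) by (apply sqrt_lt_R0; lra).
    unfold Rdiv. rewrite !Rmult_1_l. apply Rinv_le_contravar; lra. }
  rewrite Rabs_pos_eq; lra.
Qed.

Lemma cos_ge_sin_pi4 t : Rabs t <= PI / 4 -> 0 < cos t /\ Rabs (sin t) <= cos t.
Proof.
  intros Ht. apply Rabs_le_between in Ht. pose proof PI_RGT_0.
  assert (Hc : 0 < cos t) by (apply cos_gt_0; lra). split; auto.
  assert (H2 : 0 <= cos (2 * t)) by (apply cos_ge_0; lra).
  rewrite cos_2a in H2. apply Rsqr_incr_0_var; [|lra]. rewrite <- Rsqr_abs. unfold Rsqr. lra.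
Qed.

(** Both terms of [|sinh|^2 = sinh^2 + sin^2] are needed for a bound uniform in [n]: off the real
    axis the first is large; near it the second is, because the arc crosses the axis halfway between
    two poles. *)
Lemma Phi_arc b P n t : Rabs b < P -> Rabs t <= PI / 4 ->
  Cmod (Phi b P (Ci * polar (arc P n) t)) <= 6 * exp (- (P - Rabs b) * (arc P n * Rabs (sin t))).
Proof.
  intros Hb Ht. pose proof (Rabs_pos b) as Hb0. pose proof PI_RGT_0 as HPI.
  set (r := arc P n). pose proof (pos_INR n) as Hn.
  assert (Hr : 0 < r).
  { unfold r, arc. apply Rdiv_lt_0_compat; [apply Rmult_lt_0_compat|]; lra. }
  set (x := r * Rabs (sin t)). assert (Hx : 0 <= x) by (apply Rmult_le_pos; [lra|apply Rabs_pos]).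
  assert (HA : P * r = INR (S n) * PI + PI / 2) by (unfold r, arc; rewrite S_INR; field; lra).
  destruct (cos_ge_sin_pi4 t Ht) as [Hc Hsc].
  rewrite polar_Ci. set (u := (- (r * sin t), r * cos t) : C).
  assert (Ru : Rabs (Re u) = x).
  { unfold u; simpl. rewrite Rabs_Ropp, Rabs_mult, (Rabs_pos_eq r) by lra. auto. }
  assert (U : Cmod (Csinh (RtoC b * u)) <= exp (Rabs b * x)).
  { eapply Rle_trans; [apply Cmod_Csinh_le|]. rewrite Re_scal, Rabs_sinh, Rabs_mult, Ru.
    eapply Rle_trans; [|apply sinh_plus_1_le]. apply Rplus_le_compat_l. apply Rabs_le, SIN_bound. }
  assert (L : exp (P * x) / 6 <= Cmod (Csinh (RtoC P * u))).
  { pose proof (Cmod2_Csinh (RtoC P * u)) as Q. rewrite Re_scal, Im_scal in Q.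
    (* If [P x >= 1], the hyperbolic term suffices. Otherwise [P r >= 3] and [P r |sin t| < 1] give
       [P r (1 - cos t) <= 1 / 3 < PI / 4], so the sine is at least [1 / 2] while [exp (P x) <= 3];
       their ratio is the constant 6. *)
    destruct (Rle_lt_dec 1 (P * x)) as [H1|H1].
    - eapply Rle_trans; [|apply Cmod_Csinh_ge]. rewrite Re_scal, Rabs_sinh, Rabs_mult, Ru, (Rabs_pos_eq P) by lra.
      unfold sinh. pose proof (exp_ineq1_le (P * x)).
      assert (exp (- (P * x)) <= 1 / 2).
      { rewrite exp_Ropp. unfold Rdiv. rewrite Rmult_1_l. apply Rinv_le_contravar; lra. }
      lra.
    - assert (Hsin : 1 / 2 <= Rabs (sin (P * Im u))).
      { apply (sin_arc_bound (P * r) _ (S n) HA). unfold u; simpl.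
        assert (Hc1 : cos t <= 1) by apply COS_bound.
        pose proof (sin2_cos2 t) as Q1. unfold Rsqr in Q1.
        assert (Hsq : Rabs (sin t) * Rabs (sin t) = sin t * sin t) by (rewrite <- Rabs_mult, Rabs_pos_eq; [auto|apply Rle_0_sqr]).
        assert (HPr0 : 0 <= P * r) by nra.
        assert (D : P * r - P * (r * cos t) <= P * r * (sin t * sin t)).
        { replace (P * r - P * (r * cos t)) with (P * r * (1 - cos t)) by ring. apply Rmult_le_compat_l; auto. nra. }
        assert (D0 : 0 <= P * r - P * (r * cos t)).
        { replace (P * r - P * (r * cos t)) with (P * r * (1 - cos t)) by ring. apply Rmult_le_pos; lra. }
        assert (HPr : 3 <= P * r).
        { rewrite HA. rewrite S_INR. pose proof PI2_1. nra. }
        assert (Hs1 : P * r * Rabs (sin t) < 1) by (unfold x in H1; lra).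
        assert (P * r * (sin t * sin t) <= 1 / 3).
        { rewrite <- Hsq. pose proof (Rabs_pos (sin t)).
          assert (Rabs (sin t) <= 1 / 3) by nra. nra. }
        pose proof PI2_1. split; lra. }
      assert (exp (P * x) <= 3).
      { apply Rle_trans with (exp 1); [apply exp_le; lra|apply exp_le_3]. }
      apply Rle_trans with (1 / 2); [lra|].
      apply Rsqr_incr_0_var; [|apply Cmod_ge_0]. rewrite !Rsqr_pow2, Q.
      pose proof (pow2_ge_0 (sinh (P * Re u))). rewrite <- (pow2_abs (sin (P * Im u))). nra. }
  pose proof (exp_pos (P * x)) as Hep.
  assert (Hne : Csinh (RtoC P * u) <> 0) by (apply Cmod_gt_0; lra).
  unfold Phi. rewrite Cmod_div by auto. 
  apply Rmult_le_reg_r with (Cmod (Csinh (RtoC P * u))); [lra|].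
  unfold Rdiv. rewrite Rmult_assoc, Rinv_l, Rmult_1_r by lra.
  eapply Rle_trans; [exact U|].
  replace (exp (Rabs b * x)) with (6 * exp (- (P - Rabs b) * x) * (exp (P * x) / 6)).
  - apply Rmult_le_compat_l; auto. pose proof (exp_pos (- (P - Rabs b) * x)). lra.
  - replace (6 * exp (- (P - Rabs b) * x) * (exp (P * x) / 6)) with (exp (- (P - Rabs b) * x) * exp (P * x)) by field.
    rewrite <- exp_plus. f_equal. ring.
Qed.

(** Neither factor decays on the whole arc: the Gaussian fails at the ends, where [cos (2 t) = 0],
    and the quotient of sines at [t = 0]. The estimates are exchanged at [|sin t| = 1 / 2], and the
    smaller of the two rates is kept. *)
Lemma gauss_kernel_arc b P s n t : Rabs b < P -> 0 < s -> Rabs t <= PI / 4 ->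
  Cmod (gauss_kernel b P s (polar (arc P n) t)) <= 6 * exp (- Rmin ((P - Rabs b) / 2) (s * arc P 0 / 2) * arc P n).
Proof.
  intros Hb Hs Ht. pose proof (Rabs_pos b) as Hb0. pose proof PI_RGT_0 as HPI.
  assert (Hr0 : 0 < arc P 0) by (unfold arc; simpl; apply Rdiv_lt_0_compat; nra).
  assert (Hr : arc P 0 <= arc P n).
  { unfold arc, Rdiv. apply Rmult_le_compat_r; [left; apply Rinv_0_lt_compat; lra|]. simpl.
    pose proof (pos_INR n). nra. }
  unfold gauss_kernel. rewrite Cmod_mult, Cmod_Cexp_gauss, Phi_ext_Phi
    by (apply Cmult_neq_0; [apply Ci_nz|apply polar_neq_0; lra]).
  pose proof (Phi_arc b P n t Hb Ht) as Q.
  set (r := arc P n) in *. set (q := Rabs (sin t)) in *.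
  assert (Hq : 0 <= q) by apply Rabs_pos.
  assert (Eq : cos (2 * t) = 1 - 2 * (q * q)).
  { rewrite cos_2a_sin. unfold q. rewrite <- Rabs_mult, Rabs_pos_eq by apply Rle_0_sqr. ring. }
  apply Rle_trans with (exp (- s * r ^ 2 * cos (2 * t)) * (6 * exp (- (P - Rabs b) * (r * q)))).
  { apply Rmult_le_compat_l; [left; apply exp_pos|auto]. }
  replace (exp (- s * r ^ 2 * cos (2 * t)) * (6 * exp (- (P - Rabs b) * (r * q))))
    with (6 * (exp (- s * r ^ 2 * cos (2 * t)) * exp (- (P - Rabs b) * (r * q)))) by ring.
  apply Rmult_le_compat_l; [lra|]. rewrite <- exp_plus. apply exp_le.
  pose proof (Rmin_l ((P - Rabs b) / 2) (s * arc P 0 / 2)) as M1.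
  pose proof (Rmin_r ((P - Rabs b) / 2) (s * arc P 0 / 2)) as M2.
  set (d := Rmin ((P - Rabs b) / 2) (s * arc P 0 / 2)) in *.
  destruct (cos_ge_sin_pi4 t Ht) as [Hc Hsc]. fold q in Hsc.
  assert (H2 : 0 <= cos (2 * t)).
  { apply Rabs_le_between in Ht. apply cos_ge_0; lra. }
  assert (Hsr : 0 <= s * r ^ 2) by (apply Rmult_le_pos; [lra|apply pow2_ge_0]).
  destruct (Rle_lt_dec (1 / 2) q) as [Hq2|Hq2].
  - assert (0 <= s * r ^ 2 * cos (2 * t)) by nra.
    assert (d * r <= (P - Rabs b) / 2 * r) by (apply Rmult_le_compat_r; lra).
    assert ((P - Rabs b) / 2 * r <= (P - Rabs b) * (r * q)) by (assert (r / 2 <= r * q) by nra; nra). nra.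
  - assert (1 / 2 <= cos (2 * t)) by nra.
    assert (d * r <= s * arc P 0 / 2 * r) by (apply Rmult_le_compat_r; lra).
    assert (s * arc P 0 / 2 * r <= s * r ^ 2 * (1 / 2)).
    { replace (s * arc P 0 / 2 * r) with ((s * r / 2) * arc P 0) by field.
      replace (s * r ^ 2 * (1 / 2)) with ((s * r / 2) * r) by field. apply Rmult_le_compat_l; nra. }
    assert (s * r ^ 2 * (1 / 2) <= s * r ^ 2 * cos (2 * t)) by (apply Rmult_le_compat_l; auto).
    assert (0 <= (P - Rabs b) * (r * q)) by (apply Rmult_le_pos; [lra|apply Rmult_le_pos; lra]). lra.
Qed.

Lemma ccont_gauss_kernel_0 b P s : 0 < P -> ccont (gauss_kernel b P s) 0.
Proof.
  intros HP. unfold gauss_kernel. apply ccont_mult.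
  - apply chol_ccont, chol_Cexp, chol_opp. repeat apply chol_mult; auto using chol_const, chol_id.
  - apply (ccont_comp (Phi_ext b P) (fun v => Ci * v)%C); [apply chol_ccont, chol_scal_id|].
    rewrite Cmult_0_r. apply ccont_Phi_ext_0; auto.
Qed.

Lemma im_part_limit b P s J : Rabs b < P -> 0 < s ->
  is_CI_inf (ray (gauss_kernel b P s) (- (PI / 4))) J ->
  is_lim_seq (fun n => PI * Rsum (fun m => residue_at b P s (S m)) (S n)) (Im J).
Proof.
  intros Hb Hs HJ. pose proof (Rabs_pos b) as Hb0. pose proof PI_RGT_0 as HPI.
  assert (HP : 0 < P) by lra.
  assert (HJc : is_CI_inf (ray (gauss_kernel b P s) (PI / 4)) (Cconj J)).
  { eapply is_CI_inf_ext; [|apply is_CI_inf_conj, HJ]. intros r Hr. symmetry. apply ray_gauss_kernel_conj; auto. }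
  destruct (ccont_gauss_kernel_0 b P s HP 1 Rlt_0_1) as [dl [Hdl Jdl]].
  set (C0 := Cmod (gauss_kernel b P s 0) + 1).
  assert (HC0 : 0 <= C0) by (unfold C0; pose proof (Cmod_ge_0 (gauss_kernel b P s 0)); lra).
  (* Below [PI / (2 P)] there is no pole, and below [dl] the kernel is bounded by its modulus at 0
     plus 1. *)
  set (r0 := Rmin (dl / 2) (PI / (2 * P))).
  assert (HPP : 0 < PI / (2 * P)) by (apply Rdiv_lt_0_compat; lra).
  assert (Hr0 : 0 < r0) by (apply Rmin_pos; lra).
  assert (Hr01 : r0 <= dl / 2) by apply Rmin_l. assert (Hr02 : r0 <= PI / (2 * P)) by apply Rmin_r.
  assert (Harc0 : forall n, PI / (2 * P) < arc P n).
  { intros n. unfold arc. replace (PI / (2 * P)) with (PI * (1 / 2) / P) by (field; lra).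
    unfold Rdiv. apply Rmult_lt_compat_r; [now apply Rinv_0_lt_compat|]. pose proof (pos_INR n). nra. }
  assert (Hch : forall r t, 0 < r -> Rabs t <= PI / 4 -> sin t <> 0 \/ sin (P * r) <> 0 -> ccont (gauss_kernel b P s) (polar r t)).
  { intros r t Hr Ht Hne. apply chol_ccont, chol_gauss_kernel; [now apply polar_neq_0|]. apply Csinh_polar_neq_0; auto. }
  assert (Hs4 : sin (PI / 4) <> 0) by (apply Rgt_not_eq, sin_gt_0; lra).
  assert (Hab : forall t, - (PI / 4) <= t <= PI / 4 -> Rabs t <= PI / 4) by (intros; apply Rabs_le; lra).
  assert (W : forall e, 0 < e -> exists N, forall n, (N <= n)%nat ->
    Cmod (RtoC (2 * PI) * Ci * RtoC (Rsum (fun m => residue_at b P s (S m)) (S n)) - (J - Cconj J)) <= e).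
  { apply (wedge_limit (gauss_kernel b P s) (- (PI / 4)) (PI / 4) C0 r0 J (Cconj J) (arc P)); auto; try lra.
    - intros r Hr. apply Hch; auto; [apply Hab; lra|]. left. rewrite sin_neg. lra.
    - intros r Hr. apply Hch; auto. apply Hab; lra.
    - intros r t Hr Ht. apply Hch; auto; [lra|]. right. apply Rgt_not_eq, sin_gt_0; [nra|].
      assert (P * r <= P * (PI / (2 * P))) by (apply Rmult_le_compat_l; lra).
      replace (P * (PI / (2 * P))) with (PI / 2) in * by (field; lra). lra.
    - intros n t Ht. apply Hch; auto; [specialize (Harc0 n); lra|]. right.
      replace (P * arc P n) with (INR (S n) * PI + PI / 2) by (unfold arc; rewrite S_INR; field; lra).
      intros Z.
      assert (1 / 2 <= Rabs (sin (INR (S n) * PI + PI / 2))) by (apply (sin_arc_bound (INR (S n) * PI + PI / 2) _ (S n)); lra).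
      rewrite Z, Rabs_R0 in H. lra.
    - intros r t Hr Ht. unfold C0. pose proof (Cmod_le_minus (gauss_kernel b P s (polar r t)) (gauss_kernel b P s 0)).
      specialize (Jdl (polar r t)). replace (polar r t - 0)%C with (polar r t) in Jdl by ring.
      rewrite Cmod_polar in Jdl by lra. specialize (Jdl ltac:(lra)). lra.
    - intros n. specialize (Harc0 n). lra.
    - intros M. destruct (INR_unbounded (M * P / PI)) as [N HN]. exists N. intros n Hn.
      apply le_INR in Hn. unfold arc. apply Rmult_le_reg_r with (P / PI); [apply Rdiv_lt_0_compat; lra|].
      replace (PI * (INR n + 3 / 2) / P * (P / PI)) with (INR n + 3 / 2) by (field; lra).
      replace (M * (P / PI)) with (M * P / PI) by (field; lra). lra.
    - intros e He.
      assert (Ha0 : 0 < arc P 0) by (specialize (Harc0 0%nat); lra).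
      assert (Hd : 0 < Rmin ((P - Rabs b) / 2) (s * arc P 0 / 2)) by (apply Rmin_pos; nra).
      destruct (decay_times_x_small 6 _ e Hd ltac:(lra) He) as [M [HM HMx]].
      destruct (INR_unbounded (M * P / PI)) as [N HN]. exists N. intros n t Hn Ht.
      apply le_INR in Hn.
      assert (HMn : M <= arc P n).
      { unfold arc. apply Rmult_le_reg_r with (P / PI); [apply Rdiv_lt_0_compat; lra|].
        replace (PI * (INR n + 3 / 2) / P * (P / PI)) with (INR n + 3 / 2) by (field; lra).
        replace (M * (P / PI)) with (M * P / PI) by (field; lra). lra. }
      eapply Rle_trans; [|apply (HMx (arc P n) HMn)].
      apply Rmult_le_compat_r; [lra|]. apply gauss_kernel_arc; auto.
    - intros n a Ha. apply rect_int_poles; auto; lra. }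
  apply is_lim_seq_spec. intros e. destruct (W e (cond_pos e)) as [N HN]. exists N. intros n Hn.
  specialize (HN n Hn).
  set (X := Rsum (fun m => residue_at b P s (S m)) (S n)) in *.
  replace (RtoC (2 * PI) * Ci * RtoC X - (J - Cconj J))%C with (RtoC (2 * (PI * X - Im J)) * Ci)%C in HN.
  - rewrite Cmod_mult, Cmod_Ci, Cmod_R, Rabs_mult, (Rabs_pos_eq 2) in HN by lra.
    pose proof (cond_pos e). lra.
  - apply injective_projections; unfold Im; simpl; ring.
Qed.

(** * The real part: false theta series *)

Lemma ex_RInt_gauss s a b : ex_RInt (fun x => exp (- s * x ^ 2)) a b.
Proof.
  apply (ex_RInt_continuous (V := R_CompleteNormedModule)). intros z _.
  apply @ex_derive_continuous. auto_derive; auto.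
Qed.

Lemma is_derive_gauss_aux t :
  is_derive (fun t => RInt (fun x => exp (- (t ^ 2 * (1 + x ^ 2))) / (1 + x ^ 2)) 0 1) t
    (RInt (fun x => - 2 * t * exp (- (t ^ 2 * (1 + x ^ 2)))) 0 1).
Proof.
  assert (Hp : forall x : R, 0 < 1 + x ^ 2) by (intros x; pose proof (pow2_ge_0 x); lra).
  assert (HD : forall u v, is_derive (fun z => exp (- (z ^ 2 * (1 + v ^ 2))) / (1 + v ^ 2)) u
     (- 2 * u * exp (- (u ^ 2 * (1 + v ^ 2))))).
  { intros u v. pose proof (Hp v). simpl in H. auto_derive; [simpl; lra|]. simpl. field. lra. }
  replace (RInt (fun x => - 2 * t * exp (- (t ^ 2 * (1 + x ^ 2)))) 0 1)
    with (RInt (fun x => Derive (fun z => exp (- (z ^ 2 * (1 + x ^ 2))) / (1 + x ^ 2)) t) 0 1).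
  2:{ apply RInt_ext. intros x _. apply is_derive_unique, HD. }
  apply is_derive_RInt_param.
  - exists (mkposreal 1 Rlt_0_1). intros y _ x _. eexists; apply HD.
  - intros x _. apply continuity_2d_pt_ext with (fun u v => - 2 * u * exp (- (u ^ 2 * (1 + v ^ 2)))).
    { intros u v. symmetry. apply is_derive_unique, HD. }
    apply continuity_2d_pt_filterlim.
    assert (K : forall z : R * R, continuous (fun z : R * R => - 2 * fst z * exp (- (fst z ^ 2 * (1 + snd z ^ 2)))) z).
    { intros z.
      assert (Kf : continuous (fun z : R * R => fst z) z) by apply continuous_fst.
      assert (Ks : continuous (fun z : R * R => snd z) z) by apply continuous_snd.
      apply (continuous_mult (K := R_AbsRing) (fun z : R * R => - 2 * fst z) (fun z => exp (- (fst z ^ 2 * (1 + snd z ^ 2))))).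
      - apply (continuous_mult (K := R_AbsRing) (fun z : R * R => - 2) (fun z => fst z)); auto. apply continuous_const.
      - apply (continuous_comp (fun z : R * R => - (fst z ^ 2 * (1 + snd z ^ 2))) exp).
        + apply (continuous_opp (V := R_NormedModule) (fun z : R * R => fst z ^ 2 * (1 + snd z ^ 2))).
          apply (continuous_mult (K := R_AbsRing) (fun z : R * R => fst z ^ 2) (fun z => 1 + snd z ^ 2)).
          * apply (continuous_comp (fun z : R * R => fst z) (fun x => x ^ 2)); auto.
            apply @ex_derive_continuous. auto_derive; auto.
          * apply (continuous_comp (fun z : R * R => snd z) (fun x => 1 + x ^ 2)); auto.
            apply @ex_derive_continuous. auto_derive; auto.
        + apply @ex_derive_continuous. auto_derive; auto. }
    apply (K (t, x)).
  - exists (mkposreal 1 Rlt_0_1). intros y _.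
    apply (ex_RInt_continuous (V := R_CompleteNormedModule)). intros z _.
    apply @ex_derive_continuous. pose proof (Hp z). simpl in H. auto_derive. simpl. lra.
Qed.

(** The left side does not depend on [t]: differentiating the second integral under the sign and
    substituting [x -> t x] gives minus the derivative of the square. At [t = 0] it is [atan 1]. *)
Lemma gauss_square t :
  RInt (fun x => exp (- 1 * x ^ 2)) 0 t ^ 2
  + RInt (fun x => exp (- (t ^ 2 * (1 + x ^ 2))) / (1 + x ^ 2)) 0 1 = PI / 4.
Proof.
  set (A := fun t : R => RInt (fun x => exp (- 1 * x ^ 2)) 0 t : R).
  set (B := fun t : R => RInt (fun x => exp (- (t ^ 2 * (1 + x ^ 2))) / (1 + x ^ 2)) 0 1 : R).
  change (A t ^ 2 + B t = PI / 4).
  assert (Hp : forall x : R, 0 < 1 + x ^ 2) by (intros x; pose proof (pow2_ge_0 x); lra).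
  assert (HA : forall t, is_derive A t (exp (- 1 * t ^ 2))).
  { intros u. apply (is_derive_RInt (V := R_NormedModule) (fun x => exp (- 1 * x ^ 2)) A 0 u).
    - exists (mkposreal 1 Rlt_0_1). intros y _. apply (RInt_correct (V := R_CompleteNormedModule)), ex_RInt_gauss.
    - apply @ex_derive_continuous. auto_derive; auto. }
  assert (EB : forall t, RInt (fun x => - 2 * t * exp (- (t ^ 2 * (1 + x ^ 2)))) 0 1 = - 2 * exp (- 1 * t ^ 2) * A t).
  { intros u. unfold A.
    pose proof (RInt_comp_lin (V := R_CompleteNormedModule) (fun x => exp (- 1 * x ^ 2)) u 0 0 1) as Q.
    replace (u * 0 + 0) with 0 in Q by ring. replace (u * 1 + 0) with u in Q by ring.
    rewrite <- Q by apply ex_RInt_gauss.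
    assert (Ex : ex_RInt (fun y => scal u (exp (- 1 * (u * y + 0) ^ 2))) 0 1).
    { apply (ex_RInt_continuous (V := R_CompleteNormedModule)). intros z _.
      apply @ex_derive_continuous. unfold scal; simpl; unfold mult; simpl. auto_derive; auto. }
    pose proof (RInt_scal (V := R_CompleteNormedModule) _ 0 1 (- 2 * exp (- 1 * u ^ 2)) Ex) as Q2.
    change (scal (- 2 * exp (- 1 * u ^ 2)) (RInt (fun y => scal u (exp (- 1 * (u * y + 0) ^ 2))) 0 1))
      with (- 2 * exp (- 1 * u ^ 2) * RInt (fun y => scal u (exp (- 1 * (u * y + 0) ^ 2))) 0 1) in Q2.
    refine (eq_trans _ Q2). apply RInt_ext. intros x _. unfold scal; simpl; unfold mult; simpl.
    replace (- 2 * exp (- 1 * (u * (u * 1))) * (u * exp (- 1 * ((u * x + 0) * ((u * x + 0) * 1)))))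
      with (- 2 * u * (exp (- 1 * (u * (u * 1))) * exp (- 1 * ((u * x + 0) * ((u * x + 0) * 1))))) by ring.
    rewrite <- exp_plus. do 2 f_equal. ring. }
  assert (HF : forall t, is_derive (fun t => A t ^ 2 + B t) t 0).
  { intros u.
    replace 0 with (plus (INR 2 * exp (- 1 * u ^ 2) * A u ^ 1) (RInt (fun x => - 2 * u * exp (- (u ^ 2 * (1 + x ^ 2)))) 0 1)).
    - apply (is_derive_plus (fun t => A t ^ 2) B).
      + apply (is_derive_pow A 2 u). apply HA.
      + apply is_derive_gauss_aux.
    - rewrite EB. unfold plus; simpl. ring. }
  assert (H0 : A 0 ^ 2 + B 0 = PI / 4).
  { unfold A, B. rewrite RInt_point. unfold zero; simpl.
    replace (RInt _ 0 1) with (atan 1 - atan 0).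
    - rewrite atan_1, atan_0. ring.
    - symmetry. apply is_RInt_unique. apply (is_RInt_derive atan).
      + intros x _. pose proof (Hp x). simpl in H. auto_derive; auto. simpl.
        replace (- (0 * (0 * 1) * (1 + x * (x * 1)))) with 0 by ring. rewrite exp_0. field. lra.
      + intros x _. apply @ex_derive_continuous. pose proof (Hp x). simpl in H. auto_derive. simpl; lra. }
  rewrite <- H0.
  destruct (MVT_gen (fun t => A t ^ 2 + B t) 0 t (fun _ => 0)) as [c [_ Hc]].
  - intros x _. apply HF.
  - intros x _. apply derivable_continuous_pt. apply ex_derive_Reals_0. eexists; apply HF.
  - lra.
Qed.

Lemma gauss_limit e : 0 < e -> exists M, 0 < M /\ forall t, M <= t ->
  Rabs (RInt (fun x => exp (- 1 * x ^ 2)) 0 t - sqrt PI / 2) < e.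
Proof.
  intros He. pose proof PI_RGT_0 as HPI.
  set (A := fun t : R => RInt (fun x => exp (- 1 * x ^ 2)) 0 t : R).
  assert (Hsp : 0 < sqrt PI) by now apply sqrt_lt_R0.
  assert (Esp : sqrt PI / 2 * (sqrt PI / 2) = PI / 4).
  { replace (sqrt PI / 2 * (sqrt PI / 2)) with (sqrt PI * sqrt PI / 4) by field. rewrite sqrt_sqrt; lra. }
  assert (HA0 : forall t, 0 <= t -> 0 <= A t).
  { intros t Ht. apply RInt_ge_0; auto; [apply ex_RInt_gauss|]. intros; left; apply exp_pos. }
  assert (Hp : forall x : R, 0 < 1 + x ^ 2) by (intros x; pose proof (pow2_ge_0 x); lra).
  assert (HB : forall t, 1 <= t -> 0 <= PI / 4 - A t ^ 2 <= exp (- 1 * t)).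
  { intros t Ht. rewrite <- (gauss_square t). fold (A t).
    set (B := RInt (fun x => exp (- (t ^ 2 * (1 + x ^ 2))) / (1 + x ^ 2)) 0 1 : R).
    assert (Ex : ex_RInt (fun x => exp (- (t ^ 2 * (1 + x ^ 2))) / (1 + x ^ 2)) 0 1).
    { apply (ex_RInt_continuous (V := R_CompleteNormedModule)). intros z _.
      apply @ex_derive_continuous. pose proof (Hp z). simpl in H. auto_derive. simpl. lra. }
    change (0 <= A t ^ 2 + B - A t ^ 2 <= exp (- 1 * t)). replace (A t ^ 2 + B - A t ^ 2) with B by ring. split.
    - apply RInt_ge_0; auto; [lra|]. intros x _. apply Rlt_le, Rdiv_lt_0_compat; auto using exp_pos.
    - replace (exp (- 1 * t)) with (RInt (fun _ => exp (- 1 * t)) 0 1)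
        by (rewrite RInt_const; unfold scal; simpl; unfold mult; simpl; ring).
      apply RInt_le; auto; [lra|apply ex_RInt_const|]. intros x _.
      apply Rle_trans with (exp (- (t ^ 2 * (1 + x ^ 2)))).
      + rewrite <- (Rmult_1_r (exp (- (t ^ 2 * (1 + x ^ 2))))) at 2. unfold Rdiv.
        apply Rmult_le_compat_l; [left; apply exp_pos|]. rewrite <- Rinv_1. apply Rinv_le_contravar; [lra|].
        pose proof (pow2_ge_0 x); lra.
      + apply exp_le. pose proof (pow2_ge_0 x). assert (t <= t ^ 2) by nra. nra. }
  destruct (exp_decay_small 1 1 (e * (sqrt PI / 2))) as [M [HM HMx]]; [lra|lra|nra|].
  exists (Rmax 1 M). pose proof (Rmax_l 1 M). pose proof (Rmax_r 1 M). split; [lra|].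
  intros t Ht. fold (A t). specialize (HB t ltac:(lra)). specialize (HMx t ltac:(lra)). rewrite Rmult_1_l in HMx.
  replace (- (1) * t) with (- 1 * t) in HMx by ring.
  specialize (HA0 t ltac:(lra)).
  apply Rabs_lt_between. set (q := sqrt PI / 2) in *. assert (0 < q) by (unfold q; lra).
  split; [|nra]. apply Rnot_le_lt. intros Hle. assert (e * q <= (q - A t) * (q + A t)) by (apply Rmult_le_compat; lra). nra.
Qed.

Lemma gauss_limit_s s e : 0 < s -> 0 < e -> exists M, 0 < M /\ forall t, M <= t ->
  Rabs (RInt (fun x => exp (- s * x ^ 2)) 0 t - sqrt (PI / s) / 2) < e.
Proof.
  intros Hs He. pose proof PI_RGT_0 as HPI.
  set (k := sqrt s). assert (Hk : 0 < k) by now apply sqrt_lt_R0.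
  assert (Ek : k * k = s) by (apply sqrt_sqrt; lra).
  destruct (gauss_limit (e * k)) as [M [HM HMx]]; [nra|].
  exists (M / k). split; [now apply Rdiv_lt_0_compat|]. intros t Ht.
  assert (Htk : M <= k * t).
  { apply (Rmult_le_compat_l k) in Ht; [|lra]. replace (k * (M / k)) with M in Ht by (field; lra). auto. }
  specialize (HMx (k * t) Htk).
  pose proof (RInt_comp_lin (V := R_CompleteNormedModule) (fun x => exp (- 1 * x ^ 2)) k 0 0 t) as Q.
  replace (k * 0 + 0) with 0 in Q by ring. replace (k * t + 0) with (k * t) in Q by ring.
  assert (E : RInt (fun x => exp (- 1 * x ^ 2)) 0 (k * t) = k * RInt (fun x => exp (- s * x ^ 2)) 0 t).
  { rewrite <- Q by apply ex_RInt_gauss.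
    refine (eq_trans _ (RInt_scal (V := R_CompleteNormedModule) _ 0 t k (ex_RInt_gauss s 0 t))).
    apply RInt_ext. intros x _. do 2 f_equal. rewrite <- Ek. ring. }
  rewrite E in HMx.
  replace (sqrt PI / 2) with (k * (sqrt (PI / s) / 2)) in HMx.
  - rewrite <- Rmult_minus_distr_l, Rabs_mult, (Rabs_pos_eq k) in HMx by lra.
    rewrite (Rmult_comm e) in HMx. apply Rmult_lt_reg_l in HMx; auto.
  - rewrite sqrt_div_alt by auto. fold k. field. lra.
Qed.

(* The contour is shifted by [i n / (2 s)] to complete the square. *)
Lemma gauss_cos s n e : 0 < s -> 0 < n -> 0 < e -> exists M, 0 < M /\ forall N, M <= N ->
  Rabs (Re (CI (fun x => Cexp (- (RtoC s * (RtoC x * RtoC x)) - Ci * RtoC (n * x))%C) 0 N)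
        - sqrt (PI / s) / 2 * exp (- (n ^ 2 / (4 * s)))) < e.
Proof.
  intros Hs Hn He. set (c := n / (2 * s)). assert (Hc : 0 < c) by (apply Rdiv_lt_0_compat; lra).
  set (h := fun z : C => Cexp (- (RtoC s * (z * z)))).
  assert (Hh : forall z, chol h z).
  { intros z. apply chol_Cexp, chol_opp. repeat apply chol_mult; auto using chol_const, chol_id. }
  assert (Hhc : forall z, ccont h z) by (intros; apply chol_ccont; auto).
  set (k := exp (- (n ^ 2 / (4 * s)))). assert (Hk : 0 < k) by apply exp_pos.
  assert (Hk1 : k <= 1).
  { unfold k. rewrite <- exp_0. apply exp_le. assert (0 <= n ^ 2 / (4 * s)); [|lra].
    apply Rmult_le_pos; [apply pow2_ge_0|]. left. apply Rinv_0_lt_compat; lra. }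
  assert (Ek : k * exp (s * c ^ 2) = 1).
  { unfold k. rewrite <- exp_plus, <- exp_0. f_equal. unfold c. field. lra. }
  destruct (gauss_limit_s s (e / 2)) as [M1 [HM1 HM1x]]; [auto|lra|].
  destruct (exp_decay_small (c * exp (s * c ^ 2)) s (e / 2)) as [M2 [HM2 HM2x]]; auto; [|lra|].
  { pose proof (exp_pos (s * c ^ 2)). nra. }
  exists (Rmax 1 (Rmax M1 M2)).
  pose proof (Rmax_l 1 (Rmax M1 M2)). pose proof (Rmax_r 1 (Rmax M1 M2)).
  pose proof (Rmax_l M1 M2). pose proof (Rmax_r M1 M2).
  split; [lra|]. intros N HN. specialize (HM1x N ltac:(lra)). specialize (HM2x N ltac:(lra)).
  assert (G : rect_int h 0 N 0 c = 0) by (apply goursat; auto; lra).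
  unfold rect_int in G.
  assert (E1 : is_CI (fun x => h (x, 0)) 0 N (RtoC (RInt (fun x => exp (- s * x ^ 2)) 0 N))).
  { apply is_CI_pair.
    - eapply is_RInt_ext_all; [|apply (RInt_correct (V := R_CompleteNormedModule)), ex_RInt_gauss]. intros x. unfold h, Cexp, Re; simpl.
      match goal with |- _ = exp ?X * cos ?Y => replace X with (- s * (x * (x * 1))) by ring; replace Y with 0 by ring end.
      rewrite cos_0. ring.
    - replace 0 with (scal (N - 0) 0) at 2 by (unfold scal; simpl; unfold mult; simpl; ring).
      eapply is_RInt_ext_all; [|apply @is_RInt_const]. intros x. unfold h, Cexp, Im; simpl.
      match goal with |- _ = exp ?X * sin ?Y => replace Y with 0 by ring end. rewrite sin_0. ring. }
  rewrite (is_CI_unique _ _ _ _ E1) in G.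
  (* On the imaginary axis [h] is real, so this side, multiplied by [Ci], contributes nothing to the
     real part. *)
  assert (E4 : Im (CI (fun y => h (0, y)) 0 c) = 0).
  { assert (ex_CI (fun y => h (0, y)) 0 c) by (apply ex_CI_vert; auto; lra).
    pose proof (is_CI_Im _ _ _ _ (CI_correct _ _ _ H3)) as Q. apply (is_RInt_unique (V := R_CompleteNormedModule)) in Q.
    rewrite <- Q. replace 0 with (scal (c - 0) 0) at 2 by (unfold scal; simpl; unfold mult; simpl; ring).
    apply (is_RInt_unique (V := R_CompleteNormedModule)).
    eapply is_RInt_ext_all; [|apply @is_RInt_const]. intros x. unfold h, Cexp, Im; simpl.
    match goal with |- _ = exp ?X * sin ?Y => replace Y with 0 by ring end. rewrite sin_0. ring. }
  set (V2 := CI (fun y => h (0, y)) 0 c) in *.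
  assert (B3 : Cmod (CI (fun y => h (N, y)) 0 c) <= c * exp (s * c ^ 2) * exp (- s * N)).
  { replace (c * exp (s * c ^ 2) * exp (- s * N)) with ((c - 0) * (exp (s * c ^ 2) * exp (- s * N))) by ring.
    apply CI_bound; [lra| |apply ex_CI_vert; auto; lra]. intros y Hy. unfold h. rewrite Cmod_Cexp, <- exp_plus.
    apply exp_le. simpl. assert (N <= N * N) by nra. assert (y * y <= c * c) by nra. nra. }
  set (V1 := CI (fun y => h (N, y)) 0 c) in *.
  assert (E2 : CI (fun x => h (x, c)) 0 N = (RtoC (exp (s * c ^ 2)) *
     CI (fun x => Cexp (- (RtoC s * (RtoC x * RtoC x)) - Ci * RtoC (n * x))%C) 0 N)%C).
  { rewrite <- CI_scal.
    - apply CI_ext. intros x _. unfold h.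
      replace (RtoC (exp (s * c ^ 2))) with (Cexp (RtoC (s * c ^ 2)))
        by (unfold Cexp; simpl; rewrite cos_0, sin_0; apply injective_projections; simpl; ring).
      rewrite <- Cexp_plus. f_equal. unfold c. apply injective_projections; simpl; field; lra.
    - apply ex_CI_any. intros x.
      assert (Q : rcont (fun x => Cexp (- (RtoC s * (RtoC x * RtoC x)) - Ci * (RtoC n * RtoC x))%C) x).
      { apply (rcont_comp (fun z => Cexp (- (RtoC s * (z * z)) - Ci * (RtoC n * z))%C) RtoC); [|apply rcont_RtoC].
        apply chol_ccont, chol_Cexp, chol_minus; [apply chol_opp|]; repeat apply chol_mult; auto using chol_const, chol_id. }
      intros e' He'. destruct (Q e' He') as [d [Hd J]]. exists d; split; auto. intros y Hy. specialize (J y Hy).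
      rewrite !RtoC_mult. exact J. }
  rewrite E2 in G. set (X := CI _ 0 N) in G |- *.
  apply (f_equal Re) in G.
  assert (G' : exp (s * c ^ 2) * Re X = RInt (fun x => exp (- s * x ^ 2)) 0 N - Im V1).
  { destruct X as [X1 X2], V1 as [V11 V12], V2 as [V21 V22]. unfold Re, Im in *. simpl in *. lra. }
  pose proof (im_le_Cmod V1) as HV. set (g := sqrt (PI / s) / 2) in *.
  assert (EX : Re X - g * k = k * ((RInt (fun x => exp (- s * x ^ 2)) 0 N - g) - Im V1)).
  { replace (Re X) with (k * exp (s * c ^ 2) * Re X) by (rewrite Ek; ring).
    rewrite Rmult_assoc, G'. ring. }
  rewrite EX, Rabs_mult, (Rabs_pos_eq k) by lra.
  set (R1 := RInt (fun x => exp (- s * x ^ 2)) 0 N) in *.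
  assert (Rabs (R1 - g - Im V1) < e).
  { unfold Rminus at 1. eapply Rle_lt_trans; [apply Rabs_triang|]. rewrite Rabs_Ropp. lra. }
  pose proof (Rabs_pos (R1 - g - Im V1)). nra.
Qed.

(** One term of the geometric expansion: [exp (- s v^2 - n u)] with [u = i v]. *)
Definition gauss_mode (s n : R) (v : C) : C := Cexp (- (RtoC s * (v * v)) - Ci * (RtoC n * v)).

Lemma chol_gauss_mode s n v : chol (gauss_mode s n) v.
Proof.
  apply chol_Cexp, chol_minus; [apply chol_opp|]; repeat apply chol_mult; auto using chol_const, chol_id.
Qed.

(** For [- sin t >= 1 / 2] the linear term gives the rate [n / 2]. Otherwise [cos (2 t) >= 1 / 2],
    and the Gaussian gives it through [n r / 2 <= s r^2 / 2 + n^2 / (8 s)], which explains the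
    constant in front. *)
Lemma gauss_mode_bound s n r t : 0 < s -> 0 < n -> 0 <= r -> - (PI / 4) <= t <= 0 ->
  Cmod (gauss_mode s n (polar r t)) <= exp (n ^ 2 / (8 * s)) * exp (- (n / 2) * r).
Proof.
  intros Hs Hn Hr Ht. pose proof PI_RGT_0. unfold gauss_mode. rewrite Cmod_Cexp, <- exp_plus. apply exp_le.
  assert (E : Re (- (RtoC s * (polar r t * polar r t)) - Ci * (RtoC n * polar r t)) = - s * r ^ 2 * cos (2 * t) + n * r * sin t).
  { rewrite polar_pair, cos_2a. simpl. ring. }
  rewrite E, cos_2a_sin. set (q := - sin t).
  assert (Hq : 0 <= q).
  { unfold q. rewrite <- sin_neg. apply sin_ge_0; lra. }
  assert (Hc : 0 <= cos (2 * t)) by (apply cos_ge_0; lra).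
  rewrite cos_2a_sin in Hc. replace (sin t) with (- q) in * by (unfold q; ring).
  assert (Hd : 0 <= n ^ 2 / (8 * s)) by (apply Rmult_le_pos; [apply pow2_ge_0|left; apply Rinv_0_lt_compat; lra]).
  assert (Hsr : 0 <= s * r ^ 2) by (apply Rmult_le_pos; [lra|apply pow2_ge_0]).
  assert (Hnr : 0 <= n * r) by (apply Rmult_le_pos; lra).
  destruct (Rle_lt_dec (1 / 2) q) as [Hq2|Hq2].
  - assert (0 <= s * r ^ 2 * (1 - 2 * - q * - q)) by (apply Rmult_le_pos; auto).
    assert (n * r * (1 / 2) <= n * r * q) by (apply Rmult_le_compat_l; auto). lra.
  - assert (s * r ^ 2 * (1 / 2) <= s * r ^ 2 * (1 - 2 * - q * - q)) by (apply Rmult_le_compat_l; auto; nra).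
    assert (0 <= n * r * q) by (apply Rmult_le_pos; auto).
    assert (Q : n * r / 2 <= s * r ^ 2 / 2 + n ^ 2 / (8 * s)).
    { apply Rmult_le_reg_r with (8 * s); [lra|].
      replace ((s * r ^ 2 / 2 + n ^ 2 / (8 * s)) * (8 * s)) with (4 * (s * r) ^ 2 + n ^ 2) by (field; lra).
      replace (n * r / 2 * (8 * s)) with (4 * (s * r) * n) by field.
      pose proof (pow2_ge_0 (2 * (s * r) - n)). simpl in *. nra. }
    lra.
Qed.

(** The ray is rotated to the positive axis. Only the real part is evaluated: the imaginary part is
    a Dawson integral, without such a closed form. *)
Lemma gauss_mode_integral s n : 0 < s -> 0 < n ->
  exists E, is_CI_inf (ray (gauss_mode s n) (- (PI / 4))) E /\ Re E = sqrt (PI / s) / 2 * exp (- (n ^ 2 / (4 * s))).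
Proof.
  intros Hs Hn. pose proof PI_RGT_0 as HPI.
  assert (X : forall t, - (PI / 4) <= t <= 0 -> exists l, is_CI_inf (ray (gauss_mode s n) t) l).
  { intros t Ht. apply (is_CI_inf_exists _ (exp (n ^ 2 / (8 * s))) (n / 2)); [lra|left; apply exp_pos| |].
    - intros N HN. apply ex_CI_any. intros x. apply rcont_ray, chol_ccont, chol_gauss_mode.
    - intros x Hx. unfold ray. rewrite Cmod_mult, Cmod_cis, Rmult_1_r. apply gauss_mode_bound; auto. }
  destruct (X (- (PI / 4)) ltac:(lra)) as [l1 H1]. destruct (X 0 ltac:(lra)) as [l2 H2].
  exists l1. split; auto.
  assert (El : l1 = l2).
  { apply (rotate_ray (gauss_mode s n) (- (PI / 4)) 0 (exp (n ^ 2 / (8 * s))) (n / 2)); auto; try lra.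
    - left; apply exp_pos.
    - intros; apply chol_gauss_mode.
    - intros; apply gauss_mode_bound; auto. }
  rewrite El. set (v := sqrt (PI / s) / 2 * exp (- (n ^ 2 / (4 * s)))).
  assert (Hsm : forall e, 0 < e -> Rabs (Re l2 - v) <= e).
  { intros e He.
  destruct (gauss_cos s n (e / 2) Hs Hn ltac:(lra)) as [M1 [HM1 J1]]. fold v in J1.
  destruct H2 as [_ H2]. destruct (H2 (e / 2) ltac:(lra)) as [M2 J2].
  set (N := Rmax M1 M2). assert (M1 <= N) by apply Rmax_l. assert (M2 <= N) by apply Rmax_r.
  specialize (J1 N H). specialize (J2 N ltac:(lra) H0).
  rewrite (CI_ext _ (ray (gauss_mode s n) 0)) in J1.
  2:{ intros x _. unfold ray, gauss_mode. rewrite cis_0, Cmult_1_r.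
      assert (E0 : polar x 0 = RtoC x) by (unfold polar; rewrite cis_0; ring).
      rewrite E0, RtoC_mult. reflexivity. }
  set (Y := CI (ray (gauss_mode s n) 0) 0 N) in *.
  pose proof (re_le_Cmod (Y - l2)) as Q.
  replace (Re (Y - l2)) with (Re Y - Re l2) in Q by (unfold Re; simpl; ring).
  replace (Re l2 - v) with (- (Re Y - Re l2) + (Re Y - v)) by ring.
  eapply Rle_trans; [apply Rabs_triang|]. rewrite Rabs_Ropp. lra. }
  apply Rminus_diag_uniq. destruct (Req_dec (Re l2 - v) 0) as [|Hne]; auto.
  apply Rabs_pos_lt in Hne. specialize (Hsm (Rabs (Re l2 - v) / 2) ltac:(lra)). lra.
Qed.

(** Iterated [K] times, this gives [K] terms of the geometric expansion together with the exact
    remainder [Phi b P u * Cexp (- 2 P K u)]. An exact remainder is wanted because the infinite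
    expansion breaks down at [u = 0]. *)
Lemma Phi_geometric b P u : Csinh (RtoC P * u) <> 0 ->
  (Phi b P u * (1 - Cexp (- (RtoC (2 * P) * u))))%C = (Cexp (- (RtoC (P - b) * u)) - Cexp (- (RtoC (P + b) * u)))%C.
Proof.
  intros Hne. unfold Phi.
  assert (E : (1 - Cexp (- (RtoC (2 * P) * u)))%C = (2 * Cexp (- (RtoC P * u)) * Csinh (RtoC P * u))%C).
  { unfold Csinh. 
    assert (E1 : (Cexp (- (RtoC P * u)) * Cexp (RtoC P * u))%C = 1)
      by (rewrite <- Cexp_plus, <- Cexp_0; f_equal; ring).
    assert (E2 : (Cexp (- (RtoC P * u)) * Cexp (- (RtoC P * u)))%C = Cexp (- (RtoC (2 * P) * u)))
      by (rewrite <- Cexp_plus, RtoC_mult; f_equal; ring).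
    replace (2 * Cexp (- (RtoC P * u)) * ((Cexp (RtoC P * u) - Cexp (- (RtoC P * u))) / 2))%C
      with (Cexp (- (RtoC P * u)) * Cexp (RtoC P * u) - Cexp (- (RtoC P * u)) * Cexp (- (RtoC P * u)))%C by field.
    rewrite E1, E2. reflexivity. }
  rewrite E.
  replace (Csinh (RtoC b * u) / Csinh (RtoC P * u) * (2 * Cexp (- (RtoC P * u)) * Csinh (RtoC P * u)))%C
    with (2 * Cexp (- (RtoC P * u)) * Csinh (RtoC b * u))%C by (field; auto).
  unfold Csinh.
  replace (2 * Cexp (- (RtoC P * u)) * ((Cexp (RtoC b * u) - Cexp (- (RtoC b * u))) / 2))%C
    with (Cexp (- (RtoC P * u)) * Cexp (RtoC b * u) - Cexp (- (RtoC P * u)) * Cexp (- (RtoC b * u)))%C by field.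
  rewrite <- !Cexp_plus, RtoC_minus, RtoC_plus. f_equal; [f_equal; ring|]. do 2 f_equal. ring.
Qed.

Definition false_theta (b P s : R) (k : nat) : R :=
  exp (- ((P - b + 2 * P * INR k) ^ 2 / (4 * s))) - exp (- ((P + b + 2 * P * INR k) ^ 2 / (4 * s))).

Lemma re_part_limit b P s J : Rabs b < P -> 0 < s ->
  is_CI_inf (ray (gauss_kernel b P s) (- (PI / 4))) J ->
  is_lim_seq (fun K => sqrt (PI / s) / 2 * Rsum (false_theta b P s) K) (Re J).
Proof.
  intros Hb Hs HJ. pose proof (Rabs_pos b) as Hb0. pose proof PI_RGT_0 as HPI.
  assert (HP : 0 < P) by lra. assert (Hbb : - P < b < P) by (apply Rabs_lt_between; auto).
  set (q := sin (PI / 4)). assert (Hq : 0 < q) by (apply sin_gt_0; lra).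
  set (u := fun r => (Ci * polar r (- (PI / 4)))%C).
  assert (Hu : forall r, Re (u r) = q * r).
  { intros r. unfold u. rewrite polar_Ci, sin_neg. simpl. unfold q. ring. }
  assert (Hui : forall r, Im (u r) = q * r).
  { intros r. unfold u. rewrite polar_Ci, cos_neg. simpl. unfold q. rewrite cos_PI4, sin_PI4. ring. }
  (* The integrand left after [K] terms of the expansion have been subtracted. *)
  set (rem := fun (K : nat) r => (ray (gauss_kernel b P s) (- (PI / 4)) r * Cexp (- (RtoC (2 * P * INR K) * u r)))%C).
  assert (Step : forall K r, 0 < r -> (rem K r - (ray (gauss_mode s (P - b + 2 * P * INR K)) (- (PI / 4)) r
      - ray (gauss_mode s (P + b + 2 * P * INR K)) (- (PI / 4)) r))%C = rem (S K) r).
  { intros K r Hr. unfold rem, ray, gauss_kernel, gauss_mode. fold (u r). set (v := polar r (- (PI / 4))).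
    assert (Hne : Csinh (RtoC P * u r) <> 0) by (apply Csinh_neq_0; rewrite Re_scal, Hu; apply Rgt_not_eq; repeat apply Rmult_lt_0_compat; auto).
    rewrite Phi_ext_Phi by (unfold u; apply Cmult_neq_0; [apply Ci_nz|now apply polar_neq_0]).
    pose proof (Phi_geometric b P (u r) Hne) as Q.
    assert (Ee : forall n, Cexp (- (RtoC s * (v * v)) - Ci * (RtoC n * v)) = (Cexp (- (RtoC s * (v * v))) * Cexp (- (RtoC n * u r)))%C).
    { intros n. rewrite <- Cexp_plus. f_equal. unfold u. fold v. ring. }
    rewrite !Ee.
    assert (En : forall c, Cexp (- (RtoC (c + 2 * P * INR K) * u r)) = (Cexp (- (RtoC c * u r)) * Cexp (- (RtoC (2 * P * INR K) * u r)))%C).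
    { intros c. rewrite <- Cexp_plus, RtoC_plus. f_equal. ring. }
    rewrite !En.
    replace (Cexp (- (RtoC (2 * P * INR (S K)) * u r))) with (Cexp (- (RtoC (2 * P) * u r)) * Cexp (- (RtoC (2 * P * INR K) * u r)))%C.
    2:{ rewrite <- En. do 3 f_equal. rewrite S_INR. f_equal. ring. }
    set (e0 := Cexp (- (RtoC s * (v * v)))). set (e1 := Cexp (- (RtoC (2 * P * INR K) * u r))).
    replace (e0 * Phi b P (u r) * cis (- (PI / 4)) * e1 -
       (e0 * (Cexp (- (RtoC (P - b) * u r)) * e1) * cis (- (PI / 4)) - e0 * (Cexp (- (RtoC (P + b) * u r)) * e1) * cis (- (PI / 4))))%C
      with (e0 * e1 * cis (- (PI / 4)) * (Phi b P (u r) - (Cexp (- (RtoC (P - b) * u r)) - Cexp (- (RtoC (P + b) * u r)))))%C by ring.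
    rewrite <- Q. ring. }
  assert (Main : forall K, exists SK, is_CI_inf (rem K) (J - SK)%C /\ Re SK = sqrt (PI / s) / 2 * Rsum (false_theta b P s) K).
  { induction K as [|K [SK [H1 H2]]].
    - exists 0. split; [|simpl; ring]. replace (J - 0)%C with J by ring. revert HJ. apply is_CI_inf_ext.
      intros r _. unfold rem. simpl. rewrite Rmult_0_r. 
      replace (- (RtoC 0 * u r))%C with (RtoC 0) by ring. rewrite Cexp_0. ring.
    - pose proof (pos_INR K) as HK.
      assert (HPK : 0 <= 2 * P * INR K) by (apply Rmult_le_pos; lra).
      destruct (gauss_mode_integral s (P - b + 2 * P * INR K) Hs) as [E1 [I1 R1]]; [lra|].
      destruct (gauss_mode_integral s (P + b + 2 * P * INR K) Hs) as [E2 [I2 R2]]; [lra|].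
      exists (SK + (E1 - E2))%C. split.
      + replace (J - (SK + (E1 - E2)))%C with ((J - SK) - (E1 - E2))%C by ring.
        eapply is_CI_inf_ext; [|apply is_CI_inf_minus; [exact H1|apply is_CI_inf_minus; [exact I1|exact I2]]].
        intros r Hr. cbv beta. now apply Step.
      + replace (Re (SK + (E1 - E2))) with (Re SK + (Re E1 - Re E2)) by (unfold Re; simpl; ring).
        rewrite H2, R1, R2. cbn [Rsum]. unfold false_theta. ring. }
  (* On this ray [cos (2 t) = 0], so the Gaussian has modulus 1, and [Phi_ext] is at most 2 as the
     slope is [K = 1]. The integral of the remainder is thus at most [2 / (2 P K q)], which tends to
     0. *)
  assert (Bd : forall K r, 0 <= r -> Cmod (rem K r) <= 2 * exp (- (2 * P * INR K * q) * r)).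
  { intros K r Hr. unfold rem, ray, gauss_kernel. rewrite !Cmod_mult, Cmod_cis, Cmod_Cexp_gauss.
    replace (2 * - (PI / 4)) with (- (PI / 2)) by field. rewrite cos_neg, cos_PI2, Rmult_0_r, exp_0.
    rewrite Rmult_1_l, Rmult_1_r, Cmod_Cexp. fold (u r).
    apply Rmult_le_compat; [apply Cmod_ge_0|left; apply exp_pos| |].
    - pose proof (Phi_ext_bound b P 1 (u r) Hb ltac:(lra)) as Q. rewrite Hu, Hui in Q.
      eapply Rle_trans; [apply Q|].
      + destruct Hr as [Hr|<-]; [left; nra|right]. unfold u, polar. ring.
      + rewrite Rabs_pos_eq; nra.
      + replace (1 + 1) with 2 by ring. rewrite <- (Rmult_1_r 2) at 2. apply Rmult_le_compat_l; [lra|].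
        rewrite <- exp_0. apply exp_le. assert (0 <= q * r) by nra. nra.
    - apply exp_le. right.
      replace (Re (- (RtoC (2 * P * INR K) * u r))) with (- (2 * P * INR K * Re (u r))) by (unfold Re; simpl; ring).
      rewrite Hu. ring. }
  apply is_lim_seq_spec. intros e. pose proof (cond_pos e) as He.
  destruct (INR_unbounded (2 / (2 * P * q * e))) as [N HN].
  assert (HPq : 0 < 2 * P * q) by (apply Rmult_lt_0_compat; lra).
  exists (S N). intros K HK. destruct (Main K) as [SK [H1 H2]]. rewrite <- H2.
  assert (HK0 : INR N + 1 <= INR K) by (rewrite <- S_INR; apply le_INR; lia).
  pose proof (pos_INR N).
  assert (Hd : 0 < 2 * P * INR K * q) by (replace (2 * P * INR K * q) with (2 * P * q * INR K) by ring; apply Rmult_lt_0_compat; lra).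
  pose proof (is_CI_inf_bound _ _ 2 _ Hd ltac:(lra) H1 (Bd K)) as B.
  pose proof (re_le_Cmod (J - SK)) as Q.
  replace (Re (J - SK)) with (Re J - Re SK) in Q by (unfold Re; simpl; ring).
  rewrite Rabs_minus_sym in Q. eapply Rle_lt_trans; [exact Q|]. eapply Rle_lt_trans; [exact B|].
  apply Rmult_lt_reg_r with (2 * P * INR K * q); auto. unfold Rdiv. rewrite Rmult_assoc, Rinv_l by lra.
  assert (Q2 : 2 / (2 * P * q * e) < INR K) by lra.
  apply (Rmult_lt_compat_r (2 * P * q * e)) in Q2; [|now apply Rmult_lt_0_compat].
  replace (2 / (2 * P * q * e) * (2 * P * q * e)) with 2 in Q2 by (field; lra).
  lra.
Qed.

(** * Values on the negative axis *)

(** [4 P / PI] is [48 p / PI] for [P = 12 p]: the square root in front of [calL] is distributed over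
    its four terms, each of which then continues by itself. *)
Definition JS_cont (P a : R) (t : C) : C :=
  (RtoC (sqrt (4 * P / PI)) * cis (- (PI / 4)) * ray_int (P - a) P (Csqrt (- Ci * t)))%C.

Lemma slit_cut_plane t : cut_plane Upper t -> slit (- Ci * t)%C.
Proof. destruct t as [x y]; unfold slit; simpl. intros [H|H]; [left|right]; lra. Qed.

Lemma chol_JS_cont P a t : Rabs (P - a) < P -> cut_plane Upper t -> chol (JS_cont P a) t.
Proof.
  intros Hb Ht. pose proof (slit_cut_plane t Ht) as Hs. unfold JS_cont. apply chol_mult; [apply chol_const|].
  apply (chol_comp (ray_int (P - a) P) (fun t => Csqrt (- Ci * t)%C)).
  - apply (chol_comp Csqrt (fun t => - Ci * t)%C); [apply chol_scal_id|now apply chol_Csqrt_at].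
  - apply chol_ray_int; auto. now apply Csqrt_Re_pos.
Qed.

Lemma JS_cont_eq P a t : Rabs (P - a) < P -> 0 < Re t ->
  JS_cont P a t = (Csqrt (RtoC (4 * P / PI) * t) * JS P a t)%C.
Proof.
  intros Hb Ht. unfold JS_cont. rewrite Csqrt_JS; auto.
  pose proof (Rabs_pos (P - a)). apply Rdiv_lt_0_compat; [lra|apply PI_RGT_0].
Qed.

(** The root of [- i t = i T] is [sqrt T] at angle [PI / 4]. For [u = i v] this is the ray of angle
    [- PI / 4] in [v], and [r = sqrt T * y] turns [exp (i P y^2)] back into
    [exp (- (P / T) v^2)]. *)
Lemma JS_cont_neg P a T : Rabs (P - a) < P -> 0 < T -> exists J,
  is_CI_inf (ray (gauss_kernel (P - a) P (P / T)) (- (PI / 4))) J /\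
  JS_cont P a (RtoC (- T)) = (RtoC (sqrt (4 * P / (PI * T))) * J)%C.
Proof.
  intros Hb HT. set (b := P - a) in *. pose proof (Rabs_pos b) as Hb0. pose proof PI_RGT_0 as HPI.
  set (q := sqrt T). assert (Hq : 0 < q) by now apply sqrt_lt_R0.
  assert (Eq : q * q = T) by (apply sqrt_sqrt; lra).
  assert (Hre : 0 < Re (RtoC q * cis (PI / 4))).
  { rewrite Re_scal, cis_pair. simpl. apply Rmult_lt_0_compat; auto. apply cos_gt_0; lra. }
  assert (Es : Csqrt (- Ci * RtoC (- T)) = (RtoC q * cis (PI / 4))%C).
  { apply Csqrt_unique; auto.
    replace (RtoC q * cis (PI / 4) * (RtoC q * cis (PI / 4)))%C with ((RtoC q * RtoC q) * (cis (PI / 4) * cis (PI / 4)))%C by ring.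
    rewrite <- RtoC_mult, Eq, cis_pi4_sqr, RtoC_opp. ring. }
  set (G := ray_int b P (RtoC q * cis (PI / 4))).
  exists (RtoC q * cis (- (PI / 4)) * G)%C. split.
  - pose proof (is_CI_inf_scal _ (RtoC q * cis (- (PI / 4)))%C _ (ray_int_correct b P _ Hb Hre)) as Q. fold G in Q.
    apply (is_CI_inf_scale _ (/ q)) in Q; [|now apply Rinv_0_lt_compat].
    revert Q. apply is_CI_inf_ext. intros r Hr. unfold ray, ray_kernel, gauss_kernel.
    assert (Hqc : RtoC q <> 0) by (apply RtoC_neq_0; lra).
    replace (RtoC q * cis (PI / 4) * RtoC (/ q * r)%R)%C with (Ci * polar r (- (PI / 4)))%C.
    + replace (Ci * RtoC (P * (/ q * r) ^ 2))%C with (- (RtoC (P / T) * (polar r (- (PI / 4)) * polar r (- (PI / 4)))))%C.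
      * rewrite RtoC_inv by lra. field. auto.
      * replace (P * (/ q * r) ^ 2) with (P / T * (r * r)) by (rewrite <- Eq; field; lra).
        unfold polar. rewrite !RtoC_mult, cis_opp.
        replace (RtoC r * / cis (PI / 4) * (RtoC r * / cis (PI / 4)))%C with (RtoC r * RtoC r * / (cis (PI / 4) * cis (PI / 4)))%C
          by (field; apply cis_neq_0).
        rewrite cis_pi4_sqr, Ci_inv. ring.
    + unfold polar. rewrite <- cis_pi4_sqr, cis_opp, RtoC_mult, RtoC_inv by lra. field. split; auto. apply cis_neq_0.
  - unfold JS_cont. fold b. rewrite Es. fold G.
    replace (sqrt (4 * P / PI)) with (sqrt (4 * P / (PI * T)) * q).
    + rewrite RtoC_mult. ring.
    + unfold q. rewrite <- sqrt_mult_alt.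
      * f_equal. field. lra.
      * apply Rmult_le_pos; [lra|]. left. apply Rinv_0_lt_compat. nra.
Qed.

Lemma is_lim_seq_scal_l' (u : nat -> R) (l c : R) : is_lim_seq u l -> is_lim_seq (fun n => c * u n) (c * l).
Proof. intros H. apply (is_lim_seq_scal_l u c l) in H. exact H. Qed.

Lemma Rsum_scal c u n : Rsum (fun k => c * u k) n = c * Rsum u n.
Proof. induction n; simpl; [ring|]. rewrite IHn. ring. Qed.

Lemma Rsum_ext u v n : (forall k, (k < n)%nat -> u k = v k) -> Rsum u n = Rsum v n.
Proof. induction n; intros H; simpl; auto. rewrite IHn, H; auto. Qed.

Lemma Rsum_plus_fun u v n : Rsum (fun k => u k + v k) n = Rsum u n + Rsum v n.
Proof. induction n; simpl; [ring|]. rewrite IHn. ring. Qed.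

(** For [P = 12 p] and [a = 2 r] the frequencies [P - b + 2 P k] and [P + b + 2 P k] are twice
    [r + 12 p k] and [12 p - r + 12 p k]. With [s = P / T] the Gaussian weights become powers of
    [exp (- T / (12 p))] with square exponents. *)
Lemma JS_cont_neg_limits (p r : nat) (T : R) : (0 < r < 12 * p)%nat -> 0 < T ->
  let P := 12 * INR p in let X := JS_cont P (2 * INR r) (RtoC (- T)) in
  is_lim_seq (fun K => Rsum (fun k => exp (- T / (12 * INR p)) ^ ((r + 12 * p * k) * (r + 12 * p * k))
       - exp (- T / (12 * INR p)) ^ ((12 * p - r + 12 * p * k) * (12 * p - r + 12 * p * k))) K) (Re X) /\
  is_lim_seq (fun n => - (sqrt (PI / T) / sqrt (3 * INR p)) *
     Rsum (fun m => sin (PI * INR r * INR (S m) / (6 * INR p)) * exp (- PI ^ 2 / (12 * INR p * T)) ^ (S m * S m)) (S n)) (Im X).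
Proof.
  intros Hr HT P X. pose proof PI_RGT_0 as HPI.
  assert (Hp : 0 < INR p) by (apply lt_0_INR; lia).
  assert (Hr1 : 0 < INR r) by (apply lt_0_INR; lia).
  assert (Hr2 : INR r < 12 * INR p).
  { replace (12 * INR p) with (INR (12 * p)) by (rewrite mult_INR; simpl; ring). apply lt_INR. lia. }
  assert (HP : 0 < P) by (unfold P; lra).
  assert (Hb : Rabs (P - 2 * INR r) < P) by (apply Rabs_lt_between; unfold P; lra).
  destruct (JS_cont_neg P (2 * INR r) T Hb HT) as [J [HJ EX]]. fold X in EX.
  set (s := P / T) in *. assert (Hs : 0 < s) by now apply Rdiv_lt_0_compat.
  set (g := sqrt (4 * P / (PI * T))) in *.
  (* The prefactor cancels the Gaussian integral, which leaves the coefficients 1 and -1. *)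
  assert (Hg : sqrt (PI / s) / 2 * g = 1).
  { unfold g. replace (4 * P / (PI * T)) with (4 * / (PI / s)) by (unfold s; field; lra).
    assert (Hps : 0 < PI / s) by now apply Rdiv_lt_0_compat.
    rewrite sqrt_mult_alt by lra. rewrite sqrt_inv.
    replace (sqrt 4) with 2 by (replace 4 with (2 * 2) by ring; rewrite sqrt_square; lra).
    assert (0 < sqrt (PI / s)) by now apply sqrt_lt_R0. field. lra. }
  assert (HpT : 0 < 12 * INR p * T) by nra.
  split.
  - pose proof (re_part_limit (P - 2 * INR r) P s J Hb Hs HJ) as Q.
    apply (is_lim_seq_scal_l' _ _ g) in Q.
    rewrite EX, Re_scal. revert Q. apply is_lim_seq_ext. intros K.
    rewrite <- Rmult_assoc, (Rmult_comm g), Hg, Rmult_1_l. apply Rsum_ext. intros k _. unfold false_theta.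
    assert (Epow : forall m : nat, exp (- T / (12 * INR p)) ^ (m * m) = exp (- (INR m ^ 2 * T / (12 * INR p)))).
    { intros m. rewrite <- Rpower_pow by apply exp_pos. unfold Rpower. rewrite ln_exp. f_equal.
      rewrite mult_INR. field. lra. }
    rewrite !Epow. f_equal; f_equal; f_equal.
    + rewrite plus_INR, !mult_INR. replace (INR 12) with 12 by (simpl; ring). unfold s, P. field. lra.
    + rewrite plus_INR, minus_INR, !mult_INR by lia. replace (INR 12) with 12 by (simpl; ring). unfold s, P. field. lra.
  - pose proof (im_part_limit (P - 2 * INR r) P s J Hb Hs HJ) as Q.
    apply (is_lim_seq_scal_l' _ _ g) in Q.
    rewrite EX, Im_scal. revert Q. apply is_lim_seq_ext. intros n.
    assert (Hg2 : g * (PI / P) = sqrt (PI / T) / sqrt (3 * INR p)).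
    { unfold g. replace (4 * P / (PI * T)) with (PI / T * / (3 * INR p) * (P / PI) ^ 2) by (unfold P; field; lra).
      assert (0 < PI / T) by now apply Rdiv_lt_0_compat.
      assert (0 < P / PI) by now apply Rdiv_lt_0_compat.
      assert (0 < / (3 * INR p)) by (apply Rinv_0_lt_compat; lra).
      rewrite sqrt_mult_alt by nra. rewrite sqrt_mult_alt by lra. rewrite sqrt_inv, sqrt_pow2 by lra.
      assert (0 < sqrt (3 * INR p)) by (apply sqrt_lt_R0; lra).
      field. lra. }
    rewrite <- Hg2. rewrite <- Rmult_assoc, <- !Rsum_scal. apply Rsum_ext. intros m _. unfold residue_at.
    rewrite P_pole by auto. destruct (cos_nat_PI (S m)) as [Ec Es]. rewrite Ec.
    (* [sin (m PI - x) = - (-1)^m sin x]. The sign [(-1)^m] cancels against the cosine in the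
       residue; the minus sign ends up in front of the series. *)
    replace ((P - 2 * INR r) * pole P (S m)) with (INR (S m) * PI - 2 * INR r * pole P (S m))
      by (rewrite <- (P_pole P (S m) HP); ring).
    rewrite sin_minus, Ec, Es.
    assert (Epow : exp (- PI ^ 2 / (12 * INR p * T)) ^ (S m * S m) = exp (- s * pole P (S m) ^ 2)).
    { rewrite <- Rpower_pow by apply exp_pos. unfold Rpower. rewrite ln_exp. f_equal.
      rewrite mult_INR. unfold s, pole, P. field. lra. }
    rewrite Epow. replace (PI * INR r * INR (S m) / (6 * INR p)) with (2 * INR r * pole P (S m)) by (unfold pole, P; field; lra).
    pose proof (pow_m1_sqr (S m)). assert ((-1) ^ S m <> 0) by nra. field. lra.
Qed.

(** * The character identity *)

Definition odd_indicator (N r m : Z) : Z :=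
  ((if Z.eq_dec ((m - r) mod N) 0 then 1 else 0) - (if Z.eq_dec ((m + r) mod N) 0 then 1 else 0))%Z.

(** The four classes are half the parameters of the [JS] terms in [calL]. Oddness in the class
    replaces the factor [sign (6 j - p)] and the absolute value of the first parameter. *)
Definition chi (p j m : Z) : Z :=
  (odd_indicator (12 * p) (6 * j - p) m + odd_indicator (12 * p) (7 * p - 6 * j) m
   + odd_indicator (12 * p) (6 * j + p) m + odd_indicator (12 * p) (5 * p - 6 * j) m)%Z.

(** The Kronecker symbol [(12 / q)], the real primitive character modulo 12. *)
Definition chi12 (q : Z) : Z :=
  match (q mod 12)%Z with 1 | 11 => 1 | 5 | 7 => -1 | _ => 0 end%Z.

Lemma mod_0_divide (N a : Z) : (0 < N)%Z -> (a mod N = 0 <-> (N | a))%Z.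
Proof. intros H. apply Z.mod_divide. lia. Qed.

Lemma odd_indicator_opp N r m : (0 < N)%Z -> odd_indicator N r (- m) = (- odd_indicator N r m)%Z.
Proof.
  intros HN. unfold odd_indicator.
  assert (E1 : ((- m - r) mod N = 0 <-> (m + r) mod N = 0)%Z).
  { rewrite !mod_0_divide by auto. replace (- m - r)%Z with (- (m + r))%Z by ring. apply Z.divide_opp_r. }
  assert (E2 : ((- m + r) mod N = 0 <-> (m - r) mod N = 0)%Z).
  { rewrite !mod_0_divide by auto. replace (- m + r)%Z with (- (m - r))%Z by ring. apply Z.divide_opp_r. }
  repeat match goal with |- context [Z.eq_dec ?a ?b] => destruct (Z.eq_dec a b) end; try lia; tauto.
Qed.

Lemma odd_indicator_opp_r N r m : odd_indicator N (- r) m = (- odd_indicator N r m)%Z.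
Proof.
  unfold odd_indicator. replace (m - - r)%Z with (m + r)%Z by ring. replace (m + - r)%Z with (m - r)%Z by ring. lia.
Qed.

Lemma chi_opp p j m : (0 < p)%Z -> chi p j (- m) = (- chi p j m)%Z.
Proof. intros H. unfold chi. rewrite !odd_indicator_opp by lia. lia. Qed.

Lemma prime_divide_6 p k : prime p -> (5 <= p)%Z -> (p | 6 * k)%Z -> (p | k)%Z.
Proof.
  intros Hp H5 Hd. replace (6 * k)%Z with (2 * (3 * k))%Z in Hd by ring.
  apply prime_mult in Hd; auto. destruct Hd as [Hd|Hd]; [apply Z.divide_pos_le in Hd; lia|].
  apply prime_mult in Hd; auto. destruct Hd as [Hd|Hd]; [apply Z.divide_pos_le in Hd; lia|auto].
Qed.

Lemma prime_divide_12 p k : prime p -> (5 <= p)%Z -> (p | 12 * k)%Z -> (p | k)%Z.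
Proof.
  intros Hp H5 Hd. replace (12 * k)%Z with (6 * (2 * k))%Z in Hd by ring.
  apply prime_divide_6 in Hd; auto. apply prime_mult in Hd; auto. destruct Hd as [Hd|Hd]; auto.
  apply Z.divide_pos_le in Hd; lia.
Qed.

Lemma not_divide_range p k : (0 < k < p)%Z -> ~ (p | k)%Z.
Proof. intros H Hd. apply Z.divide_pos_le in Hd; lia. Qed.

(** Of the eight congruences at [m = 6 k + p q], four contain [12 k] and would force [p | 12 k]. The
    other four are conditions on [q] modulo 12: [q = 1] and [q = -1] with sign plus, [q = 5] and
    [q = 7] with sign minus. *)
Lemma chi_residue p k q : prime p -> (5 <= p)%Z -> (0 < k < p)%Z -> chi p k (6 * k + p * q) = chi12 q.
Proof.
  intros Hp H5 Hk.
  assert (Hnd : forall c, ~ (12 * p | 12 * k + p * c)%Z).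
  { intros c Hd. apply (not_divide_range p k Hk), prime_divide_12; auto.
    replace (12 * k)%Z with (12 * k + p * c - p * c)%Z by ring. apply Z.divide_sub_r; [|apply Z.divide_factor_l].
    eapply Z.divide_trans; [|exact Hd]. apply Z.divide_factor_r. }
  assert (Hdv : forall c, (12 * p | p * c)%Z <-> (c mod 12 = 0)%Z).
  { intros c. rewrite mod_0_divide by lia. rewrite (Z.mul_comm 12 p). apply Z.mul_divide_cancel_l. lia. }
  unfold chi, odd_indicator.
  replace (6 * k + p * q - (6 * k - p))%Z with (p * (q + 1))%Z by ring.
  replace (6 * k + p * q + (6 * k - p))%Z with (12 * k + p * (q - 1))%Z by ring.
  replace (6 * k + p * q - (7 * p - 6 * k))%Z with (12 * k + p * (q - 7))%Z by ring.
  replace (6 * k + p * q + (7 * p - 6 * k))%Z with (p * (q + 7))%Z by ring.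
  replace (6 * k + p * q - (6 * k + p))%Z with (p * (q - 1))%Z by ring.
  replace (6 * k + p * q + (6 * k + p))%Z with (12 * k + p * (q + 1))%Z by ring.
  replace (6 * k + p * q - (5 * p - 6 * k))%Z with (12 * k + p * (q - 5))%Z by ring.
  replace (6 * k + p * q + (5 * p - 6 * k))%Z with (p * (q + 5))%Z by ring.
  assert (Z1 : forall c, (if Z.eq_dec ((12 * k + p * c) mod (12 * p)) 0 then 1 else 0)%Z = 0%Z).
  { intros c. destruct (Z.eq_dec ((12 * k + p * c) mod (12 * p)) 0) as [E|]; auto.
    exfalso. apply mod_0_divide in E; [|lia]. now apply Hnd in E. }
  assert (Z2 : forall c, (if Z.eq_dec ((p * c) mod (12 * p)) 0 then 1 else 0)%Z = (if Z.eq_dec (c mod 12) 0 then 1 else 0)%Z).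
  { intros c. assert (E : ((p * c) mod (12 * p) = 0 <-> c mod 12 = 0)%Z) by (rewrite mod_0_divide by lia; apply Hdv).
    destruct (Z.eq_dec ((p * c) mod (12 * p)) 0), (Z.eq_dec (c mod 12) 0); tauto. }
  rewrite !Z1, !Z2. unfold chi12.
  pose proof (Z.mod_pos_bound q 12 ltac:(lia)) as Hq.
  assert (Hm : forall c, ((q + c) mod 12 = (q mod 12 + c) mod 12)%Z) by (intros; rewrite Zplus_mod_idemp_l; auto).
  replace (q - 1)%Z with (q + -1)%Z by ring. rewrite !Hm.
  set (r := (q mod 12)%Z) in *. clearbody r.
  assert (Hr : (r = 0 \/ r = 1 \/ r = 2 \/ r = 3 \/ r = 4 \/ r = 5 \/ r = 6 \/ r = 7 \/ r = 8 \/ r = 9 \/ r = 10 \/ r = 11)%Z) by lia.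
  destruct Hr as [->|[->|[->|[->|[->|[->|[->|[->|[->|[->|[->| ->]]]]]]]]]]]; reflexivity.
Qed.

Lemma chi_zero p k m : prime p -> (5 <= p)%Z -> chi p k m <> 0%Z -> (p | m - 6 * k)%Z \/ (p | m + 6 * k)%Z.
Proof.
  intros Hp H5 Hne.
  assert (K : forall r, odd_indicator (12 * p) r m <> 0%Z -> (p | m - r)%Z \/ (p | m + r)%Z).
  { intros r Hr. unfold odd_indicator in Hr.
    assert (D : (p | 12 * p)%Z) by apply Z.divide_factor_r.
    destruct (Z.eq_dec ((m - r) mod (12 * p)) 0) as [E|E].
    - left. apply mod_0_divide in E; [|lia]. now apply Z.divide_trans with (12 * p)%Z.
    - destruct (Z.eq_dec ((m + r) mod (12 * p)) 0) as [E'|E']; [|lia].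
      right. apply mod_0_divide in E'; [|lia]. now apply Z.divide_trans with (12 * p)%Z. }
  assert (T : forall a c, (p | a)%Z -> (p | a + p * c)%Z).
  { intros a c Ha. apply Z.divide_add_r; auto. apply Z.divide_factor_l. }
  unfold chi in Hne.
  destruct (Z.eq_dec (odd_indicator (12 * p) (6 * k - p) m) 0) as [E1|E1];
  [destruct (Z.eq_dec (odd_indicator (12 * p) (7 * p - 6 * k) m) 0) as [E2|E2];
  [destruct (Z.eq_dec (odd_indicator (12 * p) (6 * k + p) m) 0) as [E3|E3];
  [destruct (Z.eq_dec (odd_indicator (12 * p) (5 * p - 6 * k) m) 0) as [E4|E4]; [lia|]|]|]|].
  - apply K in E4. destruct E4 as [D|D]; [right; replace (m + 6 * k)%Z with (m - (5 * p - 6 * k) + p * 5)%Z by ring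
      |left; replace (m - 6 * k)%Z with (m + (5 * p - 6 * k) + p * -5)%Z by ring]; auto.
  - apply K in E3. destruct E3 as [D|D]; [left; replace (m - 6 * k)%Z with (m - (6 * k + p) + p * 1)%Z by ring
      |right; replace (m + 6 * k)%Z with (m + (6 * k + p) + p * -1)%Z by ring]; auto.
  - apply K in E2. destruct E2 as [D|D]; [right; replace (m + 6 * k)%Z with (m - (7 * p - 6 * k) + p * 7)%Z by ring
      |left; replace (m - 6 * k)%Z with (m + (7 * p - 6 * k) + p * -7)%Z by ring]; auto.
  - apply K in E1. destruct E1 as [D|D]; [left; replace (m - 6 * k)%Z with (m - (6 * k - p) + p * -1)%Z by ring
      |right; replace (m + 6 * k)%Z with (m + (6 * k - p) + p * 1)%Z by ring]; auto.
Qed.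

Definition sine_sum (p j m : Z) : R :=
  sin (PI * IZR (6 * j - p) * IZR m / (6 * IZR p)) + sin (PI * IZR (7 * p - 6 * j) * IZR m / (6 * IZR p))
  + sin (PI * IZR (6 * j + p) * IZR m / (6 * IZR p)) + sin (PI * IZR (5 * p - 6 * j) * IZR m / (6 * IZR p)).

Lemma cos_IZR_PI (n : Z) : sin (IZR n * PI) = 0 /\ cos (IZR n * PI) = if Z.even n then 1 else -1.
Proof.
  assert (K : forall k : Z, sin (IZR (2 * k) * PI) = 0 /\ cos (IZR (2 * k) * PI) = 1).
  { intros k. rewrite mult_IZR. replace (2 * IZR k * PI) with (2 * (IZR k * PI)) by ring.
    assert (Hs : sin (IZR k * PI) = 0) by (apply sin_eq_0_1; now exists k).
    rewrite sin_2a, cos_2a_sin, Hs. split; ring. }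
  destruct (Z.even n) eqn:E.
  - apply Z.even_spec in E. destruct E as [k ->]. apply K.
  - assert (O : Z.odd n = true) by (rewrite <- Z.negb_even, E; auto). apply Z.odd_spec in O. destruct O as [k ->].
    rewrite plus_IZR. replace ((IZR (2 * k) + 1) * PI) with (IZR (2 * k) * PI + PI) by ring.
    rewrite neg_sin, neg_cos. destruct (K k) as [-> ->]. split; ring.
Qed.

(** With [A = PI j m / p] and [B = PI m / 6] the four angles are [A - B], [A + B] and their
    complements to [m PI]. For even [m] complementary terms cancel, for odd [m] they double. *)
Lemma sine_sum_formula p j m : (0 < p)%Z ->
  sine_sum p j m = if Z.even m then 0 else 4 * sin (PI * IZR j * IZR m / IZR p) * cos (PI * IZR m / 6).
Proof.
  intros Hp. assert (HpR : 0 < IZR p) by now apply IZR_lt. unfold sine_sum.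
  destruct (cos_IZR_PI m) as [Es Ec].
  set (A := PI * IZR j * IZR m / IZR p). set (B := PI * IZR m / 6).
  replace (PI * IZR (6 * j - p) * IZR m / (6 * IZR p)) with (A - B)
    by (unfold A, B; rewrite minus_IZR, mult_IZR; field; lra).
  replace (PI * IZR (7 * p - 6 * j) * IZR m / (6 * IZR p)) with (IZR m * PI - (A - B))
    by (unfold A, B; rewrite minus_IZR, !mult_IZR; field; lra).
  replace (PI * IZR (6 * j + p) * IZR m / (6 * IZR p)) with (A + B)
    by (unfold A, B; rewrite plus_IZR, mult_IZR; field; lra).
  replace (PI * IZR (5 * p - 6 * j) * IZR m / (6 * IZR p)) with (IZR m * PI - (A + B))
    by (unfold A, B; rewrite minus_IZR, !mult_IZR; field; lra).
  rewrite !(sin_minus (IZR m * PI)), Es, Ec, sin_plus, sin_minus. destruct (Z.even m); ring.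
Qed.

Lemma cos_chi12 (n : Z) : Z.even n = false -> cos (PI * IZR n / 6) = sqrt 3 / 2 * IZR (chi12 n).
Proof.
  intros Ho. unfold chi12.
  pose proof (Z.mod_pos_bound n 12 ltac:(lia)) as Hq. pose proof (Z.div_mod n 12 ltac:(lia)) as Hd.
  set (k := (n / 12)%Z) in *. set (r := (n mod 12)%Z) in *. clearbody k r. subst n.
  replace (PI * IZR (12 * k + r) / 6) with (PI * IZR r / 6 + IZR (2 * k) * PI)
    by (rewrite plus_IZR, !mult_IZR; field).
  rewrite cos_plus. destruct (cos_IZR_PI (2 * k)) as [-> ->].
  replace (Z.even (2 * k)) with true by (symmetry; apply Z.even_spec; exists k; ring).
  rewrite Z.even_add, Z.even_mul in Ho. simpl in Ho.
  assert (C6 := cos_PI6). assert (C2 := cos_PI2).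
  assert (Cp : forall x, cos (PI - x) = - cos x) by (intros; rewrite cos_minus, cos_PI, sin_PI; ring).
  assert (Cq : forall x, cos (PI + x) = - cos x) by (intros; rewrite cos_plus, cos_PI, sin_PI; ring).
  assert (Hr : (r = 0 \/ r = 1 \/ r = 2 \/ r = 3 \/ r = 4 \/ r = 5 \/ r = 6 \/ r = 7 \/ r = 8 \/ r = 9 \/ r = 10 \/ r = 11)%Z) by lia.
  destruct Hr as [->|[->|[->|[->|[->|[->|[->|[->|[->|[->|[->| ->]]]]]]]]]]]; simpl in Ho; try discriminate; simpl.
  - replace (PI * 1 / 6) with (PI / 6) by field. rewrite C6. ring.
  - replace (PI * 3 / 6) with (PI / 2) by field. rewrite C2. ring.
  - replace (PI * 5 / 6) with (PI - PI / 6) by field. rewrite Cp, C6. ring.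
  - replace (PI * 7 / 6) with (PI + PI / 6) by field. rewrite Cq, C6. ring.
  - replace (PI * 9 / 6) with (PI + PI / 2) by field. rewrite Cq, C2. ring.
  - replace (PI * 11 / 6) with (PI + (PI - PI / 6)) by field. rewrite Cq, Cp, C6. ring.
Qed.

Lemma chi12_mult a b : chi12 (a * b) = (chi12 a * chi12 b)%Z.
Proof.
  unfold chi12. rewrite Zmult_mod.
  pose proof (Z.mod_pos_bound a 12 ltac:(lia)) as Ha. pose proof (Z.mod_pos_bound b 12 ltac:(lia)) as Hb.
  set (r := (a mod 12)%Z) in *. set (q := (b mod 12)%Z) in *. clearbody r q.
  assert (Hr : (r = 0 \/ r = 1 \/ r = 2 \/ r = 3 \/ r = 4 \/ r = 5 \/ r = 6 \/ r = 7 \/ r = 8 \/ r = 9 \/ r = 10 \/ r = 11)%Z) by lia.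
  assert (Hs : (q = 0 \/ q = 1 \/ q = 2 \/ q = 3 \/ q = 4 \/ q = 5 \/ q = 6 \/ q = 7 \/ q = 8 \/ q = 9 \/ q = 10 \/ q = 11)%Z) by lia.
  destruct Hr as [->|[->|[->|[->|[->|[->|[->|[->|[->|[->|[->| ->]]]]]]]]]]];
  destruct Hs as [->|[->|[->|[->|[->|[->|[->|[->|[->|[->|[->| ->]]]]]]]]]]]; reflexivity.
Qed.

Lemma pow_m1_mod2 n : (-1) ^ n = if Nat.even n then 1 else -1.
Proof.
  induction n; [reflexivity|]. simpl pow. rewrite IHn, Nat.even_succ, <- Nat.negb_even.
  destruct (Nat.even n); simpl; ring.
Qed.

(** This is the origin of the sign [(-1)^floor ((p + 3) / 6)] in the matrix: the value of the
    character at [p]. *)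
Lemma chi12_prime (p : nat) : prime (Z.of_nat p) -> (5 <= p)%nat ->
  IZR (chi12 (Z.of_nat p)) = (-1) ^ (Nat.div (p + 3) 6).
Proof.
  intros Hp H5. rewrite pow_m1_mod2. unfold chi12.
  assert (H2 : ~ (2 | Z.of_nat p)%Z).
  { intros D. apply prime_divisors in D; auto. lia. }
  assert (H3 : ~ (3 | Z.of_nat p)%Z).
  { intros D. apply prime_divisors in D; auto. lia. }
  pose proof (Nat.div_mod_eq p 12) as E. pose proof (Nat.mod_upper_bound p 12 ltac:(lia)) as Hr.
  set (q := (p / 12)%nat) in *. set (r := (p mod 12)%nat) in *. clearbody q r.
  assert (Em : (Z.of_nat p mod 12 = Z.of_nat r)%Z).
  { rewrite E, Nat2Z.inj_add, Nat2Z.inj_mul. change (Z.of_nat 12) with 12%Z.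
    rewrite Z.add_comm, Z.mul_comm, Z.mod_add by lia. apply Z.mod_small. lia. }
  rewrite Em.
  assert (Ev : forall d, (d < 6)%nat -> forall c, (p + 3 = 6 * c + d)%nat -> (Nat.div (p + 3) 6 = c)%nat).
  { intros d Hd c Hc. rewrite Hc, Nat.mul_comm, Nat.div_add_l by lia. rewrite Nat.div_small by lia. lia. }
  assert (Evq : forall c, Nat.even (2 * q + c) = Nat.even c).
  { intros c. rewrite Nat.even_add, Nat.even_mul. simpl. destruct (Nat.even c); auto. }
  assert (D2 : forall c, r = (2 * c)%nat -> False).
  { intros c Hc. apply H2. exists (Z.of_nat (6 * q + c)). lia. }
  assert (D3 : forall c, r = (3 * c)%nat -> False).
  { intros c Hc. apply H3. exists (Z.of_nat (4 * q + c)). lia. }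
  assert (Hc : (r = 1 \/ r = 5 \/ r = 7 \/ r = 11)%nat).
  { destruct (Nat.eq_dec r 0); [exfalso; apply (D2 0%nat); lia|].
    destruct (Nat.eq_dec r 2); [exfalso; apply (D2 1%nat); lia|].
    destruct (Nat.eq_dec r 3); [exfalso; apply (D3 1%nat); lia|].
    destruct (Nat.eq_dec r 4); [exfalso; apply (D2 2%nat); lia|].
    destruct (Nat.eq_dec r 6); [exfalso; apply (D2 3%nat); lia|].
    destruct (Nat.eq_dec r 8); [exfalso; apply (D2 4%nat); lia|].
    destruct (Nat.eq_dec r 9); [exfalso; apply (D3 3%nat); lia|].
    destruct (Nat.eq_dec r 10); [exfalso; apply (D2 5%nat); lia|]. lia. }
  destruct Hc as [->|[->|[->| ->]]].
  - rewrite (Ev 4%nat ltac:(lia) (2 * q + 0)%nat) by lia. rewrite Evq. reflexivity.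
  - rewrite (Ev 2%nat ltac:(lia) (2 * q + 1)%nat) by lia. rewrite Evq. reflexivity.
  - rewrite (Ev 4%nat ltac:(lia) (2 * q + 1)%nat) by lia. rewrite Evq. reflexivity.
  - rewrite (Ev 2%nat ltac:(lia) (2 * q + 2)%nat) by lia. rewrite Evq. reflexivity.
Qed.

Lemma sine_sum_opp p j m : sine_sum p j (- m) = - sine_sum p j m.
Proof.
  unfold sine_sum. rewrite opp_IZR.
  assert (K : forall a c, PI * a * - IZR m / c = - (PI * a * IZR m / c)) by (intros; unfold Rdiv; ring).
  rewrite !K, !sin_neg. ring.
Qed.

Lemma chi12_even q : Z.even q = true -> chi12 q = 0%Z.
Proof.
  intros E. apply Z.even_spec in E. destruct E as [c ->]. unfold chi12.
  pose proof (Z.mod_pos_bound (2 * c) 12 ltac:(lia)) as Hb. pose proof (Z.div_mod (2 * c) 12 ltac:(lia)) as Hd.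
  set (r := (2 * c mod 12)%Z) in *. set (k := (2 * c / 12)%Z) in *. clearbody r k.
  assert (Hr : (r = 0 \/ r = 2 \/ r = 4 \/ r = 6 \/ r = 8 \/ r = 10)%Z) by lia.
  destruct Hr as [->|[->|[->|[->|[->| ->]]]]]; reflexivity.
Qed.

(** For [m = 6 k + p q] with [q] odd, [PI j m / p] is the angle in [Mmat] plus [j q PI], and
    [PI m / 6] is [PI p q / 6] plus [k PI]. The shifts give [(-1)^(j + k)], the cosine gives
    [chi12 p * chi12 q]; for [q] even both sides vanish. *)
Lemma character_term (p j k : nat) (q : Z) : prime (Z.of_nat p) -> (5 <= p)%nat -> (0 < k < p)%nat ->
  Mmat p j k * IZR (chi (Z.of_nat p) (Z.of_nat k) (6 * Z.of_nat k + Z.of_nat p * q))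
  = sine_sum (Z.of_nat p) (Z.of_nat j) (6 * Z.of_nat k + Z.of_nat p * q) / sqrt (3 * INR p).
Proof.
  intros Hp H5 Hk. rewrite chi_residue by (auto; lia). rewrite sine_sum_formula by lia.
  assert (Hodd : Z.even (Z.of_nat p) = false).
  { destruct (Z.even (Z.of_nat p)) eqn:E; auto. exfalso. apply Z.even_spec in E. destruct E as [c Hc].
    assert (D : (2 | Z.of_nat p)%Z) by (exists c; lia). apply prime_divisors in D; auto. lia. }
  assert (Em : Z.even (6 * Z.of_nat k + Z.of_nat p * q) = Z.even q).
  { rewrite Z.even_add, !Z.even_mul, Hodd. simpl. destruct (Z.even q); auto. }
  rewrite Em. destruct (Z.even q) eqn:Eq.
  - rewrite chi12_even by auto. simpl. unfold Rdiv. ring.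
  - assert (HpR : 0 < INR p) by (apply lt_0_INR; lia).
    rewrite <- !INR_IZR_INZ.
    replace (PI * INR j * IZR (6 * Z.of_nat k + Z.of_nat p * q) / INR p)
      with (6 * PI * INR j * INR k / INR p + IZR (Z.of_nat j * q) * PI)
      by (rewrite plus_IZR, !mult_IZR, <- !INR_IZR_INZ; field; lra).
    replace (PI * IZR (6 * Z.of_nat k + Z.of_nat p * q) / 6)
      with (PI * IZR (Z.of_nat p * q) / 6 + IZR (Z.of_nat k) * PI)
      by (rewrite plus_IZR, !mult_IZR, <- !INR_IZR_INZ; field).
    rewrite sin_plus, cos_plus.
    destruct (cos_IZR_PI (Z.of_nat j * q)) as [-> ->]. destruct (cos_IZR_PI (Z.of_nat k)) as [-> ->].
    rewrite cos_chi12 by (rewrite Z.even_mul, Hodd, Eq; auto).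
    rewrite chi12_mult, mult_IZR, chi12_prime by auto.
    rewrite Z.even_mul, Eq, Bool.orb_false_r.
    assert (Ev : forall n : nat, (if Z.even (Z.of_nat n) then 1 else -1) = (-1) ^ n).
    { intros n. rewrite pow_m1_mod2.
      replace (Z.even (Z.of_nat n)) with (Nat.even n); auto.
      destruct (Nat.even n) eqn:En.
      - apply Nat.even_spec in En. destruct En as [c ->]. symmetry. apply Z.even_spec. exists (Z.of_nat c). lia.
      - destruct (Z.even (Z.of_nat n)) eqn:En2; auto. apply Z.even_spec in En2. destruct En2 as [c Hc].
        assert (E2 : Nat.even n = true) by (apply Nat.even_spec; exists (Z.to_nat c); lia). congruence. }
    rewrite !Ev. unfold Mmat. rewrite !pow_add. rewrite sqrt_mult_alt by lra.
    assert (0 < sqrt 3) by (apply sqrt_lt_R0; lra). assert (0 < sqrt (INR p)) by (now apply sqrt_lt_R0).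
    field. lra.
Qed.

Lemma Rsum_zero u n : (forall i, (i < n)%nat -> u i = 0) -> Rsum u n = 0.
Proof. induction n; intros H; simpl; auto. rewrite IHn, H; auto. ring. Qed.

Lemma Rsum_single u n i0 : (i0 < n)%nat -> (forall i, (i < n)%nat -> i <> i0 -> u i = 0) -> Rsum u n = u i0.
Proof.
  induction n as [|n IH]; intros Hi H; [lia|]. simpl. destruct (Nat.eq_dec i0 n) as [->|Hne].
  - rewrite Rsum_zero; [ring|]. intros i Hin. apply H; lia.
  - rewrite IH; [|lia|intros; apply H; lia]. rewrite (H n) by lia. ring.
Qed.

(** 6 is invertible modulo [p], so [m = 6 x] for a nonzero residue [x]; either [x] or [p - x] lies
    in the lower half. *)
Lemma half_system (p : Z) (m : Z) : prime p -> (5 <= p)%Z -> ~ (p | m)%Z ->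
  exists k, (1 <= k <= (p - 1) / 2)%Z /\ ((p | m - 6 * k)%Z \/ (p | m + 6 * k)%Z).
Proof.
  intros Hp H5 Hm.
  assert (R : rel_prime 6 p).
  { apply rel_prime_sym. apply prime_rel_prime; auto. intros D.
    replace 6%Z with (6 * 1)%Z in D by ring. apply prime_divide_6 in D; auto.
    apply Z.divide_pos_le in D; lia. }
  apply rel_prime_bezout in R. destruct R as [u v Huv].
  set (x := ((m * u) mod p)%Z).
  pose proof (Z.mod_pos_bound (m * u) p ltac:(lia)) as Hx. fold x in Hx.
  pose proof (Z.div_mod (m * u) p ltac:(lia)) as Hd. fold x in Hd. set (d := (m * u / p)%Z) in *.
  assert (E : (m - 6 * x = p * (v * m + 6 * d))%Z).
  { replace m with (m * (u * 6 + v * p))%Z at 1 by (rewrite Huv; ring).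
    replace (m * (u * 6 + v * p))%Z with (6 * (m * u) + m * v * p)%Z by ring. rewrite Hd. ring. }
  assert (Hx0 : x <> 0%Z).
  { intros Z. apply Hm. exists (v * m + 6 * d)%Z. lia. }
  assert (Hodd : (p mod 2 = 1)%Z).
  { pose proof (Z.mod_pos_bound p 2 ltac:(lia)). destruct (Z.eq_dec (p mod 2) 0) as [E0|]; [|lia].
    apply mod_0_divide in E0; [|lia]. apply prime_divisors in E0; auto. lia. }
  pose proof (Z.div_mod p 2 ltac:(lia)) as Hp2.
  assert (Hh : ((p - 1) / 2 = p / 2)%Z).
  { symmetry. apply Z.div_unique with 0%Z; lia. }
  destruct (Z_le_gt_dec x ((p - 1) / 2)).
  - exists x. split; [lia|]. left. exists (v * m + 6 * d)%Z. lia.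
  - exists (p - x)%Z. split; [lia|]. right. exists (v * m + 6 * d + 6)%Z. lia.
Qed.

Lemma half_system_unique (p m k k' : Z) : prime p -> (5 <= p)%Z ->
  (1 <= k <= (p - 1) / 2)%Z -> (1 <= k' <= (p - 1) / 2)%Z ->
  (p | m - 6 * k)%Z \/ (p | m + 6 * k)%Z -> (p | m - 6 * k')%Z \/ (p | m + 6 * k')%Z -> k = k'.
Proof.
  intros Hp H5 Hk Hk' D D'.
  pose proof (Z.div_mod (p - 1) 2 ltac:(lia)) as Hp2. pose proof (Z.mod_pos_bound (p - 1) 2 ltac:(lia)).
  assert (K : (p | k - k')%Z \/ (p | k + k')%Z).
  { destruct D as [D|D], D' as [D'|D'].
    - left. apply prime_divide_6; auto. replace (6 * (k - k'))%Z with ((m - 6 * k') - (m - 6 * k))%Z by ring. now apply Z.divide_sub_r.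
    - right. apply prime_divide_6; auto. replace (6 * (k + k'))%Z with ((m + 6 * k') - (m - 6 * k))%Z by ring. now apply Z.divide_sub_r.
    - right. apply prime_divide_6; auto. replace (6 * (k + k'))%Z with ((m + 6 * k) - (m - 6 * k'))%Z by ring. now apply Z.divide_sub_r.
    - left. apply prime_divide_6; auto. replace (6 * (k - k'))%Z with ((m + 6 * k) - (m + 6 * k'))%Z by ring. now apply Z.divide_sub_r. }
  destruct K as [[c Hc]|[c Hc]].
  - assert (c = 0)%Z by nia. lia.
  - assert (0 < c)%Z by nia. nia.
Qed.

Lemma ell_Z (p : nat) : (1 <= p)%nat -> Z.of_nat (ell p) = ((Z.of_nat p - 1) / 2)%Z.
Proof. intros H. unfold ell. rewrite Nat2Z.inj_div, Nat2Z.inj_sub by auto. reflexivity. Qed.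

(** If [p] does not divide [m], exactly one [k] satisfies [m = 6 k] or [m = - 6 k] modulo [p], and
    the sum has a single term; oddness reduces the second case to the first. If [p] divides [m],
    every term vanishes, and so does [sin (PI j m / p)]. *)
Lemma character_sum (p j : nat) (m : Z) : prime (Z.of_nat p) -> (5 <= p)%nat ->
  Rsum (fun i => Mmat p j (S i) * IZR (chi (Z.of_nat p) (Z.of_nat (S i)) m)) (ell p)
  = sine_sum (Z.of_nat p) (Z.of_nat j) m / sqrt (3 * INR p).
Proof.
  intros Hp H5. pose proof (ell_Z p ltac:(lia)) as Hl.
  set (P := Z.of_nat p) in *. assert (HP5 : (5 <= P)%Z) by (unfold P; lia).
  pose proof (Z.div_mod (P - 1) 2 ltac:(lia)) as Hp2. pose proof (Z.mod_pos_bound (P - 1) 2 ltac:(lia)).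
  destruct (Zdivide_dec P m) as [D|D].
  - rewrite Rsum_zero.
    + destruct D as [c ->]. rewrite sine_sum_formula by lia.
      replace (PI * IZR (Z.of_nat j) * IZR (c * P) / IZR P) with (IZR (Z.of_nat j * c) * PI)
        by (rewrite !mult_IZR; field; apply not_0_IZR; lia).
      rewrite (proj1 (cos_IZR_PI _)). destruct (Z.even (c * P)); unfold Rdiv; ring.
    + intros i Hi. destruct (Z.eq_dec (chi P (Z.of_nat (S i)) m) 0) as [->|Hne]; [ring|].
      exfalso. apply chi_zero in Hne; auto.
      assert (Dk : (P | Z.of_nat (S i))%Z).
      { apply prime_divide_6; auto. destruct Hne as [E|E].
        - replace (6 * Z.of_nat (S i))%Z with (m - (m - 6 * Z.of_nat (S i)))%Z by ring. now apply Z.divide_sub_r.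
        - replace (6 * Z.of_nat (S i))%Z with ((m + 6 * Z.of_nat (S i)) - m)%Z by ring. now apply Z.divide_sub_r. }
      revert Dk. apply not_divide_range. lia.
  - destruct (half_system P m Hp HP5 D) as [k [Hk Dk]].
    rewrite (Rsum_single _ _ (Z.to_nat (k - 1))).
    + replace (S (Z.to_nat (k - 1))) with (Z.to_nat k) by lia.
      destruct Dk as [[c Hc]|[c Hc]].
      * replace m with (6 * Z.of_nat (Z.to_nat k) + Z.of_nat p * c)%Z by (rewrite Z2Nat.id by lia; fold P; lia).
        apply character_term; auto. lia.
      * replace m with (- (6 * Z.of_nat (Z.to_nat k) + Z.of_nat p * (- c)))%Z by (rewrite Z2Nat.id by lia; fold P; lia).
        unfold P. rewrite chi_opp by lia. rewrite sine_sum_opp, opp_IZR.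
        rewrite Ropp_mult_distr_r_reverse, character_term by (auto; lia). unfold Rdiv. ring.
    + lia.
    + intros i Hi Hne. destruct (Z.eq_dec (chi P (Z.of_nat (S i)) m) 0) as [->|Hnz]; [ring|].
      exfalso. apply chi_zero in Hnz; auto. apply Hne.
      assert (k = Z.of_nat (S i)) by (apply (half_system_unique P m); auto; lia). lia.
Qed.

(** * Sums over full periods *)

Lemma Rsum_add u a b : Rsum u (a + b) = Rsum u a + Rsum (fun i => u (a + i)%nat) b.
Proof.
  induction b; simpl; [rewrite Nat.add_0_r; ring|]. rewrite Nat.add_succ_r. simpl. rewrite IHb. ring.
Qed.

Lemma Rsum_indicator (f : nat -> R) (N r : nat) : (r < N)%nat ->
  Rsum (fun i => (if Nat.eq_dec i r then 1 else 0) * f i) N = f r.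
Proof.
  intros Hr. rewrite (Rsum_single _ N r); auto.
  - destruct (Nat.eq_dec r r); [ring|tauto].
  - intros i Hi Hne. destruct (Nat.eq_dec i r); [tauto|ring].
Qed.

Lemma odd_indicator_block (N r K i : nat) : (0 < r < N)%nat -> (i < N)%nat ->
  IZR (odd_indicator (Z.of_nat N) (Z.of_nat r) (Z.of_nat (N * K + i)))
  = (if Nat.eq_dec i r then 1 else 0) - (if Nat.eq_dec i (N - r) then 1 else 0).
Proof.
  intros Hr Hi. unfold odd_indicator. rewrite minus_IZR.
  assert (E1 : ((Z.of_nat (N * K + i) - Z.of_nat r) mod Z.of_nat N = 0 <-> i = r)%Z).
  { rewrite mod_0_divide by lia. split.
    - intros [c Hc]. assert (Z.of_nat i - Z.of_nat r = (c - Z.of_nat K) * Z.of_nat N)%Z by lia.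
      assert (c - Z.of_nat K = 0)%Z by nia. lia.
    - intros ->. exists (Z.of_nat K). lia. }
  assert (E2 : ((Z.of_nat (N * K + i) + Z.of_nat r) mod Z.of_nat N = 0 <-> i = (N - r)%nat)%Z).
  { rewrite mod_0_divide by lia. split.
    - intros [c Hc]. assert (Z.of_nat i + Z.of_nat r = (c - Z.of_nat K) * Z.of_nat N)%Z by lia.
      assert (c - Z.of_nat K = 1)%Z by nia. lia.
    - intros ->. exists (Z.of_nat K + 1)%Z. lia. }
  destruct (Z.eq_dec ((Z.of_nat (N * K + i) - Z.of_nat r) mod Z.of_nat N) 0), (Nat.eq_dec i r); try tauto;
  destruct (Z.eq_dec ((Z.of_nat (N * K + i) + Z.of_nat r) mod Z.of_nat N) 0), (Nat.eq_dec i (N - r)); tauto.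
Qed.

(** A period of length [N] contains one index congruent to [r] and one congruent to [- r]. This
    matches partial sums of a false theta series with sums over full periods. *)
Lemma Rsum_odd_indicator (N r K : nat) (f : nat -> R) : (0 < r < N)%nat ->
  Rsum (fun m => IZR (odd_indicator (Z.of_nat N) (Z.of_nat r) (Z.of_nat m)) * f m) (N * K)
  = Rsum (fun k => f (r + N * k)%nat - f (N - r + N * k)%nat) K.
Proof.
  intros Hr. induction K as [|K IH]; [rewrite Nat.mul_0_r; reflexivity|].
  rewrite Nat.mul_succ_r, Rsum_add, IH. simpl. f_equal.
  rewrite (Rsum_ext _ (fun i => (if Nat.eq_dec i r then 1 else 0) * f (N * K + i)%nat
     + (-1) * ((if Nat.eq_dec i (N - r) then 1 else 0) * f (N * K + i)%nat))).
  - rewrite Rsum_plus_fun, Rsum_scal.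
    rewrite (Rsum_indicator (fun i => f (N * K + i)%nat)) by lia.
    rewrite (Rsum_indicator (fun i => f (N * K + i)%nat)) by lia.
    rewrite (Nat.add_comm (N * K) r), (Nat.add_comm (N * K) (N - r)). ring.
  - intros i Hi. rewrite odd_indicator_block by auto. ring.
Qed.

(** * The solution on the negative axis *)

(** The false theta series, the sum of [chi p j m * x^(m^2)], as an ordinary power series; its
    exponents are squares. *)
Definition coef (p j n : nat) : R :=
  if Nat.eq_dec (Nat.sqrt n * Nat.sqrt n) n then IZR (chi (Z.of_nat p) (Z.of_nat j) (Z.of_nat (Nat.sqrt n))) else 0.

Lemma coef_square p j m : coef p j (m * m) = IZR (chi (Z.of_nat p) (Z.of_nat j) (Z.of_nat m)).
Proof. unfold coef. rewrite Nat.sqrt_square. destruct (Nat.eq_dec (m * m) (m * m)); tauto. Qed.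

Lemma coef_nonsquare p j M i : (0 < i < 2 * M + 1)%nat -> coef p j (M * M + i) = 0.
Proof.
  intros Hi. unfold coef. assert (E : Nat.sqrt (M * M + i) = M) by (apply Nat.sqrt_unique; lia).
  rewrite E. destruct (Nat.eq_dec (M * M) (M * M + i)); [lia|auto].
Qed.

Lemma Rsum_coef p j (y : nat -> R) M :
  Rsum (fun n => coef p j n * y n) (M * M)
  = Rsum (fun m => IZR (chi (Z.of_nat p) (Z.of_nat j) (Z.of_nat m)) * y (m * m)%nat) M.
Proof.
  induction M as [|M IH]; [reflexivity|].
  replace (S M * S M)%nat with (M * M + S (2 * M))%nat by lia.
  rewrite Rsum_add, IH. simpl Rsum at 3. f_equal.
  rewrite (Rsum_single _ _ 0%nat); [|lia|].
  - rewrite Nat.add_0_r, coef_square. reflexivity.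
  - intros i Hi Hne. rewrite coef_nonsquare by lia. ring.
Qed.

Lemma coef_bound p j n : Rabs (coef p j n) <= 4.
Proof.
  unfold coef. destruct (Nat.eq_dec _ _); [|rewrite Rabs_R0; lra].
  rewrite <- abs_IZR. apply IZR_le. unfold chi, odd_indicator.
  repeat match goal with |- context [Z.eq_dec ?a ?b] => destruct (Z.eq_dec a b) end; simpl; lia.
Qed.

Definition theta (p j : nat) (x : R) : R := Series (fun n => coef p j n * x ^ n).

Lemma ex_series_coef p j x : Rabs x < 1 -> ex_series (fun n => Rabs (coef p j n * x ^ n)).
Proof.
  intros Hx. apply (ex_series_le (V := R_CompleteNormedModule) _ (fun n => 4 * Rabs x ^ n)).
  - intros n. unfold norm; simpl. unfold abs; simpl. rewrite Rabs_Rabsolu, Rabs_mult, <- RPow_abs.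
    apply Rmult_le_compat_r; [apply pow_le, Rabs_pos|apply coef_bound].
  - apply (ex_series_scal (V := R_NormedModule) 4). apply ex_series_geom. now rewrite Rabs_Rabsolu.
Qed.

Lemma sum_n_Rsum (u : nat -> R) n : sum_n u n = Rsum u (S n).
Proof.
  induction n; [rewrite sum_O; simpl; ring|]. rewrite sum_Sn, IHn. reflexivity.
Qed.

Lemma theta_limit p j x : Rabs x < 1 ->
  is_lim_seq (Rsum (fun n => coef p j n * x ^ n)) (theta p j x).
Proof.
  intros Hx. apply is_lim_seq_incr_1.
  apply (is_lim_seq_ext (sum_n (fun n => coef p j n * x ^ n))); [intros; apply sum_n_Rsum|].
  apply Series_correct. apply ex_series_Rabs, ex_series_coef, Hx.
Qed.

Lemma filterlim_square : filterlim (fun M : nat => (M * M)%nat) eventually eventually.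
Proof. intros Q [N HN]. exists N. intros n Hn. apply HN. nia. Qed.

Lemma theta_limit_square p j x : Rabs x < 1 ->
  is_lim_seq (Rsum (fun m => IZR (chi (Z.of_nat p) (Z.of_nat j) (Z.of_nat m)) * x ^ (m * m))) (theta p j x).
Proof.
  intros Hx. pose proof (is_lim_seq_subseq _ _ _ filterlim_square (theta_limit p j x Hx)) as Q.
  revert Q. apply is_lim_seq_ext. intros M. apply (Rsum_coef p j (fun n => x ^ n)).
Qed.

Definition calL_cont (p j : nat) (t : C) : C :=
  let P := INR p in let J := INR j in
  (RtoC (sign (6 * J - P)) * JS_cont (12 * P) (Rabs (12 * J - 2 * P)) t
   + JS_cont (12 * P) (14 * P - 12 * J) t + JS_cont (12 * P) (12 * J + 2 * P) t
   + JS_cont (12 * P) (10 * P - 12 * J) t)%C.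

(** [6 j = p] is impossible for an odd prime, so the sign is 1 or -1 and [r1 = |6 j - p|] is
    positive. The last clause prepares the absorption of the sign by oddness; [6 j <= 3 p] keeps the
    subtractions in [nat] exact. *)
Lemma range_params (p j : nat) : prime (Z.of_nat p) -> (5 <= p)%nat -> in_range p j ->
  exists r1 : nat, (0 < r1 < 12 * p)%nat /\ (0 < 7 * p - 6 * j < 12 * p)%nat /\ (0 < 6 * j + p < 12 * p)%nat /\
    (0 < 5 * p - 6 * j < 12 * p)%nat /\ (6 * j <= 3 * p)%nat /\
    Rabs (12 * INR j - 2 * INR p) = 2 * INR r1 /\
    14 * INR p - 12 * INR j = 2 * INR (7 * p - 6 * j) /\
    12 * INR j + 2 * INR p = 2 * INR (6 * j + p) /\
    10 * INR p - 12 * INR j = 2 * INR (5 * p - 6 * j) /\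
    ((sign (6 * INR j - INR p) = 1 /\ Z.of_nat r1 = (6 * Z.of_nat j - Z.of_nat p)%Z) \/
     (sign (6 * INR j - INR p) = -1 /\ Z.of_nat r1 = (- (6 * Z.of_nat j - Z.of_nat p))%Z)).
Proof.
  intros Hp H5 [Hj1 Hj2].
  assert (Hl : (2 * ell p <= p - 1)%nat).
  { unfold ell. pose proof (Nat.div_mod_eq (p - 1) 2). lia. }
  assert (Hne : (6 * j <> p)%nat).
  { intros E. assert (D : (2 | Z.of_nat p)%Z) by (exists (Z.of_nat (3 * j)); lia).
    apply prime_divisors in D; auto. lia. }
  exists (Z.abs_nat (6 * Z.of_nat j - Z.of_nat p)).
  assert (ER : forall n : nat, INR n = IZR (Z.of_nat n)) by (intros; apply INR_IZR_INZ).
  split; [lia|]. split; [lia|]. split; [lia|]. split; [lia|]. split; [lia|].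
  split; [|split; [|split; [|split]]].
  - rewrite (ER (Z.abs_nat _)), Zabs2Nat.id_abs, abs_IZR, minus_IZR, mult_IZR, <- !ER.
    rewrite <- (Rabs_pos_eq 2) at 2 by lra. rewrite <- Rabs_mult. f_equal. ring.
  - rewrite minus_INR, !mult_INR by lia. simpl. ring.
  - rewrite plus_INR, !mult_INR. simpl. ring.
  - rewrite minus_INR, !mult_INR by lia. simpl. ring.
  - assert (E6 : 6 * INR j - INR p = IZR (6 * Z.of_nat j - Z.of_nat p)) by (rewrite minus_IZR, mult_IZR, <- !ER; ring).
    destruct (Z_lt_le_dec (Z.of_nat p) (6 * Z.of_nat j)).
    + left. split; [|lia]. apply sign_eq_1. rewrite E6. apply IZR_lt. lia.
    + right. split; [|lia]. apply sign_eq_m1. rewrite E6. apply IZR_lt. lia.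
Qed.

Lemma JS_param_bound (p r : nat) : (0 < r < 12 * p)%nat -> Rabs (12 * INR p - 2 * INR r) < 12 * INR p.
Proof.
  intros H. assert (0 < INR r) by (apply lt_0_INR; lia).
  assert (INR r < 12 * INR p).
  { replace (12 * INR p) with (INR (12 * p)) by (rewrite mult_INR; simpl; ring). apply lt_INR. lia. }
  apply Rabs_lt_between. lra.
Qed.

Lemma calL_cont_is_continuation (p j : nat) : prime (Z.of_nat p) -> (5 <= p)%nat -> in_range p j ->
  is_continuation Upper (calL p j) (calL_cont p j).
Proof.
  intros Hp H5 Hj. destruct (range_params p j Hp H5 Hj) as [r1 [H1 [H2 [H3 [H4 [_ [E1 [E2 [E3 [E4 _]]]]]]]]]].
  split.
  - intros t Ht. apply ex_derive_chol. unfold calL_cont. rewrite E1, E2, E3, E4.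
    repeat apply chol_plus; try (apply chol_JS_cont; auto using JS_param_bound).
    apply chol_mult; [apply chol_const|]. apply chol_JS_cont; auto using JS_param_bound.
  - intros t Ht. unfold calL_cont, calL. rewrite E1, E2, E3, E4.
    rewrite !JS_cont_eq by auto using JS_param_bound.
    replace (4 * (12 * INR p) / PI) with (48 * INR p / PI) by (field; apply PI_neq0). ring.
Qed.

Lemma is_lim_seq_plus_R (u v : nat -> R) (a b : R) : is_lim_seq u a -> is_lim_seq v b ->
  is_lim_seq (fun n => u n + v n) (a + b).
Proof. intros Hu Hv. apply (is_lim_seq_plus' u v a b Hu Hv). Qed.

Lemma is_lim_seq_unique_R (u : nat -> R) (a b : R) : is_lim_seq u a -> is_lim_seq u b -> a = b.
Proof.
  intros Ha Hb. apply is_lim_seq_unique in Ha. apply is_lim_seq_unique in Hb.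
  rewrite Ha in Hb. now injection Hb.
Qed.

Lemma is_lim_seq_Rsum (c : nat -> R) (u : nat -> nat -> R) (l : nat -> R) n :
  (forall i, (i < n)%nat -> is_lim_seq (u i) (l i)) ->
  is_lim_seq (fun m => Rsum (fun i => c i * u i m) n) (Rsum (fun i => c i * l i) n).
Proof.
  induction n as [|n IH]; intros H; simpl; [apply is_lim_seq_const|].
  apply is_lim_seq_plus_R; [apply IH; auto|]. apply is_lim_seq_scal_l', H. lia.
Qed.

Lemma Rsum_exchange (f : nat -> nat -> R) n m :
  Rsum (fun i => Rsum (f i) m) n = Rsum (fun k => Rsum (fun i => f i k) n) m.
Proof.
  induction n; simpl.
  - symmetry. apply Rsum_zero. auto.
  - rewrite IHn, <- Rsum_plus_fun. reflexivity.
Qed.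

Lemma Rsum_shift u n : Rsum u (S n) = u 0%nat + Rsum (fun i => u (S i)) n.
Proof. induction n; [simpl; ring|]. change (Rsum u (S (S n))) with (Rsum u (S n) + u (S n)). rewrite IHn. simpl. ring. Qed.

Lemma chi_0 p j : (0 < p)%Z -> chi p j 0 = 0%Z.
Proof. intros H. pose proof (chi_opp p j 0 H) as E. simpl in E. lia. Qed.

Lemma exp_neg_Rabs x : x < 0 -> Rabs (exp x) < 1.
Proof. intros H. rewrite Rabs_pos_eq by (left; apply exp_pos). rewrite <- exp_0. now apply exp_increasing. Qed.

Lemma calL_cont_neg (p j : nat) (T : R) : prime (Z.of_nat p) -> (5 <= p)%nat -> in_range p j -> 0 < T ->
  calL_cont p j (RtoC (- T)) =
  (theta p j (exp (- T / (12 * INR p))),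
   - sqrt (PI / T) * Rsum (fun i => Mmat p j (S i) * theta p (S i) (exp (- PI ^ 2 / (12 * INR p * T)))) (ell p)).
Proof.
  intros Hp H5 Hj HT. pose proof PI_RGT_0 as HPI.
  destruct (range_params p j Hp H5 Hj) as [r1 [H1 [H2 [H3 [H4 [H6 [E1 [E2 [E3 [E4 Es]]]]]]]]]].
  assert (HpR : 0 < INR p) by (apply lt_0_INR; lia).
  destruct (JS_cont_neg_limits p r1 T H1 HT) as [L1 I1].
  destruct (JS_cont_neg_limits p _ T H2 HT) as [L2 I2].
  destruct (JS_cont_neg_limits p _ T H3 HT) as [L3 I3].
  destruct (JS_cont_neg_limits p _ T H4 HT) as [L4 I4].
  unfold calL_cont. rewrite E1, E2, E3, E4.
  set (x := exp (- T / (12 * INR p))) in *. set (y := exp (- PI ^ 2 / (12 * INR p * T))) in *.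
  set (X1 := JS_cont (12 * INR p) (2 * INR r1) (RtoC (- T))) in *.
  set (X2 := JS_cont (12 * INR p) (2 * INR (7 * p - 6 * j)) (RtoC (- T))) in *.
  set (X3 := JS_cont (12 * INR p) (2 * INR (6 * j + p)) (RtoC (- T))) in *.
  set (X4 := JS_cont (12 * INR p) (2 * INR (5 * p - 6 * j)) (RtoC (- T))) in *.
  set (sg := sign (6 * INR j - INR p)) in *.
  assert (Hx : Rabs x < 1).
  { apply exp_neg_Rabs. unfold Rdiv. apply Rmult_neg_pos; [lra|]. apply Rinv_0_lt_compat; lra. }
  assert (Hy : Rabs y < 1).
  { apply exp_neg_Rabs. unfold Rdiv. apply Rmult_neg_pos.
    - pose proof (pow_lt PI 2 HPI). lra.
    - apply Rinv_0_lt_compat. nra. }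
  replace (RtoC sg * X1 + X2 + X3 + X4)%C with
    (sg * Re X1 + Re X2 + Re X3 + Re X4, sg * Im X1 + Im X2 + Im X3 + Im X4)
    by (apply injective_projections; unfold Re, Im; simpl; ring).
  f_equal.
  - pose proof (is_lim_seq_plus_R _ _ _ _ (is_lim_seq_plus_R _ _ _ _ (is_lim_seq_plus_R _ _ _ _
      (is_lim_seq_scal_l' _ _ sg L1) L2) L3) L4) as L. cbv beta in L.
    refine (is_lim_seq_unique_R _ _ _ L _).
    (* [K] terms of the four series make up the sum over [m < 12 p K], so the limit is taken along
       this subsequence. *)
    assert (Hf : filterlim (fun K : nat => (12 * p * K)%nat) eventually eventually).
    { intros Q [N HN]. exists N. intros n Hn. apply HN. nia. }
    pose proof (is_lim_seq_subseq _ _ _ Hf (theta_limit_square p j x Hx)) as Q.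
    revert Q. apply is_lim_seq_ext. intros K.
    rewrite <- !(Rsum_odd_indicator (12 * p) _ K (fun n => x ^ (n * n))) by auto.
    rewrite <- Rsum_scal, <- !Rsum_plus_fun. apply Rsum_ext. intros m _.
    unfold chi. rewrite !plus_IZR.
    replace (Z.of_nat (12 * p)) with (12 * Z.of_nat p)%Z by lia.
    replace (Z.of_nat (7 * p - 6 * j)) with (7 * Z.of_nat p - 6 * Z.of_nat j)%Z by lia.
    replace (Z.of_nat (6 * j + p)) with (6 * Z.of_nat j + Z.of_nat p)%Z by lia.
    replace (Z.of_nat (5 * p - 6 * j)) with (5 * Z.of_nat p - 6 * Z.of_nat j)%Z by lia.
    destruct Es as [[-> ->]|[-> ->]]; [|rewrite odd_indicator_opp_r, opp_IZR]; ring.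
  - pose proof (is_lim_seq_plus_R _ _ _ _ (is_lim_seq_plus_R _ _ _ _ (is_lim_seq_plus_R _ _ _ _
      (is_lim_seq_scal_l' _ _ sg I1) I2) I3) I4) as L. cbv beta in L.
    refine (is_lim_seq_unique_R _ _ _ L _).
    pose proof (is_lim_seq_Rsum (fun i => Mmat p j (S i)) (fun i => Rsum (fun m => IZR (chi (Z.of_nat p) (Z.of_nat (S i)) (Z.of_nat m)) * y ^ (m * m)))
      (fun i => theta p (S i) y) (ell p) (fun i _ => theta_limit_square p (S i) y Hy)) as Q. cbv beta in Q.
    apply (is_lim_seq_scal_l' _ _ (- sqrt (PI / T))) in Q.
    (* The residues run over [m = 1, ..., n + 1], so the character sums are taken over [m < n + 2];
       their term at [m = 0] vanishes by [chi_0]. *)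
    apply is_lim_seq_incr_1 in Q. apply is_lim_seq_incr_1 in Q. revert Q. apply is_lim_seq_ext. intros n.
    set (g := sqrt (PI / T)).
    replace (Rsum (fun i => Mmat p j (S i) * Rsum (fun m => IZR (chi (Z.of_nat p) (Z.of_nat (S i)) (Z.of_nat m)) * y ^ (m * m)) (S (S n))) (ell p))
      with (Rsum (fun m => sine_sum (Z.of_nat p) (Z.of_nat j) (Z.of_nat (S m)) / sqrt (3 * INR p) * y ^ (S m * S m)) (S n)).
    + assert (Hs3 : 0 < sqrt (3 * INR p)) by (apply sqrt_lt_R0; lra).
      rewrite <- !Rsum_scal, <- !Rsum_plus_fun. apply Rsum_ext. intros m _. unfold sine_sum.
      rewrite <- !INR_IZR_INZ.
      replace (IZR (7 * Z.of_nat p - 6 * Z.of_nat j)) with (INR (7 * p - 6 * j)) by (rewrite INR_IZR_INZ; f_equal; lia).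
      replace (IZR (6 * Z.of_nat j + Z.of_nat p)) with (INR (6 * j + p)) by (rewrite INR_IZR_INZ; f_equal; lia).
      replace (IZR (5 * Z.of_nat p - 6 * Z.of_nat j)) with (INR (5 * p - 6 * j)) by (rewrite INR_IZR_INZ; f_equal; lia).
      assert (E0 : sin (PI * IZR (6 * Z.of_nat j - Z.of_nat p) * INR (S m) / (6 * INR p)) = sg * sin (PI * INR r1 * INR (S m) / (6 * INR p))).
      { rewrite (INR_IZR_INZ r1). destruct Es as [[-> ->]|[-> ->]]; [ring|].
        rewrite opp_IZR. replace (PI * - IZR (6 * Z.of_nat j - Z.of_nat p) * INR (S m) / (6 * INR p))
          with (- (PI * IZR (6 * Z.of_nat j - Z.of_nat p) * INR (S m) / (6 * INR p))) by (field; lra).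
        rewrite sin_neg. ring. }
      rewrite E0. field. lra.
    + rewrite (Rsum_ext (fun i => Mmat p j (S i) * _) (fun i => Rsum (fun m => Mmat p j (S i) *
         (IZR (chi (Z.of_nat p) (Z.of_nat (S i)) (Z.of_nat (S m))) * y ^ (S m * S m))) (S n))).
      * rewrite Rsum_exchange. apply Rsum_ext. intros m _. rewrite <- character_sum by auto.
        rewrite Rmult_comm, <- Rsum_scal. apply Rsum_ext. intros; ring.
      * intros i _. rewrite Rsum_scal. f_equal. rewrite Rsum_shift, chi_0 by lia. simpl Z.of_nat at 1. ring.
Qed.

Lemma JS_conj P a t : Rabs (P - a) < P -> 0 < Re t -> JS P a (Cconj t) = Cconj (JS P a t).
Proof.
  intros Hb Ht. assert (Ht0 : t <> 0) by now apply Re_pos_neq_0.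
  pose proof (JS_integral P a t Hb Ht) as Q. pose proof (is_CI_inf_RInt_gen _ _ Q) as E.
  unfold JS at 2. fold (JS_integrand P a t). rewrite E, Cmult_conj, Cinv_conj by auto.
  unfold JS. f_equal. apply is_CI_inf_RInt_gen.
  eapply is_CI_inf_ext; [|apply is_CI_inf_conj, Q]. intros u _. unfold JS_integrand.
  rewrite Cmult_conj, <- Cexp_conj, Copp_conj, Cdiv_conj, !RtoC_conj by auto. reflexivity.
Qed.

Lemma Csqrt_conj z : slit z -> Csqrt (Cconj z) = Cconj (Csqrt z).
Proof.
  intros Hz. apply Csqrt_unique.
  - rewrite re_conj. now apply Csqrt_Re_pos.
  - rewrite <- Cmult_conj, Csqrt_sqr; auto.
Qed.

Lemma calL_conj (p j : nat) t : prime (Z.of_nat p) -> (5 <= p)%nat -> in_range p j -> 0 < Re t ->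
  calL p j (Cconj t) = Cconj (calL p j t).
Proof.
  intros Hp H5 Hj Ht. destruct (range_params p j Hp H5 Hj) as [r1 [H1 [H2 [H3 [H4 [_ [E1 [E2 [E3 [E4 _]]]]]]]]]].
  assert (HpR : 0 < INR p) by (apply lt_0_INR; lia). pose proof PI_RGT_0.
  unfold calL. rewrite E1, E2, E3, E4. rewrite !JS_conj by auto using JS_param_bound.
  rewrite !Cmult_conj, !Cplus_conj, Cmult_conj, RtoC_conj. f_equal.
  rewrite <- Csqrt_conj.
  - rewrite Cmult_conj, RtoC_conj. reflexivity.
  - right. rewrite Re_scal. apply Rmult_lt_0_compat; auto. apply Rdiv_lt_0_compat; lra.
Qed.

Lemma calL_cont_is_continuation_Lower (p j : nat) : prime (Z.of_nat p) -> (5 <= p)%nat -> in_range p j ->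
  is_continuation Lower (calL p j) (fun t => Cconj (calL_cont p j (Cconj t))).
Proof.
  intros Hp H5 Hj. destruct (calL_cont_is_continuation p j Hp H5 Hj) as [C1 C2]. split.
  - intros t Ht. apply ex_derive_chol, chol_conj, ex_derive_chol, C1.
    apply cut_plane_conj. now rewrite Cconj_conj.
  - intros t Ht. rewrite C2 by (now rewrite re_conj). rewrite calL_conj, Cconj_conj by auto. reflexivity.
Qed.

(** The explicit value of [zeta]; then [zeta1 p t] is [xi p (PI^2 / t)], so one function serves both
    variables. *)
Definition xi (p : nat) (t : R) : R := exp (t / (12 * INR p)).

Lemma continuation_calL (p j : nat) (s : side) (t : R) : prime (Z.of_nat p) -> (5 <= p)%nat -> in_range p j -> t < 0 ->
  continuation s (calL p j) (RtoC t) =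
  (RtoC (theta p j (xi p t)) + stokes_factor s t *
     RtoC (Rsum (fun i => Mmat p j (S i) * theta p (S i) (xi p (PI ^ 2 / t)))%R (ell p)))%C.
Proof.
  intros Hp H5 Hj Ht. assert (HpR : 0 < INR p) by (apply lt_0_INR; lia).
  assert (V : calL_cont p j (RtoC t) = (theta p j (xi p t), - sqrt (PI / Rabs t) *
     Rsum (fun i => Mmat p j (S i) * theta p (S i) (xi p (PI ^ 2 / t))) (ell p))).
  { pose proof (calL_cont_neg p j (- t) Hp H5 Hj ltac:(lra)) as Q.
    rewrite !Ropp_involutive in Q. rewrite Q, Rabs_left by auto. unfold xi.
    replace (- PI ^ 2 / (12 * INR p * - t)) with (PI ^ 2 / t / (12 * INR p)) by (field; lra). reflexivity. }
  set (A := theta p j (xi p t)) in *. set (B := Rsum _ (ell p)) in *.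
  destruct s.
  - rewrite (continuation_value Upper _ (calL_cont p j)).
    + rewrite V. apply injective_projections; simpl; ring.
    + now apply calL_cont_is_continuation.
    + left. simpl. lra.
  - rewrite (continuation_value Lower _ _ _ (calL_cont_is_continuation_Lower p j Hp H5 Hj)).
    + rewrite RtoC_conj, V. apply injective_projections; simpl; ring.
    + left. simpl. lra.
Qed.

(** * The homogeneous equation *)

Lemma sum_n_m_C (f : nat -> C) n :
  sum_n_m (G := C_AbelianMonoid) f 1 n = (Rsum (fun i => Re (f (S i))) n, Rsum (fun i => Im (f (S i))) n).
Proof.
  induction n as [|n IH].
  - rewrite sum_n_m_zero by lia. reflexivity.
  - rewrite sum_n_Sm by lia. rewrite IH. simpl. destruct (f (S n)) as [x y]. reflexivity.
Qed.

Lemma sum_n_m_RtoC (f : nat -> C) (g : nat -> R) n : (forall k, f (S k) = RtoC (g k)) ->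
  sum_n_m (G := C_AbelianMonoid) f 1 n = RtoC (Rsum g n).
Proof.
  intros H. rewrite sum_n_m_C. unfold RtoC. f_equal.
  - apply Rsum_ext. intros k _. rewrite H. reflexivity.
  - apply Rsum_zero. intros k _. rewrite H. reflexivity.
Qed.

Lemma Rpower_Qvar t c : Rpower (Qvar t) c = exp (c * (- 2 * t)).
Proof. unfold Rpower, Qvar. now rewrite ln_exp. Qed.

Lemma zeta_xi p t : (1 <= p)%nat -> zeta p t = xi p t.
Proof.
  intros Hp. assert (0 < INR p) by (apply lt_0_INR; lia).
  unfold zeta, xi. rewrite Rpower_Qvar. f_equal. field. lra.
Qed.

Lemma Qvar1_Qvar t : t <> 0 -> Qvar1 t = Qvar (PI ^ 2 / t).
Proof. intros. unfold Qvar1, Qvar. f_equal. field. auto. Qed.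

Lemma zeta1_xi p t : (1 <= p)%nat -> t <> 0 -> zeta1 p t = xi p (PI ^ 2 / t).
Proof. intros Hp Ht. unfold zeta1. rewrite Qvar1_Qvar by auto. now apply zeta_xi. Qed.

Lemma Rpower_Qvar_pow p t n : (1 <= p)%nat -> Rpower (Qvar t) (- (INR n / (24 * INR p))) = xi p t ^ n.
Proof.
  intros Hp. assert (0 < INR p) by (apply lt_0_INR; lia).
  rewrite Rpower_Qvar, <- Rpower_pow by apply exp_pos. unfold Rpower, xi. rewrite ln_exp. f_equal. field. lra.
Qed.

Lemma xi_surj p x : (1 <= p)%nat -> 0 < x < 1 -> exists t, t < 0 /\ xi p t = x.
Proof.
  intros Hp Hx. assert (0 < INR p) by (apply lt_0_INR; lia). exists (12 * INR p * ln x). split.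
  - assert (ln x < 0) by (rewrite <- ln_1; apply ln_increasing; lra). nra.
  - unfold xi. replace (12 * INR p * ln x / (12 * INR p)) with (ln x) by (field; lra). apply exp_ln; lra.
Qed.

Lemma neg_inv_scale t : t < 0 -> PI ^ 2 / t < 0 /\ PI ^ 2 / (PI ^ 2 / t) = t.
Proof.
  intros Ht. pose proof (pow_lt PI 2 PI_RGT_0). split.
  - unfold Rdiv. apply Rmult_pos_neg; auto. now apply Rinv_lt_0_compat.
  - field. split; [lra|]. pose proof PI_RGT_0. lra.
Qed.

Lemma Mmat_sym p j k : Mmat p j k = Mmat p k j.
Proof.
  unfold Mmat. rewrite (Nat.add_comm j k). f_equal. f_equal. unfold Rdiv. ring.
Qed.

Lemma Rsum_sqr_zero u n : Rsum (fun i => u i ^ 2) n <= 0 -> forall i, (i < n)%nat -> u i = 0.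
Proof.
  assert (Pos : forall m, 0 <= Rsum (fun i => u i ^ 2) m).
  { induction m; simpl; [lra|]. pose proof (pow2_ge_0 (u m)). simpl in *. lra. }
  induction n as [|n IH]; intros H i Hi; [lia|]. simpl in H.
  pose proof (Pos n) as P. pose proof (pow2_ge_0 (u n)) as Q. simpl in P, Q.
  destruct (Nat.eq_dec i n) as [->|Hne].
  - assert (E : u n * u n = 0) by lra. apply Rmult_integral in E. tauto.
  - apply IH; [simpl; lra|lia].
Qed.

(* [|x|^2 = <x, - M^2 x> = - |M x|^2]. *)
Lemma sym_neg_square_zero (M : nat -> nat -> R) (x : nat -> R) n :
  (forall i k, M i k = M k i) ->
  (forall i, (i < n)%nat -> x i = - Rsum (fun k => M i k * Rsum (fun l => M k l * x l) n) n) ->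
  forall i, (i < n)%nat -> x i = 0.
Proof.
  intros HM Hx. set (y := fun k => Rsum (fun l => M k l * x l) n) in *.
  assert (E : Rsum (fun i => x i ^ 2) n = - Rsum (fun k => y k ^ 2) n).
  { transitivity (Rsum (fun i => - 1 * Rsum (fun k => x i * (M i k * y k)) n) n).
    - apply Rsum_ext. intros i Hi. rewrite Rsum_scal.
      assert (Hxi : x i = - Rsum (fun k => M i k * y k) n) by exact (Hx i Hi).
      replace (Rsum (fun k => M i k * y k) n) with (- x i) by lra. ring.
    - rewrite Rsum_scal, Rsum_exchange. replace (- Rsum (fun k => y k ^ 2) n) with (-1 * Rsum (fun k => y k ^ 2) n) by ring.
      f_equal. apply Rsum_ext. intros k _.
      replace (y k ^ 2) with (y k * Rsum (fun l => M k l * x l) n) by (unfold y; ring).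
      rewrite <- Rsum_scal. apply Rsum_ext. intros i _. rewrite (HM i k). ring. }
  apply Rsum_sqr_zero.
  assert (Pos : forall m, 0 <= Rsum (fun i => y i ^ 2) m).
  { induction m; simpl; [lra|]. pose proof (pow2_ge_0 (y m)). simpl in *. lra. }
  specialize (Pos n). lra.
Qed.

(** The unknown is a function of [t], which covers both a holomorphic [F] and a series in [Q]. As
    the Stokes factor is imaginary, the law ties the real part at [t] to the imaginary part at
    [PI^2 / t]; the way there and back gives [x = - M^2 x] for each part. *)
Lemma homogeneous_zero (p : nat) (s : side) (V : nat -> R -> C) :
  (forall t j, t < 0 -> in_range p j ->
     (V j t + stokes_factor s t * sum_n_m (G := C_AbelianMonoid) (fun k => RtoC (Mmat p j k) * V k (PI ^ 2 / t)%R) 1 (ell p))%C = 0) ->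
  forall t j, t < 0 -> in_range p j -> V j t = 0.
Proof.
  intros H t j Ht Hj. pose proof PI_RGT_0 as HPI.
  destruct (neg_inv_scale t Ht) as [Ht' Et].
  set (sg := match s with Upper => 1 | Lower => -1 end).
  assert (Hsg : sg * sg = 1) by (unfold sg; destruct s; ring).
  assert (Eq : forall u i, u < 0 -> (i < ell p)%nat ->
     Re (V (S i) u) = - (sg * sqrt (PI / Rabs u)) * Rsum (fun k => Mmat p (S i) (S k) * Im (V (S k) (PI ^ 2 / u))) (ell p) /\
     Im (V (S i) u) = sg * sqrt (PI / Rabs u) * Rsum (fun k => Mmat p (S i) (S k) * Re (V (S k) (PI ^ 2 / u))) (ell p)).
  { intros u i Hu Hi. specialize (H u (S i) Hu ltac:(split; lia)). rewrite sum_n_m_C in H.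
    rewrite (Rsum_ext (fun k => Re (RtoC (Mmat p (S i) (S k)) * V (S k) (PI ^ 2 / u)))
       (fun k => Mmat p (S i) (S k) * Re (V (S k) (PI ^ 2 / u)))) in H by (intros; apply Re_scal).
    rewrite (Rsum_ext (fun k => Im (RtoC (Mmat p (S i) (S k)) * V (S k) (PI ^ 2 / u)))
       (fun k => Mmat p (S i) (S k) * Im (V (S k) (PI ^ 2 / u)))) in H by (intros; apply Im_scal).
    set (A := Rsum (fun k => _ * Re _) _) in *. set (B := Rsum (fun k => _ * Im _) _) in *.
    set (g := sqrt (PI / Rabs u)) in *.
    pose proof (f_equal Re H) as HR. pose proof (f_equal Im H) as HI.
    unfold stokes_factor in HR, HI. fold g in HR, HI. unfold sg.
    destruct s; simpl in HR, HI; unfold Re, Im in *; simpl in *; split; lra. }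
  set (g := sqrt (PI / Rabs t)). set (g' := sqrt (PI / Rabs (PI ^ 2 / t))).
  (* [|t| * |PI^2 / t| = PI^2], so the two square roots are inverse to each other. *)
  assert (Hgg : g * g' = 1).
  { unfold g, g'. rewrite !Rabs_left by auto.
    assert (0 < PI / - t) by (apply Rdiv_lt_0_compat; lra).
    rewrite <- sqrt_mult_alt by lra. replace (PI / - t * (PI / - (PI ^ 2 / t))) with 1 by (field; lra). apply sqrt_1. }
  assert (RZ : forall i, (i < ell p)%nat -> Re (V (S i) t) = 0).
  { apply (sym_neg_square_zero (fun i k => Mmat p (S i) (S k)) (fun i => Re (V (S i) t))).
    - intros; apply Mmat_sym.
    - intros i Hi. destruct (Eq t i Ht Hi) as [-> _]. fold g.
      rewrite (Rsum_ext _ (fun k => (sg * g') * (Mmat p (S i) (S k) * Rsum (fun l => Mmat p (S k) (S l) * Re (V (S l) t)) (ell p)))).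
      + rewrite Rsum_scal. replace (- (sg * g) * (sg * g' * Rsum _ (ell p))) with
          (- ((sg * sg) * (g * g')) * Rsum (fun k => Mmat p (S i) (S k) * Rsum (fun l => Mmat p (S k) (S l) * Re (V (S l) t)) (ell p)) (ell p)) by ring.
        rewrite Hsg, Hgg. ring.
      + intros k Hk. destruct (Eq (PI ^ 2 / t) k Ht' Hk) as [_ ->]. fold g'. rewrite Et. ring. }
  assert (IZ : forall i, (i < ell p)%nat -> Im (V (S i) t) = 0).
  { apply (sym_neg_square_zero (fun i k => Mmat p (S i) (S k)) (fun i => Im (V (S i) t))).
    - intros; apply Mmat_sym.
    - intros i Hi. destruct (Eq t i Ht Hi) as [_ ->]. fold g.
      rewrite (Rsum_ext _ (fun k => (- (sg * g')) * (Mmat p (S i) (S k) * Rsum (fun l => Mmat p (S k) (S l) * Im (V (S l) t)) (ell p)))).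
      + rewrite Rsum_scal. replace (sg * g * (- (sg * g') * Rsum _ (ell p))) with
          (- ((sg * sg) * (g * g')) * Rsum (fun k => Mmat p (S i) (S k) * Rsum (fun l => Mmat p (S k) (S l) * Im (V (S l) t)) (ell p)) (ell p)) by ring.
        rewrite Hsg, Hgg. ring.
      + intros k Hk. destruct (Eq (PI ^ 2 / t) k Ht' Hk) as [-> _]. fold g'. rewrite Et. ring. }
  destruct Hj as [J1 J2]. replace j with (S (j - 1)) by lia.
  apply injective_projections; [apply RZ|apply IZ]; lia.
Qed.

(** * Holomorphic and series solutions *)

Definition theta_term (p j : nat) (z : C) (n : nat) : C := (RtoC (coef p j n) * z ^ n)%C.

Definition theta_fun (p j : nat) (z : C) : C := CSeries (theta_term p j z).

Lemma CSeries_ext a b : (forall n, a n = b n) -> CSeries a = CSeries b.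
Proof. intros H. unfold CSeries. f_equal; apply Series_ext; intros n; now rewrite H. Qed.

Lemma CSeries_RtoC (a : nat -> R) : CSeries (fun n => RtoC (a n)) = RtoC (Series a).
Proof.
  unfold CSeries, RtoC. f_equal. simpl. rewrite (Series_ext _ (fun n => 0 * 0)) by (intros; ring).
  rewrite (Series_scal_l 0 (fun _ => 0)). ring.
Qed.

Lemma theta_fun_real p j x : theta_fun p j (RtoC x) = RtoC (theta p j x).
Proof.
  unfold theta_fun, theta. rewrite <- CSeries_RtoC. apply CSeries_ext. intros n. unfold theta_term.
  now rewrite RtoC_mult, RtoC_pow.
Qed.

Lemma is_lim_seq_series (a : nat -> R) (l : R) : is_series a l <-> is_lim_seq (Rsum a) l.
Proof.
  split; intros H.
  - apply is_lim_seq_incr_1. apply (is_lim_seq_ext (sum_n a)); [intros; apply sum_n_Rsum|exact H].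
  - apply is_lim_seq_incr_1 in H.
    apply (is_lim_seq_ext _ (sum_n a)) in H; [exact H|]. intros; symmetry; apply sum_n_Rsum.
Qed.

Lemma theta_term_series p j z : Cmod z < 1 ->
  is_series (fun n => Re (theta_term p j z n)) (Re (theta_fun p j z)) /\ is_series (fun n => Im (theta_term p j z n)) (Im (theta_fun p j z)).
Proof.
  intros Hz.
  assert (Hb : forall n, Cmod (theta_term p j z n) <= 4 * Cmod z ^ n).
  { intros n. unfold theta_term. rewrite Cmod_mult, Cmod_R, Cmod_pow.
    apply Rmult_le_compat_r; [apply pow_le, Cmod_ge_0|apply coef_bound]. }
  assert (Hg : ex_series (fun n => 4 * Cmod z ^ n)).
  { apply (ex_series_scal (V := R_NormedModule) 4). apply ex_series_geom. rewrite Rabs_pos_eq; auto. apply Cmod_ge_0. }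
  split; apply Series_correct.
  - apply (ex_series_le (V := R_CompleteNormedModule) _ (fun n => 4 * Cmod z ^ n)); auto.
    intros n. eapply Rle_trans; [|apply Hb]. apply re_le_Cmod.
  - apply (ex_series_le (V := R_CompleteNormedModule) _ (fun n => 4 * Cmod z ^ n)); auto.
    intros n. eapply Rle_trans; [|apply Hb]. apply im_le_Cmod.
Qed.

Fixpoint Csum (u : nat -> C) (n : nat) : C :=
  match n with O => 0 | S n => (Csum u n + u n)%C end.

Lemma Csum_pair u n : Csum u n = (Rsum (fun k => Re (u k)) n, Rsum (fun k => Im (u k)) n).
Proof. induction n; simpl; [reflexivity|]. rewrite IHn. destruct (u n); reflexivity. Qed.

Lemma Csum_limit (u : nat -> C) (l : C) :
  is_lim_seq (Rsum (fun k => Re (u k))) (Re l) -> is_lim_seq (Rsum (fun k => Im (u k))) (Im l) ->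
  forall e, 0 < e -> exists N, forall n, (N <= n)%nat -> Cmod (Csum u n - l) < e.
Proof.
  intros HR HI e He. apply is_lim_seq_spec in HR. apply is_lim_seq_spec in HI.
  assert (He2 : 0 < e / 2) by lra.
  destruct (HR (mkposreal _ He2)) as [N1 H1]. destruct (HI (mkposreal _ He2)) as [N2 H2].
  exists (N1 + N2)%nat. intros n Hn. specialize (H1 n ltac:(lia)). specialize (H2 n ltac:(lia)). simpl in H1, H2.
  rewrite Csum_pair. eapply Rle_lt_trans; [apply Cmod_le_sum|].
  destruct l as [x y]; simpl in *. unfold Rminus in *. lra.
Qed.

Lemma Rsum_geom_bound q n : 0 <= q < 1 -> Rsum (fun k => 4 * q ^ k) n <= 4 / (1 - q).
Proof.
  intros Hq. rewrite (Rsum_scal 4 (fun k => q ^ k)). unfold Rdiv. apply Rmult_le_compat_l; [lra|].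
  assert (E : Rsum (fun k => q ^ k) n * (1 - q) = 1 - q ^ n).
  { induction n; simpl; [ring|]. rewrite Rmult_plus_distr_r, IHn. ring. }
  apply Rmult_le_reg_r with (1 - q); [lra|]. rewrite E, Rinv_l by lra.
  assert (0 <= q ^ n) by (apply pow_le; lra). lra.
Qed.

(** The partial sums are polynomials bounded by [4 / (1 - q)] near [z], where [q] is the midpoint of
    [|z|] and 1, and [chol_limit] applies to them. *)
Lemma chol_theta_fun p j z : Cmod z < 1 -> chol (theta_fun p j) z.
Proof.
  intros Hz. set (R0 := (1 - Cmod z) / 2). assert (HR0 : 0 < R0) by (unfold R0; lra).
  pose proof (Cmod_ge_0 z) as Hz0.
  set (q := (1 + Cmod z) / 2). assert (Hq : 0 <= q < 1) by (unfold q; lra).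
  assert (Hw : forall w, Cmod (w - z) < R0 -> Cmod w <= q).
  { intros w Hw. pose proof (Cmod_le_minus w z). unfold R0, q in *. lra. }
  apply (chol_limit (theta_fun p j) (fun n w => Csum (theta_term p j w) n) z R0 (4 / (1 - q)) HR0).
  - intros n w _. induction n; simpl; [apply chol_const|]. apply chol_plus; auto.
    unfold theta_term. apply chol_mult; [apply chol_const|]. clear IHn. induction n; simpl; [apply chol_const|].
    apply chol_mult; auto. apply chol_id.
  - intros n w Hww. specialize (Hw w Hww).
    apply Rle_trans with (Rsum (fun k => 4 * q ^ k) n); [|now apply Rsum_geom_bound].
    induction n; simpl; [rewrite Cmod_0; lra|]. eapply Rle_trans; [apply Cmod_triangle|].
    apply Rplus_le_compat; auto. unfold theta_term. rewrite Cmod_mult, Cmod_R, Cmod_pow.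
    apply Rmult_le_compat; [apply Rabs_pos|apply pow_le, Cmod_ge_0|apply coef_bound|].
    apply pow_incr. split; [apply Cmod_ge_0|auto].
  - intros w e Hww He. specialize (Hw w Hww).
    destruct (theta_term_series p j w ltac:(lra)) as [S1 S2].
    apply Csum_limit; auto; now apply is_lim_seq_series.
Qed.

Lemma sum_n_Csum (u : nat -> C) n : sum_n (G := C_AbelianMonoid) u n = Csum u (S n).
Proof.
  induction n; [rewrite sum_O; simpl; symmetry; apply Cplus_0_l|]. rewrite sum_Sn, IHn. reflexivity.
Qed.

Lemma coef_converges p j : converges_on_disk (fun n => RtoC (coef p j n)).
Proof.
  intros z Hz. destruct (theta_term_series p j z Hz) as [S1 S2]. exists (theta_fun p j z).
  apply filterlim_locally. intros e.
  destruct (Csum_limit (theta_term p j z) (theta_fun p j z)) with (e := pos e) as [N HN].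
  - now apply is_lim_seq_series.
  - now apply is_lim_seq_series.
  - apply cond_pos.
  - exists N. intros n Hn. apply C_NormedModule_mixin_compat1.
    change (sum_n (G := C_NormedModule) (fun n => RtoC (coef p j n) * z ^ n)%C n) with (sum_n (G := C_AbelianMonoid) (theta_term p j z) n).
    rewrite sum_n_Csum. apply HN. lia.
Qed.

Lemma C_series_components (a : nat -> C) : ex_series (V := C_NormedModule) a ->
  ex_series (fun n => Re (a n)) /\ ex_series (fun n => Im (a n)).
Proof.
  intros [l Hl]. 
  assert (K : forall e : posreal, exists N, forall n, (N <= n)%nat -> ball (M := C_UniformSpace) l e (Csum a (S n))).
  { intros e. assert (Hl' := proj1 (filterlim_locally (F := eventually) _ _) Hl e).
    destruct Hl' as [N HN]. exists N. intros n Hn. rewrite <- sum_n_Csum. exact (HN n Hn). }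
  split.
  - exists (Re l). apply is_lim_seq_series, is_lim_seq_incr_1, is_lim_seq_spec. intros e.
    destruct (K e) as [N HN]. exists N. intros n Hn. destruct (HN n Hn) as [B _]. rewrite Csum_pair in B. exact B.
  - exists (Im l). apply is_lim_seq_series, is_lim_seq_incr_1, is_lim_seq_spec. intros e.
    destruct (K e) as [N HN]. exists N. intros n Hn. destruct (HN n Hn) as [_ B]. rewrite Csum_pair in B. exact B.
Qed.

(** * Uniqueness of power series coefficients *)

Lemma PSeries_zero_0 (a : nat -> R) : Rbar_le (1 / 2) (CV_radius a) ->
  (forall x, 0 < x < 1 / 2 -> PSeries a x = 0) -> a 0%nat = 0.
Proof.
  intros Hr H. rewrite <- (PSeries_0 a). destruct (Req_dec (PSeries a 0) 0) as [|Hne]; auto. exfalso.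
  assert (Hc : continuity_pt (PSeries a) 0).
  { apply PSeries_continuity. rewrite Rabs_R0. eapply Rbar_lt_le_trans; [|exact Hr]. simpl. lra. }
  destruct (Hc (Rabs (PSeries a 0)) ltac:(now apply Rabs_pos_lt)) as [d [Hd J]].
  set (x := Rmin (d / 2) (1 / 4)). assert (Hx : 0 < x) by (apply Rmin_pos; lra).
  assert (Hx1 : x <= d / 2) by apply Rmin_l. assert (Hx2 : x <= 1 / 4) by apply Rmin_r.
  specialize (J x). simpl in J. unfold R_dist in J. rewrite (H x) in J by lra.
  rewrite Rminus_0_l, Rabs_Ropp in J. apply (Rlt_irrefl (Rabs (PSeries a 0))), J.
  split; [split; [exact I|lra]|]. rewrite Rminus_0_r, Rabs_pos_eq; lra.
Qed.

(** Coefficients are stripped one at a time: once [a 0] is known to vanish, the series divided by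
    [x] vanishes on the same interval and has the same radius of convergence. *)
Lemma PSeries_zero (a : nat -> R) : Rbar_le (1 / 2) (CV_radius a) ->
  (forall x, 0 < x < 1 / 2 -> PSeries a x = 0) -> forall n, a n = 0.
Proof.
  intros Hr H n. revert a Hr H. induction n as [|n IH]; intros a Hr H.
  - now apply PSeries_zero_0.
  - assert (Ha0 : a 0%nat = 0) by now apply PSeries_zero_0.
    apply (IH (PS_decr_1 a)).
    + now rewrite CV_radius_decr_1.
    + intros x Hx. pose proof (PSeries_decr_1 a x) as Q. rewrite H, Ha0 in Q by lra.
      assert (Hex : ex_pseries a x).
      { apply CV_radius_inside. eapply Rbar_lt_le_trans; [|exact Hr]. simpl. rewrite Rabs_pos_eq; lra. }
      specialize (Q Hex). symmetry in Q. rewrite Rplus_0_l in Q. apply Rmult_integral in Q. destruct Q; lra.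
Qed.

Lemma CV_radius_half (a : nat -> R) : ex_series (fun n => a n * (1 / 2) ^ n) -> Rbar_le (1 / 2) (CV_radius a).
Proof.
  intros H. apply Rbar_not_lt_le. intros Hlt.
  apply (CV_disk_outside a (1 / 2)).
  - rewrite Rabs_pos_eq by lra. exact Hlt.
  - apply ex_series_lim_0, H.
Qed.

Lemma power_series_ext (a b : nat -> R) :
  (forall x, 0 < x < 1 -> ex_series (fun n => a n * x ^ n)) -> (forall x, 0 < x < 1 -> ex_series (fun n => b n * x ^ n)) ->
  (forall x, 0 < x < 1 -> Series (fun n => a n * x ^ n) = Series (fun n => b n * x ^ n)) ->
  forall n, a n = b n.
Proof.
  intros Ha Hb E n. apply Rminus_diag_uniq.
  assert (D : forall x, 0 < x < 1 -> ex_series (fun n => (a n - b n) * x ^ n)).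
  { intros x Hx. apply (ex_series_ext (fun n => minus (a n * x ^ n) (b n * x ^ n))).
    - intros k. unfold minus, plus, opp; simpl. ring.
    - apply (ex_series_minus (V := R_NormedModule)); auto. }
  apply (PSeries_zero (fun n => a n - b n)).
  - apply CV_radius_half, D. lra.
  - intros x Hx. unfold PSeries. rewrite (Series_ext _ (fun k => a k * x ^ k - b k * x ^ k)) by (intros; ring).
    rewrite Series_minus, E by (auto; (apply Ha || apply Hb || idtac); lra). ring.
Qed.

(** * Exponents and the rational prefactor *)

Lemma odd_indicator_nonzero N r m : (0 < N)%Z -> odd_indicator N r m <> 0%Z -> exists l, (m = r + N * l \/ m = - r + N * l)%Z.
Proof.
  intros HN H. unfold odd_indicator in H.
  destruct (Z.eq_dec ((m - r) mod N) 0) as [E|E].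
  - apply mod_0_divide in E; auto. destruct E as [l Hl]. exists l. left. lia.
  - destruct (Z.eq_dec ((m + r) mod N) 0) as [E'|E']; [|lia].
    apply mod_0_divide in E'; auto. destruct E' as [l Hl]. exists l. right. lia.
Qed.

(* For [m = e r + 12 p l] with [e = 1] or [e = -1], the number [(m^2 - r^2) / (24 p)]
   is [l (e r + 6 p l)]. *)
Lemma chi_exponent (p j m : Z) : (5 <= p)%Z -> (1 <= j)%Z -> (2 * j <= p - 1)%Z -> chi p j m <> 0%Z ->
  exists c, (0 <= c /\ m * m = (6 * j - p) * (6 * j - p) + 24 * p * c)%Z.
Proof.
  intros H5 Hj1 Hj2 H.
  assert (Pos : forall r l : Z, (- 6 * p < r < 6 * p -> 0 <= l * (r + 6 * p * l))%Z).
  { intros r l Hr. destruct (Z_lt_le_dec l 0); [|destruct (Z.eq_dec l 0); [subst; lia|]].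
    - assert (r + 6 * p * l <= 0)%Z by nia. nia.
    - assert (0 <= r + 6 * p * l)%Z by nia. nia. }
  assert (HN : (0 < 12 * p)%Z) by lia.
  unfold chi in H.
  destruct (Z.eq_dec (odd_indicator (12 * p) (6 * j - p) m) 0) as [E1|E1];
  [destruct (Z.eq_dec (odd_indicator (12 * p) (7 * p - 6 * j) m) 0) as [E2|E2];
  [destruct (Z.eq_dec (odd_indicator (12 * p) (6 * j + p) m) 0) as [E3|E3];
  [destruct (Z.eq_dec (odd_indicator (12 * p) (5 * p - 6 * j) m) 0) as [E4|E4]; [lia|]|]|]|].
  - apply odd_indicator_nonzero in E4; auto. destruct E4 as [l [->| ->]].
    (* The added constant is [(r^2 - (6 j - p)^2) / (24 p)]: it is [p - 2 j] for [r = 5 p - 6 j],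
       [j] for [r = 6 j + p], and [2 p - 3 j] for [r = 7 p - 6 j]. *)
    + exists (l * ((5 * p - 6 * j) + 6 * p * l) + (p - 2 * j))%Z. split; [|ring].
      pose proof (Pos (5 * p - 6 * j)%Z l ltac:(lia)). lia.
    + exists (l * (- (5 * p - 6 * j) + 6 * p * l) + (p - 2 * j))%Z. split; [|ring].
      pose proof (Pos (- (5 * p - 6 * j))%Z l ltac:(lia)). lia.
  - apply odd_indicator_nonzero in E3; auto. destruct E3 as [l [->| ->]].
    + exists (l * ((6 * j + p) + 6 * p * l) + j)%Z. split; [|ring].
      pose proof (Pos (6 * j + p)%Z l ltac:(lia)). lia.
    + exists (l * (- (6 * j + p) + 6 * p * l) + j)%Z. split; [|ring].
      pose proof (Pos (- (6 * j + p))%Z l ltac:(lia)). lia.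
  - apply odd_indicator_nonzero in E2; auto. destruct E2 as [l [->| ->]].
    + exists (l * ((7 * p - 6 * j) + 6 * p * l) + (2 * p - 3 * j))%Z. split; [|ring].
      (* [7 p - 6 j] may exceed [6 p], which is outside the range of [Pos]. At [l = -1] the product
         can be negative, but adding [2 p - 3 j] gives [p + 3 j]. *)
      destruct (Z_lt_le_dec l (-1)); [|destruct (Z.eq_dec l (-1)); [subst; lia|]].
      * assert ((7 * p - 6 * j) + 6 * p * l <= 0)%Z by nia. nia.
      * assert (0 <= (7 * p - 6 * j) + 6 * p * l)%Z by nia. nia.
    + exists (l * (- (7 * p - 6 * j) + 6 * p * l) + (2 * p - 3 * j))%Z. split; [|ring].
      destruct (Z_lt_le_dec l 1); [|destruct (Z.eq_dec l 1); [subst; lia|]].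
      * assert (- (7 * p - 6 * j) + 6 * p * l <= 0)%Z by nia. nia.
      * assert (0 <= - (7 * p - 6 * j) + 6 * p * l)%Z by nia. nia.
  - apply odd_indicator_nonzero in E1; auto. destruct E1 as [l [->| ->]].
    + exists (l * ((6 * j - p) + 6 * p * l))%Z. split; [|ring]. apply Pos; lia.
    + exists (l * (- (6 * j - p) + 6 * p * l))%Z. split; [|ring]. apply Pos; lia.
Qed.

Lemma coef_prefactor p j : (5 <= p)%nat -> in_range p j -> has_prefactor p j (fun n => RtoC (coef p j n)).
Proof.
  intros H5 [J1 J2] n Hn.
  assert (Hl : (2 * ell p <= p - 1)%nat) by (unfold ell; pose proof (Nat.div_mod_eq (p - 1) 2); lia).
  assert (Hc : coef p j n <> 0) by (intros E; apply Hn; now rewrite E).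
  unfold coef in Hc. destruct (Nat.eq_dec (Nat.sqrt n * Nat.sqrt n) n) as [E|]; [|tauto].
  set (m := Nat.sqrt n) in *.
  assert (Hx : chi (Z.of_nat p) (Z.of_nat j) (Z.of_nat m) <> 0%Z) by (intros Z; apply Hc; now rewrite Z).
  apply chi_exponent in Hx; try lia. destruct Hx as [c [Hc0 Ec]].
  exists (Z.to_nat c). unfold Defs.Delta.
  assert (HpR : 0 < INR p) by (apply lt_0_INR; lia).
  rewrite (INR_IZR_INZ (Z.to_nat c)), Z2Nat.id by auto.
  apply (f_equal IZR) in Ec. rewrite <- Nat2Z.inj_mul, E, plus_IZR, !mult_IZR, minus_IZR, mult_IZR, <- !INR_IZR_INZ in Ec.
  rewrite Ec. field. lra.
Qed.

(** * The holomorphic solution and the solution in series *)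

Lemma theta_fun_solution p s : prime (Z.of_nat p) -> (5 <= p)%nat -> holomorphic_solution p s (theta_fun p).
Proof.
  intros Hp H5. split.
  - intros j _ z Hz. apply ex_derive_chol, chol_theta_fun, Hz.
  - intros t j Ht Hj. rewrite zeta_xi, zeta1_xi, theta_fun_real by (try lia; lra).
    rewrite continuation_calL by auto. do 2 f_equal. symmetry. apply sum_n_m_RtoC.
    intros k. now rewrite theta_fun_real, <- RtoC_mult.
Qed.

Lemma stokes_difference p s (A B : nat -> C) (A' B' : nat -> C) (L : C) (t : R) (j : nat) :
  L = (A j + stokes_factor s t * sum_n_m (G := C_AbelianMonoid) (fun k => RtoC (Mmat p j k) * A' k) 1 (ell p))%C ->
  L = (B j + stokes_factor s t * sum_n_m (G := C_AbelianMonoid) (fun k => RtoC (Mmat p j k) * B' k) 1 (ell p))%C ->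
  ((A j - B j) + stokes_factor s t *
     sum_n_m (G := C_AbelianMonoid) (fun k => RtoC (Mmat p j k) * (A' k - B' k)) 1 (ell p))%C = 0.
Proof.
  intros HA HB. rewrite HA in HB. clear HA.
  set (SA := sum_n_m _ _ _) in HB at 1. set (SB := sum_n_m _ _ _) in HB at 1.
  replace (sum_n_m (G := C_AbelianMonoid) (fun k => RtoC (Mmat p j k) * (A' k - B' k))%C 1 (ell p)) with (SA - SB)%C.
  - replace (A j - B j + stokes_factor s t * (SA - SB))%C with ((A j + stokes_factor s t * SA) - (B j + stokes_factor s t * SB))%C by ring.
    rewrite HB. ring.
  - unfold SA, SB. clear. rewrite !sum_n_m_C. unfold Cminus, Cplus, Copp. simpl.
    f_equal.
    + rewrite <- (Rmult_1_l (- _)), <- Ropp_mult_distr_r, Ropp_mult_distr_l, <- Rsum_scal, <- Rsum_plus_fun.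
      apply Rsum_ext. intros k _. unfold Re; simpl. ring.
    + rewrite <- (Rmult_1_l (- _)), <- Ropp_mult_distr_r, Ropp_mult_distr_l, <- Rsum_scal, <- Rsum_plus_fun.
      apply Rsum_ext. intros k _. unfold Im; simpl. ring.
Qed.

Lemma Qseries_coef p j t : (1 <= p)%nat -> Qseries p (fun n => RtoC (coef p j n)) (Qvar t) = RtoC (theta p j (xi p t)).
Proof.
  intros Hp. unfold Qseries, theta. rewrite <- CSeries_RtoC. apply CSeries_ext. intros n.
  now rewrite Rpower_Qvar_pow, <- RtoC_mult.
Qed.

Theorem theorem3p25 (p : nat) (hp : prime (Z.of_nat p)) (hp5 : (5 <= p)%nat)
    (s : side) :
  (exists F : nat -> C -> C,
     holomorphic_solution p s F /\
     forall F' : nat -> C -> C, holomorphic_solution p s F' ->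
       forall (j : nat) (z : C), in_range p j -> unit_disk z -> F' j z = F j z)
  /\
  (exists c : nat -> nat -> C,
     series_solution p s c /\
     (forall j : nat, in_range p j -> has_prefactor p j (c j)) /\
     forall c' : nat -> nat -> C, series_solution p s c' ->
       forall (j n : nat), in_range p j -> c' j n = c j n).
Proof.
  assert (Hp1 : (1 <= p)%nat) by lia. split.
  - exists (theta_fun p). pose proof (theta_fun_solution p s hp hp5) as HF. split; auto.
    intros F' HF' j z Hj Hz. destruct HF as [F1 F2], HF' as [G1 G2].
    (* Expressed through [xi], the value at [zeta1 p t] is the same function of [t] taken at
       [PI^2 / t], as [homogeneous_zero] requires. *)
    assert (V : forall t j, t < 0 -> in_range p j -> (F' j (RtoC (xi p t)) - theta_fun p j (RtoC (xi p t)))%C = 0).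
    { apply (homogeneous_zero p s (fun j t => F' j (RtoC (xi p t)) - theta_fun p j (RtoC (xi p t)))%C).
      intros t i Ht Hi. specialize (F2 t i Ht Hi). specialize (G2 t i Ht Hi).
      rewrite zeta_xi, zeta1_xi in F2, G2 by (try lia; lra).
      apply (stokes_difference p s (fun i => F' i (RtoC (xi p t))) (fun i => theta_fun p i (RtoC (xi p t)))
        (fun k => F' k (RtoC (xi p (PI ^ 2 / t)))) (fun k => theta_fun p k (RtoC (xi p (PI ^ 2 / t)))) _ t i G2 F2). }
    (* Every point of (0, 1) is [xi p t] for some [t < 0], so the difference vanishes on a whole
       radius. *)
    apply Ceq_minus. apply (identity_disk (fun z => F' j z - theta_fun p j z)%C 1 Rlt_0_1).
    + intros w Hw. apply chol_minus; apply ex_derive_chol; [apply G1|apply F1]; auto.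
    + intros x Hx. destruct (xi_surj p x Hp1 Hx) as [t [Ht <-]]. now apply V.
    + exact Hz.
  - exists (fun j n => RtoC (coef p j n)).
    assert (HS : series_solution p s (fun j n => RtoC (coef p j n))).
    { split; [intros; apply coef_converges|]. intros t j Ht Hj.
      rewrite Qvar1_Qvar by lra. rewrite continuation_calL by auto. rewrite Qseries_coef by auto.
      do 2 f_equal. symmetry. apply sum_n_m_RtoC. intros k. now rewrite Qseries_coef, <- RtoC_mult. }
    split; auto. split; [intros; now apply coef_prefactor|].
    intros c' HC j n Hj. destruct HS as [S1 S2], HC as [C1 C2].
    assert (V : forall t j, t < 0 -> in_range p j ->
       (Qseries p (c' j) (Qvar t) - Qseries p (fun n => RtoC (coef p j n)) (Qvar t))%C = 0).
    { apply (homogeneous_zero p s (fun j t => Qseries p (c' j) (Qvar t) - Qseries p (fun n => RtoC (coef p j n)) (Qvar t))%C).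
      intros t i Ht Hi. specialize (S2 t i Ht Hi). specialize (C2 t i Ht Hi).
      rewrite Qvar1_Qvar in S2, C2 by lra.
      apply (stokes_difference p s (fun i => Qseries p (c' i) (Qvar t)) (fun i => Qseries p (fun n => RtoC (coef p i n)) (Qvar t))
        (fun k => Qseries p (c' k) (Qvar (PI ^ 2 / t))) (fun k => Qseries p (fun n => RtoC (coef p k n)) (Qvar (PI ^ 2 / t))) _ t i C2 S2). }
    (* At real points a complex power series splits into two real ones, and the coefficients are
       compared part by part. *)
    assert (Hre : forall (d : nat -> C) (x : R), converges_on_disk d -> 0 < x < 1 ->
       ex_series (fun n => Re (d n) * x ^ n) /\ ex_series (fun n => Im (d n) * x ^ n)).
    { intros d x Hd Hx.
      assert (Hdx : unit_disk (RtoC x)) by (unfold unit_disk; rewrite Cmod_R, Rabs_pos_eq; lra).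
      destruct (C_series_components _ (Hd (RtoC x) Hdx)) as [A B]. split.
      - revert A. apply ex_series_ext. intros k. rewrite <- RtoC_pow. apply re_scal_r.
      - revert B. apply ex_series_ext. intros k. rewrite <- RtoC_pow. apply im_scal_r. }
    assert (Hval : forall (d : nat -> C) t, Qseries p d (Qvar t) =
       (Series (fun n => Re (d n) * xi p t ^ n), Series (fun n => Im (d n) * xi p t ^ n))).
    { intros d t. unfold Qseries, CSeries. f_equal; apply Series_ext; intros k;
      rewrite Rpower_Qvar_pow by auto; [apply re_scal_r|apply im_scal_r]. }
    assert (HV : forall x, 0 < x < 1 ->
       Series (fun n => Re (c' j n) * x ^ n) = Series (fun n => Re (RtoC (coef p j n)) * x ^ n) /\
       Series (fun n => Im (c' j n) * x ^ n) = Series (fun n => Im (RtoC (coef p j n)) * x ^ n)).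
    { intros x Hx. destruct (xi_surj p x Hp1 Hx) as [t [Ht <-]].
      pose proof (V t j Ht Hj) as Q. apply Ceq_minus in Q. rewrite !Hval in Q. injection Q as Q1 Q2. auto. }
    apply injective_projections.
    + apply (power_series_ext (fun n => Re (c' j n)) (fun n => Re (RtoC (coef p j n)))).
      * intros x Hx. exact (proj1 (Hre _ x (C1 j Hj) Hx)).
      * intros x Hx. exact (proj1 (Hre _ x (coef_converges p j) Hx)).
      * intros x Hx. now apply HV.
    + apply (power_series_ext (fun n => Im (c' j n)) (fun n => Im (RtoC (coef p j n)))).
      * intros x Hx. exact (proj2 (Hre _ x (C1 j Hj) Hx)).
      * intros x Hx. exact (proj2 (Hre _ x (coef_converges p j) Hx)).
      * intros x Hx. now apply HV.
Qed.
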